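(* Let $d\ge 1$, let $\Omega^d$ denote either $\mathbb{R}^d$ or $\mathbb{T}^d$, and let $m > d/2+1$ be an integer. Let $u_0\in H^m(\Omega^d)$ be pointwise positive, i.e. $u_0(x)>0$ for all $x\in\Omega^d$. Then there exist a time $T>0$ and a unique solution $u$ to $$u_t - u\,|\nabla| u + |\nabla|(u^2) = 0$$ with initial condition $u(\cdot,0)=u_0$, which belongs to the class $C([0,T);H^m(\Omega^d))\cap C^1([0,T);H^{m-1}(\Omega^d))$. Moreover, $u(x,t)>0$ for all $(x,t)\in\Omega^d\times[0,T)$, and the maximum $\max_{\Omega^d}u(t)$ is strictly decreasing in time.
   Context: $\mathbb{T}^d=(\mathbb{R}/2\pi\mathbb{Z})^d$. $|\nabla|=(-\Delta)^{1/2}$ is the Fourier multiplier with symbol $|\xi|$. $H^m$ is the usual ($L^2$-based, inhomogeneous, real-valued) Sobolev space. Since $m>d/2+1$, elements of $H^m(\Omega^d)$ are identified with their $C^1$ representatives.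
   Formalization: On the torus, strict decrease of the maximum is claimed only for non-constant initial data, since a positive constant is a stationary solution whose maximum does not decrease. *)

(* Defs.v *)
From HB Require Import structures.
From mathcomp Require Import all_boot all_order all_algebra.
From mathcomp Require Import all_classical all_reals all_analysis.
From mathcomp.real_closed Require Import complex.

Set Implicit Arguments.
Unset Strict Implicit.
Unset Printing Implicit Defensive.

Import Order.TTheory GRing.Theory Num.Theory.
Import numFieldNormedType.Exports.

Local Open Scope classical_set_scope.
Local Open Scope ring_scope.
Local Open Scope complex_scope.

(* The product sigma-algebra on R^n, generated by the coordinates. *)
Section measurable_rV.
Context {R : realType} (n : nat).

Let coord (i : 'I_n) (x : 'rV[R]_n) : measurableTypeR R := x ord0 i.

Let rV_set0 : g_sigma_preimage coord set0.
Proof. exact: sigma_algebra0. Qed.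

Let rV_setC A : g_sigma_preimage coord A -> g_sigma_preimage coord (~` A).
Proof. exact: sigma_algebraC. Qed.

Let rV_bigcup (F : (set 'rV[R]_n)^nat) :
  (forall i, g_sigma_preimage coord (F i)) ->
  g_sigma_preimage coord (\bigcup_i (F i)).
Proof. exact: sigma_algebra_bigcup. Qed.

HB.instance Definition _ := @isMeasurable.Build default_measure_display
  'rV[R]_n (g_sigma_preimage coord) rV_set0 rV_setC rV_bigcup.

Lemma measurable_coord (i : 'I_n) :
  measurable_fun [set: 'rV[R]_n] (fun x => x ord0 i : measurableTypeR R).
Proof.
move=> _ Y mY; rewrite setTI; apply: sub_sigma_algebra => /=.
rewrite -bigcup_seq/=; exists i => /=; first by rewrite mem_index_enum.
by exists Y => //; rewrite setTI.
Qed.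

Lemma measurable_fun_rV d (T : measurableType d) (f : T -> 'rV[R]_n) :
  (forall i, measurable_fun setT (fun x => f x ord0 i : measurableTypeR R)) ->
  measurable_fun setT f.
Proof.
move=> mf; apply: (@measurability _ _ _ _ _ _
  (\big[setU/set0]_(i < n) preimage_set_system setT (coord i) measurable)) => //.
move=> A [B]; rewrite -bigcup_seq => -[i _ [C mC <-]] <-.
rewrite setTI; exact: (mf i).
Qed.

End measurable_rV.

Section lebesgue_rV.
Context {R : realType}.

Definition cons_rV n (p : measurableTypeR R * 'rV[R]_n) : 'rV[R]_n.+1 :=
  row_mx (p.1)%:M p.2.

Definition uncons_rV n (x : 'rV[R]_n.+1) : measurableTypeR R * 'rV[R]_n :=
  (x ord0 ord0, \row_i x ord0 (lift ord0 i)).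

Lemma cons_rV0 n p : @cons_rV n p ord0 ord0 = p.1.
Proof.
have -> : cons_rV p ord0 ord0
    = row_mx (p.1)%:M p.2 ord0 (lshift n (ord0 : 'I_1)).
  by congr (row_mx _ _ _ _); exact: val_inj.
by rewrite row_mxEl mxE eqxx mulr1n.
Qed.

Lemma cons_rVS n p i : @cons_rV n p ord0 (lift ord0 i) = p.2 ord0 i.
Proof.
have -> : cons_rV p ord0 (lift ord0 i)
    = row_mx (p.1)%:M p.2 ord0 (rshift 1 i).
  by congr (row_mx _ _ _ _); exact: val_inj.
by rewrite row_mxEr.
Qed.

Lemma cons_rVK n : cancel (@cons_rV n) (@uncons_rV n).
Proof.
move=> [a y]; rewrite /uncons_rV cons_rV0; congr pair => /=.
by apply/rowP => i; rewrite mxE cons_rVS.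
Qed.

Lemma measurable_cons_rV n : measurable_fun setT (@cons_rV n).
Proof.
apply: measurable_fun_rV => i; case: (unliftP ord0 i) => [j ->|->].
  under eq_fun do rewrite cons_rVS.
  exact: (measurableT_comp (measurable_coord j) measurable_snd).
under eq_fun do rewrite cons_rV0; exact: measurable_fst.
Qed.

Lemma measurable_uncons_rV n : measurable_fun setT (@uncons_rV n).
Proof.
apply: measurable_fun_pair; first exact: measurable_coord.
apply: measurable_fun_rV => i; under eq_fun do rewrite mxE.
exact: measurable_coord.
Qed.

Section step.
Variables (n : nat) (mu : {sigma_finite_measure set 'rV[R]_n -> \bar R}).

Definition lebesgue_cons : set 'rV[R]_n.+1 -> \bar R :=
  pushforward (lebesgue_measure \x mu)%E (@cons_rV n).

Let measurable_preimage_cons (A : set 'rV[R]_n.+1) :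
  measurable A -> measurable (@cons_rV n @^-1` A).
Proof. by move=> mA; rewrite -[X in measurable X]setTI; exact: measurable_cons_rV. Qed.

Let lebesgue_cons0 : lebesgue_cons set0 = 0%E.
Proof. by rewrite /lebesgue_cons /pushforward preimage_set0 measure0. Qed.

Let lebesgue_cons_ge0 A : (0 <= lebesgue_cons A)%E.
Proof. by rewrite /lebesgue_cons /pushforward measure_ge0. Qed.

Let lebesgue_cons_sigma_additive : semi_sigma_additive lebesgue_cons.
Proof.
move=> F mF tF mUF; rewrite /lebesgue_cons /pushforward preimage_bigcup.
apply: measure_semi_sigma_additive.
- by move=> k; exact: measurable_preimage_cons.
- apply/trivIsetP => /= i j _ _ ij; rewrite -preimage_setI.
  by move/trivIsetP : tF => /(_ _ _ _ _ ij) ->//; rewrite preimage_set0.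
- by rewrite -preimage_bigcup; exact: measurable_preimage_cons.
Qed.

HB.instance Definition _ := isMeasure.Build _ _ _ lebesgue_cons
  lebesgue_cons0 lebesgue_cons_ge0 lebesgue_cons_sigma_additive.

Lemma lebesgue_cons_sigma_finite : sigma_finite setT lebesgue_cons.
Proof.
have /sigma_finiteP[F [FT ndF Foo]] := sigma_finiteT (@lebesgue_measure R).
have /sigma_finiteP[G [GT ndG Goo]] := sigma_finiteT mu.
exists (fun k => @uncons_rV n @^-1` (F k `*` G k)).
  apply/seteqP; split => // x _.
  have [i _ Fi] : (\bigcup_k F k) (uncons_rV x).1 by rewrite -FT.
  have [j _ Gj] : (\bigcup_k G k) (uncons_rV x).2 by rewrite -GT.
  exists (maxn i j) => //; split.
    by move: Fi; exact/subsetPset/ndF/leq_maxl.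
  by move: Gj; exact/subsetPset/ndG/leq_maxr.
move=> k; have [mF Fk] := Foo k; have [mG Gk] := Goo k; split.
  rewrite -[X in measurable X]setTI; apply: measurable_uncons_rV => //.
  exact: measurableX.
rewrite /lebesgue_cons /pushforward -comp_preimage.
rewrite (_ : _ \o _ = id) ?preimage_id; last first.
  by apply/funext => p; rewrite /= cons_rVK.
by rewrite product_measure1E// lte_mul_pinfty// ge0_fin_numE.
Qed.

HB.instance Definition _ := Measure_isSigmaFinite.Build _ _ _ lebesgue_cons
  lebesgue_cons_sigma_finite.

End step.

(* Lebesgue measure on R^n: the n-fold product, along R^(n+1) = R x R^n. *)
Fixpoint lebesgue_rV n : {sigma_finite_measure set 'rV[R]_n -> \bar R} :=
  match n with
  | 0 => dirac (0 : 'rV[R]_0)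
  | k.+1 => lebesgue_cons (lebesgue_rV k)
  end.

End lebesgue_rV.

Variant domain := WholeSpace | Torus.

Section spaces.
Context {R : realType} {d : nat}.
Implicit Types (Om : domain) (f g : 'rV[R]_d -> R) (F : 'rV[R]_d -> R[i]).

Definition dot (x y : 'rV[R]_d) : R := \sum_i x ord0 i * y ord0 i.

(* The canonical norm `|x| of 'rV[R]_d is the sup norm. *)
Definition eucl_norm (x : 'rV[R]_d) : R := Num.sqrt (dot x x).

(* Functions on the torus are encoded as 2pi-periodic functions on R^d. *)
Definition on_domain Om f : Prop :=
  if Om is Torus then
    forall x (k : 'rV[int]_d), f (x + (2 * pi) *: map_mx intr k) = f x
  else True.

(* The set over which functions on the domain are integrated. *)
Definition cell Om : set 'rV[R]_d :=
  if Om is Torus then [set x | forall i, 0 <= x ord0 i < 2 * pi] else setT.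

(* The frequencies: R^d with Lebesgue measure, Z^d with counting measure. *)
Definition freqs Om : set 'rV[R]_d :=
  if Om is Torus then range (fun k : 'rV[int]_d => map_mx intr k) else setT.

Definition freq_measure Om : {measure set 'rV[R]_d -> \bar R} :=
  if Om is Torus then counting else lebesgue_rV d.

Definition square_integrable Om f : Prop :=
  [/\ on_domain Om f, measurable_fun setT f &
      (\int[lebesgue_rV d]_(x in cell Om) ((f x) ^+ 2)%:E < +oo)%E].

Definition cube (n : nat) : set 'rV[R]_d :=
  [set x | forall i, `|x ord0 i| <= n%:R].

(* The integral of f(x) exp(-i x.xi) over [-n, n]^d; on the torus it is the
   full Fourier coefficient as soon as n >= 2pi. The (2pi)-normalisations play
   no role: they change neither the multipliers nor the topology of H^s. *)
Definition truncated_fourier Om f (n : nat) (xi : 'rV[R]_d) : R[i] :=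
  (\int[lebesgue_rV d]_(x in cell Om `&` cube n) (f x * cos (dot x xi))) -i*
  (\int[lebesgue_rV d]_(x in cell Om `&` cube n) (f x * sin (dot x xi))).

Definition sqnormc (z : R[i]) : R := complex.Re z ^+ 2 + complex.Im z ^+ 2.

(* F is the (Plancherel) Fourier transform of f: the limit in L^2 of the
   truncated transforms. It is unique up to a null set of frequencies. *)
Definition is_fourier Om f F : Prop :=
  [/\ square_integrable Om f,
      measurable_fun (freqs Om) (fun xi => complex.Re (F xi)),
      measurable_fun (freqs Om) (fun xi => complex.Im (F xi)) &
      (\int[freq_measure Om]_(xi in freqs Om)
         (sqnormc (truncated_fourier Om f n xi - F xi))%:E)%E
        @[n --> \oo] --> 0%E].

Definition fourier Om f : 'rV[R]_d -> R[i] := xget (cst 0) (is_fourier Om f).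

Definition sobolev_norm Om (s : nat) f : \bar R :=
  ((\int[freq_measure Om]_(xi in freqs Om)
     ((1 + eucl_norm xi ^+ 2) ^+ s * sqnormc (fourier Om f xi))%:E)
   `^ (2^-1)%R)%E.

Definition sobolev Om (s : nat) f : Prop :=
  square_integrable Om f /\ (sobolev_norm Om s f < +oo)%E.

(* g = |nabla| f in L^2, with |nabla| the Fourier multiplier of symbol |xi|. *)
Definition is_abs_nabla Om f g : Prop :=
  square_integrable Om f /\
  is_fourier Om g (fun xi => (eucl_norm xi)%:C * fourier Om f xi).

Definition class_C1 f : Prop :=
  (forall x, differentiable f x) /\
  (forall v, continuous (fun x => 'D_v f x)).

(* u belongs to C([0,T); H^s). *)
Definition continuous_sobolev Om (s : nat) (T : R) (u : R -> 'rV[R]_d -> R) :=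
  forall t, 0 <= t < T ->
    sobolev Om s (u t) /\
    sobolev_norm Om s (u r \- u t) @[r --> within `[0, T[ (nbhs t)] --> 0%E.

(* ut is the time derivative of u on [0,T), as an H^s-valued function
   (one-sided at t = 0). *)
Definition is_time_derivative Om (s : nat) (T : R)
    (u ut : R -> 'rV[R]_d -> R) :=
  forall t, 0 <= t < T ->
    sobolev_norm Om s
      (fun x => (u r x - u t x) / (r - t) - ut t x)
      @[r --> within `[0, T[ t^'] --> 0%E.

Definition is_solution Om (m : nat) (T : R) (u0 : 'rV[R]_d -> R)
    (u : R -> 'rV[R]_d -> R) : Prop :=
  [/\ (* elements of H^m are identified with their C^1 representatives *)
      forall t, 0 <= t < T -> class_C1 (u t),
      continuous_sobolev Om m T u,
      exists ut,
        [/\ continuous_sobolev Om m.-1 T u,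
            continuous_sobolev Om m.-1 T ut,
            is_time_derivative Om m.-1 T u ut &
            forall t, 0 <= t < T -> exists g h,
              [/\ is_abs_nabla Om (u t) g,
                  is_abs_nabla Om (fun x => u t x ^+ 2) h &
                  {ae lebesgue_rV d, forall x, cell Om x ->
                    ut t x - u t x * g x + h x = 0}]] &
      u 0 = u0].

Definition is_max f (M : R) : Prop :=
  (exists x, f x = M) /\ (forall x, f x <= M).

End spaces.

(* Main.v *)
(** Write [L] for |nabla|. If [u >= 0], the pointwise inequality
    [2 f L f >= L (f^2)] gives [2 \int u f (L f) >= - sup |L u| \int f^2], so
    the term [u L u] costs no derivative in an energy estimate; the remaining
    terms are commutators, bounded by Young's inequality for convolutions.
    Everything is done on the frequency side, with the real (Hartley) transform
    of kernel [cas t = cos t + sin t] instead of the complex Fourier transform.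

    The symbol |xi| is an average over [s] of [1 - exp (- (|xi| / s)^2)], which
    is the identity minus a gaussian average. Truncating this average to
    [|s| <= N] gives a bounded symbol for which the pointwise inequality, hence
    the energy estimate, survives, and for which an explicit Euler step
    preserves positivity. With [N = 2^j] and time step [T / 4^j] the Euler
    curves are Cauchy in [L^2] by the energy estimate for differences; the same
    estimate with the weights [tfun] bounds their high frequencies uniformly, so
    they converge in [H^m]. Uniqueness is Gronwall's inequality for the [L^2]
    norm of a difference. Where [u] attains its maximum [M],
    [u_t = L (u (M - u)) < 0], since [u (M - u) >= 0] vanishes there
    but not everywhere, and [L] is negative at such a minimum. *)

Require Import Defs.
From HB Require Import structures.
From mathcomp Require Import all_boot all_order all_algebra.
From mathcomp Require Import all_classical all_reals all_analysis.
From mathcomp Require Import measurable_realfun zify ring lra.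
From mathcomp.real_closed Require Import complex.
Set Implicit Arguments.
Unset Strict Implicit.
Unset Printing Implicit Defensive.
Import Order.TTheory GRing.Theory Num.Theory.
Import numFieldNormedType.Exports.
Local Open Scope classical_set_scope.
Local Open Scope ring_scope.

Local Notation measT := (measurable_fun setT).

(** On R^d the data tend to 0 at infinity, so the parabolic term degenerates and yields no uniform
    smoothing: only its sign can be used, and [quasi_pos] records that sign as an inequality between
    transforms. In H^m an estimate for differences would lose a derivative; convergence is therefore
    proved in L^2 and raised to H^m by the smallness of tails, uniform over the convex set [good],
    which also supplies the constants of the scheme.

    The truncated symbol is of size N, so the quadratic term of an Euler step costs (tau N)^2. It is
    of order tau once tau N^2 stays bounded, which dictates the step T / 4^j against N = 2^j.

    Both domains are treated at once: frequencies live in R^d, and [fmu] is Lebesgue measure or the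
    counting measure of Z^d. Convolutions only use invariance under reflection and under translation
    by frequencies. The Hartley kernel is real, so real functions have real transforms. With m = p +
    1, the condition d + 1 <= 2 p makes (1 + |xi|)^-p square integrable, so that functions of H^p
    have integrable transforms. *)

Lemma eq_ler (R : numDomainType) (x y : R) : x = y -> x <= y.
Proof. by move->. Qed.

(** * Real-valued integrals and [L^2] *)

Section real_integral.
Context {d : measure_display} {T : measurableType d} {R : realType}.
Variable mu : {measure set T -> \bar R}.
Implicit Types f g : T -> R.

Definition intg f := mu.-integrable setT (EFin \o f).

Lemma intg_meas f : intg f -> measT f.
Proof. by case/integrableP => /measurable_EFinP. Qed.

Lemma intgP f : measT f ->
  (\int[mu]_x (`|f x|)%:E < +oo)%E -> intg f.
Proof. by move=> mf h; apply/integrableP; split => //; exact/measurable_EFinP. Qed.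

Lemma intg_lty f : intg f -> (\int[mu]_x (`|f x|)%:E < +oo)%E.
Proof. by case/integrableP. Qed.

Lemma intg_le f g : measT f -> intg g ->
  (forall x, `|f x| <= g x) -> intg f.
Proof.
move=> mf ig fg; apply: (le_integrable measurableT _ _ ig).
  exact/measurable_EFinP.
by move=> x _ /=; rewrite lee_fin (le_trans (fg x))// ler_norm.
Qed.

Lemma intgD f g : intg f -> intg g -> intg (fun x => f x + g x).
Proof.
move=> If Ig; rewrite /intg (_ : _ \o _ = (EFin \o f) \+ (EFin \o g))%E//.
exact: integrableD.
Qed.

Lemma intgZ r f : intg f -> intg (fun x => r * f x).
Proof.
move=> If; rewrite /intg (_ : _ \o _ = (fun x => r%:E * (EFin \o f) x))%E//.
exact: integrableZl.
Qed.

Lemma intgN f : intg f -> intg (fun x => - f x).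
Proof.
move=> /(intgZ (-1)); apply: eq_integrable => // x _ /=.
by rewrite mulN1r.
Qed.

Lemma intgB f g : intg f -> intg g -> intg (fun x => f x - g x).
Proof. by move=> If Ig; apply: intgD => //; exact: intgN. Qed.

Lemma intg0 : intg (fun=> 0).
Proof. exact: integrable0. Qed.

Lemma intg_norm f : intg f -> intg (fun x => `|f x|).
Proof. exact: integrable_norm. Qed.

Lemma intgM_bounded (M : R) f g : intg f -> measT g ->
  (forall x, `|g x| <= M) -> intg (fun x => g x * f x).
Proof.
move=> If mg gM; apply: (@intg_le _ (fun x => M * `|f x|)).
- by apply: measurable_funM => //; exact: intg_meas.
- by apply: intgZ; exact: intg_norm.
- by move=> x; rewrite normrM ler_wpM2r.
Qed.

Lemma eq_intg f g : f =1 g -> intg f -> intg g.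
Proof. by move=> /funext ->. Qed.

Lemma IntE f : intg f -> (\int[mu]_x (f x)%:E = (\int[mu]_x f x)%:E)%E.
Proof. by move=> If; rewrite /Rintegral fineK//; exact: integrable_fin_num. Qed.

Lemma IntD f g : intg f -> intg g ->
  \int[mu]_x (f x + g x) = \int[mu]_x f x + \int[mu]_x g x.
Proof. exact: RintegralD. Qed.

Lemma IntB f g : intg f -> intg g ->
  \int[mu]_x (f x - g x) = \int[mu]_x f x - \int[mu]_x g x.
Proof. exact: RintegralB. Qed.

Lemma IntZ r f : intg f -> \int[mu]_x (r * f x) = r * \int[mu]_x f x.
Proof. exact: RintegralZl. Qed.

Lemma IntN f : intg f -> \int[mu]_x (- f x) = - \int[mu]_x f x.
Proof.
move=> If; rewrite -mulN1r -IntZ//; congr (fine _).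
by apply: eq_integral => x _; rewrite mulN1r.
Qed.

Lemma eq_Int f g : f =1 g -> \int[mu]_x f x = \int[mu]_x g x.
Proof. by move=> /funext ->. Qed.

Lemma Int0 : \int[mu]_x (0 : R) = 0.
Proof. by rewrite /Rintegral integral0. Qed.

Lemma Int_le f g : intg f -> intg g -> (forall x, f x <= g x) ->
  \int[mu]_x f x <= \int[mu]_x g x.
Proof. by move=> ? ? h; apply: le_Rintegral. Qed.

Lemma Int_ge0 f : (forall x, 0 <= f x) -> 0 <= \int[mu]_x f x.
Proof. by move=> h; apply: Rintegral_ge0. Qed.

Lemma le_norm_Int f g : intg f -> intg g -> (forall x, `|f x| <= g x) ->
  `|\int[mu]_x f x| <= \int[mu]_x g x.
Proof.
move=> If Ig h; apply: (le_trans (le_normr_Rintegral _ If)) => //.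
by apply: Int_le => //; exact: intg_norm.
Qed.

Lemma ae_intg f g : measT g ->
  {ae mu, forall x, f x = g x} -> intg f -> intg g.
Proof.
move=> mg fg If; apply: intgP => //; rewrite (_ : integral _ _ _ = \int[mu]_x `|f x|%:E)%E.
  exact: intg_lty.
apply: ge0_ae_eq_integral => //.
- by apply/measurable_EFinP; apply: measurableT_comp.
- by apply/measurable_EFinP; apply: measurableT_comp => //; exact: intg_meas.
- by move: fg; apply: filterS => x -> _.
Qed.

Lemma ae_Int f g : intg f -> measT g ->
  {ae mu, forall x, f x = g x} -> \int[mu]_x f x = \int[mu]_x g x.
Proof.
move=> If mg fg; congr fine; apply: ae_eq_integral => //.
- by apply/measurable_EFinP; exact: intg_meas.
- exact/measurable_EFinP.
- by move: fg; apply: filterS => x -> _.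
Qed.

Lemma Int_eq0 f : measT f -> (forall x, 0 <= f x) -> intg f ->
  \int[mu]_x f x = 0 -> {ae mu, forall x, f x = 0}.
Proof.
move=> mf f0 If h.
have : (\int[mu]_x `|(f x)%:E| = 0)%E.
  rewrite -[RHS]/(0%:E) -h -IntE//; apply: eq_integral => x _.
  by rewrite abse_EFin ger0_norm.
move/(ae_eq_integral_abs mu measurableT (proj2 (measurable_EFinP _ _) mf)).
by apply: filterS => x /(_ Logic.I) [].
Qed.

Lemma dct (f_ : nat -> T -> R) f g : (forall n, measT (f_ n)) ->
  (forall x, f_ n x @[n --> \oo] --> f x) -> intg g ->
  (forall n x, `|f_ n x| <= g x) ->
  intg f /\ \int[mu]_x (f_ n x) @[n --> \oo] --> \int[mu]_x f x.
Proof.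
move=> mf_ cf Ig bd.
have mf : measT f by apply: (measurable_fun_cvg mf_) => x _; exact: cf.
have [] := @dominated_convergence _ _ _ mu setT measurableT
  (fun n => EFin \o f_ n) (EFin \o f) (EFin \o g).
- by move=> n; exact/measurable_EFinP.
- exact/measurable_EFinP.
- by apply: aeW => x _; apply: cvg_EFin; [exact: nearW | exact: cf].
- exact: Ig.
- by apply: aeW => x n _; rewrite lee_fin.
move=> If _ h; split => //.
apply: fine_cvg; move: h; rewrite IntE//.
Qed.

(** The invariance is assumed for nonnegative extended-valued functions, the form in which
    push-forwards give it, and reaches [f] through its positive and negative parts. *)
Lemma Int_comp_inv (phi : T -> T) f : measT phi ->
  (forall h : T -> \bar R, measT h -> (forall x, 0 <= h x)%E ->
     \int[mu]_x h (phi x) = \int[mu]_x h x)%E ->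
  intg f -> intg (f \o phi) /\ \int[mu]_x f (phi x) = \int[mu]_x f x.
Proof.
move=> mphi H If; have mf := intg_meas If.
have mEf : measT (EFin \o f) by exact/measurable_EFinP.
split.
  apply: intgP; first exact: measurableT_comp.
  rewrite (H (fun x => (`|f x|)%:E))//; first exact: intg_lty.
  by apply/measurable_EFinP; exact: measurableT_comp.
congr fine; rewrite integralE [RHS]integralE.
rewrite -(H (EFin \o f)^\+%E); [|exact: measurable_funepos|by move=> x; exact: funepos_ge0].
rewrite -(H (EFin \o f)^\-%E); [|exact: measurable_funeneg|by move=> x; exact: funeneg_ge0].
by congr (_ - _)%E; apply: eq_integral => x _; rewrite !unlock.
Qed.

End real_integral.

Section real_L2.
Context {d : measure_display} {T : measurableType d} {R : realType}.
Variable mu : {measure set T -> \bar R}.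
Implicit Types f g : T -> R.
Notation intg := (intg mu).

Definition L2 f := measT f /\ intg (fun x => f x ^+ 2).
Definition nrm f := Num.sqrt (\int[mu]_x (f x ^+ 2)).

Lemma L2_le f g : measT f -> L2 g -> (forall x, `|f x| <= `|g x|) -> L2 f.
Proof.
move=> mf [mg Ig] fg; split => //; apply: (intg_le _ Ig).
  exact: measurable_funX.
by move=> x; rewrite normrX -[leRHS]real_normK ?num_real// lerXn2r ?nnegrE.
Qed.

Lemma L2M f g : L2 f -> L2 g -> intg (fun x => f x * g x).
Proof.
move=> [mf If] [mg Ig]; apply: (intg_le _ (intgD If Ig)).
  exact: measurable_funM.
move=> x; rewrite normrM -[X in _ <= X + _]real_normK ?num_real//.
rewrite -[X in _ <= _ + X]real_normK ?num_real//.
nra.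
Qed.

Lemma L2D f g : L2 f -> L2 g -> L2 (fun x => f x + g x).
Proof.
move=> Lf Lg; have [mf If] := Lf; have [mg Ig] := Lg.
split; first exact: measurable_funD.
apply: eq_intg (intgD (intgD If Ig) (intgZ 2 (L2M Lf Lg))) => x; ring.
Qed.

Lemma L2Z r f : L2 f -> L2 (fun x => r * f x).
Proof.
move=> [mf If]; split; first by apply: measurable_funM.
by apply: eq_intg (intgZ (r ^+ 2) If) => x; ring.
Qed.

Lemma L2N f : L2 f -> L2 (fun x => - f x).
Proof.
by move=> /(L2Z (-1)); congr L2; apply/funext => x; rewrite mulN1r.
Qed.

Lemma L2B f g : L2 f -> L2 g -> L2 (fun x => f x - g x).
Proof. by move=> ? ?; apply: L2D => //; exact: L2N. Qed.

Lemma L2_0 : L2 (fun=> 0).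
Proof. by split; [exact: measurable_cst|apply: eq_intg (intg0 mu) => x; rewrite expr0n]. Qed.

Lemma L2_norm f : L2 f -> L2 (fun x => `|f x|).
Proof.
move=> [mf If]; split; first exact: measurableT_comp.
by apply: eq_intg If => x; rewrite real_normK ?num_real.
Qed.

Lemma L2M_bounded (M : R) f g : L2 f -> measT g ->
  (forall x, `|g x| <= M) -> L2 (fun x => g x * f x).
Proof.
move=> Lf mg gM; apply: (L2_le _ (L2Z M Lf)).
  by apply: measurable_funM => //; case: Lf.
move=> x; rewrite !normrM ler_wpM2r// (le_trans (gM x))// ler_norm//.
Qed.

Lemma nrm_ge0 f : 0 <= nrm f. Proof. exact: sqrtr_ge0. Qed.

Lemma nrm_sqr f : nrm f ^+ 2 = \int[mu]_x (f x ^+ 2).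
Proof. by rewrite sqr_sqrtr// Int_ge0// => x; exact: sqr_ge0. Qed.

Lemma eq_nrm f g : f =1 g -> nrm f = nrm g.
Proof. by move=> /funext ->. Qed.

Lemma nrm0 : nrm (fun=> 0) = 0.
Proof.
rewrite /nrm (eq_Int mu (g := fun=> 0)) ?Int0 ?sqrtr0// => x; by rewrite expr0n.
Qed.

Lemma nrmZ r f : L2 f -> nrm (fun x => r * f x) = `|r| * nrm f.
Proof.
move=> [mf If]; rewrite /nrm -sqrtr_sqr -sqrtrM ?sqr_ge0// -IntZ//.
by congr Num.sqrt; apply: eq_Int => x; ring.
Qed.

Lemma nrmN f : nrm (fun x => - f x) = nrm f.
Proof. by congr Num.sqrt; apply: eq_Int => x; ring. Qed.

Lemma nrm_sym f g : nrm (fun x => f x - g x) = nrm (fun x => g x - f x).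
Proof. by rewrite -nrmN; apply: eq_nrm => x; ring. Qed.

Lemma cauchy_schwarz f g : L2 f -> L2 g ->
  `|\int[mu]_x (f x * g x)| <= nrm f * nrm g.
Proof.
move=> Lf Lg; have [mf If] := Lf; have [mg Ig] := Lg.
set P := Rintegral _ _ _.
have key t : 0 <= nrm f ^+ 2 + 2 * t * P + t ^+ 2 * nrm g ^+ 2.
  rewrite !nrm_sqr -!IntZ//; last exact: L2M.
  rewrite -!IntD//; last 3 first.
  - by apply: intgD => //; apply: intgZ; exact: L2M.
  - exact: intgZ.
  - by apply: intgZ; exact: L2M.
  apply: Int_ge0 => x; rewrite (_ : _ + _ = (f x + t * g x) ^+ 2); last by ring.
  exact: sqr_ge0.
have a0 := nrm_ge0 f; have b0 := nrm_ge0 g.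
have [b00|bn0] := eqVneq (nrm g) 0.
  have /eqP P0 : P == 0.
    apply/negP => /negP P0.
    (* With [nrm g = 0] the quadratic is affine in [t], and a nonzero slope would give it the value
       [-1] at this point. *)
    have := key (- (nrm f ^+ 2 + 1) / (2 * P)); rewrite b00.
    rewrite (_ : _ + _ = -1); last by field.
    by rewrite lerNr oppr0 ler10.
  by rewrite P0 normr0 mulr_ge0.
(* The minimum of the quadratic. *)
have := key (- P / nrm g ^+ 2).
rewrite (_ : _ + _ = nrm f ^+ 2 - P ^+ 2 / nrm g ^+ 2); last by field.
rewrite subr_ge0 ler_pdivrMr ?exprn_gt0 ?lt_def ?bn0// -exprMn => h.
by rewrite -(ler_pXn2r (n := 2)) ?nnegrE ?mulr_ge0// real_normK ?num_real.
Qed.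

Lemma nrmD f g : L2 f -> L2 g -> nrm (fun x => f x + g x) <= nrm f + nrm g.
Proof.
move=> Lf Lg; have [mf If] := Lf; have [mg Ig] := Lg.
rewrite -(ler_pXn2r (n := 2)) ?nnegrE ?addr_ge0 ?nrm_ge0//.
rewrite sqrrD !nrm_sqr (eq_Int mu (g := fun x => f x ^+ 2 + 2 * (f x * g x) + g x ^+ 2)).
  rewrite IntD//; last by apply: intgD => //; apply: intgZ; exact: L2M.
  rewrite IntD//; last by apply: intgZ; exact: L2M.
  rewrite IntZ; last exact: L2M.
  have := le_trans (ler_norm _) (cauchy_schwarz Lf Lg); lra.
by move=> x; ring.
Qed.

Lemma nrmB f g : L2 f -> L2 g -> nrm (fun x => f x - g x) <= nrm f + nrm g.
Proof. by move=> Lf Lg; rewrite -(nrmN g) nrmD//; exact: L2N. Qed.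

Lemma nrm_dist f g h : L2 f -> L2 g -> L2 h ->
  nrm (fun x => f x - h x) <= nrm (fun x => f x - g x) + nrm (fun x => g x - h x).
Proof.
move=> Lf Lg Lh; rewrite (eq_nrm (g := fun x => (f x - g x) + (g x - h x))).
  by rewrite nrmD//; exact: L2B.
by move=> x; ring.
Qed.

Lemma le_nrm f g : measT f -> L2 g ->
  (forall x, `|f x| <= `|g x|) -> nrm f <= nrm g.
Proof.
move=> mf Lg fg; have [_ If] := L2_le mf Lg fg.
rewrite ler_sqrt ?Int_ge0//; last by move=> x; exact: sqr_ge0.
apply: Int_le => //; first by case: Lg.
move=> x; rewrite -[leRHS]real_normK ?num_real// -[leLHS]real_normK ?num_real//.
by rewrite lerXn2r ?nnegrE.
Qed.

Lemma nrm_eq0 f : L2 f -> nrm f = 0 -> {ae mu, forall x, f x = 0}.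
Proof.
move=> [mf If] /eqP f0.
have : {ae mu, forall x, f x ^+ 2 = 0}.
  apply: Int_eq0 => //; first exact: measurable_funX.
    by move=> x; exact: sqr_ge0.
  by rewrite -nrm_sqr (eqP f0) expr0n.
by apply: filterS => x /eqP; rewrite sqrf_eq0 => /eqP.
Qed.

Lemma ae_L2 f g : measT g ->
  {ae mu, forall x, f x = g x} -> L2 f -> L2 g.
Proof.
move=> mg fg [mf If]; split => //; apply: ae_intg If; first exact: measurable_funX.
by move: fg; apply: filterS => x ->.
Qed.

Lemma ae_nrm f g : L2 f -> measT g ->
  {ae mu, forall x, f x = g x} -> nrm f = nrm g.
Proof.
move=> [mf If] mg fg; congr Num.sqrt; apply: ae_Int => //; first exact: measurable_funX.
by move: fg; apply: filterS => x ->.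
Qed.

End real_L2.

(** * Fubini's theorem for real-valued integrals *)

Section real_fubini.
Context {d1 d2 : measure_display} {T1 : measurableType d1} {T2 : measurableType d2}.
Context {R : realType}.
Variables (m1 : {sigma_finite_measure set T1 -> \bar R}).
Variables (m2 : {sigma_finite_measure set T2 -> \bar R}).
Variable F : T1 * T2 -> R.
Hypothesis mF : measT F.

Lemma measurable_Int_l : measT (fun x => \int[m2]_y F (x, y)).
Proof.
have mEF : measT (EFin \o F) by exact/measurable_EFinP.
rewrite /Rintegral; apply: measurableT_comp => //.
have hp := @measurable_fun_fubini_tonelli_F _ _ _ _ _ m2 _
  (measurable_funepos mEF) (fun z => funepos_ge0 (EFin \o F) z).
have hn := @measurable_fun_fubini_tonelli_F _ _ _ _ _ m2 _
  (measurable_funeneg mEF) (fun z => funeneg_ge0 (EFin \o F) z).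
rewrite (_ : (fun x => _) = (fun x => fubini_F m2 (EFin \o F)^\+ x -
    fubini_F m2 (EFin \o F)^\- x))%E; first exact: emeasurable_funB.
apply/funext => x; rewrite integralE; congr (_ - _)%E;
  apply: eq_integral => y _.
- by rewrite !unlock.
- by rewrite !unlock.
Qed.

(** The inner real integral is the [fine] of the extended one; the two differ only where the latter
    is infinite, which is a null set. *)
Lemma real_fubini_l : (m1 \x m2)%E.-integrable setT (EFin \o F) ->
  intg m1 (fun x => \int[m2]_y F (x, y)) /\
  (\int[m1]_x \int[m2]_y F (x, y) = fine (\int[m1]_x \int[m2]_y (F (x, y))%:E)%E).
Proof.
move=> iF; have iF1 := integrable_fubini_F iF; have mI := measurable_Int_l.
have E x : \int[m2]_y F (x, y) = fine (fubini_F m2 (EFin \o F) x) by [].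
split.
  apply: (le_integrable measurableT _ _ iF1); first exact/measurable_EFinP.
  move=> x _; rewrite [X in (X <= _)%E](_ : _ = `|fine (fubini_F m2 (EFin \o F) x)|%:E)%E//.
  by case: (fubini_F _ _ _) => //= *; rewrite normr0 leey.
congr fine; apply: ae_eq_integral => //.
- exact/measurable_EFinP.
- exact: measurable_int iF1.
- move: (integrable_ae measurableT iF1); apply: filterS => x /(_ Logic.I) h _.
  by rewrite E fineK.
Qed.

End real_fubini.

Section real_fubini_swap.
Context {d1 d2 : measure_display} {T1 : measurableType d1} {T2 : measurableType d2}.
Context {R : realType}.
Variables (m1 : {sigma_finite_measure set T1 -> \bar R}).
Variables (m2 : {sigma_finite_measure set T2 -> \bar R}).
Variable F : T1 * T2 -> R.
Hypothesis mF : measT F.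

Lemma real_fubini : (\int[m1]_x \int[m2]_y (`|F (x, y)|)%:E < +oo)%E ->
  [/\ intg m1 (fun x => \int[m2]_y F (x, y)),
      intg m2 (fun y => \int[m1]_x F (x, y)) &
      \int[m1]_x \int[m2]_y F (x, y) = \int[m2]_y \int[m1]_x F (x, y)].
Proof.
move=> Foo.
have mEF : measT (EFin \o F) by exact/measurable_EFinP.
have iF : (m1 \x m2)%E.-integrable setT (EFin \o F) by apply/integrable12ltyP.
have mG : measT (fun z : T2 * T1 => F (z.2, z.1)).
  by apply: measurableT_comp => //; exact: measurable_swap.
have iG : (m2 \x m1)%E.-integrable setT (EFin \o (fun z : T2 * T1 => F (z.2, z.1))).
  apply/integrable12ltyP; first exact/measurable_EFinP.
  exact/(integrable21ltyP m1 m2 mEF).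
have [k1 e1] := real_fubini_l mF iF.
have [k2 e2] := real_fubini_l mG iG.
by split => //; rewrite e1 e2 (Fubini iF).
Qed.

Lemma dominated_prod_lty (a : T1 -> R) (b : T2 -> R) : intg m1 a -> intg m2 b ->
  (forall x y, `|F (x, y)| <= a x * b y) ->
  (\int[m1]_x \int[m2]_y (`|F (x, y)|)%:E < +oo)%E.
Proof.
move=> Ia Ib Fab.
have ma := intg_meas Ia; have mb := intg_meas Ib.
apply: (@le_lt_trans _ _ (\int[m1]_x \int[m2]_y ((`|a x| * `|b y|)%:E))%E).
  apply: ge0_le_integral => //.
  - by move=> x _; exact: integral_ge0.
  - apply: (@measurable_fun_fubini_tonelli_F _ _ _ _ _ m2 (fun z => (`|F z|)%:E)) => //.
    by apply/measurable_EFinP; apply: measurableT_comp.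
  - apply: (@measurable_fun_fubini_tonelli_F _ _ _ _ _ m2
      (fun z => (`|a z.1| * `|b z.2|)%:E)) => //.
      by apply/measurable_EFinP; apply: measurable_funM; apply: measurableT_comp => //;
        apply: measurableT_comp => //.
  move=> x _; apply: ge0_le_integral => //.
  - apply/measurable_EFinP; apply: measurableT_comp => //.
    by apply: measurableT_comp => //; exact: measurable_pair1.
  - apply/measurable_EFinP; apply: measurable_funM => //.
    exact: measurableT_comp.
  - move=> y _; rewrite lee_fin -normrM (le_trans (Fab x y))//; exact: ler_norm.
under eq_integral => x _.
  under eq_integral do rewrite EFinM.
  rewrite ge0_integralZl//; last by apply/measurable_EFinP; exact: measurableT_comp.
  over.
rewrite ge0_integralZr//; last 2 first.
- by apply/measurable_EFinP; exact: measurableT_comp.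
- exact: integral_ge0.
rewrite lte_mul_pinfty//.
- exact: integral_ge0.
- by rewrite ge0_fin_numE ?intg_lty// integral_ge0.
- exact: intg_lty.
Qed.

Lemma fubini_dominated (a : T1 -> R) (b : T2 -> R) : intg m1 a -> intg m2 b ->
  (forall x y, `|F (x, y)| <= a x * b y) ->
  [/\ intg m1 (fun x => \int[m2]_y F (x, y)),
      intg m2 (fun y => \int[m1]_x F (x, y)) &
      \int[m1]_x \int[m2]_y F (x, y) = \int[m2]_y \int[m1]_x F (x, y)].
Proof.
move=> Ia Ib Fab; apply: real_fubini; exact: dominated_prod_lty Ia Ib Fab.
Qed.

End real_fubini_swap.

(** * Completeness of L^2 *)

Section L2_completeness.
Context {d : measure_display} {T : measurableType d} {R : realType}.
Variable mu : {measure set T -> \bar R}.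
Notation L2 := (L2 mu).
Notation nrm := (nrm mu).

Lemma limn_einf_le (u : (\bar R)^nat) (c : \bar R) (N : nat) :
  (forall n, (N <= n)%N -> (u n <= c)%E) -> (limn_einf u <= c)%E.
Proof.
move=> h; rewrite limn_einf_lim; apply: lime_le.
  by apply: is_cvg_einfs.
apply: nearW => n; apply: (@le_trans _ _ (u (maxn n N))).
  by apply: ereal_inf_lbound; exists (maxn n N) => //=; exact: leq_maxl.
by apply: h; exact: leq_maxr.
Qed.

(** Fatou's lemma for the squares. The lower limit ignores the first [N] terms, so the bounds are
    asked from rank [N] on. *)
Lemma fatou_L2 (f_ : nat -> T -> R) (f : T -> R) (c : R) (N : nat) :
  (forall n, measT (f_ n)) -> measT f ->
  (forall n, (N <= n)%N -> L2 (f_ n)) -> (forall n, (N <= n)%N -> nrm (f_ n) <= c) ->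
  {ae mu, forall x, f_ n x @[n --> \oo] --> f x} -> L2 f /\ nrm f <= c.
Proof.
move=> mf_ mf Lf_ hc cf.
have c0 : 0 <= c by apply: le_trans (hc N _) => //; exact: nrm_ge0.
have mf2 : measT (fun x => (f x ^+ 2)%:E).
  by apply/measurable_EFinP; apply: measurable_funX.
have mf2_ n : measT (fun x => (f_ n x ^+ 2)%:E).
  by apply/measurable_EFinP; apply: measurable_funX.
have ge02 (g : T -> R) x : (0 <= (g x ^+ 2)%:E)%E by rewrite lee_fin sqr_ge0.
have H : (\int[mu]_x (f x ^+ 2)%:E <= (c ^+ 2)%:E)%E.
  apply: (@le_trans _ _ (\int[mu]_x limn_einf (fun n => (f_ n x ^+ 2)%:E))%E).
    apply: ae_ge0_le_integral => //.
    - move=> x _; rewrite limn_einf_lim; apply: lime_ge; first exact: is_cvg_einfs.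
      by apply: nearW => n; apply: le_ereal_inf_tmp => _ [m /= _ <-].
    - rewrite (_ : (fun x => _) =
          (fun x => - limn_esup (fun n => - (f_ n x ^+ 2)%:E)))%E; last first.
        apply/funext => x; rewrite -limn_einfN; congr limn_einf.
        by apply/funext => n; rewrite /comp oppeK.
      apply: measurableT_comp => //; apply: measurable_fun_limn_esup => n.
      exact: measurableT_comp.
    move: cf; apply: filterS => x cf _.
    have h : (fun n => (f_ n x ^+ 2)%:E) @ \oo --> (f x ^+ 2)%:E.
      apply: cvg_EFin; first exact: nearW.
      rewrite (_ : fine \o _ = (fun n => f_ n x ^+ 2)); last by apply/funext.
      by rewrite !expr2; apply: cvgM.
    by rewrite is_cvg_limn_einfE; [rewrite (cvg_lim _ h)|exact: cvgP h].
  apply: (le_trans (fatou mu measurableT _ _)) => //.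
  apply: (@limn_einf_le _ _ N) => n Nn.
  rewrite IntE; last by case: (Lf_ n Nn).
  by rewrite lee_fin -nrm_sqr lerXn2r ?nnegrE ?nrm_ge0 ?hc.
have Lf : L2 f.
  split => //; apply: intgP; first exact: measurable_funX.
  under eq_integral do rewrite normrX real_normK ?num_real//.
  exact: le_lt_trans H (ltry _).
split => //.
rewrite -(ler_pXn2r (n := 2)) ?nnegrE ?nrm_ge0// nrm_sqr -lee_fin -IntE//.
by case: Lf.
Qed.

(** The series of the functions [4 ^+ n * g n x ^+ 2] has a finite integral, hence a finite sum [C]
    almost everywhere; there [g n x] is at most [sqrt C] times 2^-n. *)
Lemma ae_summable (g : nat -> T -> R) : (forall n, L2 (g n)) ->
  (forall n, nrm (g n) <= 4^-1 ^+ n) ->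
  {ae mu, forall x, cvgn (series (g ^~ x))}.
Proof.
move=> Lg hg.
pose H x := (\sum_(n <oo) ((4 ^+ n * g n x ^+ 2)%:E))%E.
have mH n : measT (fun x => (4 ^+ n * g n x ^+ 2)%:E).
  apply/measurable_EFinP; apply: measurable_funM => //; apply: measurable_funX.
  by case: (Lg n).
have H0 n x : (0 <= (4 ^+ n * g n x ^+ 2)%:E)%E.
  by rewrite lee_fin; apply: mulr_ge0; [exact: exprn_ge0|exact: sqr_ge0].
have mHH : measT H by apply: ge0_emeasurable_sum.
have iH : mu.-integrable setT H.
  apply/integrableP; split => //.
  under eq_integral => x _ do rewrite gee0_abs ?nneseries_ge0//.
  rewrite integral_nneseries//.
  apply: (@le_lt_trans _ _ (\sum_(n <oo) ((4^-1 ^+ n)%:E))%E).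
    apply: lee_nneseries => [n _ _|n _]; first exact: integral_ge0.
    under eq_integral do rewrite EFinM.
    rewrite ge0_integralZl//; last 2 first.
      - by apply/measurable_EFinP; apply: measurable_funX; case: (Lg n).
      - by move=> x _; rewrite lee_fin sqr_ge0.
    rewrite IntE; last by case: (Lg n).
    rewrite -nrm_sqr -EFinM lee_fin.
    have h2 : nrm (g n) ^+ 2 <= (4^-1 ^+ n) ^+ 2.
      by rewrite lerXn2r ?nnegrE ?nrm_ge0 ?exprn_ge0.
    apply: (le_trans (ler_wpM2l _ h2)); first by rewrite exprn_ge0.
    by rewrite expr2 mulrA -exprMn mulfV// expr1n mul1r.
  have cv : cvgn (series (geometric (1 : R) 4^-1)).
    by apply: is_cvg_geometric_series; rewrite ger0_norm//; lra.
  have -> : (\sum_(n <oo) ((4^-1 ^+ n)%:E))%E = (limn (series (geometric (1 : R) 4^-1)))%:E.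
    rewrite -EFin_lim//; congr (limn _); apply/funext => n /=.
    by rewrite /series/= -sumEFin; apply: eq_bigr => i _; rewrite mul1r.
  exact: ltry.
move: (integrable_ae measurableT iH); apply: filterS => x /(_ Logic.I) Hx.
apply: normed_cvg.
pose C := fine (H x).
have gC n : 4 ^+ n * g n x ^+ 2 <= C.
  rewrite -lee_fin /C fineK//.
  rewrite /H (@nneseriesD1 _ _ n xpredT)//.
  by rewrite leeDl// nneseries_ge0.
have C0 : 0 <= C by apply: le_trans (gC 0%N); apply: mulr_ge0; [exact: exprn_ge0|exact: sqr_ge0].
apply: (@series_le_cvg _ _ (geometric (Num.sqrt C) 2^-1)).
- by move=> n; exact: normr_ge0.
- by move=> n /=; rewrite mulr_ge0 ?sqrtr_ge0 ?exprn_ge0.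
- move=> n /=; rewrite exprVn ler_pdivlMr ?exprn_gt0//.
  rewrite -(ler_pXn2r (n := 2)) ?nnegrE ?mulr_ge0 ?sqrtr_ge0 ?exprn_ge0//.
  rewrite sqr_sqrtr// exprMn real_normK ?num_real//.
  by rewrite -exprM mulnC exprM (_ : 2 ^+ 2 = 4 :> R) ?(le_trans _ (gC n)) 1?mulrC//; lra.
- by apply: is_cvg_geometric_series; rewrite ger0_norm//; lra.
Qed.

Lemma L2_complete (f : nat -> T -> R) : (forall n, L2 (f n)) ->
  (forall e, 0 < e -> exists N, forall m n, (N <= m)%N -> (N <= n)%N ->
     nrm (fun x => f m x - f n x) <= e) ->
  exists2 g, L2 g & forall e, 0 < e -> exists N, forall n, (N <= n)%N ->
     nrm (fun x => f n x - g x) <= e.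
Proof.
move=> Lf cf.
have /choice[K0 hK0] : forall k, exists N, forall m n, (N <= m)%N -> (N <= n)%N ->
    nrm (fun x => f m x - f n x) <= 4^-1 ^+ k.
  by move=> k; apply: cf; rewrite exprn_gt0.
pose K k := maxn k (K0 k).
have hK k m n : (K k <= m)%N -> (K k <= n)%N ->
    nrm (fun x => f m x - f n x) <= 4^-1 ^+ k.
  by rewrite !geq_max => /andP[_ h1] /andP[_ h2]; exact: hK0.
(* Taking the running maximum of the ranks makes the subsequence nondecreasing. *)
pose s k := (\max_(i < k.+1) K i)%N.
have sK k : (K k <= s k)%N by rewrite /s (leq_bigmax (ord_max : 'I_k.+1)).
have sS k : (s k <= s k.+1)%N.
  by rewrite {2}/s big_ord_recr/= leq_max leqnn.
pose g k x := f (s k.+1) x - f (s k) x.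
have Lg k : L2 (g k) by apply: L2B.
have ng k : nrm (g k) <= 4^-1 ^+ k.
  by apply: hK; rewrite ?sK// (leq_trans (sK k)).
have aec := ae_summable Lg ng.
have fE x n : f (s n) x = f (s 0%N) x + series (g ^~ x) n.
  elim: n => [|n IH]; first by rewrite /series/= big_geq// addr0.
  by rewrite /series/= big_nat_recr//= addrA -/(series _ n) -IH /g addrC subrK.
have mfs n : measT (f (s n)) by case: (Lf (s n)).
pose h x := limn_esup (fun n => (f (s n) x)%:E).
have mh : measT (fine \o h).
  apply: measurableT_comp => //.
  by apply: measurable_fun_limn_esup => n; exact/measurable_EFinP.
have hc : {ae mu, forall x, f (s n) x @[n --> \oo] --> (fine \o h) x}.
  move: aec; apply: filterS => x cx.
  have cfx : f (s n) x @[n --> \oo] --> f (s 0%N) x + limn (series (g ^~ x)).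
    under eq_fun do rewrite fE.
    by apply: cvgD => //; exact: cvg_cst.
  rewrite /= (_ : h x = (f (s 0%N) x + limn (series (g ^~ x)))%:E)//.
  rewrite /h.
  have h' : (fun n => (f (s n) x)%:E) @ \oo --> (f (s 0%N) x + limn (series (g ^~ x)))%:E.
    by apply: cvg_EFin => //; exact: nearW.
  have [_ ->] := cvg_limn_einf_sup h'.
  by [].
have main e : 0 < e -> exists N, forall n, (N <= n)%N ->
    L2 (fun x => f n x - (fine \o h) x) /\ nrm (fun x => f n x - (fine \o h) x) <= e.
  move=> e0; have [N hN] := cf e e0.
  exists N => n Nn.
  apply: (@fatou_L2 (fun k x => f n x - f (s k) x) _ e N).
  - by move=> k; apply: measurable_funB => //; case: (Lf n).
  - by apply: measurable_funB => //; case: (Lf n).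
  - by move=> k _; exact: L2B.
  - move=> k Nk; apply: hN => //; apply: (leq_trans Nk).
    by apply: leq_trans (sK k); exact: leq_maxl.
  - by move: hc; apply: filterS => x hx; apply: cvgB => //; exact: cvg_cst.
have [N hN] := main 1 ltr01.
exists (fine \o h).
  rewrite (_ : fine \o h = (fun x => f N x - (f N x - (fine \o h) x))).
    by apply: L2B => //; case: (hN N (leqnn N)).
  by apply/funext => x; rewrite opprB addrC subrK.
move=> e e0; have [M hM] := main e e0; exists M => n Mn.
by case: (hM n Mn).
Qed.

End L2_completeness.

(** * Lebesgue measure on row vectors and gaussians *)

Section lebesgue_affine.
Context {R : realType}.
Notation lam := (@lebesgue_measure R).

Lemma measurable_affine (s a : R) :
  measT (fun x : measurableTypeR R => s * x + a : measurableTypeR R).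
Proof. by apply: measurable_funD => //; apply: measurable_funM. Qed.

(** The push-forward under the affine map, scaled by [s], gives each half-open interval its length;
    the uniqueness of Lebesgue measure concludes. *)
Lemma lebesgue_affine (s a : R) (A : set (measurableTypeR R)) : 0 < s -> measurable A ->
  lam A = (s%:E * lam ((fun x : R => (s * x + a)%R) @^-1` A))%E.
Proof.
move=> s0 mA; pose S := NngNum (ltW s0).
pose nu := mscale S (measure_function_pushforward__canonical__measure_function_Measure
  lam (measurable_affine s a)).
apply: (@lebesgue_measure_unique _ nu) => //.
move=> _ [[c e]] _ <- /=.
rewrite -[RHS]/(s%:E * lam ((fun x : R => (s * x + a)%R) @^-1` `]c, e]%classic))%E.
rewrite (_ : _ @^-1` _ = `](c - a) / s, (e - a) / s]%classic); last first.
  apply/seteqP; split => x /=; rewrite !in_itv/= ltr_pdivrMr// ler_pdivlMr//;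
    by rewrite ltrBlDr lerBrDr mulrC.
rewrite !lebesgue_measure_itv/= !lte_fin ltr_pM2r ?invr_gt0// ltrD2r.
case: ifPn => _; last by rewrite mule0.
by rewrite -!EFinB -EFinM; congr EFin; field; rewrite gt_eqF.
Qed.

Lemma ge0_integral_affine (s a : R) (f : measurableTypeR R -> \bar R) : 0 < s ->
  measT f -> (forall x, 0 <= f x)%E ->
  (\int[lam]_x f x = s%:E * \int[lam]_x f (s * x + a)%R)%E.
Proof.
move=> s0 mf f0; pose S := NngNum (ltW s0).
have := ge0_integral_pushforward (measurable_affine s a) lam measurableT mf (fun y _ => f0 y).
rewrite preimage_setT => <-.
pose nu := measure_function_pushforward__canonical__measure_function_Measure
  lam (measurable_affine s a).
rewrite -(@ge0_integral_mscale _ _ _ nu setT measurableT S _ mf)//.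
by apply: eq_measure_integral => A mA _; have := lebesgue_affine a s0 mA.
Qed.

Lemma ge0_integral_opp1 (f : measurableTypeR R -> \bar R) :
  measT f -> (forall x, 0 <= f x)%E ->
  (\int[lam]_x f (- x)%R = \int[lam]_x f x)%E.
Proof.
move=> mf f0; have mN : measT (-%R : measurableTypeR R -> measurableTypeR R).
  by [].
have := ge0_integral_pushforward mN lam measurableT mf (fun y _ => f0 y).
rewrite preimage_setT => <-.
apply: eq_measure_integral => A mA _; rewrite /pushforward.
exact: lebesgue_measureN.
Qed.

End lebesgue_affine.

(** * Integration on R^n, one coordinate at a time *)

Section lebesgue_rV_theory.
Context {R : realType}.
Notation lam := (@lebesgue_measure R).
Notation lamn := lebesgue_rV.

Lemma ge0_integral_rVS n (f : 'rV[R]_n.+1 -> \bar R) :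
  measT f -> (forall x, 0 <= f x)%E ->
  (\int[lamn n.+1]_x f x = \int[lam]_a \int[lamn n]_y f (cons_rV (a, y)))%E.
Proof.
move=> mf f0.
have := ge0_integral_pushforward (measurable_cons_rV (n := n) (R := R))
  (lam \x lamn n)%E measurableT mf (fun y _ => f0 y).
rewrite preimage_setT => h.
rewrite -(@fubini_tonelli1 _ _ _ _ _ lam (lamn n) (f \o @cons_rV R n)); last 2 first.
- by apply: measurableT_comp => //; exact: measurable_cons_rV.
- by move=> z; exact: f0.
apply: etrans h.
exact: (eq_measure_integral (measure_function_pushforward__canonical__measure_function_Measure
  (lam \x lamn n)%E (measurable_cons_rV (n := n) (R := R)))).
Qed.

Lemma measurable_rV_map2 d (T : measurableType d) n (f : T -> 'rV[R]_n)
    (g : T -> 'rV[R]_n) : measT f -> measT g ->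
  measT (fun x => f x + g x).
Proof.
move=> mf mg; apply: measurable_fun_rV => i; under eq_fun do rewrite mxE.
by apply: measurable_funD; apply: (measurableT_comp (measurable_coord i)).
Qed.

Lemma measurable_rV_opp d (T : measurableType d) n (f : T -> 'rV[R]_n) :
  measT f -> measT (fun x => - f x).
Proof.
move=> mf; apply: measurable_fun_rV => i; under eq_fun do rewrite mxE.
have h := measurableT_comp (measurable_coord i) mf.
by apply: measurableT_comp => //; exact: h.
Qed.

Lemma measurable_dot n (y : 'rV[R]_n) : measT (fun x => dot x y).
Proof.
apply: measurable_sum => i; apply: measurable_funM => //; exact: measurable_coord.
Qed.

Lemma measurable_dot2 d (T : measurableType d) n (f g : T -> 'rV[R]_n) :
  measT f -> measT g ->
  measT (fun x => dot (f x) (g x)).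
Proof.
move=> mf mg; apply: measurable_sum => i; apply: measurable_funM.
  exact: (measurableT_comp (measurable_coord i) mf).
exact: (measurableT_comp (measurable_coord i) mg).
Qed.

Lemma dot_cons n (a b : R) (x y : 'rV[R]_n) :
  dot (cons_rV (a, x)) (cons_rV (b, y)) = a * b + dot x y.
Proof.
rewrite /dot big_ord_recl !cons_rV0; congr (_ + _).
by apply: eq_bigr => i _; rewrite !cons_rVS.
Qed.

Lemma cons_rVE n (x : 'rV[R]_n.+1) : x = cons_rV (uncons_rV x).
Proof.
apply/rowP => i; case: (unliftP ord0 i) => [j ->|->].
  by rewrite cons_rVS mxE.
by rewrite cons_rV0.
Qed.

Lemma cons_rVD n (a b : R) (x y : 'rV[R]_n) :
  cons_rV (a, x) + cons_rV (b, y) = cons_rV (a + b, x + y).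
Proof.
apply/rowP => i; case: (unliftP ord0 i) => [j ->|->].
  by rewrite mxE !cons_rVS mxE.
by rewrite mxE !cons_rV0.
Qed.

Lemma cons_rVN n (a : R) (x : 'rV[R]_n) : - cons_rV (a, x) = cons_rV (- a, - x).
Proof.
apply/rowP => i; case: (unliftP ord0 i) => [j ->|->].
  by rewrite mxE !cons_rVS mxE.
by rewrite mxE !cons_rV0.
Qed.

Lemma rV0E (x y : 'rV[R]_0) : x = y.
Proof. by apply/rowP => -[]. Qed.

Lemma measurable_cons1 n (a : R) : measT (fun y : 'rV[R]_n => cons_rV (a, y)).
Proof.
apply: (measurableT_comp (measurable_cons_rV (n := n) (R := R))).
exact: measurable_pair1.
Qed.

Lemma measurable_section_int n (f : 'rV[R]_n.+1 -> \bar R) :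
  measT f -> (forall x, 0 <= f x)%E ->
  measT (fun a : measurableTypeR R => \int[lamn n]_y f (cons_rV (a, y)))%E.
Proof.
move=> mf f0.
apply: (@measurable_fun_fubini_tonelli_F _ _ _ _ _ (lamn n) (f \o @cons_rV R n)).
- by apply: measurableT_comp => //; exact: measurable_cons_rV.
- by move=> z; exact: f0.
Qed.

(** The last coordinates are shifted by induction, inside the integral over the first one, which is
    then shifted by the one-dimensional case. *)
Lemma ge0_integral_rV_shift n (z : 'rV[R]_n) (f : 'rV[R]_n -> \bar R) :
  measT f -> (forall x, 0 <= f x)%E ->
  (\int[lamn n]_x f (x + z)%R = \int[lamn n]_x f x)%E.
Proof.
elim: n z f => [|n IH] z f mf f0.
  by apply: eq_integral => x _; congr f; exact: rV0E.
rewrite (cons_rVE z); case: (uncons_rV z) => b w.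
rewrite !ge0_integral_rVS//; last by apply: (measurableT_comp mf); apply: measurable_rV_map2.
under eq_integral => a _.
  under eq_integral => y _ do rewrite cons_rVD.
  rewrite (IH w (fun y => f (cons_rV (a + b, y)))); first over.
    by apply: (measurableT_comp mf); exact: measurable_cons1.
  by move=> x; exact: f0.
rewrite (@ge0_integral_affine _ 1 b (fun a => \int[lamn n]_x f (cons_rV (a, x))))%E//.
- by rewrite mul1e; apply: eq_integral => a _; rewrite mul1r.
- exact: measurable_section_int.
- by move=> x; apply: integral_ge0.
Qed.

Lemma ge0_integral_rV_opp n (f : 'rV[R]_n -> \bar R) :
  measT f -> (forall x, 0 <= f x)%E ->
  (\int[lamn n]_x f (- x)%R = \int[lamn n]_x f x)%E.
Proof.
elim: n f => [|n IH] f mf f0.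
  by apply: eq_integral => x _; congr f; exact: rV0E.
rewrite !ge0_integral_rVS//; last by apply: (measurableT_comp mf); exact: measurable_rV_opp.
under eq_integral => a _.
  under eq_integral => y _ do rewrite cons_rVN.
  rewrite (IH (fun y => f (cons_rV (- a, y)))); first over.
    by apply: (measurableT_comp mf); exact: measurable_cons1.
  by move=> x; exact: f0.
rewrite (@ge0_integral_opp1 _ (fun a => \int[lamn n]_x f (cons_rV (a, x))))%E//.
- exact: measurable_section_int.
- by move=> x; apply: integral_ge0.
Qed.

Lemma intg_rVS n (F : 'rV[R]_n.+1 -> R) (a : R -> R) (b : 'rV[R]_n -> R) :
  measT F -> intg lam a -> intg (lamn n) b ->
  (forall t y, `|F (cons_rV (t, y))| <= a t * b y) ->
  intg (lamn n.+1) F /\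
  \int[lamn n.+1]_x F x = \int[lam]_t \int[lamn n]_y F (cons_rV (t, y)).
Proof.
move=> mF Ia Ib Fab.
have mFc : measT (F \o @cons_rV R n).
  by apply: measurableT_comp => //; exact: measurable_cons_rV.
have iF : (lam \x lamn n)%E.-integrable setT (EFin \o (F \o @cons_rV R n)).
  apply/integrable12ltyP; first exact/measurable_EFinP.
  exact: (dominated_prod_lty mFc Ia Ib).
have mc := measurable_cons_rV (n := n) (R := R).
have mEF : measT (EFin \o F) by exact/measurable_EFinP.
have iF' : (lam \x lamn n)%E.-integrable (@cons_rV R n @^-1` setT) ((EFin \o F) \o @cons_rV R n).
  by rewrite preimage_setT.
split.
  have [_ h] := integrableP _ _ _ (integrable_pushforward mc mEF iF' measurableT).
  apply/integrableP; split => //; apply: le_lt_trans h.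
have [_ ->] := real_fubini_l mFc iF; congr fine.
apply: etrans (esym (integral12_prod_meas1 iF)).
have h := integral_pushforward mc mEF iF' measurableT.
rewrite preimage_setT in h; apply: etrans h.
exact: (eq_measure_integral (measure_function_pushforward__canonical__measure_function_Measure
  (lam \x lamn n)%E mc)).
Qed.

End lebesgue_rV_theory.

(** * Products of functions of one variable *)

Section product_functions.
Context {R : realType}.
Notation lam := (@lebesgue_measure R).
Notation lamn := lebesgue_rV.
Variable g : R -> R.
Hypothesis Ig : intg lam g.

Definition prodf n (x : 'rV[R]_n) : R := \prod_i g (x ord0 i).

Lemma prodf_cons n (a : R) (y : 'rV[R]_n) : prodf (cons_rV (a, y)) = g a * prodf y.
Proof.
rewrite /prodf big_ord_recl cons_rV0; congr (_ * _).
by apply: eq_bigr => i _; rewrite cons_rVS.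
Qed.

Lemma measurable_prodf n : measT (@prodf n).
Proof.
apply: measurable_prod => i _.
exact: (measurableT_comp (intg_meas Ig) (measurable_coord i)).
Qed.

Lemma Int_rV0 (f : 'rV[R]_0 -> R) : measT f ->
  intg (lamn 0) f /\ \int[lamn 0]_x f x = f (0 : 'rV[R]_0).
Proof.
move=> mf; have E (h : 'rV[R]_0 -> \bar R) : measT h ->
   (\int[lamn 0]_x h x = h (0%R : 'rV[R]_0))%E.
  by move=> mh; rewrite integral_dirac//= diracT mul1e.
split; last by rewrite /Rintegral E//; exact/measurable_EFinP.
apply: intgP => //; rewrite E ?ltry//.
by apply/measurable_EFinP; exact: measurableT_comp.
Qed.

Lemma intg_prodf n : intg (lamn n) (@prodf n).
Proof.
elim: n => [|n IH]; first by apply: (Int_rV0 _).1; exact: measurable_prodf.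
apply: (intg_rVS _ (intg_norm Ig) (intg_norm IH) _).1; first exact: measurable_prodf.
by move=> t y; rewrite prodf_cons normrM.
Qed.

(** The addition formulas split off one coordinate at a time; every term that contains a sine
    integral of [g] vanishes, and only the product of cosine integrals survives. *)
Lemma prodf_trig n (xi : 'rV[R]_n) :
  (forall i, \int[lam]_x (g x * sin (x * xi ord0 i)) = 0) ->
  \int[lamn n]_x (prodf x * cos (dot x xi)) = \prod_i \int[lam]_x (g x * cos (x * xi ord0 i)) /\
  \int[lamn n]_x (prodf x * sin (dot x xi)) = 0.
Proof.
have mc t : measT (fun x : measurableTypeR R => cos (x * t)).
  by apply: (measurableT_comp (continuous_measurable_fun (@continuous_cos R))); apply: measurable_funM.
have ms t : measT (fun x : measurableTypeR R => sin (x * t)).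
  by apply: (measurableT_comp (continuous_measurable_fun (@continuous_sin R))); apply: measurable_funM.
have Igc t : intg lam (fun x => g x * cos (x * t)).
  apply: eq_intg (intgM_bounded (M := 1) Ig (mc t) _) => x; first by rewrite mulrC.
  exact: cos_max.
have Igs t : intg lam (fun x => g x * sin (x * t)).
  apply: eq_intg (intgM_bounded (M := 1) Ig (ms t) _) => x; first by rewrite mulrC.
  exact: sin_max.
have mcd k (y : 'rV[R]_k) : measT (fun x => cos (dot x y)).
  by apply: (measurableT_comp (continuous_measurable_fun (@continuous_cos R))); exact: measurable_dot.
have msd k (y : 'rV[R]_k) : measT (fun x => sin (dot x y)).
  by apply: (measurableT_comp (continuous_measurable_fun (@continuous_sin R))); exact: measurable_dot.
have Ipc k (y : 'rV[R]_k) : intg (lamn k) (fun x => prodf x * cos (dot x y)).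
  apply: eq_intg (intgM_bounded (M := 1) (intg_prodf k) (mcd k y) _) => x; first by rewrite mulrC.
  exact: cos_max.
have Ips k (y : 'rV[R]_k) : intg (lamn k) (fun x => prodf x * sin (dot x y)).
  apply: eq_intg (intgM_bounded (M := 1) (intg_prodf k) (msd k y) _) => x; first by rewrite mulrC.
  exact: sin_max.
elim: n xi => [|n IH] xi s0.
  have [_ ->] := Int_rV0 (intg_meas (Ipc 0%N xi)).
  have [_ ->] := Int_rV0 (intg_meas (Ips 0%N xi)).
  by rewrite /prodf /dot !big_ord0 cos0 sin0 mulr1 mulr0.
have [|IHc IHs] := IH (uncons_rV xi).2.
  by move=> i; rewrite mxE; exact: s0.
set b := (uncons_rV xi).1; set y := (uncons_rV xi).2 in IHc IHs *.
have xiE : xi = cons_rV (b, y) by rewrite {1}(cons_rVE xi).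
have pE : \prod_i \int[lam]_x (g x * cos (x * xi ord0 i)) =
    \int[lam]_x (g x * cos (x * b)) * \prod_i \int[lam]_x (g x * cos (x * y ord0 i)).
  rewrite big_ord_recl; congr (_ * _).
  by apply: eq_bigr => i _; rewrite mxE.
have bd (f : R -> R) : (forall x, `|f x| <= 1) -> forall t (x : 'rV[R]_n),
    `|prodf (cons_rV (t, x)) * f (dot (cons_rV (t, x)) xi)| <= `|g t| * `|prodf x|.
  move=> f1 t x; rewrite normrM prodf_cons normrM ler_piMr// mulr_ge0//.
split.
  have [_ ->] := intg_rVS (intg_meas (Ipc n.+1 xi)) (intg_norm Ig)
    (intg_norm (intg_prodf n)) (bd _ (@cos_max R)).
  rewrite pE -IHc [RHS]mulrC -IntZ//; apply: eq_Int => t.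
  rewrite (eq_Int _ (g := fun x => g t * cos (t * b) * (prodf x * cos (dot x y)) -
     g t * sin (t * b) * (prodf x * sin (dot x y)))); last first.
    by move=> x; rewrite xiE dot_cons prodf_cons cosD; ring.
  rewrite IntB; [|exact: intgZ|exact: intgZ].
  by rewrite !IntZ// IHs mulr0 subr0 mulrC.
have [_ ->] := intg_rVS (intg_meas (Ips n.+1 xi)) (intg_norm Ig)
  (intg_norm (intg_prodf n)) (bd _ (@sin_max R)).
rewrite (eq_Int _ (g := fun t : measurableTypeR R => (\int[lamn n]_x (prodf x * cos (dot x y))) * (g t * sin (t * b)))).
  by rewrite IntZ// [X in _ * X](s0 ord0) mulr0.
move=> t; rewrite (eq_Int _ (g := fun x => g t * sin (t * b) * (prodf x * cos (dot x y)) +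
     g t * cos (t * b) * (prodf x * sin (dot x y)))); last first.
  by move=> x; rewrite xiE dot_cons prodf_cons sinD; ring.
rewrite IntD; [|exact: intgZ|exact: intgZ].
by rewrite !IntZ// IHs mulr0 addr0 mulrC.
Qed.

End product_functions.

(** * The gaussian on the line and its transform *)

Section gaussian1.
Context {R : realType}.
Notation lam := (@lebesgue_measure R).
Implicit Types s t x : R.

Lemma is_derive_eps (f : R -> R) (t l : R) : (forall e, 0 < e -> exists2 del, 0 < del &
    forall h, `|h| < del -> `|f (t + h) - f t - h * l| <= e * `|h|) -> is_derive t (1 : R) f l.
Proof.
move=> H; have cl : (fun h => h^-1 *: (f (h *: 1 + t) - f t)) @ 0^' --> l.
  apply/cvgrPdist_le => /= e e0; have [del del0 hd] := H e e0.
  near=> h; have h0 : h != 0 by near: h; exact: nbhs_dnbhs_neq.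
  have hl : `|h| < del by near: h; exact: dnbhs0_lt.
  have he := hd h hl; rewrite distrC [h *: 1 + t]addrC [h *: 1]mulr1 /GRing.scale/=.
  rewrite (_ : _ - l = h^-1 * (f (t + h) - f t - h * l)); last by field.
  by rewrite normrM normfV ler_pdivrMl ?normr_gt0// [leRHS]mulrC.
by apply: DeriveDef; [exact: cvgP cl|exact: cvg_lim cl].
Unshelve. all: by end_near.
Qed.

(** Serves to differentiate under an integral: a quadratic bound on the remainder of the integrand
    passes to the integral. *)
Lemma is_derive_quadratic (f : R -> R) (t l K : R) :
  (forall e, `|f (t + e) - f t - e * l| <= K * e ^+ 2) -> is_derive t 1 f l.
Proof.
move=> h; have K0 : 0 <= K by have := le_trans (normr_ge0 _) (h 1); rewrite expr1n mulr1.
apply: is_derive_eps => e e0; exists (e / (K + 1)); first by rewrite divr_gt0// ltr_wpDl.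
move=> r /ltW; rewrite ler_pdivlMr ?ltr_wpDl// => hr; apply: (le_trans (h r)).
rewrite -(real_normK (num_real r)) expr2 mulrA ler_wpM2r//; apply: le_trans hr.
by rewrite mulrC ler_wpM2l// lerDl.
Qed.

Lemma lipschitz_derive (f df : R -> R) (K a b : R) :
  (forall x, is_derive x 1 f (df x)) -> (forall x, `|x - a| <= `|b - a| -> `|df x| <= K) ->
  `|f b - f a| <= K * `|b - a|.
Proof.
move=> hf hK.
have cf : continuous f.
  by move=> x; apply: differentiable_continuous; apply/derivable1_diffP; case: (hf x).
have := ltgtP a b => -[ab|ba|->]; last by rewrite !subrr !normr0 mulr0.
  have [c] := @MVT R f df a b ab (fun x _ => hf x) (continuous_subspaceT cf).
  rewrite in_itv/= => /andP[ac cb] ->.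
  rewrite normrM ler_wpM2r// hK// !ger0_norm ?subr_ge0 ?(ltW ac) ?(ltW ab)//.
  by rewrite lerB// ltW.
have [c] := @MVT R f df b a ba (fun x _ => hf x) (continuous_subspaceT cf).
rewrite in_itv/= => /andP[bc ca]; rewrite distrC => ->.
rewrite normrM [`|b - a|]distrC ler_wpM2r// hK// distrC [`|b - a|]distrC.
by rewrite !ger0_norm ?subr_ge0 ?(ltW ca) ?(ltW ba)// lerB// ltW.
Qed.

Lemma sin_lipschitz (a b : R) : `|sin b - sin a| <= `|b - a|.
Proof.
rewrite -[leRHS]mul1r; apply: (@lipschitz_derive _ cos).
by move=> x _; exact: cos_max.
Qed.

Lemma cos_lipschitz (a b : R) : `|cos b - cos a| <= `|b - a|.
Proof.
rewrite -[leRHS]mul1r; apply: (@lipschitz_derive _ (fun x => - sin x)).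
by move=> x _; rewrite normrN; exact: sin_max.
Qed.

Lemma measurable_sin_mulr t : measurable_fun [set: measurableTypeR R] (fun x : R => sin (x * t)).
Proof.
apply: continuous_measurable_fun => x; apply: continuous_comp; first exact: mulrr_continuous.
exact: continuous_sin.
Qed.

Lemma measurable_cos_mulr t : measurable_fun [set: measurableTypeR R] (fun x : R => cos (x * t)).
Proof.
apply: continuous_measurable_fun => x; apply: continuous_comp; first exact: mulrr_continuous.
exact: continuous_cos.
Qed.

Lemma measurable_sin d (T : measurableType d) (f : T -> R) :
  measT f -> measT (fun y => sin (f y)).
Proof. exact: (measurableT_comp (continuous_measurable_fun (@continuous_sin R))). Qed.

Lemma measurable_cos d (T : measurableType d) (f : T -> R) :
  measT f -> measT (fun y => cos (f y)).
Proof. exact: (measurableT_comp (continuous_measurable_fun (@continuous_cos R))). Qed.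

Definition gau s x := expR (- (s * x ^+ 2)).

Lemma gau_ge0 s x : 0 <= gau s x. Proof. exact: expR_ge0. Qed.

Lemma measurable_gau s : measT (gau s : measurableTypeR R -> R).
Proof.
apply: measurableT_comp => //; apply: measurableT_comp => //; apply: measurable_funM => //.
Qed.

Lemma integral_gau s : 0 < s ->
  intg lam (gau s) /\ \int[lam]_x gau s x = Num.sqrt (pi / s).
Proof.
move=> s0; have q0 : 0 < Num.sqrt s by rewrite sqrtr_gt0.
have := @ge0_integral_affine R (Num.sqrt s) 0 (fun x => (gauss_fun x)%:E) q0.
rewrite integralT_gauss => /(_ _ _) H.
have {}H : ((Num.sqrt pi)%:E = (Num.sqrt s)%:E * \int[lam]_x (gau s x)%:E)%E.
  rewrite H//; last 2 first.
  - by apply/measurable_EFinP; exact: measurable_gauss_fun.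
  - by move=> x; rewrite lee_fin gauss_fun_ge0.
  congr (_ * _)%E; apply: eq_integral => x _; rewrite /gauss_fun /gau addr0 exprMn.
  by rewrite sqr_sqrtr// ltW.
have {}H : (\int[lam]_x (gau s x)%:E = (Num.sqrt (pi / s))%:E)%E.
  have -> : (\int[lam]_x (gau s x)%:E = ((Num.sqrt s)^-1)%:E * ((Num.sqrt s)%:E * \int[lam]_x (gau s x)%:E))%E.
    by rewrite muleA -EFinM mulVf ?mul1e// gt_eqF.
  rewrite -H -EFinM; congr EFin.
  by rewrite sqrtrM ?pi_ge0// sqrtrV ?(ltW s0)// mulrC.
split; last by rewrite /Rintegral H.
apply: intgP; first exact: measurable_gau.
under eq_integral do rewrite ger0_norm ?gau_ge0//.
by rewrite H ltry.
Qed.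

Lemma gau_sqr_le s x : 0 < s -> x ^+ 2 * gau s x <= 2 / s * gau (s / 2) x.
Proof.
move=> s0; rewrite /gau.
have -> : expR (- (s * x ^+ 2)) = expR (- (s / 2 * x ^+ 2)) * expR (- (s / 2 * x ^+ 2)).
  by rewrite -expRD; congr expR; field.
rewrite mulrA ler_wpM2r ?expR_ge0//.
rewrite expRN ler_pdivrMr ?expR_gt0//.
have h := expR_ge1Dx (s / 2 * x ^+ 2).
apply: (@le_trans _ _ (2 / s * (s / 2 * x ^+ 2))).
  by apply: eq_ler; field; rewrite gt_eqF.
rewrite ler_wpM2l//; first by rewrite divr_ge0// ltW.
by apply: le_trans h; rewrite lerDr.
Qed.

Lemma intg_gauM (p : R -> R) (c1 c2 s : R) : 0 < s -> measT (p : measurableTypeR R -> R) ->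
  0 <= c1 -> 0 <= c2 -> (forall x, `|p x| <= c1 + c2 * x ^+ 2) -> intg lam (fun x => gau s x * p x).
Proof.
move=> s0 mp c10 c20 pb.
have s20 : 0 < s / 2 by rewrite divr_gt0.
apply: (@intg_le _ (measurableTypeR R) R lam _ (fun x => c1 * gau s x + c2 * (2 / s) * gau (s / 2) x)).
- by apply: measurable_funM => //; exact: measurable_gau.
- by apply: intgD; apply: intgZ; exact: (integral_gau _).1.
- move=> x; rewrite normrM ger0_norm ?gau_ge0//.
  apply: (le_trans (ler_wpM2l (gau_ge0 s x) (pb x))).
  rewrite mulrDr [X in X + _ <= _]mulrC lerD2l.
  have := ler_wpM2l c20 (gau_sqr_le x s0).
  by congr (_ <= _); ring.
Qed.

(** The mean value inequality for [cos (a + x) + x * sin a], whose derivative is at most [|x|]; the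
    optimal factor 1/2 is not sought. *)
Lemma cos_taylor2 (a b : R) : `|cos (a + b) - cos a + b * sin a| <= 1 * b ^+ 2.
Proof.
rewrite mul1r.
pose f x := cos (a + x) + x * sin a.
have df x : is_derive x 1 f (- sin (a + x) + sin a).
  have d1 : is_derive x 1 (fun x => a + x) 1.
    by apply: (@is_derive_quadratic _ _ _ 0) => e; rewrite mul0r mulr1 (_ : _ - _ = 0) ?normr0//; ring.
  have d2 : is_derive x 1 (fun x => x * sin a) (sin a).
    by apply: (@is_derive_quadratic _ _ _ 0) => e; rewrite mul0r (_ : _ - _ = 0) ?normr0//; ring.
  have d3 := @is_derive1_comp R cos (fun x => a + x) x _ _ (is_derive_cos _) d1.
  by have := is_deriveD d3 d2; rewrite mulr1; exact.
have -> : cos (a + b) - cos a + b * sin a = f b - f 0 by rewrite /f addr0 mul0r; ring.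
rewrite -(real_normK (num_real b)) expr2.
have := @lipschitz_derive f _ `|b| 0 b df; rewrite subr0; apply => x; rewrite subr0 => xb.
rewrite addrC; apply: le_trans xb.
by apply: (le_trans (sin_lipschitz _ _)); rewrite opprD addNKr normrN.
Qed.

Lemma gau_sin s t : 0 < s -> \int[lam]_x (gau s x * sin (x * t)) = 0.
Proof.
move=> s0; set I := Rintegral _ _ _.
have Is : intg lam (fun x => gau s x * sin (x * t)).
  apply: (intg_gauM (c1 := 1) (c2 := 0)) => //.
    exact: measurable_sin_mulr.
  by move=> x; rewrite mul0r addr0 sin_max.
have mN : measT (-%R : measurableTypeR R -> measurableTypeR R) by [].
have [_] := Int_comp_inv mN (@ge0_integral_opp1 R) Is.
rewrite (eq_Int _ (g := fun x : measurableTypeR R => - (gau s x * sin (x * t)))); last first.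
  by move=> x; rewrite /gau sqrrN mulNr sinN mulrN.
rewrite IntN// -/I; lra.
Qed.

(** Integration by parts: the difference of the two integrands is the derivative of
    [- gau s x * sin (x * t) / (2 * s)], which vanishes at both infinities. Dominated convergence
    passes from bounded intervals to the line. *)
Lemma gau_ibp s t : 0 < s ->
  \int[lam]_x (gau s x * (x * sin (x * t))) = t / (2 * s) * \int[lam]_x (gau s x * cos (x * t)).
Proof.
move=> s0.
have Ic : intg lam (fun x => gau s x * cos (x * t)).
  apply: (intg_gauM (c1 := 1) (c2 := 0)) => //.
    exact: measurable_cos_mulr.
  by move=> x; rewrite mul0r addr0 cos_max.
have Is : intg lam (fun x => gau s x * (x * sin (x * t))).
  apply: (intg_gauM (c1 := 1) (c2 := 1)) => //.
    by apply: measurable_funM => //; exact: measurable_sin_mulr.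
  move=> x; rewrite normrM mul1r (@le_trans _ _ `|x|)//.
    by rewrite ler_piMr// sin_max.
  by rewrite -(real_normK (num_real x)); nra.
rewrite -IntZ//; apply/eqP; rewrite -subr_eq0 -IntB//; last exact: intgZ.
pose F (x : R) : R := - (2 * s)^-1 * (gau s x * sin (x * t)).
pose f (x : R) : R := gau s x * (x * sin (x * t)) - t / (2 * s) * (gau s x * cos (x * t)).
have dF x : is_derive x 1 F (f x).
  have d1 : is_derive x 1 (fun y : R => - (s * y ^+ 2)) (- (s * (2 * x))).
    apply: (@is_derive_quadratic _ _ _ s) => e.
    rewrite (_ : _ - _ = - (s * e ^+ 2)); last by ring.
    by rewrite normrN ger0_norm// mulr_ge0 ?sqr_ge0// ltW.
  have d2 : is_derive x 1 (fun x => x * t) t.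
    by apply: (@is_derive_quadratic _ _ _ 0) => e; rewrite mul0r (_ : _ - _ = 0) ?normr0//; ring.
  have d3 := @is_derive1_comp R expR _ x _ _ (is_derive_expR _) d1.
  have d4 := @is_derive1_comp R sin _ x _ _ (is_derive_sin _) d2.
  have := is_deriveZ (- (2 * s)^-1) (is_deriveM d3 d4).
  rewrite (_ : _ *: _ = f x); first exact.
  by rewrite /f /gau /GRing.scale/=; field; rewrite gt_eqF.
have If : intg lam f by apply: intgB => //; exact: intgZ.
have cF : continuous F.
  by move=> x; apply: differentiable_continuous; apply/derivable1_diffP; case: (dF x).
have cf : continuous f.
  have cg : continuous (gau s).
    move=> x; apply: (@continuous_comp _ _ _ (fun x => - (s * x ^+ 2)) expR); last exact: continuous_expR.
    by apply: cvgN; apply: cvgMr; apply: exprn_continuous.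
  have cst' (h : R -> R) : continuous h -> continuous (fun x => h (x * t)).
    move=> ch x; apply: (@continuous_comp _ _ _ (fun x => x * t) h); last exact: ch.
    exact: mulrr_continuous.
  move=> x; apply: cvgB.
    apply: cvgM; first exact: cg.
    by apply: cvgM; [exact: cvg_id|apply: cst'; exact: continuous_sin].
  apply: cvgMr; apply: cvgM; first exact: cg.
  by apply: cst'; exact: continuous_cos.
pose A (n : nat) := `[- n.+1%:R, n.+1%:R : R]%classic.
have [||||_] := @dct _ (measurableTypeR R) R lam (fun n => f \_ (A n)) f (fun x => `|f x|).
- move=> n; have mf := intg_meas If.
  have mA : measurable (A n : set (measurableTypeR R)) by exact: measurable_itv.
  exact: (measurable_restrictT f mA).1 (measurable_funTS mf).
- move=> x; apply/cvgrPdist_le => e e0; near=> n.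
  rewrite patchE mem_set ?subrr ?normr0 ?ltW// /A /= in_itv/=.
  rewrite -ler_norml; near: n; exists (Num.truncn `|x|) => // k /= xk.
  by rewrite (le_trans (ltW (truncnS_gt _)))// ler_nat.
- exact: intg_norm.
- by move=> n x; rewrite patchE; case: ifP; rewrite ?normr0.
rewrite (_ : (fun n => _) = (fun n => F n.+1%:R - F (- n.+1%:R))); last first.
  apply/funext => n; rewrite -Rintegral_mkcond /Rintegral (@continuous_FTC2 _ f F) //.
  - by rewrite gtrN.
  - exact: continuous_subspaceT.
  - split.
    + by move=> x _; case: (dF x).
    + by apply: cvg_at_right_filter; exact: cF.
    + by apply: cvg_at_left_filter; exact: cF.
  - by move=> x _; rewrite derive1E; case: (dF x) => _ ->.
move=> h1.
have h2 : (fun n => F n.+1%:R - F (- n.+1%:R)) @ \oo --> (0 : R).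
  apply/norm_cvg0P; apply: (@squeeze_cvgr _ _ _ _ (fun=> 0) (fun n => s^-1 ^+ 2 * harmonic n)); last 2 first.
  - exact: cvg_cst.
  - by rewrite -[X in _ --> X](mulr0 (s^-1 ^+ 2)); apply: cvgMr; exact: cvg_harmonic.
  apply: nearW => n; rewrite normr_ge0/=.
  have bF x : `|F x| <= (2 * s)^-1 * gau s x.
    have p0 : 0 <= (2 * s)^-1 by rewrite invr_ge0 mulr_ge0// ltW.
    rewrite /F normrM normrN (ger0_norm p0) normrM (ger0_norm (gau_ge0 s x)).
    by rewrite ler_wpM2l// ler_piMr ?gau_ge0// sin_max.
  apply: (le_trans (ler_normB _ _)); apply: (le_trans (lerD (bF _) (bF _))).
  rewrite (_ : gau s (- n.+1%:R) = gau s n.+1%:R); last by rewrite /gau sqrrN.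
  rewrite (_ : _ + _ = s^-1 * gau s n.+1%:R); last by field; rewrite gt_eqF.
  have q0 : 0 <= s^-1 by rewrite invr_ge0 ltW.
  rewrite expr2 -mulrA ler_wpM2l// /gau expRN /harmonic/=.
  rewrite -invfM lef_pV2 ?posrE ?expR_gt0 ?mulr_gt0//.
  apply: le_trans (expR_ge1Dx _).
  rewrite (@le_trans _ _ (s * n.+1%:R ^+ 2))// ?lerDr// ler_wpM2l ?(ltW s0)// expr2.
  by rewrite ler_peMr// ler1n.
apply/eqP; exact: cvg_unique h1 h2.
Unshelve. all: by end_near.
Qed.

(** As a function of [t] the integral [c] satisfies [c' = - t / (2 * s) * c], by differentiation
    under the integral and [gau_ibp]. Hence [c t * expR (t ^+ 2 / (4 * s))] is constant, and its
    value at 0 is the mass of the gaussian. *)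
Lemma gau_cos s t : 0 < s ->
  \int[lam]_x (gau s x * cos (x * t)) = Num.sqrt (pi / s) * gau (4 * s)^-1 t.
Proof.
move=> s0.
pose c t := \int[lam]_x (gau s x * cos (x * t)).
have Ic r : intg lam (fun x => gau s x * cos (x * r)).
  apply: (intg_gauM (c1 := 1) (c2 := 0)) => //.
    exact: measurable_cos_mulr.
  by move=> x; rewrite mul0r addr0 cos_max.
have Is r : intg lam (fun x => gau s x * (x * sin (x * r))).
  apply: (intg_gauM (c1 := 1) (c2 := 1)) => //.
    by apply: measurable_funM => //; exact: measurable_sin_mulr.
  move=> x; rewrite normrM mul1r (@le_trans _ _ `|x|)//.
    by rewrite ler_piMr// sin_max.
  by rewrite -(real_normK (num_real x)); nra.
have I2 : intg lam (fun x => gau s x * x ^+ 2).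
  apply: (intg_gauM (c1 := 0) (c2 := 1)) => //.
  by move=> x; rewrite add0r mul1r ger0_norm// sqr_ge0.
have dc (r : R) : is_derive r 1 c (- (r / (2 * s) * c r)).
  apply: (@is_derive_quadratic _ _ _ (\int[lam]_x (gau s x * x ^+ 2))) => e.
  rewrite -gau_ibp// mulrN opprK -IntB// -IntZ// -IntD//; last 2 first.
  - exact: intgB.
  - exact: intgZ.
  rewrite [leRHS]mulrC -IntZ//; apply: le_norm_Int.
  - by apply: intgD; [exact: intgB|exact: intgZ].
  - exact: intgZ.
  move=> x; rewrite (_ : _ + _ = gau s x * (cos (x * r + x * e) - cos (x * r) + (x * e) * sin (x * r))).
    rewrite normrM ger0_norm ?gau_ge0// mulrCA ler_wpM2l ?gau_ge0//.
    by apply: (le_trans (cos_taylor2 _ _)); rewrite mul1r exprMn mulrC.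
  by rewrite mulrDr; ring.
pose h t := c t * expR ((4 * s)^-1 * t ^+ 2).
have dh (r : R) : is_derive r 1 h 0.
  have d1 : is_derive r 1 (fun y : R => (4 * s)^-1 * y ^+ 2) ((4 * s)^-1 * (2 * r)).
    apply: (@is_derive_quadratic _ _ _ (4 * s)^-1) => e.
    rewrite (_ : _ - _ = (4 * s)^-1 * e ^+ 2); last by ring.
    by rewrite ger0_norm// mulr_ge0 ?sqr_ge0// invr_ge0 mulr_ge0 ?ltW.
  have d3 := @is_derive1_comp R expR _ r _ _ (is_derive_expR _) d1.
  have := is_deriveM (dc r) d3; rewrite (_ : _ + _ = 0 :> R); first exact.
  by rewrite /GRing.scale/=; field; rewrite gt_eqF.
have hE : h t = h 0 by apply: (@is_derive_0_is_cst _ h) => x; exact: dh.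
have c0 : c 0 = Num.sqrt (pi / s).
  rewrite /c -(integral_gau s0).2; apply: eq_Int => x.
  by rewrite mulr0 cos0 mulr1.
move: hE; rewrite /h expr0n/= mulr0 expR0 mulr1 c0 => <-.
by rewrite /gau -mulrA -expRD subrr expR0 mulr1.
Qed.

End gaussian1.

(** * The gaussian on R^n *)

Section gaussian_rV.
Context {R : realType}.
Notation lamn := lebesgue_rV.
Variable n : nat.
Implicit Types (s : R) (x xi : 'rV[R]_n).

Definition gaun s x := expR (- (s * dot x x)).

Lemma gaunE s x : prodf (gau s) x = gaun s x.
Proof.
rewrite /prodf /gaun /gau /dot mulr_sumr -sumrN expR_sum.
by apply: eq_bigr => i _; rewrite expr2.
Qed.

Lemma gaun_gt0 s x : 0 < gaun s x. Proof. exact: expR_gt0. Qed.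

Lemma measurable_gaun s : measT (@gaun s).
Proof.
apply: measurableT_comp => //; apply: measurableT_comp => //; apply: measurable_funM => //.
exact: measurable_dot2.
Qed.

Lemma gaun_le1 s x : 0 < s -> gaun s x <= 1.
Proof.
move=> s0; rewrite -expR0 ler_expR oppr_le0 mulr_ge0 ?(ltW s0)//.
by apply: sumr_ge0 => i _; rewrite -expr2 sqr_ge0.
Qed.

Lemma intg_gaun s : 0 < s -> intg (lamn n) (gaun s).
Proof.
move=> s0; rewrite -(funext (gaunE s)).
exact: (intg_prodf (integral_gau s0).1).
Qed.

Lemma gaun_cos s xi : 0 < s ->
  \int[lamn n]_x (gaun s x * cos (dot x xi)) = Num.sqrt (pi / s) ^+ n * gaun (4 * s)^-1 xi.
Proof.
move=> s0; have [h _] := prodf_trig (integral_gau s0).1 (fun i => gau_sin (xi ord0 i) s0).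
rewrite -(gaunE (4 * s)^-1) -(funext (gaunE s)) h /prodf.
under eq_bigr do rewrite gau_cos//.
by rewrite big_split/= prodr_const card_ord.
Qed.

Lemma gaun_sin s xi : 0 < s -> \int[lamn n]_x (gaun s x * sin (dot x xi)) = 0.
Proof.
move=> s0; have [_ h] := prodf_trig (integral_gau s0).1 (fun i => gau_sin (xi ord0 i) s0).
by rewrite -(funext (gaunE s)).
Qed.

End gaussian_rV.

(** * Frequencies *)

Section cubes.
Context {R : realType} {n : nat}.
Notation lam := (@lebesgue_measure R).
Notation lamn := lebesgue_rV.

Lemma measurable_coord_itv (i : 'I_n) (I : interval R) :
  measurable [set x : 'rV[R]_n | x ord0 i \in I].
Proof.
have := @measurable_coord R n i measurableT [set` I]%classic.
by rewrite setTI; apply; exact: measurable_itv.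
Qed.

Lemma measurable_box (I : 'I_n -> interval R) :
  measurable [set x : 'rV[R]_n | forall i, x ord0 i \in I i].
Proof.
have -> : [set x : 'rV[R]_n | forall i, x ord0 i \in I i] =
    ~` \bigcup_i ~` [set x : 'rV[R]_n | x ord0 i \in I i].
  apply/seteqP; split => x /=; first by move=> h [i _ /= hi]; apply: hi.
  by move=> h i; apply: contrapT => hi; apply: h; exists i.
apply: measurableC; apply: countable_bigcupT_measurable; first exact: countableP.
by move=> i; apply: measurableC; exact: measurable_coord_itv.
Qed.

Lemma measurable_cube (N : nat) : measurable (@cube R n N).
Proof.
rewrite (_ : cube N = [set x : 'rV[R]_n | forall i, x ord0 i \in `[- N%:R, N%:R]]).
  exact: measurable_box.
by apply/seteqP; split => x /= h i; have := h i; rewrite in_itv/= ler_norml.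
Qed.

Lemma measurable_cell Om : measurable (@cell R n Om).
Proof.
case: Om => /=; first exact: measurableT.
rewrite (_ : (fun x => _) = [set x : 'rV[R]_n | forall i, x ord0 i \in `[0, 2 * pi[]).
  exact: measurable_box.
by apply/seteqP; split => x /= h i; have := h i; rewrite in_itv.
Qed.

Lemma intg_itv (a b : R) : a <= b -> intg lam (\1_(`[a, b]%classic) : R -> R) /\
  \int[lam]_x (\1_(`[a, b]%classic) x : R) = b - a.
Proof.
move=> ab.
have E : (\int[lam]_x (\1_(`[a, b]%classic) x : R)%:E = (b - a)%:E)%E.
  transitivity (lam `[a, b]%classic); first by rewrite integral_indic// setIT.
  rewrite lebesgue_measure_itv/= lte_fin; case: ltP => // ba.
  by rewrite (le_anti (_ : a <= b <= a)) ?subrr// ab ba.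
split; last by rewrite /Rintegral E.
apply: intgP; first exact: measurable_indic.
by under eq_integral do rewrite ger0_norm//; rewrite E ltry.
Qed.

Lemma prodf_indic (A : set R) (x : 'rV[R]_n) :
  prodf (\1_A : R -> R) x = \1_[set x : 'rV[R]_n | forall i, A (x ord0 i)] x.
Proof.
rewrite /prodf indicE; have [h|h] := pselect (forall i, A (x ord0 i)).
  by rewrite mem_set// big1// => i _; rewrite indicE mem_set.
have /existsNP[i hi] := h.
by rewrite memNset// (bigD1 i)//= indicE memNset// mul0r.
Qed.

Lemma intg_cube (N : nat) : intg (lamn n) (\1_(@cube R n N)) /\
  \int[lamn n]_x (\1_(@cube R n N) x : R) = (2 * N%:R) ^+ n.
Proof.
have NN : - N%:R <= N%:R :> R by rewrite (@le_trans _ _ 0)// oppr_le0.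
have [I1 E1] := intg_itv NN.
have cE : \1_(@cube R n N) = @prodf R (\1_(`[- N%:R, N%:R]%classic) : R -> R) n :> ('rV[R]_n -> R).
  apply/funext => x; rewrite prodf_indic; congr (\1_ _ _).
  by apply/seteqP; split => y /= h i; have := h i; rewrite in_itv/= ler_norml.
split; first by rewrite cE; exact: intg_prodf.
have [] := prodf_trig I1 (xi := (0 : 'rV[R]_n)) _.
  by move=> i; rewrite mxE -[RHS](Int0 lam); apply: eq_Int => x; rewrite mulr0 sin0 mulr0.
move=> h _; rewrite cE; transitivity (\int[lamn n]_x (prodf (\1_(`[- N%:R, N%:R]%classic) : R -> R) x * cos (dot x 0))).
  apply: eq_Int => x; rewrite (_ : dot x 0 = 0) ?cos0 ?mulr1//.
  by rewrite /dot big1// => i _; rewrite mxE mulr0.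
rewrite h -[X in _ = _ ^+ X]card_ord -prodr_const; apply: eq_bigr => i _.
rewrite (_ : 2 * N%:R = N%:R - - N%:R); last by ring.
rewrite -E1; apply: eq_Int => x; by rewrite mxE mulr0 cos0 mulr1.
Qed.

End cubes.

(** * The counting measure of the integer lattice *)

Section torus_measure.
Context {R : realType} {n : nat}.
Notation V := 'rV[R]_n.
Notation Zn := (@freqs R n Torus).

Lemma measurable_set1_rV (x : V) : measurable [set x].
Proof.
rewrite (_ : [set x] = [set y : V | forall i, y ord0 i \in `[x ord0 i, x ord0 i]]).
  exact: measurable_box.
apply/seteqP; split => y /=; first by move=> -> i; rewrite in_itv/= lexx.
by move=> h; apply/rowP => i; apply/eqP; have := h i; rewrite in_itv/= eq_le andbC.
Qed.

Lemma countable_Zn : countable Zn.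
Proof. by apply: (sub_countable (B := [set: 'rV[int]_n])); [exact: card_image_le|exact: countableP]. Qed.

Lemma measurable_Zn : measurable Zn.
Proof. by apply: countable_measurable; [exact: measurable_set1_rV|exact: countable_Zn]. Qed.

(** Extending the counting measure of the lattice by zero to R^n lets functions of the frequency
    have the same type on both domains; identities then hold at frequencies, or almost
    everywhere. *)
Definition muT : set V -> \bar R := mrestr counting measurable_Zn.
HB.instance Definition _ := Measure.on muT.

(** The lattice is exhausted by finite sets through [unpickle]; its complement, of mass zero, is
    added to each of them. *)
Lemma muT_sigma_finite : sigma_finite setT muT.
Proof.
pose e (k : nat) : set V := if unpickle k is Some z then [set map_mx intr (z : 'rV[int]_n)] else set0.
exists (fun k => ~` Zn `|` \big[setU/set0]_(i < k) e i).
  apply/seteqP; split => // x _.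
  have [[z _ zx]|nx] := pselect (Zn x); last by exists 0%N => //; left.
  exists (pickle z).+1 => //; right; rewrite big_ord_recr/=; right.
  by rewrite /e pickleK.
have me i : measurable (e i) by rewrite /e; case: unpickle => // z; exact: measurable_set1_rV.
move=> k; split.
  apply: measurableU; first by apply: measurableC; exact: measurable_Zn.
  by apply: bigsetU_measurable.
rewrite /muT /mrestr /counting setIUl setICl set0U.
rewrite asboolT ?ltry//; apply: sub_finite_set (@subIsetl _ _ _) _.
rewrite -bigcup_mkord; apply: bigcup_finite; first exact: finite_II.
by move=> i _; rewrite /e; case: unpickle => // z; exact: finite_set1.
Qed.
HB.instance Definition _ := Measure_isSigmaFinite.Build _ _ _ muT muT_sigma_finite.

Lemma counting_bij (f : V -> V) (A : set V) : injective f ->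
  counting (f @` A) = counting A :> \bar R.
Proof.
move=> fi; have fe := @inj_card_eq _ _ A f (in2W fi).
rewrite /counting; case: (pselect (finite_set A)) => Af.
  have Bf : finite_set (f @` A) by exact: finite_image.
  by rewrite !asboolT//; congr ((_%:R)%:E); apply/fcard_eq.
rewrite !asboolF//; apply: contra_not Af => Bf.
by apply: card_le_finite Bf; move: fe; rewrite card_eq_le => /andP[].
Qed.

Lemma Zn_add x y : Zn x -> Zn y -> Zn (x + y).
Proof. by move=> [a _ <-] [b _ <-]; exists (a + b) => //; rewrite map_mxD. Qed.

Lemma Zn_opp x : Zn x -> Zn (- x).
Proof. by move=> [a _ <-]; exists (- a) => //; rewrite map_mxN. Qed.

Lemma muT_shift (z : V) (A : set V) : Zn z -> muT ((fun x => x + z) @^-1` A) = muT A.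
Proof.
move=> Zz; rewrite /muT /mrestr -(@counting_bij (fun x => x + z) (_ `&` Zn)) ?addIr//; last exact: addIr.
congr counting; apply/seteqP; split => x /=.
  by move=> [y [Ay Zy] <-]; split => //; exact: Zn_add.
move=> [Ax Zx]; exists (x - z); last by rewrite subrK.
by rewrite subrK; split => //; apply: Zn_add => //; exact: Zn_opp.
Qed.

Lemma muT_opp (A : set V) : muT (-%R @^-1` A) = muT A.
Proof.
rewrite /muT /mrestr -(@counting_bij -%R (_ `&` Zn)); last exact: oppr_inj.
congr counting; apply/seteqP; split => x /=.
  by move=> [y [Ay Zy] <-]; split => //; exact: Zn_opp.
move=> [Ax Zx]; exists (- x); last by rewrite opprK.
by rewrite opprK; split => //; exact: Zn_opp.
Qed.

Lemma ge0_integral_muT_comp (phi : V -> V) (f : V -> \bar R) :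
  measT phi -> (forall A, measurable A -> muT (phi @^-1` A) = muT A) ->
  measT f -> (forall x, 0 <= f x)%E ->
  (\int[muT]_x f (phi x) = \int[muT]_x f x)%E.
Proof.
move=> mphi h mf f0.
have := ge0_integral_pushforward mphi muT measurableT mf (fun y _ => f0 y).
rewrite preimage_setT => <-.
by apply: (eq_measure_integral muT) => A mA _; exact: h.
Qed.

Lemma counting_enum (T : eqType) (f : T -> V) (s : seq T) :
  (counting (\big[setU/set0]_(h <- s) [set f h]) <= ((size s)%:R : R)%:E)%E.
Proof.
elim: s => [|a s IH]; first by rewrite big_nil measure0.
have mb (r : seq T) : measurable (\big[setU/set0]_(h <- r) [set f h]).
  by apply: bigsetU_measurable => h _; exact: measurable_set1_rV.
rewrite big_cons (le_trans (measureU2 _ (measurable_set1_rV _) (mb s)))//.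
rewrite /= -[(size s).+1]addn1 natrD addeC EFinD leeD//.
by rewrite /counting asboolT// fset_set1 finmap.cardfs1.
Qed.

(** An integer point of the cube is determined by coordinates in [[-N, N]], shifted by [N] into
    ['I_((2 * N).+1)]; then [2 N + 1 <= 2 (N + 1)]. *)
Lemma muT_cube (N : nat) : (muT (cube N) <= ((2 * N.+1%:R) ^+ n)%:E)%E.
Proof.
pose f (h : {ffun 'I_n -> 'I_((2 * N).+1)}) : V := \row_i ((h i : nat)%:R - N%:R).
have sub : cube N `&` Zn `<=` \big[setU/set0]_(h <- enum {ffun 'I_n -> 'I_((2 * N).+1)}) [set f h].
  move=> x [cx [k _ kx]]; rewrite -bigcup_seq.
  have kb i : (`|k ord0 i| <= N%:Z)%R.
    by have := cx i; rewrite -kx mxE -intr_norm -[N%:R]/(N%:Z%:~R) ler_int.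
  exists [ffun i => inord (absz (k ord0 i + N%:Z))]; first by rewrite /= mem_enum.
  apply/rowP => i; rewrite mxE -kx mxE ffunE inordK; last first.
    by have := kb i; lia.
  have -> : ((absz (k ord0 i + N%:Z))%:R : R) = ((absz (k ord0 i + N%:Z))%:Z)%:~R by [].
  rewrite gez0_abs; first by rewrite intrD addrK.
  by have := kb i; lia.
apply: (@le_trans _ _ (counting (\big[setU/set0]_(h <- enum {ffun 'I_n -> 'I_((2 * N).+1)}) [set f h]))).
  apply: le_measure => //; rewrite inE; last by apply: bigsetU_measurable => h _; exact: measurable_set1_rV.
  by apply: measurableI; [exact: measurable_cube|exact: measurable_Zn].
apply: (le_trans (counting_enum _ _)).
rewrite -cardE card_ffun !card_ord lee_fin natrX.
by rewrite lerXn2r ?nnegrE// -natrM ler_nat; lia.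
Qed.

End torus_measure.

(** * The common measure on frequencies *)

Section frequency_measure.
Context {R : realType} {d : nat}.
Notation V := 'rV[R]_d.
Implicit Types (Om : domain).

(** Both measures are invariant under reflection and under translation by a frequency, and both give
    a cube of side N a mass of order N^d; the estimates use nothing else about them. *)
Definition fmu Om : {sigma_finite_measure set V -> \bar R} :=
  match Om with WholeSpace => lebesgue_rV d | Torus => muT end.

Lemma measurable_freqs Om : measurable (@freqs R d Om).
Proof. by case: Om => /=; [exact: measurableT|exact: measurable_Zn]. Qed.

Lemma freqs_add Om (x y : V) : freqs Om x -> freqs Om y -> freqs Om (x + y).
Proof. by case: Om => //; exact: Zn_add. Qed.

Lemma freqs_opp Om (x : V) : freqs Om x -> freqs Om (- x).
Proof. by case: Om => //; exact: Zn_opp. Qed.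

Lemma freqs_sub Om (x y : V) : freqs Om x -> freqs Om y -> freqs Om (x - y).
Proof. by move=> hx hy; apply: freqs_add => //; exact: freqs_opp. Qed.

Lemma freqs0 Om : freqs Om (0 : V).
Proof. by case: Om => //=; exists 0 => //; apply/rowP => i; rewrite !mxE. Qed.

Lemma ae_freqs Om : {ae fmu Om, forall x, freqs Om x}.
Proof.
case: Om => /=; first exact: aeW.
exists (~` freqs Torus); split => //.
  by apply: measurableC; exact: measurable_Zn.
by rewrite /muT /mrestr setICl measure0.
Qed.

Lemma fmu_opp Om (f : V -> \bar R) : measT f -> (forall x, 0 <= f x)%E ->
  (\int[fmu Om]_x f (- x)%R = \int[fmu Om]_x f x)%E.
Proof.
case: Om => /= mf f0; first exact: ge0_integral_rV_opp.
apply: ge0_integral_muT_comp => //; first by apply: measurable_rV_opp.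
by move=> A _; exact: muT_opp.
Qed.

Lemma fmu_shift Om (z : V) (f : V -> \bar R) : freqs Om z ->
  measT f -> (forall x, 0 <= f x)%E ->
  (\int[fmu Om]_x f (x + z)%R = \int[fmu Om]_x f x)%E.
Proof.
case: Om => /= Sz mf f0; first exact: ge0_integral_rV_shift.
apply: (@ge0_integral_muT_comp _ _ (fun x => x + z)) => //.
  by apply: measurable_rV_map2.
by move=> A _; exact: muT_shift.
Qed.

Lemma fmu_reflect Om (z : V) (f : V -> \bar R) : freqs Om z ->
  measT f -> (forall x, 0 <= f x)%E ->
  (\int[fmu Om]_x f (z - x)%R = \int[fmu Om]_x f x)%E.
Proof.
move=> Sz mf f0; rewrite -(fmu_shift Sz mf f0).
rewrite -[RHS](@fmu_opp Om (fun x => f (x + z)))//.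
- by apply: eq_integral => x _; rewrite addrC.
- by apply: (measurableT_comp mf); apply: measurable_rV_map2.
Qed.

Lemma fmu_cube Om (N : nat) : (fmu Om (cube N) <= ((2 * N.+1%:R) ^+ d)%:E)%E.
Proof.
case: Om => /=; last exact: muT_cube.
have [I1 E1] := @intg_cube R d N.
have := IntE I1; rewrite E1 integral_indic//; last exact: measurable_cube.
rewrite setIT => ->; rewrite lee_fin lerXn2r ?nnegrE ?mulr_ge0//.
by rewrite ler_wpM2l// ler_nat.
Qed.

Lemma integral_freqs Om (f : V -> \bar R) : measT f -> (forall x, 0 <= f x)%E ->
  (\int[freq_measure Om]_(x in freqs Om) f x = \int[fmu Om]_x f x)%E.
Proof.
case: Om => //= mf f0.
transitivity (\int[muT]_(x in freqs Torus) f x)%E.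
  by apply: eq_measure_integral => A mA AS; rewrite -[RHS]/(counting (A `&` freqs Torus)) setIidl.
rewrite -[in RHS](setUv (freqs Torus)) ge0_integral_setU//.
- rewrite [X in (_ + X)%E](_ : _ = 0%E) ?adde0//.
  apply: null_set_integral => //.
  + by apply: measurableC; exact: measurable_Zn.
  + exact: measurable_funTS.
  + by rewrite -[LHS]/(counting (~` freqs Torus `&` freqs Torus)) setICl measure0.
- exact: measurable_Zn.
- by apply: measurableC; exact: measurable_Zn.
- by rewrite setUv.
- exact/disj_setPCl.
Qed.

End frequency_measure.

(** * The euclidean norm *)

Section euclidean_norm.
Context {R : realType} {d : nat}.
Implicit Types x y : 'rV[R]_d.

Lemma dotC x y : dot x y = dot y x.
Proof. by apply: eq_bigr => i _; rewrite mulrC. Qed.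

Lemma dotDl x y z : dot (x + y) z = dot x z + dot y z.
Proof. by rewrite /dot -big_split/=; apply: eq_bigr => i _; rewrite mxE mulrDl. Qed.

Lemma dotNl x y : dot (- x) y = - dot x y.
Proof. by rewrite /dot -sumrN; apply: eq_bigr => i _; rewrite mxE mulNr. Qed.

Lemma dotZl a x y : dot (a *: x) y = a * dot x y.
Proof. by rewrite /dot mulr_sumr; apply: eq_bigr => i _; rewrite mxE mulrA. Qed.

Lemma dotDr x y z : dot x (y + z) = dot x y + dot x z.
Proof. by rewrite !(dotC x) dotDl. Qed.

Lemma dotNr x y : dot x (- y) = - dot x y.
Proof. by rewrite !(dotC x) dotNl. Qed.

Lemma dot0r x : dot x 0 = 0.
Proof. by rewrite /dot big1// => i _; rewrite mxE mulr0. Qed.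

Lemma dot_ge0 x : 0 <= dot x x.
Proof. by apply: sumr_ge0 => i _; rewrite -expr2 sqr_ge0. Qed.

Lemma enorm_ge0 x : 0 <= eucl_norm x. Proof. exact: sqrtr_ge0. Qed.

Lemma enorm_sqr x : eucl_norm x ^+ 2 = dot x x.
Proof. by rewrite sqr_sqrtr// dot_ge0. Qed.

Lemma enormN x : eucl_norm (- x) = eucl_norm x.
Proof. by rewrite /eucl_norm dotNl dotNr opprK. Qed.

Lemma dot_cs x y : `|dot x y| <= eucl_norm x * eucl_norm y.
Proof.
rewrite -(ler_pXn2r (n := 2)) ?nnegrE ?mulr_ge0 ?enorm_ge0// real_normK ?num_real//.
rewrite exprMn !enorm_sqr.
have key t : 0 <= dot x x + 2 * t * dot x y + t ^+ 2 * dot y y.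
  have := dot_ge0 (x + t *: y); rewrite dotDl !dotDr !dotZl !(dotC _ (_ *: _)) !dotZl.
  by rewrite (dotC y x); congr (0 <= _); ring.
have [y0|y0] := eqVneq (dot y y) 0.
  have /eqP -> : dot x y == 0.
    apply/negP => /negP xy0.
    have := key (- (dot x x + 1) / (2 * dot x y)); rewrite y0.
    rewrite (_ : _ + _ = -1); last by field.
    by rewrite lerNr oppr0 ler10.
  by rewrite expr0n/= y0 mulr0.
have yp : 0 < dot y y by rewrite lt_def y0 dot_ge0.
have := key (- dot x y / dot y y).
rewrite (_ : _ + _ = dot x x - dot x y ^+ 2 / dot y y); last by field.
by rewrite subr_ge0 ler_pdivrMr.
Qed.

Lemma enormD x y : eucl_norm (x + y) <= eucl_norm x + eucl_norm y.
Proof.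
rewrite -(ler_pXn2r (n := 2)) ?nnegrE ?addr_ge0 ?enorm_ge0//.
rewrite sqrrD !enorm_sqr dotDl !dotDr (dotC y x).
have := le_trans (ler_norm _) (dot_cs x y); lra.
Qed.

Lemma enormB x y : `|eucl_norm x - eucl_norm y| <= eucl_norm (x - y).
Proof.
have h1 := enormD (y - x) x; have h2 := enormD (x - y) y.
rewrite !subrK in h1 h2; rewrite -opprB enormN in h1.
by rewrite ler_norml; lra.
Qed.

Lemma coord_le_enorm x i : `|x ord0 i| <= eucl_norm x.
Proof.
rewrite -(ler_pXn2r (n := 2)) ?nnegrE ?enorm_ge0// real_normK ?num_real// enorm_sqr.
by rewrite /dot (bigD1 i)//= expr2 lerDl sumr_ge0// => j _; rewrite -expr2 sqr_ge0.
Qed.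

Lemma measurable_enorm : measT (@eucl_norm R d).
Proof.
apply: (measurableT_comp (continuous_measurable_fun (@sqrt_continuous R))).
exact: measurable_dot2.
Qed.

End euclidean_norm.

(** * An integrable radial function *)

Section decay.
Context {R : realType} {d : nat} (Om : domain).
Notation V := 'rV[R]_d.
Notation mu := (fmu Om).

Lemma dyadic (a : R) : 1 <= a -> exists k : nat, 2 ^+ k <= a < 2 ^+ k.+1.
Proof.
move=> a1.
have ex : exists k : nat, a < 2 ^+ k.+1.
  exists (Num.truncn a); apply: (lt_le_trans (truncnS_gt _)).
  rewrite -natrX ler_nat; apply: ltnW; exact: ltn_expl.
case: (ex_minnP ex) => k hk mk; exists k; rewrite hk andbT.
case: k hk mk => [|k] hk mk; first by rewrite expr0.
by rewrite leNgt; apply/negP => /mk; rewrite ltnn.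
Qed.

Lemma measurable_radial (w : R -> R) : measT w ->
  measT (fun x : V => w (eucl_norm x)).
Proof. by move=> mw; apply: (measurableT_comp mw); exact: measurable_enorm. Qed.

Lemma measurable_inv_pos d0 (T : measurableType d0) (f : T -> R) :
  measT f -> (forall x, 0 < f x) -> measT (fun x => (f x)^-1).
Proof.
move=> mf f0; rewrite (_ : (fun x => _) = (fun x => expR (- ln (f x)))).
  apply: measurableT_comp => //; apply: measurableT_comp => //.
  exact: (measurableT_comp (@measurable_ln R)).
by apply/funext => x; rewrite expRN lnK ?posrE.
Qed.

(** Dyadic shells: where [1 + |x|] lies between 2^k and 2^(k+1), the function is at most 2^-(k
    (d+1)), and the shell sits in a cube of measure of order 2^(k d). A geometric series of ratio
    1/2 remains. *)
Lemma intg_decay : intg mu (fun x : V => (1 + eucl_norm x) ^- d.+1).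
Proof.
have r0 (x : V) : 0 < 1 + eucl_norm x by rewrite ltr_wpDr ?enorm_ge0.
have mdec : measT (fun x : V => (1 + eucl_norm x) ^- d.+1).
  apply: measurable_inv_pos; last by move=> x; rewrite exprn_gt0.
  by apply: measurable_funX; apply: measurable_funD => //; exact: measurable_enorm.
pose f (k : nat) (x : V) : \bar R := (2^-1 ^+ (k * d.+1) * \1_(@cube R d (2 ^ k.+1)) x)%:E.
have f0 k x : (0 <= f k x)%E by rewrite lee_fin mulr_ge0// exprn_ge0.
have mf k : measT (f k).
  apply/measurable_EFinP; apply: measurable_funM => //.
  by apply: measurable_indic; exact: measurable_cube.
apply: intgP => //.
apply: (@le_lt_trans _ _ (\int[mu]_x \sum_(k <oo) f k x)%E).
  apply: ge0_le_integral => //.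
  - by apply/measurable_EFinP; exact: measurableT_comp.
  - by apply: ge0_emeasurable_sum => //.
  move=> x _; have x1 : 1 <= 1 + eucl_norm x by rewrite lerDl enorm_ge0.
  have [k /andP[k1 k2]] := dyadic x1.
  rewrite (@nneseriesD1 _ _ k xpredT)//.
  apply: (@le_trans _ _ (f k x)); last by rewrite leeDl// nneseries_ge0.
  rewrite /f indicE mem_set ?mulr1; last first.
    move=> i; apply: (le_trans (coord_le_enorm _ _)).
    by rewrite natrX; apply: ltW; apply: le_lt_trans k2; rewrite lerDr.
  rewrite lee_fin ger0_norm ?invr_ge0 ?exprn_ge0 ?(ltW (r0 x))//.
  rewrite exprVn lef_pV2 ?posrE ?exprn_gt0// exprM.
  by rewrite lerXn2r ?nnegrE ?exprn_ge0// ltW.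
rewrite integral_nneseries//.
(* The cube of half-side 2^(k+1) has measure at most (2 (2^(k+1) + 1))^d, hence at most 8^d 2^(k
   d). *)
apply: (@le_lt_trans _ _ (\sum_(k <oo) ((8 ^+ d * 2^-1 ^+ k : R))%:E)%E).
  apply: lee_nneseries => [k _ _|k _]; first exact: integral_ge0.
  rewrite /f; under eq_integral do rewrite EFinM.
  rewrite ge0_integralZl//; last first.
    by apply/measurable_EFinP; apply: measurable_indic; exact: measurable_cube.
  rewrite integral_indic//; last exact: measurable_cube.
  rewrite setIT; apply: (le_trans (lee_wpmul2l _ (fmu_cube _ _))).
    by rewrite lee_fin exprn_ge0.
  rewrite -EFinM lee_fin mulnS exprD [8 ^+ d * _]mulrC -mulrA ler_wpM2l ?exprn_ge0//.
  rewrite exprM -exprMn lerXn2r ?nnegrE ?mulr_ge0 ?exprn_ge0//.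
  rewrite exprVn ler_pdivrMl// -[(2 ^ k.+1).+1]addn1 natrD natrX exprS.
  have : 1 <= (2 : R) ^+ k by rewrite exprn_ege1// ler1n.
  lra.
have cv : cvgn (series (geometric (8 ^+ d : R) 2^-1)).
  by apply: is_cvg_geometric_series; rewrite ger0_norm//; lra.
have -> : (\sum_(k <oo) ((8 ^+ d * 2^-1 ^+ k : R))%:E)%E = (limn (series (geometric (8 ^+ d : R) 2^-1)))%:E.
  rewrite -EFin_lim//; congr (limn _); apply/funext => n /=.
  by rewrite /series/= -sumEFin.
exact: ltry.
Qed.

End decay.

(** * Bilinear frequency-side operators *)

Section cas.
Context {R : realType}.
Implicit Types a b t : R.

Definition cas t : R := cos t + sin t.

Lemma cas_bound t : `|cas t| <= 2.
Proof.
apply: (le_trans (ler_normD _ _)); rewrite [leRHS](_ : 2 = 1 + 1) //.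
by rewrite lerD ?cos_max ?sin_max.
Qed.

Lemma casD a b : cas (a + b) = cas a * cos b + cas (- a) * sin b.
Proof. by rewrite /cas cosD sinD cosN sinN; ring. Qed.

Lemma cas_lipschitz a b : `|cas b - cas a| <= 2 * `|b - a|.
Proof.
rewrite /cas (_ : _ - _ = (cos b - cos a) + (sin b - sin a)); last by ring.
apply: (le_trans (ler_normD _ _)); rewrite mulr_natl mulr2n.
by rewrite lerD ?cos_lipschitz ?sin_lipschitz.
Qed.

Lemma cas_taylor2 a b : `|cas (a + b) - cas a - b * cas (- a)| <= 2 * b ^+ 2.
Proof.
(* A shift by [pi / 2] turns the estimate for the cosine into the one for the sine. *)
have h1 := cos_taylor2 a b; have := cos_taylor2 (a + pi / 2) b.
rewrite (_ : a + pi / 2 + b = a + b + pi / 2); last by ring.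
rewrite !cosDpihalf sinDpihalf => h2.
rewrite /cas cosN sinN.
rewrite (_ : _ - _ = (cos (a + b) - cos a + b * sin a) - (- sin (a + b) - - sin a + b * cos a)); last by ring.
apply: (le_trans (ler_normB _ _)); rewrite mulr_natl mulr2n -[X in X + X]mul1r.
exact: lerD.
Qed.

Lemma measurable_cas d (T : measurableType d) (f : T -> R) :
  measT f -> measT (fun x => cas (f x)).
Proof. by move=> mf; apply: measurable_funD; [exact: measurable_cos|exact: measurable_sin]. Qed.

End cas.

Lemma weighted_cauchy_schwarz d (T : measurableType d) (R : realType)
  (mu : {measure set T -> \bar R}) (a b : T -> R) : (forall x, 0 <= a x) -> intg mu a ->
  measT b -> intg mu (fun x => a x * b x ^+ 2) ->
  (\int[mu]_x (a x * b x)) ^+ 2 <= \int[mu]_x a x * \int[mu]_x (a x * b x ^+ 2).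
Proof.
move=> a0 Ia mb Iab; have ma := intg_meas Ia.
pose f1 (x : T) : R := Num.sqrt (a x); pose f2 (x : T) : R := f1 x * b x.
have mf1 : measT f1.
  exact: (measurableT_comp (continuous_measurable_fun (@sqrt_continuous R)) ma).
have mf2 : measT f2 by exact: measurable_funM.
have e1 x : f1 x ^+ 2 = a x by rewrite sqr_sqrtr.
have e2 x : f2 x ^+ 2 = a x * b x ^+ 2 by rewrite exprMn e1.
have Lf1 : L2 mu f1 by split; [exact: mf1|apply: eq_intg Ia => x; rewrite e1].
have Lf2 : L2 mu f2 by split; [exact: mf2|apply: eq_intg Iab => x; rewrite e2].
have cs := cauchy_schwarz Lf1 Lf2.
have : `|\int[mu]_x (f1 x * f2 x)| ^+ 2 <= (nrm mu f1 * nrm mu f2) ^+ 2.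
  by rewrite lerXn2r ?nnegrE ?mulr_ge0 ?nrm_ge0.
rewrite real_normK ?num_real// exprMn !nrm_sqr.
rewrite (eq_Int mu e1) (eq_Int mu e2) (eq_Int mu (g := fun x => a x * b x))//.
by move=> x; rewrite /f2 mulrA -expr2 e1.
Qed.

Lemma ler_sqr_pos (R : realDomainType) (x y : R) : 0 <= y -> x ^+ 2 <= y ^+ 2 -> x <= y.
Proof.
move=> y0 h; case: (leP 0 x) => x0; last exact: le_trans (ltW x0) y0.
by rewrite -(ler_pXn2r (n := 2)) ?nnegrE.
Qed.

Lemma L2_ae_sqr_le d (T : measurableType d) (R : realType)
  (mu : {measure set T -> \bar R}) (f g : T -> R) : measT f ->
  intg mu g -> (forall x, 0 <= g x) -> {ae mu, forall x, f x ^+ 2 <= g x} ->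
  L2 mu f /\ nrm mu f ^+ 2 <= \int[mu]_x g x.
Proof.
move=> mf Ig g0 h; have mf2 : measT (fun x => f x ^+ 2) by exact: measurable_funX.
have le : (\int[mu]_x (f x ^+ 2)%:E <= \int[mu]_x (g x)%:E)%E.
  apply: ae_ge0_le_integral.
  - exact: measurableT.
  - by move=> x _; rewrite lee_fin sqr_ge0.
  - by apply/measurable_EFinP.
  - by move=> x _; rewrite lee_fin.
  - by apply/measurable_EFinP; exact: intg_meas Ig.
  - by move: h; apply: filterS => x hx _; rewrite lee_fin.
have I2 : intg mu (fun x => f x ^+ 2).
  apply: intgP => //; apply: le_lt_trans (intg_lty Ig).
  rewrite (_ : (fun x => (`|f x ^+ 2|)%:E) = (fun x => (f x ^+ 2)%:E)); last first.
    by apply/funext => x; rewrite ger0_norm ?sqr_ge0.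
  rewrite (_ : (fun x => (`|g x|)%:E) = (fun x => (g x)%:E)) ?le//.
  by apply/funext => x; rewrite ger0_norm.
split; first by split.
by rewrite nrm_sqr -lee_fin -(IntE I2) -(IntE Ig).
Qed.

(** * Radial weights of polynomial growth *)

Section weights.
Context {R : realType}.
Implicit Types (g : R -> R) (k : nat).

(* The last condition says that [g t / t ^ k] is nonincreasing, whence
   [g (l * t) <= l ^ k * g t] for [1 <= l]. *)
Definition wfun g k := [/\ measT g, forall t, 0 <= t -> 0 <= g t,
  forall t s, 0 <= t -> t <= s -> g t <= g s &
  forall t s, 0 <= t -> t <= s -> g s * t ^+ k <= s ^+ k * g t].

Lemma wfun_mul g1 k1 g2 k2 : wfun g1 k1 -> wfun g2 k2 ->
  wfun (fun t => g1 t * g2 t) (k1 + k2).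
Proof.
move=> [m1 p1 n1 d1] [m2 p2 n2 d2]; split.
- exact: measurable_funM.
- by move=> t t0; rewrite mulr_ge0 ?p1 ?p2.
- by move=> t s t0 ts; rewrite ler_pM ?p1 ?p2 ?n1 ?n2.
- move=> t s t0 ts; have s0 := le_trans t0 ts; rewrite !exprD.
  have h := ler_pM _ _ (d1 _ _ t0 ts) (d2 _ _ t0 ts).
  rewrite mulrACA [X in _ <= X]mulrACA; apply: h.
  by rewrite mulr_ge0 ?p1 ?exprn_ge0.
  by rewrite mulr_ge0 ?p2 ?exprn_ge0.
Qed.

Lemma wfun1 : wfun (fun=> 1) 0.
Proof. by split => // *; rewrite !expr0 mulr1. Qed.

Lemma wfun_1D : wfun (fun t => 1 + t) 1.
Proof.
split => [|t t0|t s _ ts|t s t0 ts].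
- exact: measurable_funD.
- by rewrite addr_ge0.
- by rewrite lerD2l.
- by rewrite !expr1 mulrDl mulrDr mul1r mulr1 lerD2r.
Qed.

Lemma wfun_1DX k : wfun (fun t => (1 + t) ^+ k) k.
Proof.
elim: k => [|k ih]; first exact: wfun1.
have := wfun_mul wfun_1D ih; rewrite add1n.
by rewrite (_ : (fun t => _ * _) = (fun t => (1 + t) ^+ k.+1))//; apply/funext => t; rewrite exprS.
Qed.

(** The absolute value keeps the denominator positive, hence the function measurable, on the whole
    line; weights are only evaluated at nonnegative arguments. *)
Lemma wfun_tail (N : R) : 0 < N -> wfun (fun t => t / (N + `|t|)) 1.
Proof.
move=> N0; have Nt (t : R) : 0 < N + `|t| by rewrite ltr_pwDl.
split => [|t t0|t s t0 ts|t s t0 ts].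
- apply: measurable_funM => //; apply: (@measurable_inv_pos _ _ _ (fun t : measurableTypeR R => N + `|t|)) => //.
  by apply: measurable_funD => //; exact: normr_measurable.
- by rewrite divr_ge0// ltW.
- have s0 := le_trans t0 ts.
  rewrite ler_pdivrMr// mulrAC ler_pdivlMr// !mulrDr !ger0_norm//.
  by rewrite (mulrC s t) lerD2r ler_wpM2r// ltW.
- have s0 := le_trans t0 ts.
  rewrite !expr1 -mulrA; apply: ler_wpM2l => //; rewrite mulrC; apply: ler_wpM2l => //.
  by rewrite lef_pV2 ?posrE// lerD2l !ger0_norm.
Qed.

Lemma wfun_le g k (l x y : R) : wfun g k -> 1 <= l -> 0 <= x -> 0 <= y -> x <= l * y ->
  g x <= l ^+ k * g y.
Proof.
move=> [_ p n dd] l1 x0 y0 xly; have gy := p _ y0; have l0 := le_trans ler01 l1.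
have lk : 1 <= l ^+ k by rewrite exprn_ege1.
case: (leP x y) => xy.
  by apply: (le_trans (n _ _ x0 xy)); rewrite ler_peMl.
have y_gt0 : 0 < y.
  rewrite lt_neqAle y0 andbT; apply/eqP => y00; move: xy xly.
  by rewrite -y00 mulr0 => xp xn; move: (lt_le_trans xp xn); rewrite ltxx.
have yk : 0 < y ^+ k by rewrite exprn_gt0.
rewrite -(ler_pM2r yk); apply: (le_trans (dd _ _ y0 (ltW xy))).
rewrite mulrAC -exprMn; apply: ler_wpM2r => //.
by rewrite lerXn2r ?nnegrE// mulr_ge0.
Qed.

(** The bound of a convex function on [[0, 1]] by its chord, obtained by induction on [k]. *)
Lemma bernoulli_rev (x : R) k : 0 <= x <= 1 -> (1 + x) ^+ k <= 1 + (2 ^+ k - 1) * x.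
Proof.
move=> /andP[x0 x1]; elim: k => [|k ih]; first by rewrite !expr0 subrr mul0r addr0.
rewrite exprS; apply: (le_trans (ler_wpM2l _ ih)); first by rewrite addr_ge0.
have h : 1 <= 2 ^+ k :> R by rewrite exprn_ege1// ler1n.
have -> : 2 ^+ k.+1 = 2 * 2 ^+ k :> R by rewrite exprS.
have : 0 <= (2 ^+ k - 1) * (x * (1 - x)) by rewrite !mulr_ge0 ?subr_ge0.
by move: (2 ^+ k) => K; lra.
Qed.

(** Replaces a bound on the derivative of [g]. With [s = t * (1 + x)] and [x] in [[0, 1]], the
    growth condition gives [g s <= (1 + x) ^+ k * g t], and the chord bound makes the increment
    linear in [x]. *)
Lemma wfun_grow g k (t s : R) : wfun g k -> 0 < t -> t <= s -> s <= 2 * t ->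
  t * (g s - g t) <= 2 ^+ k * (s - t) * g t.
Proof.
move=> [_ p n dd] t0 ts s2; have gt0 := p _ (ltW t0).
have tk : 0 < t ^+ k by rewrite exprn_gt0.
pose x := (s - t) / t; have xE : s = t * (1 + x) by rewrite /x; field; rewrite gt_eqF.
have x01 : 0 <= x <= 1.
  apply/andP; split; first by apply: divr_ge0; rewrite ?subr_ge0// ltW.
  by rewrite /x ler_pdivrMr// mul1r; lra.
have hb := bernoulli_rev k x01.
have : g s <= (1 + (2 ^+ k - 1) * x) * g t.
  rewrite -(ler_pM2r tk); apply: (le_trans (dd _ _ (ltW t0) ts)).
  rewrite mulrAC; apply: ler_wpM2r => //.
  by rewrite {1}xE exprMn mulrC; apply: ler_wpM2r => //; exact: ltW.
move=> h; have st : s - t = t * x by rewrite xE; ring.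
have /andP[x0 _] := x01.
rewrite st; have -> : 2 ^+ k * (t * x) * g t = t * (2 ^+ k * x * g t) by ring.
rewrite ler_pM2l//; have xg : 0 <= x * g t by rewrite mulr_ge0.
by move: h; rewrite !mulrDl; lra.
Qed.

(* The commutator of the weight with the bilinear term gains one derivative. *)
Lemma weight_kernel g k (a b c sa sb sc : R) : wfun g k ->
  0 <= a -> 0 <= b -> 0 <= c -> `|b - c| <= a -> `|a - c| <= b ->
  0 <= sa <= a -> 0 <= sb <= b -> `|sa - sc| <= b -> `|sc - sb| <= a ->
  `|g c * (sa - sc) + sb * g b| <= 4 * 3 ^+ k * (a * g b + g a * b).
Proof.
move=> wg a0 b0 c0; have [_ p n dd] := wg.
move=> /ler_normlP[b1 b2] /ler_normlP[a1 a2] /andP[sa0 saa] /andP[sb0 sbb] u v.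
have E : 4 * 3 ^+ k * (a * g b + g a * b) = 4 * (3 ^+ k * (a * g b) + 3 ^+ k * (g a * b)) by ring.
rewrite E {E}.
have ga := p _ a0; have gb := p _ b0; have gc := p _ c0.
have k3 : 2 ^+ k <= 3 ^+ k :> R by rewrite lerXn2r ?nnegrE// ler_nat.
have t0 : 0 <= a * g b by rewrite mulr_ge0.
have t1 : 0 <= g a * b by rewrite mulr_ge0.
case: (leP b (2 * a)) => ab.
  have h1 : g c <= 3 ^+ k * g a by apply: (wfun_le wg) => //; lra.
  have h2 : g b <= 2 ^+ k * g a by apply: (wfun_le wg) => //; lra.
  have e1 : `|g c * (sa - sc)| <= 3 ^+ k * (g a * b).
    rewrite normrM (ger0_norm gc) mulrA; exact: ler_pM.
  have e2 : `|sb * g b| <= 2 ^+ k * (g a * b).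
    rewrite ger0_norm ?mulr_ge0// mulrA mulrC; exact: ler_pM.
  apply: (le_trans (ler_normD _ _)).
  have q1 : 0 <= 3 ^+ k * (a * g b) by rewrite mulr_ge0// exprn_ge0.
  have q2 : 2 ^+ k * (g a * b) <= 3 ^+ k * (g a * b) by rewrite ler_wpM2r.
  have q3 : 0 <= 3 ^+ k * (g a * b) by rewrite mulr_ge0// exprn_ge0.
  lra.
(* For [2 * a < b] the numbers [b] and [c] are within a factor 2 of each other, and [g] varies
   between them by at most a multiple of [a * g b / b]. *)
have bp : 0 < b by lra.
have h1 : g c <= 2 ^+ k * g b by apply: (wfun_le wg) => //; lra.
have e1 : `|g c * sa| <= 2 ^+ k * (a * g b).
  rewrite ger0_norm ?mulr_ge0// (mulrC a) mulrA; exact: ler_pM.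
have e2 : `|g c * (sc - sb)| <= 2 ^+ k * (a * g b).
  rewrite normrM (ger0_norm gc) (mulrC a) mulrA; exact: ler_pM.
have e3 : `|sb * (g c - g b)| <= 2 * (2 ^+ k * (a * g b)).
  rewrite normrM (ger0_norm sb0); apply: (@le_trans _ _ (b * `|g c - g b|)).
    by rewrite ler_wpM2r.
  have q : 0 <= 2 ^+ k * (a * g b) by rewrite mulr_ge0// exprn_ge0.
  case: (leP b c) => bc.
    have G : 0 <= g c - g b by rewrite subr_ge0 n.
    rewrite (ger0_norm G); have := @wfun_grow g k b c wg bp bc.
    have c2 : c <= 2 * b by lra.
    move=> /(_ c2) h; apply: (le_trans h).
    have ca : c - b <= a by lra.
    have : 2 ^+ k * (c - b) * g b <= 2 ^+ k * a * g b.
      by rewrite ler_wpM2r// ler_wpM2l// exprn_ge0.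
    by rewrite -!mulrA in q *; lra.
  have cp : 0 < c by lra.
  have G : g c - g b <= 0 by rewrite subr_le0 n// ltW.
  rewrite (ler0_norm G) opprB; have := @wfun_grow g k c b wg cp (ltW bc).
  have c2 : b <= 2 * c by lra.
  move=> /(_ c2) h.
  have G' : 0 <= g b - g c by lra.
  have : b * (g b - g c) <= 2 * (c * (g b - g c)) by rewrite mulrA ler_wpM2r.
  have : 2 ^+ k * (b - c) * g c <= 2 ^+ k * a * g b.
    apply: ler_pM => //; last by apply: n => //; exact: ltW.
      by rewrite mulr_ge0 ?exprn_ge0//; lra.
    by rewrite ler_wpM2l ?exprn_ge0//; lra.
  by rewrite -!mulrA in q *; lra.
(* The two large terms [g c * sc] and [sb * g b] nearly cancel; what is left is one difference of
   symbols and one difference of weights. *)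
have -> : g c * (sa - sc) + sb * g b = g c * sa - g c * (sc - sb) - sb * (g c - g b) by ring.
apply: (le_trans (ler_normB _ _)).
apply: (le_trans (lerD (ler_normB _ _) (lexx _))).
have q1 : 0 <= 3 ^+ k * (g a * b) by rewrite mulr_ge0// exprn_ge0.
have q2 : 2 ^+ k * (a * g b) <= 3 ^+ k * (a * g b) by rewrite ler_wpM2r.
lra.
Qed.

End weights.

(** * Convolutions, bilinear operators and weighted L^2 spaces *)

Section hartley_convolution.
Context {R : realType} {d : nat} (Om : domain).
Notation V := 'rV[R]_d.
Notation rr := (@eucl_norm R d).
Implicit Types chi : V -> R.
Notation mu := (fmu Om).
Notation S := (@freqs R d Om).
Notation L2 := (L2 mu).
Notation intg := (intg mu).
Notation nrm := (nrm mu).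
Implicit Types phi psi a b : V -> R.

Definition n1 phi := \int[mu]_x `|phi x|.

Lemma n1E phi : n1 phi = \int[mu]_x `|phi x|. Proof. by []. Qed.

Lemma n1_ge0 phi : 0 <= n1 phi. Proof. by apply: Int_ge0. Qed.

Lemma measurable_oppV : measT (fun x : V => - x).
Proof. exact: measurable_rV_opp. Qed.

Lemma measurable_reflectV (z : V) : measT (fun x : V => z - x).
Proof. by apply: measurable_rV_map2 => //; exact: measurable_rV_opp. Qed.

Lemma intg_opp phi : intg phi -> intg (fun x => phi (- x)) /\
  \int[mu]_x phi (- x) = \int[mu]_x phi x.
Proof. by move=> h; apply: (Int_comp_inv measurable_oppV _ h) => f mf f0; exact: fmu_opp. Qed.

Lemma intg_reflect phi z : S z -> intg phi -> intg (fun x => phi (z - x)) /\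
  \int[mu]_x phi (z - x) = \int[mu]_x phi x.
Proof.
move=> Sz h; apply: (Int_comp_inv (measurable_reflectV z) _ h) => f mf f0.
exact: fmu_reflect.
Qed.

Lemma L2_opp phi : L2 phi -> L2 (fun x => phi (- x)).
Proof.
move=> [mp Ip]; split; first by apply: (measurableT_comp mp); exact: measurable_oppV.
exact: (intg_opp Ip).1.
Qed.

Lemma nrm_opp phi : L2 phi -> nrm (fun x => phi (- x)) = nrm phi.
Proof. by move=> [mp Ip]; congr Num.sqrt; exact: (intg_opp Ip).2. Qed.

Lemma L2_reflect phi z : S z -> L2 phi -> L2 (fun x => phi (z - x)).
Proof.
move=> Sz [mp Ip]; split; first by apply: (measurableT_comp mp); exact: measurable_reflectV.
exact: (intg_reflect Sz Ip).1.
Qed.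

Lemma nrm_reflect phi z : S z -> L2 phi -> nrm (fun x => phi (z - x)) = nrm phi.
Proof. by move=> Sz [mp Ip]; congr Num.sqrt; exact: (intg_reflect Sz Ip).2. Qed.

Definition cv a b xi := \int[mu]_eta (a eta * b (xi - eta)).

Lemma measurable_sub2 (f : V -> R) : measT f ->
  measT (fun p : V * V => f (p.1 - p.2)).
Proof.
move=> mf; apply: (measurableT_comp mf); apply: measurable_rV_map2 => //.
by apply: measurable_rV_opp.
Qed.

Lemma measurable_cv a b : measT a -> measT b ->
  measT (cv a b).
Proof.
move=> ma mb.
apply: (@measurable_Int_l _ _ _ _ _ mu (fun p : V * V => a p.2 * b (p.1 - p.2))).
apply: measurable_funM; first by apply: (measurableT_comp ma).
exact: measurable_sub2.
Qed.

Lemma cv_intg a b xi : S xi -> L2 a -> L2 b -> intg (fun eta => a eta * b (xi - eta)).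
Proof. by move=> Sx La Lb; apply: L2M => //; exact: L2_reflect. Qed.

Lemma cvC a b xi : S xi -> L2 a -> L2 b -> cv a b xi = cv b a xi.
Proof.
move=> Sx La Lb; rewrite /cv.
have [_ <-] := intg_reflect Sx (cv_intg Sx La Lb).
by apply: eq_Int => x; rewrite subKr mulrC.
Qed.

(* Young's inequality, by Cauchy-Schwarz for the measure [a eta deta]. *)
Lemma young1 a b : (forall x, 0 <= a x) -> (forall x, 0 <= b x) -> intg a -> L2 b ->
  L2 (cv a b) /\ nrm (cv a b) <= \int[mu]_x a x * nrm b.
Proof.
move=> a0 b0 Ia Lb; have [mb Ib] := Lb; have ma := intg_meas Ia.
pose F (p : V * V) := a p.2 * b (p.1 - p.2) ^+ 2.
have mF : measT F.
  apply: measurable_funM; first by apply: (measurableT_comp ma).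
  by apply: measurable_funX; exact: measurable_sub2.
have F0 p : 0 <= F p by rewrite mulr_ge0// sqr_ge0.
have B0 : 0 <= \int[mu]_x b x ^+ 2 by apply: Int_ge0 => x; exact: sqr_ge0.
have shiftb eta : S eta -> intg (fun xi => b (xi - eta) ^+ 2) /\
    \int[mu]_xi (b (xi - eta) ^+ 2) = \int[mu]_x b x ^+ 2.
  move=> Se; have Sn := freqs_opp Se.
  apply: (@Int_comp_inv _ _ _ mu (fun x => x - eta) (fun x => b x ^+ 2)) => //.
    exact: measurable_rV_map2.
  by move=> h mh h0; exact: (fmu_shift Sn).
(* Translation invariance holds at frequencies only, that is almost everywhere. *)
have Fsec : {ae mu, forall eta, (\int[mu]_xi (F (xi, eta))%:E =
    (a eta)%:E * (\int[mu]_x b x ^+ 2)%:E)%E}.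
  move: (ae_freqs (R := R) (d := d) Om); apply: filterS => eta Se.
  have [I1 E1] := shiftb eta Se.
  have I' : intg (fun xi => F (xi, eta)) := intgZ (a eta) I1.
  by rewrite (IntE I') -EFinM -E1 -IntZ.
have Foo : (\int[mu]_xi \int[mu]_eta (`|F (xi, eta)|)%:E < +oo)%E.
  rewrite (@fubini_tonelli _ _ _ _ _ mu mu (fun p => (`|F p|)%:E)); last 2 first.
  - by apply/measurable_EFinP; exact: measurableT_comp.
  - by [].
  have -> : (\int[mu]_eta \int[mu]_xi (`|F (xi, eta)|)%:E =
      \int[mu]_eta ((a eta)%:E * (\int[mu]_x b x ^+ 2)%:E))%E.
    apply: ae_eq_integral => //.
    - apply: (@measurable_fun_fubini_tonelli_G _ _ _ _ _ mu (fun p => (`|F p|)%:E)) => //.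
      by apply/measurable_EFinP; exact: measurableT_comp.
    - by apply/measurable_EFinP; apply: measurable_funM.
    - move: Fsec; apply: filterS => eta <- _; apply: eq_integral => xi _.
      by rewrite ger0_norm.
  have IB := intgZ (\int[mu]_x b x ^+ 2) Ia.
  rewrite (_ : integral _ _ _ = \int[mu]_eta ((\int[mu]_x b x ^+ 2) * a eta)%:E)%E.
    by rewrite (IntE IB) ltry.
  by apply: eq_integral => eta _; rewrite mulrC.
have [IJ _ EJ] := real_fubini mF Foo.
have iF : (mu \x mu)%E.-integrable setT (EFin \o F).
  have mEF : measT (EFin \o F) by exact/measurable_EFinP.
  apply/(integrable12ltyP mu mu mEF); exact: Foo.
have EJ2 : \int[mu]_xi \int[mu]_eta F (xi, eta) = \int[mu]_x a x * \int[mu]_x b x ^+ 2.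
  have [_ IJ2 _] := real_fubini mF Foo.
  rewrite EJ mulrC -(IntZ _ Ia); apply: (ae_Int IJ2); first exact: measurable_funM.
  move: Fsec; apply: filterS => eta h.
  by rewrite {1}/Rintegral h -EFinM /= mulrC.
have A0 : 0 <= \int[mu]_x a x by exact: Int_ge0.
have key : {ae mu, forall xi, cv a b xi ^+ 2 <= \int[mu]_x a x * \int[mu]_eta F (xi, eta)}.
  move: (ae_integrable1 iF); apply: filterS => xi Ixi.
  have mbx : measT (fun x : V => b (xi - x)).
    by apply: (measurableT_comp mb); exact: measurable_reflectV.
  exact: (weighted_cauchy_schwarz a0 Ia mbx Ixi).
have mcv := measurable_cv ma mb.
have IG : intg (fun xi => \int[mu]_x a x * \int[mu]_eta F (xi, eta)) := intgZ _ IJ.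
have G0 xi : 0 <= \int[mu]_x a x * \int[mu]_eta F (xi, eta).
  have J0 : 0 <= \int[mu]_eta F (xi, eta) by apply: Int_ge0 => eta; exact: F0.
  exact: mulr_ge0 A0 J0.
have [Lcv le] := L2_ae_sqr_le mcv IG G0 key.
split; first exact: Lcv.
apply: (ler_sqr_pos (mulr_ge0 A0 (nrm_ge0 mu b))).
apply: (le_trans le); rewrite (IntZ _ IJ) EJ2 exprMn nrm_sqr expr2 mulrA; exact: lexx.
Qed.

Lemma young2 a b : (forall x, 0 <= a x) -> (forall x, 0 <= b x) -> L2 a -> intg b -> L2 b ->
  L2 (cv a b) /\ nrm (cv a b) <= nrm a * \int[mu]_x b x.
Proof.
move=> a0 b0 La Ib Lb; have [L N] := young1 b0 a0 Ib La.
have e : {ae mu, forall x, cv b a x = cv a b x}.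
  by move: (ae_freqs (R := R) (d := d) Om); apply: filterS => x Sx; exact: cvC.
have m : measT (cv a b).
  by apply: measurable_cv; [case: La|case: Lb].
split; first exact: ae_L2 e L.
by rewrite -(ae_nrm L m e) mulrC.
Qed.

Definition ev psi x := (psi x + psi (- x)) / 2.
Definition od psi x := (psi x - psi (- x)) / 2.

(* By the addition formula for [cas], [kst (fun _ _ _ => 1) phi psi] is the
   transform of the product of the functions with transforms [phi] and [psi]. *)
Definition kst (k : V -> V -> V -> R) phi psi xi :=
  (\int[mu]_eta (k xi eta (xi - eta) *
     (phi eta * ev psi (xi - eta) + phi (- eta) * od psi (xi - eta)))) * \1_S xi.

Lemma kstE k phi psi xi : kst k phi psi xi =
  (\int[mu]_eta (k xi eta (xi - eta) *
     (phi eta * ev psi (xi - eta) + phi (- eta) * od psi (xi - eta)))) * \1_S xi.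
Proof. by []. Qed.

Definition mker (k : V -> V -> V -> R) :=
  measT (fun p : V * V => k p.1 p.2 (p.1 - p.2)).

Lemma measurable_ev psi : measT psi -> measT (ev psi).
Proof.
move=> mp; apply: measurable_funM => //; apply: measurable_funD => //.
by apply: (measurableT_comp mp); exact: measurable_oppV.
Qed.

Lemma measurable_od psi : measT psi -> measT (od psi).
Proof.
move=> mp; apply: measurable_funM => //; apply: measurable_funB => //.
by apply: (measurableT_comp mp); exact: measurable_oppV.
Qed.

Lemma measurable_kst_integrand k phi psi : mker k -> measT phi ->
  measT psi ->
  measT (fun p : V * V => k p.1 p.2 (p.1 - p.2) *
     (phi p.2 * ev psi (p.1 - p.2) + phi (- p.2) * od psi (p.1 - p.2))).
Proof.
move=> mk mph mps; apply: measurable_funM => //; apply: measurable_funD.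
  apply: measurable_funM; first exact: (measurableT_comp mph).
  by apply: measurable_sub2; exact: measurable_ev.
apply: measurable_funM; last by apply: measurable_sub2; exact: measurable_od.
by apply: (measurableT_comp mph); exact: measurable_rV_opp.
Qed.

Lemma measurable_kst k phi psi : mker k -> measT phi ->
  measT psi -> measT (kst k phi psi).
Proof.
move=> mk mph mps; apply: measurable_funM; last first.
  by apply: measurable_indic; exact: measurable_freqs.
exact: (@measurable_Int_l _ _ _ _ _ mu _ (measurable_kst_integrand mk mph mps)).
Qed.

(** A symmetrised majorant: the integrand of [kst] involves [phi] and [psi] at reflected arguments
    too. *)
Definition sy (p phi : V -> R) x := p x * (`|phi x| + `|phi (- x)|).

Lemma sy_ge0 p phi x : (forall x, 0 <= p x) -> 0 <= sy p phi x.
Proof. by move=> p0; rewrite mulr_ge0// addr_ge0. Qed.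

Lemma syE p phi : (forall x, 0 <= p x) -> (forall x, p (- x) = p x) ->
  sy p phi = (fun x => `|p x * phi x| + `|p (- x) * phi (- x)|).
Proof.
by move=> p0 pN; apply/funext => x; rewrite /sy !normrM pN (ger0_norm (p0 x)) -mulrDr.
Qed.

Lemma sy_intg p phi : (forall x, 0 <= p x) -> (forall x, p (- x) = p x) ->
  intg (fun x => p x * phi x) -> intg (sy p phi) /\
  \int[mu]_x sy p phi x = 2 * n1 (fun x => p x * phi x).
Proof.
move=> p0 pN /intg_norm I; rewrite syE//; have [I2 E2] := intg_opp I.
by split; [exact: intgD|rewrite IntD// E2 mulr_natl mulr2n].
Qed.

Lemma sy_L2 p phi : (forall x, 0 <= p x) -> (forall x, p (- x) = p x) ->
  L2 (fun x => p x * phi x) -> L2 (sy p phi) /\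
  nrm (sy p phi) <= 2 * nrm (fun x => p x * phi x).
Proof.
move=> p0 pN /[dup] L /L2_norm Ln; rewrite syE//.
have L' := L2_opp Ln; split; first exact: L2D.
apply: (le_trans (nrmD Ln L')); rewrite (nrm_opp Ln) mulr_natl mulr2n.
have -> : nrm (fun x => `|p x * phi x|) = nrm (fun x => p x * phi x).
  by congr Num.sqrt; apply: eq_Int => x; rewrite real_normK ?num_real.
by [].
Qed.

Lemma evod_bound phi psi (x y : V) :
  `|phi x * ev psi y + phi (- x) * od psi y| <=
  2^-1 * ((`|phi x| + `|phi (- x)|) * (`|psi y| + `|psi (- y)|)).
Proof.
have h1 : `|ev psi y| <= (`|psi y| + `|psi (- y)|) / 2.
  by rewrite /ev normrM (@ger0_norm _ 2^-1)// ler_wpM2r// ler_normD.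
have h2 : `|od psi y| <= (`|psi y| + `|psi (- y)|) / 2.
  by rewrite /od normrM (@ger0_norm _ 2^-1)// ler_wpM2r// ler_normB.
apply: (le_trans (ler_normD _ _)); rewrite normrM [X in _ + X]normrM.
apply: (le_trans (lerD (ler_wpM2l _ h1) (ler_wpM2l _ h2))) => //.
by apply: eq_ler; field.
Qed.

Definition wt (p : V -> R) := (forall x, 0 <= p x) /\ (forall x, p (- x) = p x).

Lemma kst_intg k phi psi p q C xi : S xi -> mker k -> wt p -> wt q ->
  measT phi -> measT psi ->
  (forall eta, `|k xi eta (xi - eta)| <= C * (p eta * q (xi - eta))) ->
  L2 (fun x => p x * phi x) -> L2 (fun x => q x * psi x) ->
  intg (fun eta => k xi eta (xi - eta) *
     (phi eta * ev psi (xi - eta) + phi (- eta) * od psi (xi - eta))).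
Proof.
move=> Sx mk [p0 pN] [q0 qN] mph mps kb Lp Lq.
have [La _] := sy_L2 p0 pN Lp; have [Lb _] := sy_L2 q0 qN Lq.
apply: (intg_le _ (intgZ (C * 2^-1) (cv_intg Sx La Lb))).
  have h := measurableT_comp (measurable_kst_integrand mk mph mps) (measurable_pair1 xi).
  exact: h.
move=> eta; rewrite normrM.
apply: (le_trans (ler_pM _ _ (kb eta) (evod_bound phi psi eta (xi - eta)))) => //.
by rewrite le_eqVlt /sy; apply/orP; left; apply/eqP; ring.
Qed.

(** Young's inequality for the symmetrised majorants. The kernel is dominated by two products of
    weights, with the integrable factor on [phi] in the first and on [psi] in the second. Each
    symmetrisation doubles a norm and [evod_bound] halves the product, whence [2 * C]. *)
Lemma kst_bound k phi psi p q p' q' C : mker k -> wt p -> wt q -> wt p' -> wt q' ->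
  0 <= C -> measT phi -> measT psi ->
  (forall xi eta, `|k xi eta (xi - eta)| <=
      C * (p eta * q (xi - eta) + p' eta * q' (xi - eta))) ->
  intg (fun x => p x * phi x) -> L2 (fun x => p x * phi x) -> L2 (fun x => q x * psi x) ->
  L2 (fun x => p' x * phi x) -> intg (fun x => q' x * psi x) -> L2 (fun x => q' x * psi x) ->
  L2 (kst k phi psi) /\ nrm (kst k phi psi) <=
   2 * C * (n1 (fun x => p x * phi x) * nrm (fun x => q x * psi x) +
            nrm (fun x => p' x * phi x) * n1 (fun x => q' x * psi x)).
Proof.
move=> mk [p0 pN] [q0 qN] [p'0 p'N] [q'0 q'N] C0 mph mps kb Ip Lp Lq Lp' Iq' Lq'.
have [Ia Ea] := sy_intg p0 pN Ip; have [La _] := sy_L2 p0 pN Lp.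
have [Lb Nb] := sy_L2 q0 qN Lq; have [La' Na'] := sy_L2 p'0 p'N Lp'.
have [Ib' Eb'] := sy_intg q'0 q'N Iq'; have [Lb' _] := sy_L2 q'0 q'N Lq'.
have [L1 N1] := young1 (fun x => sy_ge0 phi x p0) (fun x => sy_ge0 psi x q0) Ia Lb.
have [L2' N2] := young2 (fun x => sy_ge0 phi x p'0) (fun x => sy_ge0 psi x q'0) La' Ib' Lb'.
pose B x := C * 2^-1 * (cv (sy p phi) (sy q psi) x + cv (sy p' phi) (sy q' psi) x).
have LB : L2 B by apply: L2Z; exact: L2D.
have cv0 a b x : (forall x, 0 <= a x) -> (forall x, 0 <= b x) -> 0 <= cv a b x.
  by move=> a0 b0; apply: Int_ge0 => y; rewrite mulr_ge0.
have B0 x : 0 <= B x.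
  by rewrite mulr_ge0 ?addr_ge0 ?cv0 ?mulr_ge0// => y; exact: sy_ge0.
have mk' := measurable_kst mk mph mps.
have bd x : `|kst k phi psi x| <= `|B x|.
  rewrite (ger0_norm (B0 x)) /kst indicE.
  have [Sx|Sx] := pselect (S x); last by rewrite memNset// mulr0 normr0.
  rewrite mem_set// mulr1.
  have I1 := cv_intg Sx La Lb; have I2 := cv_intg Sx La' Lb'.
  have IB := intgZ (C * 2^-1) (intgD I1 I2).
  have hb eta : `|k x eta (x - eta) *
     (phi eta * ev psi (x - eta) + phi (- eta) * od psi (x - eta))| <=
     C * 2^-1 * (sy p phi eta * sy q psi (x - eta) + sy p' phi eta * sy q' psi (x - eta)).
    rewrite normrM.
    apply: (le_trans (ler_pM _ _ (kb x eta) (evod_bound phi psi eta (x - eta)))) => //.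
    by rewrite le_eqVlt /sy; apply/orP; left; apply/eqP; ring.
  apply: (le_trans (le_norm_Int _ IB hb)).
    apply: (intg_le _ IB hb).
    have h := measurableT_comp (measurable_kst_integrand mk mph mps) (measurable_pair1 x).
    exact: h.
  by rewrite IntZ ?IntD//; exact: intgD.
split; first exact: L2_le bd.
apply: (le_trans (le_nrm mk' LB bd)).
rewrite /B nrmZ; last exact: L2D.
rewrite ger0_norm ?mulr_ge0//.
apply: (le_trans (ler_wpM2l _ (nrmD L1 L2'))); first by rewrite mulr_ge0.
rewrite Ea in N1; rewrite Eb' in N2.
have M1 : nrm (cv (sy p phi) (sy q psi)) <= 4 * (n1 (fun x => p x * phi x) * nrm (fun x => q x * psi x)).
  apply: (le_trans N1); apply: (le_trans (ler_wpM2l _ Nb)); first by rewrite mulr_ge0// n1_ge0.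
  by apply: eq_ler; ring.
have M2 : nrm (cv (sy p' phi) (sy q' psi)) <= 4 * (nrm (fun x => p' x * phi x) * n1 (fun x => q' x * psi x)).
  apply: (le_trans N2); apply: (le_trans (ler_wpM2r _ Na')); first by rewrite mulr_ge0// n1_ge0.
  by apply: eq_ler; ring.
apply: (le_trans (ler_wpM2l _ (lerD M1 M2))); first by rewrite mulr_ge0.
by apply: eq_ler; field.
Qed.

(** Comparable with the usual Sobolev weight (1 + |x|^2)^(k/2), but an instance of [wfun]; [Hs k]
    below is then H^k on the frequency side. *)
Definition wgt (k : nat) (x : V) := (1 + rr x) ^+ k.
Definition Hs k phi := L2 (fun x => wgt k x * phi x).
Definition hn k phi := nrm (fun x => wgt k x * phi x).

Lemma HsE k phi : Hs k phi = L2 (fun x => wgt k x * phi x). Proof. by []. Qed.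

Lemma hnE k phi : hn k phi = nrm (fun x => wgt k x * phi x). Proof. by []. Qed.

Lemma wgt_ge1 k x : 1 <= wgt k x.
Proof. by rewrite exprn_ege1// lerDl enorm_ge0. Qed.

Lemma wgt_gt0 k x : 0 < wgt k x. Proof. exact: lt_le_trans ltr01 (wgt_ge1 k x). Qed.

Lemma wgt_ge0 k x : 0 <= wgt k x. Proof. exact: ltW (wgt_gt0 k x). Qed.

Lemma measurable_wgt k : measT (wgt k).
Proof. by apply: measurable_funX; apply: measurable_funD => //; exact: measurable_enorm. Qed.

Lemma wgtN k x : wgt k (- x) = wgt k x. Proof. by rewrite /wgt enormN. Qed.

Lemma wgt_le k l x : (k <= l)%N -> wgt k x <= wgt l x.
Proof. by move=> kl; rewrite /wgt ler_weXn2l// lerDl enorm_ge0. Qed.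

Lemma wgt0 x : wgt 0 x = 1. Proof. exact: expr0. Qed.

Lemma Hs_meas k phi : Hs k phi -> measT phi.
Proof.
move=> [m _]; rewrite (_ : phi = fun x => (wgt k x)^-1 * (wgt k x * phi x)).
  apply: measurable_funM => //; apply: measurable_inv_pos; first exact: measurable_wgt.
  exact: wgt_gt0.
by apply/funext => x; rewrite mulKf// gt_eqF// wgt_gt0.
Qed.

Lemma hn_ge0 k phi : 0 <= hn k phi. Proof. exact: nrm_ge0. Qed.

Lemma Hs_mul k l (g : V -> R) C phi : 0 <= C -> measT g ->
  (forall x, `|g x| * wgt k x <= C * wgt l x) -> Hs l phi ->
  Hs k (fun x => g x * phi x) /\ hn k (fun x => g x * phi x) <= C * hn l phi.
Proof.
move=> C0 mg gC Hp; have mp := Hs_meas Hp.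
have L := L2Z C Hp.
have m : measT (fun x => wgt k x * (g x * phi x)).
  by apply: measurable_funM; [exact: measurable_wgt|exact: measurable_funM].
have h x : `|wgt k x * (g x * phi x)| <= `|C * (wgt l x * phi x)|.
  rewrite mulrA [leLHS]normrM (mulrA C) [leRHS]normrM; apply: ler_wpM2r => //.
  rewrite normrM (ger0_norm (wgt_ge0 _ _)) mulrC (le_trans (gC x))//.
  exact: ler_norm.
split; first exact: L2_le h.
by rewrite -[X in X * _](ger0_norm C0) -(nrmZ C Hp); exact: le_nrm.
Qed.

Lemma Hs_le k l phi : (k <= l)%N -> Hs l phi -> Hs k phi /\ hn k phi <= hn l phi.
Proof.
move=> kl Hp; have h x : `|1 : R| * wgt k x <= 1 * wgt l x by rewrite normr1 !mul1r wgt_le.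
have [H N] := @Hs_mul k l (fun=> 1) 1 phi ler01 (measurable_cst _) h Hp.
have e : (fun x => 1 * phi x) = phi by apply/funext => x; rewrite mul1r.
by rewrite e mul1r in H N.
Qed.

Lemma HsD k phi psi : Hs k phi -> Hs k psi -> Hs k (fun x => phi x + psi x).
Proof.
move=> h1 h2; have := L2D h1 h2; rewrite /Hs.
by congr L2; apply/funext => x; rewrite mulrDr.
Qed.

Lemma HsZ k (a : R) phi : Hs k phi -> Hs k (fun x => a * phi x).
Proof. by move=> /(L2Z a); congr L2; apply/funext => x; rewrite mulrCA. Qed.

Lemma HsB k phi psi : Hs k phi -> Hs k psi -> Hs k (fun x => phi x - psi x).
Proof.
move=> h1 h2; have := L2B h1 h2; rewrite /Hs.
by congr L2; apply/funext => x; rewrite mulrBr.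
Qed.

Lemma hnD k phi psi : Hs k phi -> Hs k psi ->
  hn k (fun x => phi x + psi x) <= hn k phi + hn k psi.
Proof.
move=> h1 h2; apply: le_trans (nrmD h1 h2).
by rewrite /hn (eq_nrm mu (g := fun x => wgt k x * phi x + wgt k x * psi x))// => x; rewrite mulrDr.
Qed.

Lemma hnB k phi psi : Hs k phi -> Hs k psi ->
  hn k (fun x => phi x - psi x) <= hn k phi + hn k psi.
Proof.
move=> h1 h2; apply: le_trans (nrmB h1 h2).
by rewrite /hn (eq_nrm mu (g := fun x => wgt k x * phi x - wgt k x * psi x))// => x; rewrite mulrBr.
Qed.

Lemma hnZ k (a : R) phi : Hs k phi -> hn k (fun x => a * phi x) = `|a| * hn k phi.
Proof. by move=> h; rewrite -(nrmZ a h); apply: eq_nrm => x; rewrite mulrCA. Qed.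

Lemma hn_dist k phi psi chi : Hs k phi -> Hs k psi -> Hs k chi ->
  hn k (fun x => phi x - chi x) <=
  hn k (fun x => phi x - psi x) + hn k (fun x => psi x - chi x).
Proof.
move=> h1 h2 h3; apply: le_trans (hnD (HsB h1 h2) (HsB h2 h3)).
by rewrite /hn (eq_nrm mu (g := fun x => wgt k x * (phi x - psi x + (psi x - chi x))))// => x; congr (_ * _); ring.
Qed.

Lemma hn_sym k phi psi : hn k (fun x => phi x - psi x) = hn k (fun x => psi x - phi x).
Proof. by rewrite /hn -nrmN; apply: eq_nrm => x; rewrite -mulrN opprB. Qed.

Lemma Hs0E phi : (fun x => wgt 0 x * phi x) = phi.
Proof. by apply/funext => x; rewrite wgt0 mul1r. Qed.

Lemma hn0 phi : hn 0 phi = nrm phi. Proof. by rewrite /hn Hs0E. Qed.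

Lemma Hs_L2 k phi : Hs k phi -> L2 phi.
Proof. by move=> /(Hs_le (leq0n k))[+ _]; rewrite /Hs Hs0E. Qed.

Lemma L2_Hs0 phi : L2 phi -> Hs 0 phi. Proof. by rewrite /Hs Hs0E. Qed.

(** The symbols under consideration: [|xi|] itself and its truncated averages. What follows is
    proved for all of them, hence both for the equation and for its approximations. *)
Definition mult (s : V -> R) := [/\ measT s, forall x, s (- x) = s x,
  forall x, 0 <= s x <= rr x & forall x y, `|s x - s y| <= `|rr x - rr y|].

Lemma mult_enorm : mult rr.
Proof.
split => [||x|x y]; [exact: measurable_enorm|exact: enormN| |exact: lexx].
by rewrite enorm_ge0 lexx.
Qed.

Lemma mker_xi (a : V -> R) : measT a -> mker (fun xi eta zeta : V => a xi).
Proof. by move=> ma; apply: (measurableT_comp ma). Qed.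

Lemma mker_eta (a : V -> R) : measT a -> mker (fun xi eta zeta : V => a eta).
Proof. by move=> ma; apply: (measurableT_comp ma). Qed.

Lemma mker_zeta (a : V -> R) : measT a -> mker (fun xi eta zeta : V => a zeta).
Proof. exact: measurable_sub2. Qed.

Lemma mkerD (k l : V -> V -> V -> R) : mker k -> mker l ->
  mker (fun x y z => k x y z + l x y z).
Proof. exact: measurable_funD. Qed.

Lemma mkerB (k l : V -> V -> V -> R) : mker k -> mker l ->
  mker (fun x y z => k x y z - l x y z).
Proof. exact: measurable_funB. Qed.

Lemma mkerM (k l : V -> V -> V -> R) : mker k -> mker l ->
  mker (fun x y z => k x y z * l x y z).
Proof. exact: measurable_funM. Qed.

Definition kin (k : V -> V -> V -> R) phi psi xi := intg (fun eta => k xi eta (xi - eta) *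
     (phi eta * ev psi (xi - eta) + phi (- eta) * od psi (xi - eta))).

Lemma kst_out k phi psi xi : ~ S xi -> kst k phi psi xi = 0.
Proof. by move=> nS; rewrite !kstE indicE memNset// mulr0. Qed.

Lemma kst_kD k l phi psi xi : (S xi -> kin k phi psi xi) -> (S xi -> kin l phi psi xi) ->
  kst (fun x y z => k x y z + l x y z) phi psi xi = kst k phi psi xi + kst l phi psi xi.
Proof.
move=> h1 h2; have [Sx|nS] := pselect (S xi); last by rewrite !kst_out// addr0.
rewrite !kstE -mulrDl -IntD ?h1 ?h2//; first [exact: h1|exact: h2|idtac].
by congr (_ * _); apply: eq_Int => eta; rewrite mulrDl.
Qed.

Lemma kst_kZ a k phi psi xi : (S xi -> kin k phi psi xi) ->
  kst (fun x y z => a x * k x y z) phi psi xi = a xi * kst k phi psi xi.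
Proof.
move=> h1; have [Sx|nS] := pselect (S xi); last by rewrite !kst_out// mulr0.
rewrite !kstE mulrA -IntZ; last exact: h1.
by congr (_ * _); apply: eq_Int => eta; rewrite mulrA.
Qed.

Lemma kst_zeta k (a : V -> R) phi psi xi : (forall x, a (- x) = a x) ->
  kst (fun x y z => k x y z * a z) phi psi xi = kst k phi (fun x => a x * psi x) xi.
Proof.
move=> aN; rewrite !kstE; congr (_ * _); apply: eq_Int => eta.
by rewrite /ev /od aN; field.
Qed.

Lemma kst_Bl k phi1 phi2 psi xi : (S xi -> kin k phi1 psi xi) -> (S xi -> kin k phi2 psi xi) ->
  kst k (fun x => phi1 x - phi2 x) psi xi = kst k phi1 psi xi - kst k phi2 psi xi.
Proof.
move=> h1 h2; have [Sx|nS] := pselect (S xi); last by rewrite !kst_out// subr0.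
rewrite !kstE -mulrBl -IntB; first [exact: h1|exact: h2|idtac].
by congr (_ * _); apply: eq_Int => eta; ring.
Qed.

Lemma kst_Br k phi psi1 psi2 xi : (S xi -> kin k phi psi1 xi) -> (S xi -> kin k phi psi2 xi) ->
  kst k phi (fun x => psi1 x - psi2 x) xi = kst k phi psi1 xi - kst k phi psi2 xi.
Proof.
move=> h1 h2; have [Sx|nS] := pselect (S xi); last by rewrite !kst_out// subr0.
rewrite !kstE -mulrBl -IntB; first [exact: h1|exact: h2|idtac].
by congr (_ * _); apply: eq_Int => eta; rewrite /ev /od; field.
Qed.

Lemma wt1 : wt (fun=> 1). Proof. by []. Qed.

Lemma wt0 : wt (fun=> 0). Proof. by []. Qed.

Lemma wt_enorm : wt rr. Proof. by split; [exact: enorm_ge0|exact: enormN]. Qed.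

Lemma wt_wgt k : wt (wgt k). Proof. by split; [exact: wgt_ge0|exact: wgtN]. Qed.

Lemma zeroM phi : L2 (fun x => 0 * phi x) /\ intg (fun x => 0 * phi x) /\
  nrm (fun x => 0 * phi x) = 0.
Proof.
have -> : (fun x => 0 * phi x) = (fun=> 0) by apply/funext => x; rewrite mul0r.
by split; [exact: L2_0|split; [exact: intg0|exact: nrm0]].
Qed.

Lemma kst_bound_l k phi psi (p q : V -> R) C : mker k -> wt p -> wt q ->
  0 <= C -> measT phi -> measT psi ->
  (forall xi eta, `|k xi eta (xi - eta)| <= C * (p eta * q (xi - eta))) ->
  intg (fun x => p x * phi x) -> L2 (fun x => p x * phi x) -> L2 (fun x => q x * psi x) ->
  L2 (kst k phi psi) /\ nrm (kst k phi psi) <=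
   2 * C * (n1 (fun x => p x * phi x) * nrm (fun x => q x * psi x)).
Proof.
move=> mk wp wq C0 mph mps kb I1 L1 L2'.
have kb' xi eta : `|k xi eta (xi - eta)| <= C * (p eta * q (xi - eta) + (fun=> 0) eta * (fun=> 0) (xi - eta)).
  by rewrite /= mulr0 addr0.
have [z1 [_ z3]] := zeroM phi; have [y1 [y2 _]] := zeroM psi.
have [h1 h2] := kst_bound mk wp wq wt0 wt0 C0 mph mps kb' I1 L1 L2' z1 y2 y1.
by split; [exact: h1|move: h2; rewrite z3 mul0r addr0].
Qed.

Lemma kst_bound_r k phi psi (p q : V -> R) C : mker k -> wt p -> wt q ->
  0 <= C -> measT phi -> measT psi ->
  (forall xi eta, `|k xi eta (xi - eta)| <= C * (p eta * q (xi - eta))) ->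
  L2 (fun x => p x * phi x) -> intg (fun x => q x * psi x) -> L2 (fun x => q x * psi x) ->
  L2 (kst k phi psi) /\ nrm (kst k phi psi) <=
   2 * C * (nrm (fun x => p x * phi x) * n1 (fun x => q x * psi x)).
Proof.
move=> mk wp wq C0 mph mps kb L1 I2 L2'.
have kb' xi eta : `|k xi eta (xi - eta)| <= C * ((fun=> 0) eta * (fun=> 0) (xi - eta) + p eta * q (xi - eta)).
  by rewrite /= mulr0 add0r.
have [z1 [z2 _]] := zeroM phi; have [y1 [_ y3]] := zeroM psi.
have [h1 h2] := kst_bound mk wt0 wt0 wp wq C0 mph mps kb' z2 z1 y1 L1 I2 L2'.
by split; [exact: h1|move: h2; rewrite y3 mulr0 add0r].
Qed.

Lemma fun1M phi : (fun x => 1 * phi x) = phi.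
Proof. by apply/funext => x; rewrite mul1r. Qed.

End hartley_convolution.

(** In [energy_rate], [I] is the integral with the commutator and [J] the one that positivity bounds
    from below. *)
Lemma energy_arith (R : realFieldType) (I J N M A c : R) : I <= N * M -> N * M <= N * (c * A * N) ->
  - (A * (N * N)) <= J -> I - J <= (1 + c) * A * (N * N).
Proof. by move=> h1 h2 h3; lra. Qed.

Lemma lip_arith (R : realFieldType) (a b x y h k K : R) : 0 <= a -> 0 <= y -> 0 <= k ->
  0 <= h -> a <= K * x -> b <= K * y -> k <= h -> 0 <= b ->
  2 * a * h + 2 * k * b <= 2 * K * (x + y) * h.
Proof.
move=> a0 y0 k0 h0 ax bx kh b0.
have h1 := ler_wpM2r h0 ax; have h2 : k * b <= h * (K * y) by rewrite ler_pM.
lra.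
Qed.

Lemma diff_arith (R : realFieldType) (I J L N B F A A' : R) :
  I <= N * B -> N * B <= N * (2 * 2 * (A * N)) -> L <= N * F -> N * F <= N * (2 * N * A') ->
  - (A * (N * N)) <= J -> I - J + L <= (5 * A + 2 * A') * (N * N).
Proof. by move=> *; lra. Qed.

Lemma sqr_arith (R : realFieldType) (N M P Q t r : R) : 0 <= t -> 0 <= M -> M <= P * N ->
  r <= Q * N ^+ 2 ->
  N ^+ 2 + 2 * t * r + t ^+ 2 * M ^+ 2 <= N ^+ 2 * (1 + 2 * t * Q + t ^+ 2 * P ^+ 2).
Proof.
move=> t0 M0 h r1.
have h2 : M ^+ 2 <= P ^+ 2 * N ^+ 2 by rewrite -exprMn lerXn2r ?nnegrE//; exact: le_trans M0 h.
have h3 := ler_wpM2l (sqr_ge0 t) h2; have h4 := ler_wpM2l (mulr_ge0 (ler0n R 2) t0) r1.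
lra.
Qed.

(** * Energy estimates *)

Section estimates.
Context {R : realType} {d : nat} (Om : domain) (p : nat) (hp : (d.+1 <= 2 * p)%N).
Notation V := 'rV[R]_d.
Notation rr := (@eucl_norm R d).
Notation mu := (fmu Om).
Notation S := (@freqs R d Om).
Notation L2 := (L2 mu).
Notation intg := (intg mu).
Notation nrm := (nrm mu).
Notation kst := (kst Om).
Notation n1 := (n1 Om).
Notation Hs := (Hs Om).
Notation hn := (hn Om).
Notation kin := (kin Om).
Implicit Types phi psi : V -> R.

Definition Kemb := nrm (fun x : V => (wgt p x)^-1).

Lemma Kemb_ge0 : 0 <= Kemb. Proof. exact: nrm_ge0. Qed.

Lemma L2_inv_wgt : L2 (fun x : V => (wgt p x)^-1).
Proof.
have m : measT (fun x : V => (wgt p x)^-1).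
  by apply: measurable_inv_pos; [exact: measurable_wgt|exact: wgt_gt0].
split => //; apply: (intg_le _ (intg_decay Om (R := R) (d := d))).
  exact: measurable_funX.
move=> x; rewrite ger0_norm ?sqr_ge0// exprVn lef_pV2 ?posrE.
- by rewrite /wgt -exprM mulnC ler_weXn2l// lerDl enorm_ge0.
- by rewrite exprn_gt0// wgt_gt0.
- by rewrite exprn_gt0// ltr_wpDr// enorm_ge0.
Qed.

(** Cauchy-Schwarz against [(wgt p x)^-1], which is square integrable since [2 * p] is at least
    [d + 1]. This is the embedding of H^p into bounded continuous functions, read on transforms. *)
Lemma embed phi : Hs p phi -> intg phi /\ n1 phi <= Kemb * hn p phi.
Proof.
move=> H; have L := L2_inv_wgt; have Ln := L2_norm H.
have e x : (wgt p x)^-1 * `|wgt p x * phi x| = `|phi x|.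
  by rewrite normrM (ger0_norm (wgt_ge0 _ _)) mulKf// gt_eqF// wgt_gt0.
have I := L2M L Ln.
have I1 : intg (fun x => `|phi x|) by apply: eq_intg I => x; exact: e.
split.
  apply: (intg_le (Hs_meas H) I1) => x; exact: lexx.
rewrite n1E -(eq_Int mu e).
apply: (le_trans (ler_norm _)); apply: (le_trans (cauchy_schwarz L Ln)).
apply: ler_wpM2l; first exact: Kemb_ge0.
by apply: le_nrm => //; [case: Ln|move=> x; rewrite normr_id].
Qed.

Lemma mul_enorm k phi : Hs k.+1 phi ->
  Hs k (fun x => rr x * phi x) /\ hn k (fun x => rr x * phi x) <= hn k.+1 phi.
Proof.
move=> H; rewrite -[leRHS]mul1r; apply: Hs_mul => //; first exact: measurable_enorm.
move=> x; rewrite mul1r ger0_norm ?enorm_ge0// /wgt exprS; apply: ler_wpM2r.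
  by rewrite exprn_ge0// addr_ge0// enorm_ge0.
by rewrite lerDr.
Qed.

Lemma embed_enorm phi : Hs p.+1 phi -> intg (fun x => rr x * phi x) /\
  n1 (fun x => rr x * phi x) <= Kemb * hn p.+1 phi.
Proof.
move=> /mul_enorm[H N]; have [I N1] := embed H; split => //.
apply: (le_trans N1); apply: ler_wpM2l => //; exact: Kemb_ge0.
Qed.

Lemma embedS phi : Hs p.+1 phi -> intg phi /\ n1 phi <= Kemb * hn p.+1 phi.
Proof.
move=> /(Hs_le (leqnSn p))[H N]; have [I N1] := embed H; split => //.
apply: (le_trans N1); apply: ler_wpM2l => //; exact: Kemb_ge0.
Qed.

Lemma star_bound phi psi : intg phi -> L2 phi -> L2 psi ->
  L2 (kst (fun _ _ _ => 1) phi psi) /\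
  nrm (kst (fun _ _ _ => 1) phi psi) <= 2 * n1 phi * nrm psi.
Proof.
move=> Ip Lp Ls; have w1 := @wt1 R d.
have := @kst_bound_l R d Om (fun _ _ _ => 1) phi psi (fun=> 1) (fun=> 1) 1
  (measurable_cst _) w1 w1 ler01 (proj1 Lp) (proj1 Ls).
rewrite !fun1M mulr1.
have kb (xi eta : V) : `|1 : R| <= 1 * 1 by rewrite normr1 !mul1r.
by move=> /(_ kb Ip Lp Ls)[h1 h2]; split => //; move: h2; rewrite mulr1 mulrA.
Qed.

Lemma kin_zeta (a : V -> R) phi psi xi : (forall x, a (- x) = a x) ->
  kin (fun _ _ _ => 1) phi (fun x => a x * psi x) xi -> kin (fun _ _ z => 1 * a z) phi psi xi.
Proof. by move=> aN; apply: eq_intg => eta; rewrite /ev /od aN; field. Qed.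

Lemma kin_kZ (a : V -> R) k phi psi xi : kin k phi psi xi ->
  kin (fun x y z => a x * k x y z) phi psi xi.
Proof. by move=> /(intgZ (a xi)); apply: eq_intg => eta; rewrite mulrA. Qed.

(* Energy estimates only see the positivity of the solution through this
   inequality. *)
Definition quasi_pos (s phi : V -> R) := forall psi, L2 psi -> L2 (fun x => s x * psi x) ->
  - (n1 (fun x => rr x * phi x) * nrm psi ^+ 2) <=
  \int[mu]_xi (psi xi * kst (fun _ _ _ => 1) phi (fun x => s x * psi x) xi).

Section multiplier.
Variables (s : V -> R) (ms : mult s).

Let sm : measT s. Proof. by case: ms. Qed.
Let sN x : s (- x) = s x. Proof. by case: ms. Qed.
Let s_ge0 x : 0 <= s x. Proof. by case: ms => _ _ /(_ x)/andP[]. Qed.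
Let s_le x : s x <= rr x. Proof. by case: ms => _ _ /(_ x)/andP[]. Qed.
Let s_lip x y : `|s x - s y| <= rr (x - y).
Proof. by case: ms => _ _ _ /(_ x y) h; apply: (le_trans h); exact: enormB. Qed.

Definition kF : V -> V -> V -> R := fun xi eta zeta => s eta - s xi.

(* [Fs phi psi] is the transform of [v |nabla| u - |nabla|(u v)], when [phi]
   and [psi] are those of [u] and [v]. *)
Definition Fs phi psi := kst kF phi psi.

Lemma FsE phi psi : Fs phi psi = kst kF phi psi. Proof. by []. Qed.

Lemma mult_Hs k phi : Hs k.+1 phi ->
  Hs k (fun x => s x * phi x) /\ hn k (fun x => s x * phi x) <= hn k.+1 phi.
Proof.
move=> H; rewrite -[leRHS]mul1r; apply: Hs_mul => // x.
rewrite mul1r ger0_norm// /wgt exprS; apply: ler_wpM2r.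
  by rewrite exprn_ge0// addr_ge0// enorm_ge0.
by rewrite (le_trans (s_le x))// lerDr.
Qed.

Lemma mult_n1 phi : Hs p.+1 phi -> intg (fun x => s x * phi x) /\
  n1 (fun x => s x * phi x) <= n1 (fun x => rr x * phi x).
Proof.
move=> H; have [I _] := embed_enorm H; have In := intg_norm I.
have b x : `|s x * phi x| <= `|rr x * phi x|.
  by rewrite !normrM ler_wpM2r// !ger0_norm ?enorm_ge0.
have Is : intg (fun x => s x * phi x).
  by apply: (intg_le _ In b); apply: measurable_funM => //; exact: Hs_meas H.
split => //; apply: Int_le => //; exact: intg_norm.
Qed.

Lemma mker_kF : mker kF. Proof. by apply: mkerB; [exact: mker_eta|exact: mker_xi]. Qed.

Lemma kF_bound (xi eta : V) : `|kF xi eta (xi - eta)| <= rr (xi - eta).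
Proof. by rewrite /kF distrC; exact: s_lip. Qed.

Lemma kin_kF phi psi xi : S xi -> Hs 0 phi -> Hs 1 psi -> kin kF phi psi xi.
Proof.
move=> Sx H0 H1; have [Hr _] := mul_enorm H1; rewrite HsE Hs0E in Hr.
apply: (@kst_intg _ _ _ _ _ _ (fun=> 1) rr 1 xi) => //.
- exact: mker_kF.
- exact: wt_enorm.
- exact: Hs_meas H0.
- exact: Hs_meas H1.
- by move=> eta; rewrite !mul1r; exact: kF_bound.
Qed.

Lemma kin1 phi psi xi : S xi -> L2 phi -> L2 psi -> kin (fun _ _ _ => 1) phi psi xi.
Proof.
move=> Sx H0 H1.
apply: (@kst_intg _ _ _ _ _ _ (fun=> 1) (fun=> 1) 1 xi) => //; rewrite ?fun1M//.
- exact: measurable_cst.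
- by case: H0.
- by case: H1.
- by move=> eta; rewrite normr1 !mul1r.
Qed.

(** The kernel is at most [|xi - eta|], so the derivative falls on [psi]. The weight at [xi] is at
    most 2^p times the sum of those at [eta] and [xi - eta]; whichever factor does not receive it is
    integrable by the embedding. *)
Lemma Fs_bound phi psi : Hs p.+1 phi -> Hs p.+1 psi -> Hs p (Fs phi psi) /\
  hn p (Fs phi psi) <= 2 * 2 ^+ p * 2 * Kemb * (hn p.+1 phi * hn p.+1 psi).
Proof.
move=> H1 H2; have [I1 N1] := embedS H1; have [Ir Nr] := embed_enorm H2.
have [Hp1 Np1] := Hs_le (leqnSn p) H1; have [Hp2 Np2] := mul_enorm H2.
have wF x : wgt p x * Fs phi psi x = kst (fun xi eta zeta => wgt p xi * kF xi eta zeta) phi psi x.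
  rewrite kst_kZ// => Sx; apply: kin_kF => //; first exact: (Hs_le (leq0n _) H1).1.
  exact: (Hs_le _ H2).1.
have L1 := Hs_L2 H1.
have mwk : mker (fun xi eta zeta : V => wgt p xi * kF xi eta zeta).
  by apply: mkerM; [apply: mker_xi; exact: measurable_wgt|exact: mker_kF].
have wp := @wt_wgt R d p.
have wpr : wt (fun x : V => wgt p x * rr x).
  by split => x; rewrite ?mulr_ge0 ?enorm_ge0 ?wgt_ge0// wgtN enormN.
have kb (xi eta : V) : `|wgt p xi * kF xi eta (xi - eta)| <=
    2 ^+ p * (1 * (wgt p (xi - eta) * rr (xi - eta)) + wgt p eta * rr (xi - eta)).
  rewrite normrM (ger0_norm (wgt_ge0 _ _)).
  have : wgt p xi <= 2 ^+ p * (wgt p (xi - eta) + wgt p eta).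
    have h : rr xi <= rr (xi - eta) + rr eta by have := enormD (xi - eta) eta; rewrite subrK.
    have a0 := enorm_ge0 xi.
    have u0 := wgt_ge0 p (xi - eta); have v0 := wgt_ge0 p eta.
    case: (leP (rr eta) (rr (xi - eta))) => ab.
      apply: (le_trans (wfun_le (y := rr (xi - eta)) (l := 2) (wfun_1DX p) _ _ _ _)) => //; try lra.
      by rewrite mulrDr lerDl mulr_ge0.
    apply: (le_trans (wfun_le (y := rr eta) (l := 2) (wfun_1DX p) _ _ _ _)) => //; try lra.
    by rewrite mulrDr lerDr mulr_ge0.
  move=> h; apply: (le_trans (ler_pM _ _ h (kF_bound xi eta))) => //; first exact: wgt_ge0.
  by apply: eq_ler; ring.
have C0 : 0 <= 2 ^+ p :> R by rewrite exprn_ge0.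
have e1 : (fun x => wgt p x * rr x * psi x) = (fun x => wgt p x * (rr x * psi x)).
  by apply/funext => x; rewrite mulrA.
have := kst_bound mwk (@wt1 R d) wpr wp (wt_enorm) C0 (proj1 L1) (Hs_meas H2) kb.
rewrite !fun1M e1.
have Lr : L2 (fun x => rr x * psi x) by apply: Hs_L2 Hp2.
move=> /(_ Om I1 L1 Hp2 Hp1 Ir Lr)[B1 B2].
have -> : Hs p (Fs phi psi) = L2 (kst (fun xi eta zeta => wgt p xi * kF xi eta zeta) phi psi).
  by rewrite HsE (funext wF).
split => //; rewrite hnE (eq_nrm mu wF); apply: (le_trans B2).
rewrite -!(mulrA (2 * 2 ^+ p)); apply: ler_wpM2l; first by rewrite mulr_ge0.
have a1 : n1 phi * nrm (fun x => wgt p x * (rr x * psi x)) <= (Kemb * hn p.+1 phi) * hn p.+1 psi.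
  by apply: ler_pM => //; [exact: n1_ge0|exact: nrm_ge0].
have a2 : nrm (fun x => wgt p x * phi x) * n1 (fun x => rr x * psi x) <= hn p.+1 phi * (Kemb * hn p.+1 psi).
  by apply: ler_pM => //; [exact: nrm_ge0|exact: n1_ge0].
lra.
Qed.

Lemma Fs_bound0l phi psi : Hs p.+1 phi -> Hs 1 psi -> L2 (Fs phi psi) /\
  nrm (Fs phi psi) <= 2 * n1 phi * hn 1 psi.
Proof.
move=> H1 H2; have [I1 N1] := embedS H1; have [Hr Nr] := mul_enorm H2.
have L1 := Hs_L2 H1; have Lr := Hs_L2 Hr; rewrite hn0 in Nr.
have := kst_bound_l mker_kF (@wt1 R d) wt_enorm ler01 (Hs_meas H1) (Hs_meas H2).
rewrite !fun1M mulr1.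
have kb (xi eta : V) : `|kF xi eta (xi - eta)| <= 1 * (1 * rr (xi - eta)).
  by rewrite !mul1r; exact: kF_bound.
move=> /(_ Om kb I1 L1 Lr)[h1 h2]; split => //.
apply: (le_trans h2); rewrite mulrA; apply: ler_wpM2l => //.
by rewrite mulr_ge0// n1_ge0.
Qed.

(** The derivative falls on [psi], so the first argument may be merely square integrable: it will be
    a difference of two solutions. *)
Lemma Fs_bound0r phi psi : L2 phi -> Hs p.+1 psi -> L2 (Fs phi psi) /\
  nrm (Fs phi psi) <= 2 * nrm phi * n1 (fun x => rr x * psi x).
Proof.
move=> L1 H2; have [I1 N1] := embed_enorm H2; have [Hr Nr] := mul_enorm H2.
have Lr := Hs_L2 Hr.
have := kst_bound_r mker_kF (@wt1 R d) wt_enorm ler01 (proj1 L1) (Hs_meas H2).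
rewrite !fun1M mulr1.
have kb (xi eta : V) : `|kF xi eta (xi - eta)| <= 1 * (1 * rr (xi - eta)).
  by rewrite !mul1r; exact: kF_bound.
move=> /(_ Om kb L1 I1 Lr)[h1 h2]; split => //.
by move: h2; rewrite mulrA.
Qed.

Section weighted.
Variables (g : R -> R) (k : nat) (wg : wfun g k).
Let w (x : V) := g (rr x).

Let mw : measT w.
Proof. by case: wg => mg _ _ _; exact: measurable_radial. Qed.
Let w0 x : 0 <= w x. Proof. by case: wg => _ h _ _; apply: h; exact: enorm_ge0. Qed.
Let wN x : w (- x) = w x. Proof. by rewrite /w enormN. Qed.

(** The part of full order in [w * Fs phi phi] is minus the product of [phi] with [s * (w * phi)].
    Adding that product back leaves this kernel, which the weights control as a commutator. *)
Definition kB : V -> V -> V -> R :=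
  fun xi eta zeta => w xi * kF xi eta zeta + 1 * (s zeta * w zeta).

Lemma kB_bound xi eta :
  `|kB xi eta (xi - eta)| <= 4 * 3 ^+ k * (rr eta * w (xi - eta) + w eta * rr (xi - eta)).
Proof.
rewrite /kB mul1r /kF; apply: weight_kernel => //; try exact: enorm_ge0.
- by have := enormB (xi - eta) xi; rewrite addrAC subrr sub0r enormN.
- by have := enormB eta xi; rewrite -(enormN (eta - xi)) opprB.
- by rewrite s_ge0 s_le.
- by rewrite s_ge0 s_le.
- by rewrite distrC s_lip.
- by have := s_lip xi (xi - eta); rewrite subKr.
Qed.

Variable phi : V -> R.
Hypotheses (Hphi : Hs p.+1 phi) (Lw : L2 (fun x => w x * phi x))
  (Lsw : L2 (fun x => s x * (w x * phi x))).

Let A := n1 (fun x => rr x * phi x).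
Let A0 : 0 <= A. Proof. exact: n1_ge0. Qed.
Let Lphi : L2 phi. Proof. exact: Hs_L2 Hphi. Qed.

(** The factor 16 is the 2 of [kst_bound], times the 4 of [weight_kernel], times two equal terms. *)
Lemma kB_L2 : L2 (kst kB phi phi) /\
  nrm (kst kB phi phi) <= 16 * 3 ^+ k * A * nrm (fun x => w x * phi x).
Proof.
have mk : mker kB.
  apply: mkerD; first by apply: mkerM; [exact: mker_xi|exact: mker_kF].
  apply: mkerM; first exact: measurable_cst.
  by apply: mker_zeta; exact: measurable_funM.
have C0 : 0 <= 4 * 3 ^+ k :> R by rewrite mulr_ge0// exprn_ge0.
have ww : wt w by [].
have [Ir _] := embed_enorm Hphi.
have Lr : L2 (fun x => rr x * phi x) by have [/Hs_L2] := mul_enorm Hphi.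
have mphi := proj1 Lphi.
have [h1 h2] := kst_bound mk wt_enorm ww ww wt_enorm C0 mphi mphi kB_bound Ir Lr Lw Lw Ir Lr.
split; first exact: h1.
apply: (le_trans h2); apply: eq_ler; rewrite /A; ring.
Qed.

Lemma weighted_Fs xi : w xi * Fs phi phi xi =
  kst kB phi phi xi - kst (fun _ _ _ => 1) phi (fun x => s x * (w x * phi x)) xi.
Proof.
have k1 : S xi -> kin kF phi phi xi.
  by move=> Sx; apply: kin_kF => //; [exact: L2_Hs0|exact: (Hs_le _ Hphi).1].
have e : (fun x => s x * (w x * phi x)) = (fun x => s x * w x * phi x).
  by apply/funext => x; rewrite mulrA.
have swN x : s (- x) * w (- x) = s x * w x by rewrite sN wN.
have k2 : S xi -> kin (fun _ _ z => 1 * (s z * w z)) phi phi xi.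
  by move=> Sx; apply: (kin_zeta (a := fun z => s z * w z)) => //; rewrite -e; exact: kin1.
rewrite /kB kst_kD//; last by move=> Sx; apply: kin_kZ; exact: k1.
rewrite kst_kZ// (@kst_zeta _ _ Om (fun _ _ _ => 1) (fun z => s z * w z))// -e FsE; ring.
Qed.

Lemma weighted_Fs_L2 : L2 (fun x => w x * Fs phi phi x) /\
  nrm (fun x => w x * Fs phi phi x) <=
  2 * n1 phi * nrm (fun x => s x * (w x * phi x)) +
  16 * 3 ^+ k * A * nrm (fun x => w x * phi x).
Proof.
have [L1 N1] := kB_L2; have [I0 _] := embedS Hphi.
have [L3 N3] := star_bound I0 Lphi Lsw.
rewrite (funext weighted_Fs); split; first exact: L2B.
by apply: (le_trans (nrmB L1 L3)); rewrite addrC lerD.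
Qed.

Hypothesis qp : quasi_pos s phi.

(** Cauchy-Schwarz for the commutator; the product that was added back is handled by [quasi_pos],
    tested on [w * phi]. *)
Lemma energy_rate : \int[mu]_x (w x * phi x * (w x * Fs phi phi x)) <=
  (1 + 16 * 3 ^+ k) * A * nrm (fun x => w x * phi x) ^+ 2.
Proof.
have [L1 N1] := kB_L2; have [I0 _] := embedS Hphi.
have [L3 N3] := star_bound I0 Lphi Lsw.
rewrite (eq_Int mu (g := fun x => w x * phi x * kst kB phi phi x -
  w x * phi x * kst (fun _ _ _ => 1) phi (fun x => s x * (w x * phi x)) x)); last first.
  by move=> x; rewrite weighted_Fs mulrBr.
rewrite (IntB (L2M Lw L1) (L2M Lw L3)).
have q := qp Lw Lsw; rewrite -/A in q.
have cs := le_trans (ler_norm _) (cauchy_schwarz Lw L1).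
have := ler_wpM2l (nrm_ge0 mu (fun x => w x * phi x)) N1.
by rewrite expr2 in q *; move=> h; exact: energy_arith cs h q.
Qed.

(** In the expansion of the square the cross term is [energy_rate]. The last term may use the bound
    [Cs] of the symbol, although it grows with the truncation, because it carries the factor
    [tau ^+ 2]. *)
Lemma euler_energy (Cs tau : R) : 0 <= tau -> (forall x, s x <= Cs) ->
  nrm (fun x => w x * (phi x + tau * Fs phi phi x)) ^+ 2 <=
  nrm (fun x => w x * phi x) ^+ 2 *
  (1 + 2 * tau * ((1 + 16 * 3 ^+ k) * A) + tau ^+ 2 * (2 * n1 phi * Cs + 16 * 3 ^+ k * A) ^+ 2).
Proof.
move=> t0 sC; have [LF NF] := weighted_Fs_L2; have r := energy_rate.
have Cs0 : 0 <= Cs := le_trans (s_ge0 0) (sC 0).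
have Ns : nrm (fun x => s x * (w x * phi x)) <= Cs * nrm (fun x => w x * phi x).
  rewrite -[Cs](ger0_norm Cs0) -(nrmZ _ Lw); apply: le_nrm; [by case: Lsw|exact: L2Z|].
  by move=> x; rewrite [leLHS]normrM [leRHS]normrM ler_wpM2r// !ger0_norm.
rewrite nrm_sqr (eq_Int mu (g := fun x => (w x * phi x) ^+ 2 +
   (2 * tau) * (w x * phi x * (w x * Fs phi phi x)) + tau ^+ 2 * (w x * Fs phi phi x) ^+ 2)); last first.
  by move=> x; ring.
have [mw1 I1] := Lw; have [mF IF] := LF; have I2 := L2M Lw LF.
rewrite (IntD (intgD I1 (intgZ _ I2)) (intgZ _ IF)) (IntD I1 (intgZ _ I2)) (IntZ _ I2) (IntZ _ IF).
rewrite -!nrm_sqr.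
apply: sqr_arith => //; first exact: nrm_ge0.
apply: (le_trans NF); rewrite [leRHS]mulrDl; apply: lerD => //.
rewrite -[leRHS]mulrA; apply: ler_wpM2l => //; apply: mulr_ge0 => //; exact: n1_ge0.
Qed.

End weighted.

Lemma kin_Fs phi psi xi : S xi -> Hs p.+1 phi -> Hs p.+1 psi -> kin kF phi psi xi.
Proof.
move=> Sx H1 H2; apply: kin_kF => //; [exact: (Hs_le _ H1).1|exact: (Hs_le _ H2).1].
Qed.

Lemma Fs_sub phi psi xi : Hs p.+1 phi -> Hs p.+1 psi ->
  Fs phi phi xi - Fs psi psi xi =
  Fs phi (fun x => phi x - psi x) xi + Fs (fun x => phi x - psi x) psi xi.
Proof.
move=> H1 H2; rewrite !FsE kst_Br ?kst_Bl; try by move=> Sx; exact: kin_Fs.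
by ring.
Qed.

(** One derivative of the difference is lost, which is harmless where the difference is small in
    H^1, as between two points of one segment of an Euler curve. *)
Lemma Fs_lip phi psi : Hs p.+1 phi -> Hs p.+1 psi ->
  L2 (fun x => Fs phi phi x - Fs psi psi x) /\
  nrm (fun x => Fs phi phi x - Fs psi psi x) <=
   2 * Kemb * (hn p.+1 phi + hn p.+1 psi) *
   hn 1 (fun x => phi x - psi x).
Proof.
move=> H1 H2; have H3 := HsB H1 H2; have [H31 _] := Hs_le (isT : 1 <= p.+1)%N H3.
have [L1 N1] := Fs_bound0l H1 H31.
have [L2' N2] := Fs_bound0r (Hs_L2 H3) H2.
have [_ M1] := embedS H1; have [_ M2] := embed_enorm H2.
have [_ M3] := Hs_le (leq0n 1) H31; rewrite hn0 in M3.
rewrite (funext (fun xi => Fs_sub xi H1 H2)); split; first exact: L2D.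
apply: (le_trans (nrmD L1 L2')); apply: (le_trans (lerD N1 N2)).
by apply: lip_arith => //; rewrite ?n1_ge0 ?hn_ge0 ?nrm_ge0.
Qed.

(** The rate splits into [Fs D psi], where the derivative falls on [psi], and [Fs phi D]. To the
    latter the product of [phi] with [s * D] is added: the kernel becomes at most [2 * |eta|], so
    the derivative moves to [phi], and [quasi_pos] for [phi] accounts for what was added. The
    constant 5 is 4 for this kernel and 1 for [quasi_pos]. *)
Lemma difference_rate phi psi : Hs p.+1 phi -> Hs p.+1 psi -> quasi_pos s phi ->
  \int[mu]_x ((phi x - psi x) * (Fs phi phi x - Fs psi psi x)) <=
  (5 * n1 (fun x => rr x * phi x) + 2 * n1 (fun x => rr x * psi x)) *
  nrm (fun x => phi x - psi x) ^+ 2.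
Proof.
move=> H1 H2 qp; have H3 := HsB H1 H2; have Ld := Hs_L2 H3.
set D := fun x => phi x - psi x in H3 Ld *.
have L1 := Hs_L2 H1; have [I1 _] := embedS H1; have [Ir1 _] := embed_enorm H1.
have Lr1 : L2 (fun x => rr x * phi x) by have [/Hs_L2] := mul_enorm H1.
have [Hs3 _] := mult_Hs H3; have Ls3 := Hs_L2 Hs3.
have [L2' N2] := Fs_bound0r Ld H2.
have [L3 N3] := star_bound I1 L1 Ls3.
(* The summand [s zeta] compensates [- s xi], up to [|eta|]. *)
pose kb : V -> V -> V -> R := fun xi eta zeta => kF xi eta zeta + 1 * s zeta.
have mk : mker kb.
  apply: mkerD; first exact: mker_kF.
  by apply: mkerM; [exact: measurable_cst|exact: mker_zeta].
have kbb xi eta : `|kb xi eta (xi - eta)| <= 2 * (rr eta * 1).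
  rewrite /kb mul1r mulr1 /kF.
  have h1 := s_lip (xi - eta) xi; rewrite addrAC subrr sub0r enormN in h1.
  have h2 : `|s eta| <= rr eta by rewrite ger0_norm.
  rewrite (_ : _ + _ = s eta + (s (xi - eta) - s xi)); last by ring.
  by apply: (le_trans (ler_normD _ _)); rewrite mulr_natl mulr2n lerD.
have := kst_bound_l mk wt_enorm (@wt1 R d) (ler0n R 2) (Hs_meas H1) (Hs_meas H3) kbb Ir1 Lr1.
rewrite fun1M => /(_ Ld)[L4 N4].
have e xi : Fs phi D xi = kst kb phi D xi - kst (fun _ _ _ => 1) phi (fun x => s x * D x) xi.
  have k1 : S xi -> kin kF phi D xi by move=> Sx; exact: kin_Fs.
  have k2 : S xi -> kin (fun _ _ z => 1 * s z) phi D xi.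
    by move=> Sx; apply: kin_zeta => //; exact: kin1.
  by rewrite /kb kst_kD// (@kst_zeta _ _ Om (fun _ _ _ => 1) s)// FsE; ring.
rewrite (eq_Int mu (g := fun x => D x * kst kb phi D x - D x * kst (fun _ _ _ => 1) phi (fun x => s x * D x) x
   + D x * Fs D psi x)); last first.
  by move=> x; rewrite Fs_sub// -/D e -[phi x - psi x]/(D x); ring.
rewrite (IntD (intgB (L2M Ld L4) (L2M Ld L3)) (L2M Ld L2')) (IntB (L2M Ld L4) (L2M Ld L3)).
have q := qp _ Ld Ls3.
have c1 := le_trans (ler_norm _) (cauchy_schwarz Ld L4).
have c2 := le_trans (ler_norm _) (cauchy_schwarz Ld L2').
have b1 := ler_wpM2l (nrm_ge0 mu D) N4.
have b2 := ler_wpM2l (nrm_ge0 mu D) N2.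
by rewrite expr2 in q *; exact: diff_arith c1 b1 c2 b2 q.
Qed.

End multiplier.

Lemma kst_kB k l phi psi xi : (S xi -> kin k phi psi xi) -> (S xi -> kin l phi psi xi) ->
  kst (fun x y z => k x y z - l x y z) phi psi xi = kst k phi psi xi - kst l phi psi xi.
Proof.
move=> h1 h2; have [Sx|nS] := pselect (S xi); last by rewrite !kst_out// subr0.
rewrite !kstE -mulrBl -IntB; first [exact: h1|exact: h2|idtac].
by congr (_ * _); apply: eq_Int => eta; rewrite mulrBl.
Qed.

(** The error [e] of the symbol enters at [eta] and at [xi], and both norms are at most twice the
    larger of [|eta|] and [|xi - eta|]. The growth of the weights moves error and weight together
    onto that factor. *)
Lemma change_mult (s1 s2 : V -> R) (e : R -> R) ke q phi : mult s1 -> mult s2 -> wfun e ke ->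
  (forall x, `|s1 x - s2 x| <= e (rr x)) -> Hs p.+1 phi ->
  L2 (fun x => ((1 + rr x) ^+ q * e (rr x)) * phi x) ->
  Hs q (fun x => Fs s1 phi phi x - Fs s2 phi phi x) /\
  hn q (fun x => Fs s1 phi phi x - Fs s2 phi phi x) <=
    8 * 2 ^+ (q + ke) * (n1 phi * nrm (fun x => ((1 + rr x) ^+ q * e (rr x)) * phi x)).
Proof.
move=> ms1 ms2 we hs H LG; pose G (t : R) := (1 + t) ^+ q * e t.
have wG : wfun G (q + ke) := wfun_mul (wfun_1DX q) we.
have [mG G0 nG _] := wG; have [me e0 ne _] := we; have [_ w0 nw _] := wfun_1DX (R := R) q.
have L0 := Hs_L2 H; have mphi := Hs_meas H; have [I0 _] := embedS H.
pose k (xi eta zeta : V) : R := wgt q xi * (kF s1 xi eta zeta - kF s2 xi eta zeta).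
have E xi : wgt q xi * (Fs s1 phi phi xi - Fs s2 phi phi xi) = kst k phi phi xi.
  have k1 : S xi -> kin (kF s1) phi phi xi by move=> Sx; exact: (kin_Fs ms1).
  have k2 : S xi -> kin (kF s2) phi phi xi by move=> Sx; exact: (kin_Fs ms2).
  rewrite kst_kZ; first by rewrite !FsE kst_kB.
  by move=> Sx; have := intgB (k1 Sx) (k2 Sx); apply: eq_intg => eta; rewrite [RHS]mulrBl.
have mk : mker k.
  apply: mkerM; first by apply: mker_xi; exact: measurable_wgt.
  by apply: mkerB; exact: mker_kF.
have wtG : wt (fun x : V => G (rr x)).
  by split => x; [apply: G0; exact: enorm_ge0|rewrite enormN].
have C0 : 0 <= 2 * 2 ^+ (q + ke) :> R by rewrite mulr_ge0// exprn_ge0.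
have kb (xi eta : V) : `|k xi eta (xi - eta)| <=
    2 * 2 ^+ (q + ke) * (1 * G (rr (xi - eta)) + G (rr eta) * 1).
  rewrite /k normrM (ger0_norm (wgt_ge0 _ _)) /kF mul1r mulr1.
  have a0 := enorm_ge0 xi; have b0 := enorm_ge0 (xi - eta); have c0 := enorm_ge0 eta.
  have h : rr xi <= rr (xi - eta) + rr eta by have := enormD (xi - eta) eta; rewrite subrK.
  pose M := Num.max (rr eta) (rr (xi - eta)).
  have M1 : rr eta <= M by rewrite le_max lexx.
  have M2 : rr (xi - eta) <= M by rewrite le_max lexx orbT.
  have M0 := le_trans c0 M1.
  have xM : rr xi <= 2 * M by rewrite mulr_natl mulr2n (le_trans h)// addrC lerD.
  have eM : rr eta <= 2 * M by rewrite (le_trans M1)// ler_peMl// ler1n.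
  have GM : G M <= G (rr (xi - eta)) + G (rr eta).
    by rewrite /M; case: (leP (rr eta) (rr (xi - eta))) => _; rewrite ?lerDl ?lerDr G0.
  have G2 : G (2 * M) <= 2 ^+ (q + ke) * (G (rr (xi - eta)) + G (rr eta)).
    apply: (@le_trans _ _ (2 ^+ (q + ke) * G M)).
      by apply: (wfun_le wG) => //; rewrite ?ler1n// mulr_ge0.
    by apply: ler_wpM2l => //; rewrite exprn_ge0.
  have wM : wgt q xi <= (1 + 2 * M) ^+ q by apply: nw.
  have tri : `|s1 eta - s1 xi - (s2 eta - s2 xi)| <= e (2 * M) + e (2 * M).
    rewrite (_ : _ - _ = (s1 eta - s2 eta) - (s1 xi - s2 xi)); last by ring.
    apply: (le_trans (ler_normB _ _)); apply: lerD; apply: (le_trans (hs _)); exact: ne.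
  apply: (le_trans (ler_pM (wgt_ge0 q xi) (normr_ge0 _) wM tri)).
  rewrite mulrDr -/(G (2 * M)) -mulr2n -[leLHS]mulr_natl -mulrA; apply: ler_wpM2l => //.
have := kst_bound mk (@wt1 R d) wtG wtG (@wt1 R d) C0 mphi mphi kb.
rewrite !fun1M => /(_ Om I0 L0 LG LG I0 L0)[h1 h2].
rewrite HsE hnE (funext E); split; first exact: h1.
apply: (le_trans h2); apply: eq_ler; rewrite /G; ring.
Qed.

(* As [N] grows this tends to [0], dominated by the weight of [H^(p+1)], but it
   is at least half that weight at frequencies beyond [N]. *)
Definition tfun (N t : R) := (1 + t) ^+ p.+1 * (t / (N + `|t|)).

Lemma wfun_tfun (N : R) : 0 < N -> wfun (tfun N) (p.+1 + 1).
Proof. by move=> N0; apply: wfun_mul; [exact: wfun_1DX|exact: wfun_tail]. Qed.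

Definition tl N phi := nrm (fun x => tfun N (rr x) * phi x).

Lemma tfrac (N t : R) : 0 < N -> 0 <= t -> 0 <= t / (N + `|t|) <= 1.
Proof.
move=> N0 t0; have Nt : 0 < N + `|t| by rewrite ltr_pwDl.
by rewrite divr_ge0 ?(ltW Nt)//= ler_pdivrMr// mul1r ger0_norm// lerDr ltW.
Qed.

Lemma tfun_norm (N : R) (x : V) : 0 < N ->
  `|tfun N (rr x)| = wgt p.+1 x * (rr x / (N + `|rr x|)).
Proof.
move=> N0; have /andP[h0 _] := tfrac N0 (enorm_ge0 x).
by rewrite ger0_norm// mulr_ge0// wgt_ge0.
Qed.

Lemma tfun_le (N : R) (x : V) : 0 < N -> `|tfun N (rr x)| <= `|wgt p.+1 x|.
Proof.
move=> N0; have /andP[h0 h1] := tfrac N0 (enorm_ge0 x).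
by rewrite tfun_norm// (ger0_norm (wgt_ge0 p.+1 x)) ler_piMr// wgt_ge0.
Qed.

Lemma tl_L2 N phi : 0 < N -> Hs p.+1 phi -> L2 (fun x => tfun N (rr x) * phi x) /\ tl N phi <= hn p.+1 phi.
Proof.
move=> N0 H; have [mt _ _ _] := wfun_tfun N0.
have m : measT (fun x : V => tfun N (rr x) * phi x).
  by apply: measurable_funM; [exact: measurable_radial|exact: Hs_meas H].
have b x : `|tfun N (rr x) * phi x| <= `|wgt p.+1 x * phi x|.
  by rewrite normrM [X in _ <= X]normrM; apply: ler_wpM2r => //; exact: tfun_le.
split; first exact: L2_le H b.
exact: le_nrm H b.
Qed.

(** Dominated convergence: the weight is below that of H^(p+1) and tends to 0 at each frequency like
    the inverse of its parameter. *)
Lemma tl_cvg phi : Hs p.+1 phi -> tl n.+1%:R phi @[n --> \oo] --> (0 : R).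
Proof.
move=> H; have [mH IH] := H; have mphi := Hs_meas H.
have b (n : nat) (x : V) : `|(tfun n.+1%:R (rr x) * phi x) ^+ 2| <= (wgt p.+1 x * phi x) ^+ 2.
  rewrite ger0_norm ?sqr_ge0// -real_normK ?num_real// -[leRHS]real_normK ?num_real//.
  by rewrite lerXn2r ?nnegrE// normrM [X in _ <= X]normrM; apply: ler_wpM2r => //; exact: tfun_le.
have [||||_ h] := @dct _ _ R mu (fun n x => (tfun n.+1%:R (rr x) * phi x) ^+ 2) (fun=> 0)
   (fun x => (wgt p.+1 x * phi x) ^+ 2).
- move=> n; apply: measurable_funX; apply: measurable_funM => //.
  by apply: measurable_radial; have [mt _ _ _] := @wfun_tfun n.+1%:R (ltr0Sn _ _).
- move=> x.
  have c : (n.+1%:R : R)^-1 @[n --> \oo] --> 0 by exact: cvg_harmonic.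
  apply/cvgrPdist_le => eps e0; have := c => /cvgrPdist_le.
  pose K := (wgt p.+1 x * rr x * phi x) ^+ 2 + 1.
  have K0 : 0 < K by rewrite ltr_wpDl// sqr_ge0.
  move=> /(_ (eps / K)); rewrite divr_gt0// => /(_ isT).
  apply: filterS => n; rewrite !sub0r !normrN ger0_norm ?invr_ge0// => hn'.
  rewrite ger0_norm ?sqr_ge0//.
  have i1 : (n.+1%:R : R)^-1 <= 1 by rewrite invf_le1// ler1n.
  apply: (@le_trans _ _ ((wgt p.+1 x * rr x * phi x) ^+ 2 * n.+1%:R^-1)); last first.
    apply: (@le_trans _ _ (K * (eps / K))); last by rewrite mulrCA mulfV ?mulr1// gt_eqF.
    apply: ler_pM => //; first exact: sqr_ge0.
    by rewrite /K lerDl.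
  apply: (@le_trans _ _ ((wgt p.+1 x * rr x * phi x) ^+ 2 * n.+1%:R^-1 ^+ 2)); last first.
    by apply: ler_wpM2l; [exact: sqr_ge0|rewrite expr2 ler_piMl].
  rewrite -exprMn -real_normK ?num_real// -[leRHS]real_normK ?num_real//.
  rewrite lerXn2r ?nnegrE// normrM tfun_norm// [leRHS]normrM [X in _ <= X * _]normrM.
  rewrite [X in _ <= X * _ * _]normrM -!mulrA (ger0_norm (wgt_ge0 _ _)).
  apply: ler_wpM2l; first exact: wgt_ge0.
  rewrite (ger0_norm (enorm_ge0 x)); apply: ler_wpM2l; first exact: enorm_ge0.
  rewrite mulrC; apply: ler_wpM2l => //.
  rewrite ger0_norm ?invr_ge0//.
  by rewrite lef_pV2 ?posrE ?ltr_pwDl// ?enorm_ge0// lerDl enorm_ge0.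
- exact: IH.
- exact: b.
have h2 := cvg_comp _ _ h (@sqrt_continuous R _).
by rewrite Int0 sqrtr0 in h2; exact: h2.
Qed.

(** Up to frequency [N] the Sobolev weight is at most [(1 + N) ^+ p.+1]; beyond [N] it is at most
    twice [tfun N]. Smallness in L^2 and small tails thus give smallness in H^(p+1). *)
Lemma hn_tail (N : R) phi : 0 < N -> Hs p.+1 phi ->
  hn p.+1 phi <= (1 + N) ^+ p.+1 * nrm phi + 2 * tl N phi.
Proof.
move=> N0 H; have [Lt _] := tl_L2 N0 H; have L0 := Hs_L2 H.
have L1 := L2Z ((1 + N) ^+ p.+1) (L2_norm L0); have L2' := L2Z 2 (L2_norm Lt).
have -> : (1 + N) ^+ p.+1 * nrm phi = nrm (fun x => (1 + N) ^+ p.+1 * `|phi x|).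
  rewrite (nrmZ _ (L2_norm L0)) ger0_norm ?exprn_ge0 ?addr_ge0 1?ltW//.
  by congr (_ * _); congr Num.sqrt; apply: eq_Int => x; rewrite real_normK ?num_real.
have -> : 2 * tl N phi = nrm (fun x => 2 * `|tfun N (rr x) * phi x|).
  rewrite (nrmZ _ (L2_norm Lt)) ger0_norm//.
  by congr (_ * _); congr Num.sqrt; apply: eq_Int => x; rewrite real_normK ?num_real.
apply: le_trans (nrmD L1 L2'); apply: le_nrm; [by case: H|exact: L2D|move=> x].
have N1 : 0 <= (1 + N) ^+ p.+1 by rewrite exprn_ge0// addr_ge0// ltW.
rewrite [leRHS]ger0_norm; last by rewrite addr_ge0 ?mulr_ge0.
have r0 := enorm_ge0 x; have w1 := wgt_ge0 p.+1 x.
rewrite normrM (normrM (tfun N (rr x))) (ger0_norm w1) mulrA -mulrDl; apply: ler_wpM2r => //.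
have /andP[h0 _] := tfrac N0 r0.
rewrite tfun_norm//.
case: (leP (rr x) N) => rN.
  apply: (@le_trans _ _ ((1 + N) ^+ p.+1)).
    by rewrite lerXn2r ?nnegrE ?addr_ge0// ?lerD2l// ltW.
  by rewrite lerDl mulr_ge0// mulr_ge0.
rewrite ler_wpDl// mulrCA ler_peMr// mulrA ler_pdivlMr ?ltr_pwDl// mul1r ger0_norm//.
by rewrite mulr_natl mulr2n lerD2r ltW.
Qed.

End estimates.

Lemma eq_L2 d (T : measurableType d) (R : realType) (mu : {measure set T -> \bar R})
  (f g : T -> R) : f =1 g -> L2 mu f -> L2 mu g.
Proof. by move=> /funext ->. Qed.

(** * The inverse transform *)

Section inverse_transform.
Context {R : realType} {d : nat} (Om : domain).
Notation V := 'rV[R]_d.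
Notation rr := (@eucl_norm R d).
Notation mu := (fmu Om).
Notation S := (@freqs R d Om).
Notation L2 := (L2 mu).
Notation intg := (intg mu).
Notation kst := (kst Om).
Notation n1 := (n1 Om).
Notation star := (kst (fun _ _ _ => 1)).
Implicit Types phi psi f g c : V -> R.

(** Fubini, then the substitution [xi = zeta + eta] in the inner integral, available for almost
    every [eta] since it has to be a frequency. *)
Lemma conv_fub f g c M : intg f -> intg g -> measT c ->
  (forall x, `|c x| <= M) ->
  intg (fun xi => \int[mu]_eta (f eta * g (xi - eta) * c xi)) /\
  \int[mu]_xi \int[mu]_eta (f eta * g (xi - eta) * c xi) =
  \int[mu]_eta (f eta * \int[mu]_zeta (g zeta * c (zeta + eta))).
Proof.
move=> If Ig mc cM; have mf := intg_meas If; have mg := intg_meas Ig.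
pose F (p : V * V) := f p.2 * g (p.1 - p.2) * c p.1.
have mF : measT F.
  apply: measurable_funM; last exact: (measurableT_comp mc).
  by apply: measurable_funM; [exact: (measurableT_comp mf)|exact: measurable_sub2].
have shift eta : S eta -> forall h, intg h -> intg (fun xi => h (xi - eta)) /\
    \int[mu]_xi (h (xi - eta)) = \int[mu]_x h x.
  move=> Se h Ih; apply: (@Int_comp_inv _ _ _ mu (fun x => x - eta) h) => //.
    exact: measurable_rV_map2.
  by move=> k mk k0; exact: (fmu_shift (freqs_opp Se)).
have M0 : 0 <= M := le_trans (normr_ge0 _) (cM 0).
have Foo : (\int[mu]_xi \int[mu]_eta (`|F (xi, eta)|)%:E < +oo)%E.
  rewrite (@fubini_tonelli _ _ _ _ _ mu mu (fun p => (`|F p|)%:E)); last 2 first.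
  - by apply/measurable_EFinP; exact: measurableT_comp.
  - by [].
  have IB := intgZ (M * \int[mu]_x `|g x|) (intg_norm If).
  apply: (@le_lt_trans _ _ (\int[mu]_eta (`|M * (\int[mu]_x `|g x|) * `|f eta| |)%:E)%E); last exact: intg_lty IB.
  apply: ae_ge0_le_integral.
  - exact: measurableT.
  - by move=> x _; apply: integral_ge0.
  - apply: (@measurable_fun_fubini_tonelli_G _ _ _ _ _ mu (fun p => (`|F p|)%:E)) => //.
    by apply/measurable_EFinP; exact: measurableT_comp.
  - by move=> x _; rewrite lee_fin.
  - by apply/measurable_EFinP; apply: measurableT_comp => //; exact: intg_meas IB.
  - move: (ae_freqs (R := R) (d := d) Om); apply: filterS => eta Se _.
    have [I1 E1] := shift eta Se _ (intg_norm Ig).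
    have I2 := intgZ (M * `|f eta|) I1.
    apply: (@le_trans _ _ (\int[mu]_xi (M * `|f eta| * `|g (xi - eta)|)%:E)%E).
      apply: ge0_le_integral.
      - exact: measurableT.
      - by move=> x _; rewrite lee_fin.
      - apply/measurable_EFinP; apply: measurableT_comp => //.
        have h := measurableT_comp mF (measurable_pair2 eta); exact: h.
      - by apply/measurable_EFinP; exact: intg_meas I2.
      - move=> x _; rewrite lee_fin /F /= !normrM mulrC -mulrA.
        by rewrite ler_wpM2r// mulr_ge0.
    rewrite (IntE I2) lee_fin (IntZ _ I1) E1 mulrAC; exact: ler_norm.
have [IJ IK EJ] := real_fubini mF Foo.
split; first exact: IJ.
rewrite [LHS]EJ; apply: (ae_Int IK).
  apply: measurable_funM => //.
  apply: (@measurable_Int_l _ _ _ _ _ mu (fun p : V * V => g p.2 * c (p.2 + p.1))).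
  apply: measurable_funM; first exact: (measurableT_comp mg).
  by apply: (measurableT_comp mc); exact: measurable_rV_map2.
move: (ae_freqs (R := R) (d := d) Om); apply: filterS => eta Se.
have Ih : intg (fun z => g z * c (z + eta)).
  rewrite (_ : (fun z => _) = (fun z => c (z + eta) * g z)); last by apply/funext => z; rewrite mulrC.
  apply: (intgM_bounded (M := M) Ig) => //.
  by apply: (measurableT_comp mc); exact: measurable_rV_map2.
have [I1 E1] := shift eta Se _ Ih.
rewrite -E1 -(IntZ _ I1); apply: eq_Int => xi.
by rewrite subrK mulrA.
Qed.

Lemma ev_intg psi : intg psi -> intg (ev psi).
Proof.
move=> I; have [I' _] := intg_opp I.
by have := intgZ 2^-1 (intgD I I'); apply: eq_intg => x; rewrite mulrC.
Qed.

Lemma od_intg psi : intg psi -> intg (od psi).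
Proof.
move=> I; have [I' _] := intg_opp I.
by have := intgZ 2^-1 (intgB I I'); apply: eq_intg => x; rewrite mulrC.
Qed.

Lemma ev_L2 psi : L2 psi -> L2 (ev psi).
Proof.
move=> I; have I' := L2_opp I; have := L2Z 2^-1 (L2D I I').
by apply: eq_L2 => x; rewrite mulrC.
Qed.

Lemma od_L2 psi : L2 psi -> L2 (od psi).
Proof.
move=> I; have I' := L2_opp I; have := L2Z 2^-1 (L2B I I').
by apply: eq_L2 => x; rewrite mulrC.
Qed.

Lemma star_Int phi psi c M : L2 phi -> intg phi -> L2 psi -> intg psi ->
  measT c -> (forall x, `|c x| <= M) ->
  intg (fun xi => star phi psi xi * c xi) /\
  \int[mu]_xi (star phi psi xi * c xi) =
  \int[mu]_eta (phi eta * \int[mu]_zeta (ev psi zeta * c (zeta + eta))) +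
  \int[mu]_eta (phi (- eta) * \int[mu]_zeta (od psi zeta * c (zeta + eta))).
Proof.
move=> Lp Ip Ls Is mc cM; have [In _] := intg_opp Ip.
have [I1 E1] := conv_fub Ip (ev_intg Is) mc cM.
have [I2 E2] := conv_fub In (od_intg Is) mc cM.
have e : {ae mu, forall xi, \int[mu]_eta (phi eta * ev psi (xi - eta) * c xi) +
    \int[mu]_eta (phi (- eta) * od psi (xi - eta) * c xi) = star phi psi xi * c xi}.
  move: (ae_freqs (R := R) (d := d) Om); apply: filterS => xi Sx.
  have k1 := cv_intg Sx Lp (ev_L2 Ls); have k2 := cv_intg Sx (L2_opp Lp) (od_L2 Ls).
  rewrite kstE indicE mem_set// mulr1 mulrC.
  rewrite (eq_Int mu (f := fun eta => 1 * _) (g := fun eta => phi eta * ev psi (xi - eta) + phi (- eta) * od psi (xi - eta))); last first.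
    by move=> eta; rewrite mul1r.
  rewrite (IntD k1 k2) mulrDr -(IntZ _ k1) -(IntZ _ k2).
  by congr (_ + _); apply: eq_Int => eta; rewrite mulrC.
have ms : measT (fun xi => star phi psi xi * c xi).
  apply: measurable_funM => //; apply: measurable_kst; first exact: measurable_cst.
    by case: Lp.
  by case: Ls.
have I := intgD I1 I2.
split; first exact: ae_intg ms e I.
by rewrite -E1 -E2 -(IntD I1 I2); exact/esym/(ae_Int I ms e).
Qed.

Lemma star_intg phi psi : L2 phi -> intg phi -> L2 psi -> intg psi -> intg (star phi psi).
Proof.
move=> Lp Ip Ls Is.
have b (x : V) : `|1 : R| <= 1 by rewrite normr1.
have [I _] := star_Int Lp Ip Ls Is (measurable_cst _) b.
by apply: eq_intg I => x; rewrite mulr1.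
Qed.

Lemma Int_odd f : intg f -> (forall x, f (- x) = - f x) -> \int[mu]_x f x = 0.
Proof.
move=> I fN; have [_ E] := intg_opp I.
have : \int[mu]_x f x = - \int[mu]_x f x.
  by rewrite -{1}E -IntN//; apply: eq_Int => x; rewrite fN.
lra.
Qed.

(** The inverse Hartley transform without normalisation; the kernel is symmetric, so the same
    formula computes the direct transform. The factor (2 pi)^d is placed in [htr]. *)
Definition ift phi x := \int[mu]_xi (phi xi * cas (dot x xi)).

Lemma iftE phi x : ift phi x = \int[mu]_xi (phi xi * cas (dot x xi)). Proof. by []. Qed.

Lemma measurable_dotr (x : V) : measT (fun xi : V => dot x xi).
Proof. by apply: measurable_dot2 => //; exact: measurable_id. Qed.

Lemma measurable_casdot (x : V) : measT (fun xi : V => cas (dot x xi)).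
Proof. exact: (measurable_cas (measurable_dotr x)). Qed.

Lemma ift_intg phi x : intg phi -> intg (fun xi => phi xi * cas (dot x xi)).
Proof.
move=> I; have := intgM_bounded I (measurable_casdot x) (fun y => cas_bound _).
by apply: eq_intg => xi; rewrite mulrC.
Qed.

Lemma ift_bound phi x : intg phi -> `|ift phi x| <= 2 * n1 phi.
Proof.
move=> I; rewrite n1E -(IntZ _ (intg_norm I)).
apply: le_norm_Int; [exact: ift_intg|exact/intgZ/intg_norm|move=> xi].
by rewrite normrM mulrC ler_wpM2r// cas_bound.
Qed.

Lemma iftD phi psi x : intg phi -> intg psi ->
  ift (fun xi => phi xi + psi xi) x = ift phi x + ift psi x.
Proof.
move=> I1 I2; rewrite -(IntD (ift_intg x I1) (ift_intg x I2)).
by apply: eq_Int => xi; rewrite mulrDl.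
Qed.

Lemma iftB phi psi x : intg phi -> intg psi ->
  ift (fun xi => phi xi - psi xi) x = ift phi x - ift psi x.
Proof.
move=> I1 I2; rewrite -(IntB (ift_intg x I1) (ift_intg x I2)).
by apply: eq_Int => xi; rewrite mulrBl.
Qed.

Lemma iftZ a phi x : intg phi -> ift (fun xi => a * phi xi) x = a * ift phi x.
Proof.
move=> I; rewrite -(IntZ _ (ift_intg x I)).
by apply: eq_Int => xi; rewrite mulrA.
Qed.

Lemma ae_ift phi psi : intg phi -> measT psi ->
  {ae mu, forall x, phi x = psi x} -> ift phi =1 ift psi.
Proof.
move=> I m h x; apply: (ae_Int (ift_intg x I)).
  by apply: measurable_funM => //; exact: measurable_casdot.
by move: h; apply: filterS => xi ->.
Qed.

(** In the addition formula for [cas] only the cosine integral [C] of the even part of [psi] and the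
    sine integral [D] of its odd part survive; they multiply [phi] and its reflection, and [C + D]
    is [ift psi x]. *)
Lemma ift_star phi psi x : L2 phi -> intg phi -> L2 psi -> intg psi ->
  ift (star phi psi) x = ift phi x * ift psi x.
Proof.
move=> Lp Ip Ls Is.
have [_ E] := star_Int Lp Ip Ls Is (measurable_casdot x) (fun y => cas_bound _).
have mc : measT (fun xi : V => cos (dot x xi)) by exact: (measurable_cos (measurable_dotr x)).
have ms : measT (fun xi : V => sin (dot x xi)) by exact: (measurable_sin (measurable_dotr x)).
have ic f : intg f -> intg (fun z => f z * cos (dot x z)).
  move=> I; have := intgM_bounded I mc (fun y => cos_max _).
  by apply: eq_intg => z; rewrite mulrC.
have is_ f : intg f -> intg (fun z => f z * sin (dot x z)).
  move=> I; have := intgM_bounded I ms (fun y => sin_max _).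
  by apply: eq_intg => z; rewrite mulrC.
have Ie := ev_intg Is; have Io := od_intg Is.
have evN z : ev psi (- z) = ev psi z by rewrite /ev opprK addrC.
have odN z : od psi (- z) = - od psi z by rewrite /od opprK -mulNr opprB.
have z1 : \int[mu]_z (ev psi z * sin (dot x z)) = 0.
  by apply: Int_odd; [exact: is_|move=> z; rewrite evN dotNr sinN mulrN].
have z2 : \int[mu]_z (od psi z * cos (dot x z)) = 0.
  by apply: Int_odd; [exact: ic|move=> z; rewrite odN dotNr cosN mulNr].
set C := \int[mu]_z (ev psi z * cos (dot x z)).
set D := \int[mu]_z (od psi z * sin (dot x z)).
have iftpsi : ift psi x = C + D.
  rewrite /ift (eq_Int mu (g := fun z => (ev psi z * cos (dot x z) + ev psi z * sin (dot x z)) +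
    (od psi z * cos (dot x z) + od psi z * sin (dot x z)))); last first.
    by move=> z; rewrite /ev /od /cas; field.
  rewrite (IntD (intgD (ic _ Ie) (is_ _ Ie)) (intgD (ic _ Io) (is_ _ Io))).
  by rewrite (IntD (ic _ Ie) (is_ _ Ie)) (IntD (ic _ Io) (is_ _ Io)) z1 z2 addr0 add0r.
have e1 eta : \int[mu]_z (ev psi z * cas (dot x (z + eta))) = cas (dot x eta) * C.
  rewrite (eq_Int mu (g := fun z => cas (dot x eta) * (ev psi z * cos (dot x z)) +
     cas (- dot x eta) * (ev psi z * sin (dot x z)))); last first.
    by move=> z; rewrite dotDr addrC casD; ring.
  rewrite (IntD (intgZ _ (ic _ Ie)) (intgZ _ (is_ _ Ie))) (IntZ _ (ic _ Ie)) (IntZ _ (is_ _ Ie)).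
  by rewrite z1 mulr0 addr0.
have e2 eta : \int[mu]_z (od psi z * cas (dot x (z + eta))) = cas (- dot x eta) * D.
  rewrite (eq_Int mu (g := fun z => cas (dot x eta) * (od psi z * cos (dot x z)) +
     cas (- dot x eta) * (od psi z * sin (dot x z)))); last first.
    by move=> z; rewrite dotDr addrC casD; ring.
  rewrite (IntD (intgZ _ (ic _ Io)) (intgZ _ (is_ _ Io))) (IntZ _ (ic _ Io)) (IntZ _ (is_ _ Io)).
  by rewrite z2 mulr0 add0r.
rewrite [LHS]E iftpsi mulrDr; congr (_ + _).
  rewrite mulrC -(IntZ _ (ift_intg x Ip)); apply: eq_Int => eta; rewrite e1; ring.
have [In En] := intg_opp (ift_intg x Ip).
rewrite mulrC {1}/ift -En -(IntZ _ In); apply: eq_Int => eta; rewrite e2 dotNr; ring.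
Qed.

(** The norm of [v] is the sup norm of row vectors, in which neighbourhoods are expressed; hence the
    factor [d]. *)
Lemma dot_le_norm (v x : V) : `|dot v x| <= d%:R * `|v| * rr x.
Proof.
rewrite /dot (le_trans (ler_norm_sum _ _ _))//.
rewrite -mulrA mulr_natl -[X in _ *+ X]card_ord -sumr_const; apply: ler_sum => i _.
rewrite normrM; apply: ler_pM => //; last exact: coord_le_enorm.
by rewrite [leRHS]mx_normrE; exact: (le_bigmax _ (fun ij : 'I_1 * 'I_d => `|v ij.1 ij.2|) (ord0, i)).
Qed.

Definition hi (N : R) (x : V) : R := (N < rr x)%R%:R.

Lemma measurable_hi N : measT (hi N).
Proof.
have m : measT (fun x : V => N < rr x).
  by apply: measurable_fun_ltr => //; exact: measurable_enorm.
rewrite (_ : hi N = fun x => if N < rr x then 1 else 0); last first.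
  by apply/funext => x; rewrite /hi; case: ifP.
by apply: measurable_fun_if => //; exact: measurable_cst.
Qed.

Lemma L1_tail phi e : intg phi -> 0 < e ->
  exists2 N : R, 0 < N & \int[mu]_x (hi N x * `|phi x|) <= e.
Proof.
move=> I e0; have In := intg_norm I.
have [||||_ h] := @dct _ _ R mu (fun n x => hi n.+1%:R x * `|phi x|) (fun=> 0) (fun x => `|phi x|).
- move=> n; apply: measurable_funM; first exact: measurable_hi.
  exact: intg_meas In.
- move=> x; apply: cvg_near_cst; exists (Num.trunc (rr x)) => // n /= hn.
  rewrite /hi (_ : (_ < _) = false) ?mul0r//; apply/negbTE; rewrite -leNgt.
  have /andP[_ h] := truncn_itv (enorm_ge0 x).
  by rewrite (le_trans (ltW h))// ler_nat ltnS.
- exact: In.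
- move=> n x; rewrite ger0_norm ?mulr_ge0// /hi; case: (_ < _); rewrite ?mul1r ?mul0r//.
have := h; rewrite Int0 => /cvgrPdist_le/(_ e e0)[n _ /(_ n (leqnn n))] /=.
rewrite sub0r normrN => hn; exists n.+1%:R => //.
exact: le_trans (ler_norm _) hn.
Qed.

Lemma hi_intg N phi : intg phi -> intg (fun x => hi N x * `|phi x|).
Proof.
move=> I; apply: (intg_le _ (intg_norm I)).
  apply: measurable_funM; first exact: measurable_hi.
  exact: intg_meas (intg_norm I).
by move=> x; rewrite normrM normr_id ler_piMl// /hi normr_nat lern1 leq_b1.
Qed.

Lemma cts_eps (h : V -> R) (x : V) : (forall e, 0 < e -> exists2 del : R, 0 < del &
  forall y, `|y - x| < del -> `|h y - h x| <= e) -> h y @[y --> x] --> h x.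
Proof.
move=> H; apply/(@cvgrPdist_le _ _ _ _ (@nbhs_filter V x)) => e e0; have [del del0 hd] := H e e0.
near=> y; rewrite distrC; apply: hd; near: y.
apply: (filterS _ (nbhsx_ballx x del del0)) => y /=.
by rewrite -ball_normE /= distrC.
Unshelve. all: by end_near. Qed.

(** Frequencies beyond [N] contribute at most four times a small integral, as each [cas] is at most
    2; below [N] the kernel is Lipschitz in [x]. The two halves of [e] go to these two parts. *)
Lemma ift_cts phi x e : intg phi -> 0 < e ->
  exists2 del : R, 0 < del & forall y, `|y - x| < del -> `|ift phi y - ift phi x| <= e.
Proof.
move=> I e0; have e8 : 0 < e / 8 by rewrite divr_gt0.
have [N N0 hN] := L1_tail I e8.
pose K := 2 * d%:R * N * n1 phi + 1.
have K0 : 0 < K by rewrite ltr_wpDl// !mulr_ge0 ?n1_ge0// ltW.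
exists (e / 2 / K); first by rewrite !divr_gt0.
move=> y yx; have Ih := hi_intg N I; have In := intg_norm I.
rewrite -(IntB (ift_intg y I) (ift_intg x I)).
have IB := intgD (intgZ (2 * d%:R * N * `|y - x|) In) (intgZ 4 Ih).
apply: (@le_trans _ _ (2 * d%:R * N * `|y - x| * n1 phi + 4 * \int[mu]_x (hi N x * `|phi x|))).
  rewrite n1E -(IntZ _ In) -(IntZ _ Ih) -(IntD (intgZ _ In) (intgZ _ Ih)).
  apply: (le_norm_Int (intgB (ift_intg y I) (ift_intg x I)) IB) => xi.
  rewrite -mulrBr normrM mulrC [X in _ <= _ + X]mulrA -mulrDl; apply: ler_wpM2r => //.
  rewrite /hi; case: (ltP N (rr xi)) => Nx.
    rewrite mulr1 (le_trans (ler_normB _ _))// (@le_trans _ _ (2 + 2))//.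
      by rewrite lerD// cas_bound.
    by rewrite (_ : 2 + 2 = 4 :> R) ?lerDr ?mulr_ge0// ?(ltW N0)//; lra.
  rewrite mulr0 addr0 (le_trans (cas_lipschitz _ _))// -!mulrA; apply: ler_wpM2l => //.
  rewrite -dotNl -dotDl; apply: (le_trans (dot_le_norm _ _)).
  by rewrite -mulrA; apply: ler_wpM2l => //; rewrite mulrC; apply: ler_wpM2r.
have h1 : 2 * d%:R * N * `|y - x| * n1 phi <= e / 2.
  rewrite mulrAC; apply: (@le_trans _ _ (K * (e / 2 / K))); last first.
    by rewrite mulrCA mulfV ?mulr1// gt_eqF.
  apply: ler_pM => //; last exact: ltW.
    by rewrite !mulr_ge0// ?n1_ge0// ltW.
  by rewrite /K lerDl.
lra.
Qed.

Lemma ift_continuous phi : intg phi -> continuous (ift phi).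
Proof.
by move=> I x; apply: cts_eps => e e0; exact: ift_cts.
Qed.

Lemma measurable_ift phi : measT phi -> measT (ift phi).
Proof.
move=> mp; apply: (@measurable_Int_l _ _ _ _ _ mu (fun p : V * V => phi p.2 * cas (dot p.1 p.2))).
apply: measurable_funM; first exact: (measurableT_comp mp).
by apply: measurable_cas; apply: measurable_dot2.
Qed.

(* The transform of the derivative of [ift phi] in the direction [v]. *)
Definition dphi (v : V) phi xi := - (dot v xi * phi (- xi)).

Lemma dphi_intg v phi : intg phi -> intg (fun xi => rr xi * phi xi) -> intg (dphi v phi).
Proof.
move=> I Ir; have [I' _] := intg_opp Ir; have [I2 _] := intg_opp I.
apply: (intg_le _ (intgZ (d%:R * `|v|) (intg_norm I'))).
  apply: measurable_funN; apply: measurable_funM; first exact: measurable_dotr.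
  exact: intg_meas I2.
move=> xi; rewrite normrN normrM [X in _ <= _ * X]normrM mulrA; apply: ler_wpM2r => //.
by rewrite (ger0_norm (enorm_ge0 _)) enormN; exact: dot_le_norm.
Qed.

Lemma ift_dphi v phi x : intg phi -> intg (fun xi => rr xi * phi xi) ->
  intg (fun xi => dot v xi * phi xi * cas (- dot x xi)) /\
  ift (dphi v phi) x = \int[mu]_xi (dot v xi * phi xi * cas (- dot x xi)).
Proof.
move=> I Ir; have Id := ift_intg x (dphi_intg v I Ir).
have [I1 E1] := intg_opp Id.
have e xi : dphi v phi (- xi) * cas (dot x (- xi)) = dot v xi * phi xi * cas (- dot x xi).
  by rewrite /dphi !dotNr (opprK xi); ring.
by split; [apply: eq_intg I1 => xi; exact: e|rewrite -(eq_Int mu e) E1].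
Qed.

(** Beyond [N] the remainder is at most [4 * D * |v| * |xi|], against a small integral of
    [|xi| * |phi|]. Below [N] it is quadratic in [|v| * |xi|], and one factor [|xi|] is traded for
    [N], so that no second moment of [phi] appears. *)
Lemma ift_taylor phi x e : intg phi -> intg (fun xi => rr xi * phi xi) -> 0 < e ->
  exists2 del : R, 0 < del & forall v, `|v| < del ->
  `|ift phi (x + v) - ift phi x - ift (dphi v phi) x| <= e * `|v|.
Proof.
move=> I Ir e0; pose D : R := d%:R + 1.
have D0 : 0 < D by rewrite ltr_wpDl.
have e8 : 0 < e / (8 * D) by rewrite divr_gt0// mulr_gt0.
have [N N0 hN] := L1_tail Ir e8.
set A := n1 (fun xi => rr xi * phi xi); have A0 : 0 <= A by exact: n1_ge0.
pose K := 2 * D ^+ 2 * N * A + 1.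
have K0 : 0 < K by rewrite ltr_wpDl// !mulr_ge0// ?sqr_ge0// ltW.
exists (e / 2 / K); first by rewrite !divr_gt0.
move=> v vd; have Ih := hi_intg N Ir; have In := intg_norm Ir.
have [I3 E3] := ift_dphi v x I Ir.
rewrite E3 -(IntB (ift_intg _ I) (ift_intg x I)).
rewrite -(IntB (intgB (ift_intg _ I) (ift_intg x I)) I3).
have IB := intgD (intgZ (2 * D ^+ 2 * N * `|v| ^+ 2) In) (intgZ (4 * D * `|v|) Ih).
apply: (@le_trans _ _ (2 * D ^+ 2 * N * `|v| ^+ 2 * A + 4 * D * `|v| * \int[mu]_x (hi N x * `|rr x * phi x|))).
  rewrite /A n1E -(IntZ _ In) -(IntZ _ Ih) -(IntD (intgZ _ In) (intgZ _ Ih)).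
  apply: (le_norm_Int (intgB (intgB (ift_intg _ I) (ift_intg x I)) I3) IB) => xi.
  rewrite (_ : _ - _ - _ = phi xi * (cas (dot x xi + dot v xi) - cas (dot x xi) - dot v xi * cas (- dot x xi))); last first.
    by rewrite dotDl; ring.
  rewrite normrM mulrC !normrM (ger0_norm (enorm_ge0 _)) (mulrA (hi N xi)) (mulrA _ (hi N xi * _)) (mulrA _ (rr xi)) -mulrDl.
  apply: ler_wpM2r => //; have r0 := enorm_ge0 xi.
  have b : `|dot v xi| <= D * `|v| * rr xi.
    apply: (le_trans (dot_le_norm _ _)); rewrite -!mulrA; apply: ler_wpM2r; first by rewrite mulr_ge0.
    by rewrite /D lerDl.
  have b0 : 0 <= D * `|v| * rr xi := le_trans (normr_ge0 _) b.
  rewrite /hi; case: (ltP N (rr xi)) => Nx.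
    rewrite mul1r (le_trans (ler_normB _ _))//.
    have c1 := cas_lipschitz (dot x xi) (dot x xi + dot v xi).
    rewrite [X in _ <= _ * `|X|]addrAC subrr add0r in c1.
    have c2 : `|dot v xi * cas (- dot x xi)| <= 2 * `|dot v xi|.
      by rewrite normrM mulrC ler_wpM2r// cas_bound.
    apply: (le_trans (lerD c1 c2)).
    have q : 0 <= 2 * D ^+ 2 * N * `|v| ^+ 2 * rr xi.
      by rewrite !mulr_ge0// ?sqr_ge0// ltW.
    rewrite -!mulrA in b q *; lra.
  rewrite mul0r mulr0 addr0 (le_trans (cas_taylor2 _ _))//.
  have : `|dot v xi| ^+ 2 <= (D * `|v| * rr xi) ^+ 2 by rewrite lerXn2r ?nnegrE.
  rewrite real_normK ?num_real// => h2; rewrite -!mulrA; apply: ler_wpM2l => //.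
  apply: (le_trans h2); rewrite -subr_ge0.
  have -> : D * (D * (N * (`|v| * (`|v| * rr xi)))) - (D * `|v| * rr xi) ^+ 2 =
    (D * `|v|) ^+ 2 * (rr xi * (N - rr xi)) by ring.
  by rewrite mulr_ge0 ?sqr_ge0// mulr_ge0// subr_ge0.
have h1 : 2 * D ^+ 2 * N * `|v| ^+ 2 * A <= e / 2 * `|v|.
  rewrite (_ : _ * A = 2 * D ^+ 2 * N * A * `|v| * `|v|); last by ring.
  apply: ler_wpM2r => //; apply: (@le_trans _ _ (K * (e / 2 / K))); last first.
    by rewrite mulrCA mulfV ?mulr1// gt_eqF.
  apply: ler_pM => //; last exact: ltW.
    by rewrite !mulr_ge0// ?sqr_ge0// ltW.
  by rewrite /K lerDl.
have h2 : 4 * D * `|v| * \int[mu]_x (hi N x * `|rr x * phi x|) <= e / 2 * `|v|.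
  rewrite mulrAC; apply: ler_wpM2r => //.
  apply: (@le_trans _ _ (4 * D * (e / (8 * D)))); first by apply: ler_wpM2l => //; rewrite mulr_ge0// ltW.
  by apply: eq_ler; field; rewrite gt_eqF.
apply: (le_trans (lerD h1 h2)).
by rewrite -mulrDl (_ : e / 2 + e / 2 = e)//; field.
Qed.

Lemma ift_dphi_linear phi x : intg phi -> intg (fun xi => rr xi * phi xi) ->
  linear (fun v => ift (dphi v phi) x : R^o).
Proof.
move=> I Ir a u v; change (ift (dphi (a *: u + v) phi) x = a * ift (dphi u phi) x + ift (dphi v phi) x).
rewrite -(iftZ _ _ (dphi_intg u I Ir)) -(iftD _ (intgZ a (dphi_intg u I Ir)) (dphi_intg v I Ir)).
by apply: eq_Int => xi; rewrite /dphi dotDl dotZl; ring.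
Qed.

Lemma ift_differentiable phi x : intg phi -> intg (fun xi => rr xi * phi xi) ->
  differentiable (ift phi) x /\ forall v, 'd (ift phi) x v = ift (dphi v phi) x.
Proof.
move=> I Ir; have lin := ift_dphi_linear x I Ir.
pose L : {linear V -> R^o} := HB.pack (fun v => ift (dphi v phi) x : R^o)
  (GRing.isLinear.Build R V R^o _ (fun v => ift (dphi v phi) x) lin).
have LE v : L v = ift (dphi v phi) x by [].
have cL : continuous L.
  move=> u; apply: cts_eps => e e0.
  pose K := 2 * n1 (fun xi => rr xi * phi xi) * d%:R + 1.
  have K0 : 0 < K by rewrite ltr_wpDl// !mulr_ge0 ?n1_ge0.
  have lip w : `|L w| <= K * `|w|.
    rewrite LE; have [I' E'] := ift_dphi w x I Ir; rewrite E'.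
    have IB := intgZ (2 * d%:R * `|w|) (intg_norm Ir).
    apply: (le_trans (le_norm_Int I' IB _)).
      move=> xi; rewrite normrM mulrC normrM [X in _ <= _ * X]normrM.
      apply: (le_trans (ler_pM _ _ (cas_bound _) (ler_wpM2r (normr_ge0 _) (dot_le_norm w xi)))) => //.
      by rewrite (ger0_norm (enorm_ge0 _)) -!mulrA.
    rewrite (IntZ _ (intg_norm Ir)) mulrAC; apply: ler_wpM2r => //.
    by rewrite /K n1E mulrAC lerDl.
  exists (e / K); first by rewrite divr_gt0.
  move=> y yu; rewrite -[_ - _]/(L y - L u) -linearB (le_trans (lip _))// mulrC -ler_pdivlMr//; exact: ltW.
have h : (ift phi : V -> R^o) \o shift x = cst (ift phi x : R^o) + L +o_ 0 id.
  apply/eqaddoP => e e0; have [del del0 hd] := ift_taylor x I Ir e0.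
  near=> v; rewrite /= opprD addrA.
  have vd : `|v| < del.
    near: v; apply: (filterS _ (nbhsx_ballx (0 : V) del del0)) => y /=.
    by rewrite -ball_normE /= sub0r normrN.
  by have := hd v vd; rewrite (addrC x v).
have dE := diff_unique cL h.
split; last by move=> v; rewrite dE.
by apply/diff_locallyP; rewrite dE; split; [exact: cL|exact: h].
Unshelve. all: by end_near. Qed.

Lemma ift_class_C1 phi : intg phi -> intg (fun xi => rr xi * phi xi) -> class_C1 (ift phi).
Proof.
move=> I Ir; split => [x|v]; first exact: (ift_differentiable x I Ir).1.
rewrite (_ : (fun x => 'D_v (ift phi) x) = ift (dphi v phi)).
  by apply: ift_continuous; exact: dphi_intg.
apply/funext => x; have [df dE] := ift_differentiable x I Ir.
by rewrite deriveE// dE.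
Qed.

(** At an integer frequency a shift by [2 * pi] times an integer vector changes the phase by a
    multiple of [2 * pi]; the remaining points form a null set. *)
Lemma ift_periodic phi : intg phi -> on_domain Om (ift phi).
Proof.
move=> I; case: (pselect (Om = Torus)) => [OT|]; last by case: (Om).
move: (I); rewrite {1 2}OT => I' x k.
have e : {ae mu, forall xi, cas (dot (x + (2 * pi) *: map_mx intr k) xi) = cas (dot x xi)}.
  move: (ae_freqs (R := R) (d := d) Om); apply: filterS => xi.
  rewrite {1}OT => -[l _ <-].
  rewrite dotDl dotZl.
  have [n ->] : exists n : int, dot (map_mx intr k) (map_mx intr l) = n%:~R :> R.
    exists (\sum_i k ord0 i * l ord0 i); rewrite /dot rmorph_sum /=.
    by apply: eq_bigr => i _; rewrite !mxE -intrM.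
  have step (t : R) (m : nat) : cas (t + (2 * pi) * m%:R) = cas t.
    elim: m t => [|m ih] t; first by rewrite mulr0 addr0.
    rewrite -[in RHS](ih t) -[m.+1%:R]natr1 mulrDr mulr1 addrA mulr_natl.
    by rewrite /cas cosD2pi sinD2pi.
  case: n => m; first exact: step.
  by rewrite NegzE -(step _ m.+1) mulrNz mulrN subrK.
have I2 := ift_intg (x + (2 * pi) *: map_mx intr k) I.
apply: (ae_Int I2); first exact: (intg_meas (ift_intg x I)).
by move: e; apply: filterS => xi ->.
Qed.

End inverse_transform.

(** * Gaussian subordination of the norm *)

Section subordination.
Context {R : realType}.
Notation lam := (@lebesgue_measure R).
Notation intg := (intg lam).

Lemma intg_oneDsqrV : intg (fun x : R => (1 + x ^+ 2)^-1).
Proof.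
have m : measT (fun x : measurableTypeR R => (1 + x ^+ 2)^-1).
  apply: measurable_inv_pos => [|x]; last by rewrite ltr_pwDl// sqr_ge0.
  by apply: measurable_funD => //; exact: measurable_funX.
apply: intgP => //.
rewrite (_ : (fun x => (`|(1 + x ^+ 2)^-1|)%:E) = EFin \o (fun x : R => (1 + x ^+ 2)^-1)); last first.
  by apply/funext => x; rewrite /= ger0_norm// invr_ge0 addr_ge0// sqr_ge0.
rewrite (@ge0_symfun_integralT R (fun x => (1 + x ^+ 2)^-1)).
- by rewrite -set_itvcy; have := @integral0y_oneDsqr R; rewrite /oneDsqr => ->; rewrite -EFinM ltry.
- by move=> x; rewrite invr_ge0 addr_ge0// sqr_ge0.
- exact: continuous_oneDsqrV.
- by move=> x /=; rewrite sqrrN.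
Qed.

(** The symbol of the identity minus a gaussian average at scale [s^-1]. At [s = 0] division returns
    0, so [kap a 0 = 0]. *)
Definition kap (a s : R) := 1 - expR (- (a / s) ^+ 2).

Lemma kap_ge0 a s : 0 <= kap a s.
Proof. by rewrite subr_ge0 -expR0 ler_expR oppr_le0 sqr_ge0. Qed.

Lemma kap_le1 a s : kap a s <= 1.
Proof. by rewrite lerBlDr lerDl expR_ge0. Qed.

Lemma kap_le_sqr a s : kap a s <= (a / s) ^+ 2.
Proof. by have := expR_ge1Dx (- (a / s) ^+ 2); rewrite /kap; lra. Qed.

Lemma kap_mono a b s : 0 <= a -> a <= b -> kap a s <= kap b s.
Proof.
move=> a0 ab; rewrite lerD2l lerN2 ler_expR lerN2 !exprMn ler_wpM2r ?sqr_ge0//.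
by rewrite lerXn2r ?nnegrE//; exact: le_trans a0 ab.
Qed.

Lemma measurable_kap d (T : measurableType d) (f g : T -> R) :
  measT f -> measT g ->
  measT (fun x => kap (f x) (g x)).
Proof.
move=> mf mg; apply: measurable_funB => //; apply: measurableT_comp => //.
apply: measurable_funN; apply: measurable_funX; apply: measurable_funM => //.
(* The inverse is rewritten with a positive denominator, to which [measurable_inv_pos] applies. *)
rewrite (_ : (fun x => (g x)^-1) = (fun x => if g x == 0 then 0 else g x * (g x ^+ 2 + (g x == 0)%:R)^-1)); last first.
  apply/funext => x; have [->|g0] := eqVneq (g x) 0; first by rewrite invr0.
  by rewrite addr0 expr2 invfM mulrA mulfV// mul1r.
have mz : measT (fun x => g x == 0).
  by apply: measurable_fun_eqr.
apply: measurable_fun_if => //; apply: measurable_funM; first exact: measurable_funTS.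
apply: measurable_funTS; apply: measurable_inv_pos.
  apply: measurable_funD; first exact: measurable_funX.
  rewrite (_ : (fun x => _) = (fun x => if g x == 0 then 1 else 0)); last first.
    by apply/funext => x; case: eqP.
  by apply: measurable_fun_if => //; exact: measurable_cst.
move=> x; have [->|g0] := eqVneq (g x) 0; first by rewrite expr0n add0r.
by rewrite addr0 exprn_even_gt0.
Qed.

(** The minimum of 1 and [s^-2] is at most 2 / (1 + s^2). *)
Lemma kap_intg1 : intg (kap 1).
Proof.
apply: (intg_le _ (intgZ 2 intg_oneDsqrV)).
  by apply: measurable_kap => //; exact: measurable_id.
move=> s; rewrite ger0_norm ?kap_ge0//.
have p : 0 < 1 + s ^+ 2 by rewrite ltr_pwDl// sqr_ge0.
rewrite ler_pdivlMr//; case: (leP (s ^+ 2) 1) => s1.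
  by have := kap_le1 1 s; have := kap_ge0 1 s; nra.
have := kap_le_sqr 1 s; rewrite mul1r exprVn => h.
have h2 : (s ^+ 2)^-1 * (1 + s ^+ 2) <= 2.
  by rewrite mulrDr mulr1 mulVf ?gt_eqF ?(lt_trans ltr01 s1)// -lerBrDr (_ : 2 - 1 = 1 :> R) ?invf_le1 ?(lt_trans ltr01 s1) ?ltW//; lra.
by apply: le_trans h2; rewrite ler_wpM2r// ltW.
Qed.

Lemma Int_scale (f : R -> R) (a : R) : 0 < a -> intg f ->
  intg (fun s => f (a^-1 * s)) /\ \int[lam]_s f (a^-1 * s) = a * \int[lam]_s f s.
Proof.
move=> a0 If; have mf := intg_meas If; have an0 : a != 0 by rewrite gt_eqF.
have aff (h : R -> \bar R) : measT h -> (forall x, 0 <= h x)%E ->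
   (\int[lam]_s h (a^-1 * s)%R = a%:E * \int[lam]_s h s)%E.
  move=> mh h0.
  have mh' : measT (fun s : measurableTypeR R => h (a^-1 * s)).
    by apply: (measurableT_comp mh); exact: measurable_funM.
  have := @ge0_integral_affine R a 0 (fun s => h (a^-1 * s)%R) a0 mh' (fun s => h0 _).
  by move=> ->; congr (_ * _)%E; apply: eq_integral => s _; rewrite addr0 mulKf.
have mg : measT (fun s : measurableTypeR R => f (a^-1 * s)).
  by apply: (measurableT_comp mf); exact: measurable_funM.
have Ig : intg (fun s => f (a^-1 * s)).
  apply: intgP => //; rewrite (aff (fun s => (`|f s|)%:E))//; last first.
    by apply/measurable_EFinP; exact: measurableT_comp.
  by rewrite lte_mul_pinfty ?lee_fin ?ltW//; exact: intg_lty.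
split=> //.
have pos (h : R -> R) : intg h -> (forall x, 0 <= h x) -> measT h ->
   \int[lam]_s h (a^-1 * s) = a * \int[lam]_s h s.
  move=> Ih h0 mh; rewrite {1}/Rintegral (aff (fun s => (h s)%:E))//; last exact/measurable_EFinP.
  by rewrite (IntE Ih).
have Ip : intg (fun s => (`|f s| + f s) / 2).
  by have := intgZ 2^-1 (intgD (intg_norm If) If); apply: eq_intg => s; rewrite mulrC.
have In : intg (fun s => (`|f s| - f s) / 2).
  by have := intgZ 2^-1 (intgB (intg_norm If) If); apply: eq_intg => s; rewrite mulrC.
have p0 s : 0 <= (`|f s| + f s) / 2 by rewrite divr_ge0//; have := ler_norm (- f s); rewrite normrN; lra.
have n0 s : 0 <= (`|f s| - f s) / 2 by rewrite divr_ge0//; have := ler_norm (f s); lra.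
have := pos _ Ip p0 (intg_meas Ip); have := pos _ In n0 (intg_meas In).
have c (h : R -> R) : intg h -> (forall x, 0 <= h x) -> intg (fun s => h (a^-1 * s)).
  move=> Ih h0; have mh := intg_meas Ih.
  have mh' : measT (fun s : measurableTypeR R => h (a^-1 * s)).
    by apply: (measurableT_comp mh); exact: measurable_funM.
  apply: intgP => //; rewrite (aff (fun s => (`|h s|)%:E))//; last first.
    by apply/measurable_EFinP; exact: measurableT_comp.
  by rewrite lte_mul_pinfty ?lee_fin ?ltW//; exact: intg_lty.
have c1 := c _ Ip p0; have c2 := c _ In n0.
have e s : f s = (`|f s| + f s) / 2 - (`|f s| - f s) / 2 by field.
have e1 : \int[lam]_s f (a^-1 * s) = \int[lam]_s ((`|f (a^-1 * s)| + f (a^-1 * s)) / 2 -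
    (`|f (a^-1 * s)| - f (a^-1 * s)) / 2) by apply: eq_Int => s; exact: e.
have e2 : \int[lam]_s f s = \int[lam]_s ((`|f s| + f s) / 2 - (`|f s| - f s) / 2).
  by apply: eq_Int => s; exact: e.
by rewrite e1 e2 (IntB c1 c2) (IntB Ip In) mulrBr => -> ->.
Qed.

(** By scaling, [kap a] has integral [a * JJ]: this is the normalising constant of the subordination
    formula. Only its positivity enters. *)
Definition JJ := \int[lam]_s kap 1 s.

Lemma kap_intg a : 0 <= a -> intg (kap a) /\ \int[lam]_s kap a s = a * JJ.
Proof.
rewrite le_eqVlt => /predU1P[<-|a0].
  have e s : kap 0 s = 0 by rewrite /kap mul0r expr0n oppr0 expR0 subrr.
  by rewrite mul0r (funext e) Int0; split => //; exact: intg0.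
have [I E] := Int_scale a0 kap_intg1.
have e s : kap 1 (a^-1 * s) = kap a s by rewrite /kap mul1r invfM invrK.
split; first by apply: eq_intg I => s; rewrite e.
by rewrite /JJ -E; apply/esym; exact: eq_Int.
Qed.

Lemma JJ_gt0 : 0 < JJ.
Proof.
have h : 2^-1 <= 1 :> R by rewrite invf_le1// ler1n.
have [I E] := intg_itv h.
(* On the interval from 1/2 to 1 the integrand is at least [1 - expR (-1)]. *)
apply: (@lt_le_trans _ _ ((1 - expR (-1)) * (1 - 2^-1))).
  by rewrite mulr_gt0// subr_gt0 invf_lt1// ltr1n.
rewrite -E -(IntZ _ I); apply: Int_le; [exact: intgZ|exact: kap_intg1|move=> s].
rewrite indicE; case: (boolP (s \in _)) => [|_]; last by rewrite mulr0 kap_ge0.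
rewrite inE /= in_itv/= => /andP[s1 s2]; rewrite mulr1 lerD2l lerN2 ler_expR lerN2.
have s0 : 0 < s by apply: lt_le_trans s1.
by rewrite mul1r exprVn invf_ge1 ?exprn_gt0// expr_le1// ltW.
Qed.

Definition cut (N s : R) : R := \1_(`[- N, N]%classic) s.

Lemma measurable_cut N : measT (cut N).
Proof. by apply: measurable_indic; exact: measurable_itv. Qed.

Lemma cut01 N s : 0 <= cut N s <= 1.
Proof. by rewrite /cut indicE; case: (_ \in _); rewrite ?lexx ?ler01. Qed.

End subordination.

(** * Symbols obtained by subordination *)

Section subordinated.
Context {R : realType} {d : nat}.
Notation V := 'rV[R]_d.
Notation rr := (@eucl_norm R d).
Notation lam := (@lebesgue_measure R).
Notation intg := (intg lam).

Section profile.
Variable c : R -> R.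
Hypotheses (mc : measT c) (c01 : forall s, 0 <= c s <= 1).

(** The profile [c = 1] returns [|xi|], and [c = cut N] the truncated symbol; keeping [c] general
    proves positivity for both at once. *)
Definition sub_mult (x : V) := JJ^-1 * \int[lam]_s (c s * kap (rr x) s).

Lemma ckap_intg a : 0 <= a -> intg (fun s => c s * kap a s).
Proof.
move=> a0; have [I _] := kap_intg a0; apply: (intg_le _ I).
  by apply: measurable_funM => //; exact: intg_meas I.
move=> s; have /andP[h0 h1] := c01 s.
by rewrite normrM !ger0_norm ?kap_ge0// ler_piMl// kap_ge0.
Qed.

(** Since [kap] increases with its first argument and [c] lies in [[0, 1]], an increment of the
    weighted average is nonnegative and at most that of the full one, which is linear in the
    norm. *)
Lemma sub_mult_mult : mult sub_mult.
Proof.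
have j0 : 0 <= (JJ : R)^-1 by rewrite invr_ge0 ltW// JJ_gt0.
have lip a b : 0 <= a -> a <= b ->
   0 <= \int[lam]_s (c s * kap b s) - \int[lam]_s (c s * kap a s) <= (b - a) * JJ.
  move=> a0 ab; have b0 := le_trans a0 ab.
  have [Ia Ea] := kap_intg a0; have [Ib Eb] := kap_intg b0.
  have Ca := ckap_intg a0; have Cb := ckap_intg b0.
  rewrite mulrBl -Ea -Eb -(IntB Ib Ia) -(IntB Cb Ca).
  have h s : 0 <= c s * kap b s - c s * kap a s.
    by rewrite -mulrBr mulr_ge0 ?subr_ge0 ?kap_mono//; have /andP[] := c01 s.
  rewrite Int_ge0//=; apply: Int_le; [exact: intgB|exact: intgB|move=> s].
  rewrite -mulrBr ler_piMl ?subr_ge0 ?kap_mono//; by have /andP[] := c01 s.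
split.
- apply: measurable_funM => //.
  apply: (@measurable_Int_l _ _ _ _ _ lam (fun p : V * R => c p.2 * kap (rr p.1) p.2)).
  apply: measurable_funM; first exact: (measurableT_comp mc).
  apply: measurable_kap => //; apply: (measurableT_comp (@measurable_enorm R d)).
  exact: measurable_fst.
- by move=> x; rewrite /sub_mult enormN.
- move=> x; have := lip 0 (rr x) (lexx _) (enorm_ge0 x).
  rewrite subr0 (eq_Int lam (f := fun s => c s * kap 0 s) (g := fun=> 0)) ?Int0 ?subr0; last first.
    by move=> s; rewrite /kap mul0r expr0n oppr0 expR0 subrr mulr0.
  move=> /andP[h0 h1]; rewrite /sub_mult mulr_ge0//= mulrC ler_pdivrMr// JJ_gt0//.
- move=> x y; rewrite /sub_mult -mulrBr normrM (ger0_norm j0) mulrC ler_pdivrMr ?JJ_gt0//.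
  wlog xy : x y / rr y <= rr x.
    move=> H; case: (leP (rr y) (rr x)) => [/H//|/ltW/H].
    by move=> h; rewrite distrC (distrC (rr x)); exact: h.
  have /andP[h0 h1] := lip _ _ (enorm_ge0 y) xy.
  have d0 : 0 <= rr x - rr y by rewrite subr_ge0.
  by rewrite (ger0_norm h0) (ger0_norm d0).
Qed.

End profile.

Lemma sub_mult1 x : sub_mult (fun=> 1) x = rr x.
Proof.
rewrite /sub_mult (eq_Int lam (g := kap (rr x))); last by move=> s; rewrite mul1r.
by have [_ ->] := kap_intg (enorm_ge0 x); rewrite mulrCA mulVf ?mulr1// gt_eqF// JJ_gt0.
Qed.

Lemma cut_mult N : mult (sub_mult (cut N)).
Proof. by apply: sub_mult_mult; [exact: measurable_cut|exact: cut01]. Qed.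

Lemma cut_mult_bounded N x : 0 <= N -> sub_mult (cut N) x <= 2 / JJ * N.
Proof.
move=> N0; have NN : - N <= N by lra.
have [I E] := intg_itv NN.
rewrite /sub_mult -mulrA mulrCA; apply: ler_wpM2l; first by rewrite invr_ge0 ltW// JJ_gt0.
rewrite (_ : 2 * N = N - - N); last by ring.
rewrite -E; apply: Int_le => //.
  by apply: ckap_intg; [exact: measurable_cut|exact: cut01|exact: enorm_ge0].
by move=> s; rewrite ler_piMr ?kap_le1//; have /andP[] := cut01 N s.
Qed.

Definition Kcut : R := 2 * (1 + 2 * (\int[lam]_s (1 + s ^+ 2)^-1) / JJ).

Lemma Kcut_ge0 : 0 <= Kcut.
Proof.
rewrite mulr_ge0// addr_ge0// divr_ge0 ?mulr_ge0 ?(ltW JJ_gt0)// Int_ge0// => s.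
by rewrite invr_ge0 addr_ge0// sqr_ge0.
Qed.

(** The discarded part [|s| > N] is at most a multiple of [|x|^2 / N], by [kap_le_sqr], and in any
    case at most [|x|]. The first bound serves for [|x| <= N], the second beyond. *)
Lemma cut_mult_close N x : 0 < N ->
  `|sub_mult (cut N) x - rr x| <= Kcut * rr x * (rr x / (N + `|rr x|)).
Proof.
move=> N0; set P := \int[lam]_s (1 + s ^+ 2)^-1.
have P0 : 0 <= P by apply: Int_ge0 => s; rewrite invr_ge0 addr_ge0// sqr_ge0.
have r0 := enorm_ge0 x; have J0 := @JJ_gt0 R.
have [_ _ /(_ x) /andP[s0 s1] _] := cut_mult N.
rewrite distrC ger0_norm ?subr_ge0// (ger0_norm r0).
have C := ckap_intg (@measurable_cut R N) (cut01 N) r0; have [I E] := kap_intg r0.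
have [Is Es] := Int_scale N0 intg_oneDsqrV.
have h : rr x - sub_mult (cut N) x <= 2 * P / JJ * (rr x ^+ 2 / N).
  have -> : rr x - sub_mult (cut N) x = JJ^-1 * \int[lam]_s (kap (rr x) s - cut N s * kap (rr x) s).
    by rewrite (IntB I C) mulrBr E mulrCA mulVf ?mulr1// gt_eqF.
  rewrite (_ : 2 * P / JJ * _ = JJ^-1 * (2 * rr x ^+ 2 / N ^+ 2 * (N * P))); last first.
    by field; rewrite !gt_eqF.
  apply: ler_wpM2l; first by rewrite invr_ge0 ltW.
  rewrite -Es -(IntZ _ Is); apply: Int_le; [exact: intgB|exact: intgZ|move=> s].
  have q : 0 <= 2 * rr x ^+ 2 / N ^+ 2 * (1 + (N^-1 * s) ^+ 2)^-1.
    by rewrite !mulr_ge0 ?sqr_ge0 ?invr_ge0 ?addr_ge0 ?sqr_ge0.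
  rewrite /cut indicE; case: (boolP (s \in _)) => [_|]; first by rewrite mul1r subrr.
  rewrite mul0r subr0 notin_setE /= in_itv/= -ler_norml => /negP; rewrite -ltNge => sN.
  apply: (le_trans (kap_le_sqr _ _)).
  have s2 : N ^+ 2 < s ^+ 2.
    by rewrite -[s ^+ 2]real_normK ?num_real// ltrXn2r ?nnegrE// ltW.
  have s2p : 0 < s ^+ 2 by apply: lt_trans s2; rewrite exprn_gt0.
  have N2p : 0 < N ^+ 2 by rewrite exprn_gt0.
  have Ns : 0 < N ^+ 2 + s ^+ 2 by rewrite ltr_pwDl// sqr_ge0.
  have -> : 2 * rr x ^+ 2 / N ^+ 2 / (1 + (N^-1 * s) ^+ 2) = rr x ^+ 2 * (2 / (N ^+ 2 + s ^+ 2)).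
    have K : 1 + (N^-1 * s) ^+ 2 = (N ^+ 2 + s ^+ 2) / N ^+ 2.
      by rewrite exprMn exprVn mulrDl mulfV ?gt_eqF// mulrC.
    rewrite K; have := lt0r_neq0 Ns; have := lt0r_neq0 N2p.
    move: (N ^+ 2 + s ^+ 2) => B; move: (N ^+ 2) => A An Bn.
    by field; rewrite An Bn.
  rewrite exprMn exprVn; apply: ler_wpM2l; first exact: sqr_ge0.
  by rewrite ler_pdivlMr// mulrC ler_pdivrMr//; lra.
have Nr : 0 < N + rr x by rewrite ltr_pwDl.
rewrite mulrA ler_pdivlMr//.
have K1 : 0 <= 2 * P / JJ by rewrite divr_ge0 ?mulr_ge0// ltW.
rewrite /Kcut -/P.
have a0 : 0 <= rr x - sub_mult (cut N) x by rewrite subr_ge0.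
have b0 : 0 <= N + rr x := ltW Nr.
case: (leP (rr x) N) => rN.
  apply: (@le_trans _ _ ((2 * P / JJ * (rr x ^+ 2 / N)) * (2 * N))).
    have c2 : N + rr x <= 2 * N by rewrite mulr_natl mulr2n lerD2l.
    exact: ler_pM a0 b0 h c2.
  rewrite (_ : _ * (2 * N) = 2 * (2 * P / JJ) * rr x * rr x); last by field; rewrite !gt_eqF.
  by rewrite -!mulrA; apply: ler_wpM2l => //; rewrite !mulrA ler_wpM2r// ler_wpM2r// lerDr.
apply: (@le_trans _ _ (rr x * (2 * rr x))).
  have c1 : rr x - sub_mult (cut N) x <= rr x by rewrite lerBlDr lerDl.
  have c2 : N + rr x <= 2 * rr x by rewrite mulr_natl mulr2n lerD2r ltW.
  exact: ler_pM a0 b0 c1 c2.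
rewrite mulrA (mulrC (rr x) 2); apply: ler_wpM2r => //; apply: ler_wpM2r => //.
by rewrite ler_peMr// lerDl.
Qed.

End subordinated.

(** * From almost everywhere to everywhere *)

Section continuity_ae.
Context {R : realType} {d : nat}.
Notation V := 'rV[R]_d.
Notation lamd := (@lebesgue_rV R d).

Lemma Int_box (rho : R) (z : V) : 0 <= rho ->
  intg lamd (fun y => prodf (\1_(`[- rho, rho]%classic) : R -> R) (y + z)) /\
  \int[lamd]_y prodf (\1_(`[- rho, rho]%classic) : R -> R) (y + z) = (2 * rho) ^+ d.
Proof.
move=> r0; have NN : - rho <= rho by lra.
have [I1 E1] := intg_itv NN.
have I2 := intg_prodf I1 d.
have [I3 E3] : intg lamd (fun y => prodf (\1_(`[- rho, rho]%classic) : R -> R) (y + z)) /\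
   \int[lamd]_y prodf (\1_(`[- rho, rho]%classic) : R -> R) (y + z) =
   \int[lamd]_y prodf (\1_(`[- rho, rho]%classic) : R -> R) y.
  apply: (@Int_comp_inv _ _ _ lamd (fun x : V => x + z)) => //.
    exact: measurable_rV_map2.
  by move=> h mh h0; exact: ge0_integral_rV_shift.
split; first exact: I3.
have [h _] := @prodf_trig R _ I1 d 0 (fun i => ltac:(
  by rewrite (eq_Int (@lebesgue_measure R) (g := fun=> 0)) ?Int0// => t; rewrite mxE mulr0 sin0 mulr0)).
rewrite E3 (eq_Int lamd (g := fun x => prodf (\1_(`[- rho, rho]%classic) : R -> R) x * cos (dot x 0))); last first.
  by move=> x; rewrite dot0r cos0 mulr1.
rewrite h (eq_bigr (fun=> 2 * rho)) ?prodr_const ?card_ord// => i _.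
rewrite (eq_Int (@lebesgue_measure R) (g := \1_(`[- rho, rho]%classic) : R -> R)).
  by rewrite E1; ring.
by move=> t; rewrite mxE mulr0 cos0 mulr1.
Qed.

Definition box (z : V) (r : R) : set V := [set y | forall i, `|y ord0 i - z ord0 i| <= r].

Lemma box_integral (z : V) (r : R) : 0 <= r ->
  intg lamd (\1_(box z r)) /\ \int[lamd]_y (\1_(box z r) y : R) = (2 * r) ^+ d.
Proof.
move=> r0; have [I E] := Int_box (- z) r0.
have e y : prodf (\1_(`[- r, r]%classic) : R -> R) (y - z) = \1_(box z r) y.
  rewrite prodf_indic !indicE; congr (_%:R); congr (nat_of_bool _); apply/idP/idP => /set_mem h; apply/mem_set => i; have := h i;
    by rewrite /= in_itv/= !mxE ler_norml.
split; first exact: eq_intg e I.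
by rewrite -E; apply: eq_Int => y; rewrite e.
Qed.

Lemma box_close (z y : V) (r : R) : box z r y -> 0 <= r -> `|y - z| <= r.
Proof.
move=> h r0; rewrite [X in X <= _]mx_normrE; apply/bigmax_leP; split => // -[i j] _ /=.
by rewrite ord1 !mxE; exact: h.
Qed.

(** A nonzero value at [y0] would persist on a box, of positive measure, on which [P] holds. The box
    only has to lie near [y0], which covers a boundary point of the cell. *)
Lemma continuous_ae0_at (P : V -> Prop) (g : V -> R) y0 : continuous g ->
  {ae lamd, forall y, P y -> g y = 0} ->
  (forall rho, 0 < rho -> exists z r, 0 < r /\ forall y, box z r y -> P y /\ box y0 rho y) -> g y0 = 0.
Proof.
move=> cg g0 hP; apply/eqP; apply: contrapT => /negP gn.
have e0 : 0 < `|g y0| by rewrite normr_gt0.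
have := cg y0 => /(@cvgrPdist_lt _ _ _ _ (@nbhs_filter V y0))/(_ _ e0) nb.
have [rho /= rho0 hb] : exists2 rho : R, 0 < rho & forall y, `|y0 - y| < rho -> `|g y0 - g y| < `|g y0|.
  have /nbhs_ballP[r r0 hr] := nb; exists r => // y yr; apply: hr.
  by rewrite -ball_normE.
have rho2 : 0 < rho / 2 by rewrite divr_gt0.
have [z [r [r0 hr]]] := hP _ rho2; have [I E] := box_integral z (ltW r0).
have : \int[lamd]_y (\1_(box z r) y : R) = 0.
  rewrite -(Int0 lamd); apply: (ae_Int I) => //.
  move: g0; apply: filterS => y gy; rewrite indicE memNset// => /= hy.
  have [Py yr] := hr y hy; have yc := box_close yr (ltW rho2).
  have : `|y0 - y| < rho by rewrite distrC; apply: (le_lt_trans yc); rewrite ltr_pdivrMr// ltr_pMr// ltr1n.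
  by move=> /hb; rewrite gy// subr0 ltxx.
by move=> /eqP; rewrite E expf_eq0 => /andP[_]; rewrite gt_eqF// mulr_gt0.
Qed.

Lemma continuous_ae0 (g : V -> R) : continuous g -> {ae lamd, forall y, g y = 0} -> forall y, g y = 0.
Proof.
move=> cg g0 y0; apply: (continuous_ae0_at (P := fun=> True) cg).
  by apply: filterS g0 => y h _.
by move=> rho rho0; exists y0, rho; split => // y hy; split.
Qed.

End continuity_ae.

(** * Gaussian averages and pointwise inequalities *)

Section gaussian_average.
Context {R : realType} {d : nat} (Om : domain).
Notation V := 'rV[R]_d.
Notation rr := (@eucl_norm R d).
Notation mu := (fmu Om).
Notation L2 := (L2 mu).
Notation intg1 := (intg (@lebesgue_measure R)).
Notation intgd := (intg (@lebesgue_rV R d)).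
Notation intg := (intg mu).
Notation lam := (@lebesgue_measure R).
Notation lamd := (@lebesgue_rV R d).
Notation ift := (ift Om).
Notation star := (kst Om (fun _ _ _ => 1)).
Implicit Types phi : V -> R.

(** The mass of the gaussian of parameter s^2/4, chosen so that its normalised transform is exp (-
    (|xi| / s)^2). *)
Definition gZ (s : R) := Num.sqrt (pi / (s ^+ 2 / 4)) ^+ d.
Definition ave (s : R) (f : V -> R) x := (gZ s)^-1 * \int[lamd]_y (gaun (s ^+ 2 / 4) y * f (x + y)).

Lemma s24 (s : R) : s != 0 -> 0 < s ^+ 2 / 4.
Proof. by move=> s0; rewrite divr_gt0// exprn_even_gt0. Qed.

Lemma gZ_gt0 s : s != 0 -> 0 < gZ s.
Proof. by move=> s0; rewrite exprn_gt0// sqrtr_gt0 divr_gt0// ?pi_gt0// s24. Qed.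

Lemma gaun_kap (s : R) (xi : V) : s != 0 -> gaun (4 * (s ^+ 2 / 4))^-1 xi = 1 - kap (rr xi) s.
Proof.
move=> s0; rewrite /kap opprB addrC subrK /gaun exprMn exprVn enorm_sqr; congr expR.
by rewrite mulrCA mulfV ?mulr1 ?pnatr_eq0// mulrC.
Qed.

Lemma gauM_intg (s M : R) (h : V -> R) : s != 0 -> measT h ->
  (forall y, `|h y| <= M) -> intgd (fun y => gaun (s ^+ 2 / 4) y * h y).
Proof.
move=> s0 mh hM; have := intgM_bounded (intg_gaun d (s24 s0)) mh hM.
by apply: eq_intg => y; rewrite mulrC.
Qed.

Lemma ave1 s x : s != 0 -> ave s (fun=> 1) x = 1.
Proof.
move=> s0; rewrite /ave (eq_Int lamd (g := fun y => gaun (s ^+ 2 / 4) y * cos (dot y 0))); last first.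
  by move=> y; rewrite dot0r cos0.
rewrite (gaun_cos _ (s24 s0)) /gaun dot0r mulr0 oppr0 expR0 mulr1 mulVf//.
by rewrite gt_eqF// gZ_gt0.
Qed.

(** Fubini and the addition formula for [cas]: the sine integral of the gaussian vanishes, and its
    cosine integral is the factor [1 - kap]. *)
Lemma ave_ift s phi x : s != 0 -> intg phi ->
  ave s (ift phi) x = ift (fun xi => (1 - kap (rr xi) s) * phi xi) x.
Proof.
move=> s0 I; have sp := s24 s0; set del := s ^+ 2 / 4 in sp *.
have Ig := intg_gaun d sp; have mp := intg_meas I.
pose F (p : V * V) := gaun del p.1 * (phi p.2 * cas (dot (x + p.1) p.2)).
have mF : measT F.
  apply: measurable_funM; first by apply: (measurableT_comp (@measurable_gaun R d del)).
  apply: measurable_funM; first exact: (measurableT_comp mp).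
  apply: measurable_cas; apply: measurable_dot2 => //.
  by apply: measurable_rV_map2.
have b y xi : `|F (y, xi)| <= gaun del y * (2 * `|phi xi|).
  rewrite normrM ger0_norm ?(ltW (gaun_gt0 _ _))//; apply: ler_wpM2l; first exact/ltW/gaun_gt0.
  by rewrite normrM mulrC ler_wpM2r// cas_bound.
have [I1 I2 E] := fubini_dominated mF Ig (intgZ 2 (intg_norm I)) b.
have e1 y : \int[mu]_xi F (y, xi) = gaun del y * ift phi (x + y).
  by rewrite -(IntZ _ (ift_intg (x + y) I)).
have e2 xi : \int[lamd]_y F (y, xi) = gZ s * ((1 - kap (rr xi) s) * phi xi * cas (dot x xi)).
  have mc : measT (fun y : V => cos (dot y xi)).
    by apply: measurable_cos; exact: measurable_dot.
  have ms : measT (fun y : V => sin (dot y xi)).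
    by apply: measurable_sin; exact: measurable_dot.
  have Ic : intgd (fun y => gaun del y * cos (dot y xi)).
    exact: (gauM_intg s0 mc (fun y => cos_max _)).
  have Is : intgd (fun y => gaun del y * sin (dot y xi)).
    exact: (gauM_intg s0 ms (fun y => sin_max _)).
  rewrite (eq_Int lamd (g := fun y => phi xi * cas (dot x xi) * (gaun del y * cos (dot y xi)) +
     phi xi * cas (- dot x xi) * (gaun del y * sin (dot y xi)))); last first.
    by move=> y; rewrite /F /= dotDl casD; ring.
  rewrite (IntD (intgZ _ Ic) (intgZ _ Is)) (IntZ _ Ic) (IntZ _ Is) gaun_sin// mulr0 addr0.
  by rewrite gaun_cos// gaun_kap// /gZ -/del; ring.
rewrite /ave -/del -(eq_Int lamd e1) E (eq_Int mu e2).
have I3 : intg (fun xi => (1 - kap (rr xi) s) * phi xi * cas (dot x xi)).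
  apply: ift_intg; apply: (intgM_bounded (M := 1) I).
    apply: measurable_funB => //; apply: measurable_kap => //; exact: measurable_enorm.
  by move=> y; rewrite ger0_norm ?subr_ge0 ?kap_le1// lerBlDr lerDl kap_ge0.
by rewrite (IntZ _ I3) mulKf// gt_eqF// gZ_gt0.
Qed.

Lemma kap_phi_intg s phi : intg phi -> intg (fun xi => kap (rr xi) s * phi xi).
Proof.
move=> I; apply: (intgM_bounded (M := 1) I).
  by apply: measurable_kap => //; exact: measurable_enorm.
by move=> y; rewrite ger0_norm ?kap_ge0// kap_le1.
Qed.

Lemma ift_kap s phi x : s != 0 -> intg phi ->
  ift (fun xi => kap (rr xi) s * phi xi) x = ift phi x - ave s (ift phi) x.
Proof.
move=> s0 I; have Ik := kap_phi_intg s I; rewrite ave_ift//.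
have I1 : intg (fun xi => (1 - kap (rr xi) s) * phi xi).
  by apply: eq_intg (intgB I Ik) => xi; ring.
by rewrite -(iftB _ I I1); apply: eq_Int => xi; ring.
Qed.

Lemma kap_ift0 phi x : ift (fun xi => kap (rr xi) 0 * phi xi) x = 0.
Proof.
transitivity (\int[mu]_xi ((fun _ : V => 0 : R) xi)); last exact: Int0.
apply: eq_Int => xi; by rewrite /kap invr0 mulr0 expr0n oppr0 expR0 subrr !mul0r.
Qed.

(** With [f = ift phi], the expression is the gaussian average of [(f x - f (x + y)) ^+ 2]. *)
Lemma kap_positive s phi x : L2 phi -> intg phi ->
  0 <= 2 * ift phi x * ift (fun xi => kap (rr xi) s * phi xi) x -
       ift (fun xi => kap (rr xi) s * star phi phi xi) x.
Proof.
move=> L I; have [->|s0] := eqVneq s 0; first by rewrite !kap_ift0 mulr0 subr0.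
have I2 := star_intg L I L I.
rewrite !ift_kap// (ift_star x L I L I).
have E y : ift (star phi phi) y = ift phi y ^+ 2 by rewrite (ift_star y L I L I) expr2.
rewrite (funext E); set f := ift phi.
have mf : measT (fun y : V => f (x + y)).
  apply: (measurableT_comp (measurable_ift Om (intg_meas I))).
  by apply: measurable_rV_map2.
have fb y : `|f (x + y)| <= 2 * n1 Om phi by exact: ift_bound.
have Z0 : 0 <= (gZ s)^-1 by rewrite invr_ge0 ltW// gZ_gt0.
have J1 := gauM_intg s0 mf fb.
have J2 : intgd (fun y => gaun (s ^+ 2 / 4) y * f (x + y) ^+ 2).
  apply: (@gauM_intg s ((2 * n1 Om phi) ^+ 2)) => //; first exact: measurable_funX.
  by move=> y; rewrite normrX lerXn2r ?nnegrE// mulr_ge0// n1_ge0.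
have J0 := intg_gaun d (s24 s0).
have a1 := ave1 x s0; rewrite /ave (eq_Int lamd (g := gaun (s ^+ 2 / 4))) in a1; last by move=> y; rewrite mulr1.
have P : 0 <= (gZ s)^-1 * \int[lamd]_y (gaun (s ^+ 2 / 4) y * (f x - f (x + y)) ^+ 2).
  by rewrite mulr_ge0// Int_ge0// => y; rewrite mulr_ge0 ?sqr_ge0// ltW// gaun_gt0.
suff -> : 2 * f x * (f x - ave s f x) - (f x * f x - ave s (fun y => f y ^+ 2) x) =
   (gZ s)^-1 * \int[lamd]_y (gaun (s ^+ 2 / 4) y * (f x - f (x + y)) ^+ 2) by [].
rewrite (eq_Int lamd (g := fun y => (f x ^+ 2 * gaun (s ^+ 2 / 4) y - (2 * f x) * (gaun (s ^+ 2 / 4) y * f (x + y))) +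
   gaun (s ^+ 2 / 4) y * f (x + y) ^+ 2)); last by move=> y; ring.
rewrite (IntD (intgB (intgZ _ J0) (intgZ _ J1)) J2) (IntB (intgZ _ J0) (intgZ _ J1)) (IntZ _ J0) (IntZ _ J1).
rewrite [RHS]mulrDr [X in _ = X + _]mulrBr [X in _ = X - _ + _]mulrCA a1 /ave; ring.
Qed.

Section profile.
Variable c : R -> R.
Hypotheses (mc : measT c) (c01 : forall s, 0 <= c s <= 1).

Lemma ift_sub_mult phi x : intg phi -> intg (fun xi => sub_mult c xi * phi xi) ->
  intg1 (fun s => c s * ift (fun xi => kap (rr xi) s * phi xi) x) /\
  ift (fun xi => sub_mult c xi * phi xi) x =
  JJ^-1 * \int[lam]_s (c s * ift (fun xi => kap (rr xi) s * phi xi) x).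
Proof.
move=> I Is; have mp := intg_meas I.
pose F (p : V * measurableTypeR R) : R := c p.2 * kap (rr p.1) p.2 * (phi p.1 * cas (dot x p.1)).
have mF : measT F.
  apply: measurable_funM.
    apply: measurable_funM; first exact: (measurableT_comp mc).
    apply: measurable_kap => //; apply: (measurableT_comp (@measurable_enorm R d)).
    exact: measurable_fst.
  apply: measurable_funM; first exact: (measurableT_comp mp).
  exact: (measurableT_comp (measurable_casdot x)).
have J0 : JJ != 0 :> R by rewrite gt_eqF// JJ_gt0.
have e1 xi : \int[lam]_s F (xi, s) = JJ * (sub_mult c xi * phi xi * cas (dot x xi)).
  rewrite /sub_mult -!mulrA mulVKf// [RHS]mulrC -(IntZ _ (ckap_intg mc c01 (enorm_ge0 xi))).
  by apply: eq_Int => s; rewrite /F /= [LHS]mulrC.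
have Foo : (\int[mu]_xi \int[lam]_s (`|F (xi, s)|)%:E < +oo)%E.
  have h := intg_lty (intgZ JJ (ift_intg x Is)).
  rewrite (eq_integral (fun xi => (`|JJ * (sub_mult c xi * phi xi * cas (dot x xi))|)%:E))//.
  move=> xi _; have Ck := ckap_intg mc c01 (enorm_ge0 xi).
  have Cn := intgZ (`|phi xi * cas (dot x xi)|) Ck.
  rewrite (eq_integral (fun s : measurableTypeR R => (`|phi xi * cas (dot x xi)| * (c s * kap (rr xi) s))%:E)); last first.
    move=> s _; rewrite /F /= normrM [in RHS]mulrC ger0_norm// mulr_ge0 ?kap_ge0//.
    by have /andP[] := c01 s.
  rewrite (IntE Cn) (IntZ _ Ck); congr (_%:E).
  rewrite /sub_mult -!mulrA mulVKf// [in RHS]normrM mulrC; congr (_ * _).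
  rewrite ger0_norm// Int_ge0// => s; rewrite mulr_ge0 ?kap_ge0//.
  by have /andP[] := c01 s.
have [I1 I2 E] := real_fubini mF Foo.
have e2 s : \int[mu]_xi F (xi, s) = c s * ift (fun xi => kap (rr xi) s * phi xi) x.
  rewrite -(IntZ _ (ift_intg x (kap_phi_intg s I))).
  by apply: eq_Int => xi; rewrite /F /= !mulrA.
rewrite (funext e2) in I2; split; first exact: I2.
rewrite -(eq_Int lam e2) -E (eq_Int mu e1) (IntZ _ (ift_intg x Is)).
by rewrite mulKf.
Qed.

(** [kap_positive] integrated over [s] against a nonnegative profile; this is why truncating the
    average, unlike an arbitrary cut-off of the symbol, preserves the inequality. *)
Lemma sub_mult_positive phi x : L2 phi -> intg phi ->
  intg (fun xi => sub_mult c xi * phi xi) ->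
  intg (fun xi => sub_mult c xi * star phi phi xi) ->
  0 <= 2 * ift phi x * ift (fun xi => sub_mult c xi * phi xi) x -
       ift (fun xi => sub_mult c xi * star phi phi xi) x.
Proof.
move=> L I Is Iss; have I2 := star_intg L I L I.
have [J1 ->] := ift_sub_mult x I Is; have [J2 ->] := ift_sub_mult x I2 Iss.
rewrite mulrCA -mulrBr mulr_ge0 ?invr_ge0 ?(ltW (@JJ_gt0 R))//.
rewrite -(IntZ _ J1) -(IntB (intgZ _ J1) J2); apply: Int_ge0 => s.
rewrite mulrCA -mulrBr; apply: mulr_ge0; first by have /andP[] := c01 s.
exact: kap_positive.
Qed.

End profile.

(* At a zero minimum [x0] of [f = ift phi], [|nabla| f (x0)] is an average of
   the negative quantities [f x0 - ave s f x0]. *)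
Lemma enorm_ift_lt0 phi x0 : intg phi -> intg (fun xi => rr xi * phi xi) ->
  (forall x, 0 <= ift phi x) -> ift phi x0 = 0 -> (exists x1, 0 < ift phi x1) ->
  ift (fun xi => rr xi * phi xi) x0 < 0.
Proof.
move=> I Ir f0 fx0 [x1 fx1].
have e xi : sub_mult (fun=> 1) xi * phi xi = rr xi * phi xi by rewrite sub_mult1.
have c01 (s : R) : 0 <= (fun=> 1 : R) s <= 1 by rewrite ler01 lexx.
have Is : intg (fun xi => sub_mult (fun=> 1) xi * phi xi) by apply: eq_intg Ir => xi; rewrite e.
have [J E] := ift_sub_mult (measurable_cst _) c01 x0 I Is.
rewrite -(funext e) E pmulr_rlt0 ?invr_gt0 ?JJ_gt0//.
set h := fun s => _ in J *.
have mf : measT (fun y : V => ift phi (x0 + y)).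
  apply: (measurableT_comp (measurable_ift Om (intg_meas I))).
  by apply: measurable_rV_map2.
have hs s : s != 0 -> h s < 0.
  move=> s0; rewrite /h mul1r ift_kap// fx0 sub0r oppr_lt0.
  rewrite /ave mulr_gt0 ?invr_gt0 ?gZ_gt0// lt_neqAle Int_ge0 ?andbT; last first.
    by move=> y; rewrite mulr_ge0// ltW// gaun_gt0.
  (* If the average of the nonnegative function [ift phi] vanished, the function would vanish
     everywhere by continuity. *)
  apply/eqP => /esym h0.
  have J1 := gauM_intg s0 mf (fun y => ift_bound (x0 + y) I).
  have ae0 := Int_eq0 (intg_meas J1) (fun y => mulr_ge0 (ltW (gaun_gt0 _ _)) (f0 _)) J1 h0.
  have : forall y, ift phi (x0 + y) = 0.
    apply: continuous_ae0.
      move=> y; apply: cts_eps => e0 e00; have [del del0 hd] := ift_cts (x0 + y) I e00.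
      by exists del => // z zy; apply: hd; rewrite opprD addrACA subrr add0r.
    move: ae0; apply: filterS => y /eqP; rewrite mulf_eq0 => /orP[|/eqP//].
    by rewrite gt_eqF// gaun_gt0.
  by move=> /(_ (x1 - x0)); rewrite addrC subrK => z; rewrite z ltxx in fx1.
have h_le0 s : h s <= 0.
  by have [->|/hs/ltW//] := eqVneq s 0; rewrite /h kap_ift0 mulr0.
rewrite lt_neqAle; apply/andP; split; last first.
  by rewrite -(Int0 lam); apply: Int_le => //; exact: intg0.
(* Otherwise [h] would be 0 almost everywhere, although it is negative on the whole interval
   [[1, 2]]. *)
apply/eqP => h0.
have JN := intgN J.
have hn s : 0 <= - h s by rewrite oppr_ge0.
have EN : \int[lam]_s (- h s) = 0 by rewrite (IntN J) h0 oppr0.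
have ae0 := Int_eq0 (intg_meas JN) hn JN EN.
have h12 : 1 <= 2 :> R by rewrite ler1n.
have [K1 K2] := intg_itv h12.
have : \int[lam]_s (\1_(`[1, 2]%classic) s : R) = \int[lam]_s (0 : R).
  apply: (ae_Int K1) => //; move: ae0; apply: filterS => s hs0.
  rewrite indicE memNset//= in_itv/= => /andP[s1 _].
  have /hs : s != 0 by rewrite gt_eqF// (lt_le_trans _ s1).
  by rewrite -oppr_gt0 hs0 ltxx.
by rewrite K2 Int0 => /eqP; rewrite (_ : 2 - 1 = 1 :> R) ?oner_eq0//; ring.
Qed.

End gaussian_average.

(** * Plancherel's theorem *)

Section determining.
Context {R : realType} {d : nat}.
Notation V := 'rV[R]_d.
Notation lamd := (@lebesgue_rV R d).
Notation intg := (intg lamd).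

Variable Gam : V -> Prop.
Hypotheses (GamD : forall x y, Gam x -> Gam y -> Gam (x + y))
  (GamN : forall x, Gam x -> Gam (- x)) (Gam0 : Gam 0).
Variable F : V -> R.
Hypothesis IF : intg F.

(** The bounded [q] for which [q * F] is orthogonal to all waves with frequency in [Gam]; the phase
    [th] covers cosine and sine together. *)
Definition annih (q : V -> R) := [/\ measT q, (exists M, forall x, `|q x| <= M) &
  forall b th, Gam b -> \int[lamd]_x (q x * F x * cos (dot b x + th)) = 0].

(* The multipliers form an algebra closed under bounded pointwise limits. *)
Definition multiplier (s : V -> R) := [/\ measT s,
  (exists M, forall x, `|s x| <= M) & forall q, annih q -> annih (fun x => q x * s x)].

Let mcosb b th : measT (fun x : V => cos (dot b x + th)).
Proof. by apply: measurable_cos; apply: measurable_funD => //; exact: measurable_dotr. Qed.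

Let bI (q : V -> R) b th : measT q -> (exists M, forall x, `|q x| <= M) ->
  intg (fun x => q x * F x * cos (dot b x + th)).
Proof.
move=> mq [M qM].
have I := intgM_bounded (intgM_bounded IF mq qM) (mcosb b th) (fun x => cos_max _).
by apply: eq_intg I => x; rewrite mulrC.
Qed.

Lemma annihD q1 q2 a : annih q1 -> annih q2 -> annih (fun x => a * q1 x + q2 x).
Proof.
move=> [m1 [M1 b1] h1] [m2 [M2 b2] h2]; split.
- by apply: measurable_funD => //; exact: measurable_funM.
- exists (`|a| * M1 + M2) => x; apply: (le_trans (ler_normD _ _)).
  by rewrite normrM lerD// ler_wpM2l.
- move=> b th Gb.
  have J1 := bI b th m1 (ex_intro _ _ b1); have J2 := bI b th m2 (ex_intro _ _ b2).
  rewrite (eq_Int lamd (g := fun x => a * (q1 x * F x * cos (dot b x + th)) + q2 x * F x * cos (dot b x + th))).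
    by rewrite (IntD (intgZ _ J1) J2) (IntZ _ J1) h1// h2// mulr0 addr0.
  by move=> x; ring.
Qed.

Lemma eq_annih q1 q2 : q1 =1 q2 -> annih q1 -> annih q2.
Proof. by move=> /funext ->. Qed.

Lemma annih_cos q b th : annih q -> Gam b -> annih (fun x => q x * cos (dot b x + th)).
Proof.
move=> [m [M hM] h] Gb; split.
- exact: measurable_funM.
- exists M => x; rewrite normrM (le_trans _ (hM x))// ler_piMr//; exact: cos_max.
- move=> b' th' Gb'.
  have J1 := bI (b + b') (th + th') m (ex_intro _ _ hM).
  have J2 := bI (b - b') (th - th') m (ex_intro _ _ hM).
  rewrite (eq_Int lamd (g := fun x => 2^-1 * (q x * F x * cos (dot (b + b') x + (th + th'))) +
    2^-1 * (q x * F x * cos (dot (b - b') x + (th - th'))))).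
    rewrite (IntD (intgZ _ J1) (intgZ _ J2)) (IntZ _ J1) (IntZ _ J2) !h ?mulr0 ?addr0//.
      by apply: GamD => //; exact: GamN.
    exact: GamD.
  move=> x; rewrite !dotDl dotNl.
  rewrite (_ : dot b x + dot b' x + (th + th') = (dot b x + th) + (dot b' x + th')); last by ring.
  rewrite (_ : dot b x - dot b' x + (th - th') = (dot b x + th) - (dot b' x + th')); last by ring.
  by rewrite (cosD (dot b x + th) (dot b' x + th')) (cosB (dot b x + th) (dot b' x + th')); field.
Qed.

Lemma annih_lim (q_ : nat -> V -> R) (q : V -> R) M : (forall n, annih (q_ n)) ->
  (forall n x, `|q_ n x| <= M) -> measT q ->
  (forall x, q_ n x @[n --> \oo] --> q x) -> annih q.
Proof.
move=> h hM mq cq.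
have qM x : `|q x| <= M.
  have c : (fun n => `|q_ n x|) @ \oo --> `|q x| by apply: cvg_norm; exact: cq.
  rewrite -(cvg_lim _ c)//; apply: limr_le; first by apply/cvg_ex; exists `|q x|.
  by apply: nearW => n.
split => //; first by exists M.
move=> b th Gb.
have [||||_ c] := @dct _ _ R lamd (fun n x => q_ n x * F x * cos (dot b x + th))
  (fun x => q x * F x * cos (dot b x + th)) (fun x => M * `|F x|).
- move=> n; have [mn [Mn bn] _] := h n.
  exact: intg_meas (bI b th mn (ex_intro _ _ bn)).
- by move=> x; apply: cvgMl; apply: cvgMl; exact: cq.
- exact: intgZ (intg_norm IF).
- move=> n x; rewrite -mulrA normrM; apply: ler_pM => //.
  by rewrite normrM ler_piMr//; exact: cos_max.
have c0 : (fun n => \int[lamd]_x (q_ n x * F x * cos (dot b x + th))) @ \oo --> (0 : R).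
  rewrite (_ : (fun n => _) = fun=> 0); first exact: cvg_cst.
  by apply/funext => n; have [_ _ ->] := h n.
exact: (cvg_unique _ c c0).
Qed.

Lemma eq_multiplier s1 s2 : s1 =1 s2 -> multiplier s1 -> multiplier s2.
Proof. by move=> /funext ->. Qed.

Lemma multiplierD s1 s2 a : multiplier s1 -> multiplier s2 -> multiplier (fun x => a * s1 x + s2 x).
Proof.
move=> [m1 [M1 b1] h1] [m2 [M2 b2] h2]; split.
- by apply: measurable_funD => //; exact: measurable_funM.
- exists (`|a| * M1 + M2) => x; apply: (le_trans (ler_normD _ _)).
  by rewrite normrM lerD// ler_wpM2l.
- move=> q hq; apply: eq_annih (annihD a (h1 q hq) (h2 q hq)) => x; ring.
Qed.

Lemma multiplierM s1 s2 : multiplier s1 -> multiplier s2 -> multiplier (fun x => s1 x * s2 x).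
Proof.
move=> [m1 [M1 b1] h1] [m2 [M2 b2] h2]; split.
- exact: measurable_funM.
- by exists (M1 * M2) => x; rewrite normrM ler_pM.
- move=> q hq; apply: eq_annih (h2 _ (h1 _ hq)) => x; ring.
Qed.

Lemma multiplier_cst a : multiplier (fun=> a).
Proof.
split; [exact: measurable_cst|by exists (`|a|)|move=> q hq].
have [m [M hM] h] := hq; have z : annih (fun=> 0).
  split; [exact: measurable_cst|by exists 0 => x; rewrite normr0|move=> b th Gb].
  by rewrite (eq_Int lamd (g := fun=> 0)) ?Int0// => x; rewrite !mul0r.
by apply: eq_annih (annihD a hq z) => x; ring.
Qed.

Lemma multiplier_cos b th : Gam b -> multiplier (fun x => cos (dot b x + th)).
Proof.
move=> Gb; split; [exact: mcosb|by exists 1 => x; exact: cos_max|].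
by move=> q hq; exact: annih_cos.
Qed.

Lemma multiplier_lim (s_ : nat -> V -> R) s M : (forall n, multiplier (s_ n)) ->
  (forall n x, `|s_ n x| <= M) -> (forall x, s_ n x @[n --> \oo] --> s x) -> multiplier s.
Proof.
move=> h hM cs.
have ms : measT s.
  apply: (measurable_fun_cvg (fun n => let: And3 m _ _ := h n in m)) => x _; exact: cs.
have sM x : `|s x| <= M.
  have c : (fun n => `|s_ n x|) @ \oo --> `|s x| by apply: cvg_norm; exact: cs.
  rewrite -(cvg_lim _ c)//; apply: limr_le; first by apply/cvg_ex; exists `|s x|.
  by apply: nearW => n.
split => //; first by exists M.
move=> q hq; have [mq [K qK] _] := hq.
apply: (@annih_lim (fun n x => q x * s_ n x) _ (K * M)).
- by move=> n; have [_ _ H] := h n; exact: H.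
- by move=> n x; rewrite normrM ler_pM.
- exact: measurable_funM.
- by move=> x; apply: cvgMr; exact: cs.
Qed.

Lemma multiplier_congr (s1 s2 : V -> R) : (forall x, F x != 0 -> s1 x = s2 x) ->
  measT s2 -> (exists M, forall x, `|s2 x| <= M) -> multiplier s1 -> multiplier s2.
Proof.
move=> e m2 [M hM] [m1 b1 h1]; split => //; first by exists M.
move=> q hq; have [mq [K qK] _] := hq; split.
- exact: measurable_funM.
- by exists (K * M) => x; rewrite normrM ler_pM.
- move=> b th Gb; have [_ _ H] := h1 _ hq; rewrite -[RHS](H b th Gb).
  apply: eq_Int => x; have [->|Fx] := eqVneq (F x) 0; first by rewrite !mulr0 !mul0r.
  by rewrite e.
Qed.

(** The iterates of this odd polynomial, started in [[-1, 1]], converge to the sign. They turn a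
    multiplier into the indicator of one of its superlevel sets without any approximation
    theorem. *)
Let P (y : R) := (3 * y - y ^+ 3) / 2.

Let P01 y : 0 <= y <= 1 -> 0 <= P y <= 1.
Proof.
move=> /andP[y0 y1]; have : 0 <= (1 - y) ^+ 2 * (2 + y) by rewrite mulr_ge0 ?sqr_ge0// addr_ge0.
have : 0 <= y * (3 - y * y) by rewrite mulr_ge0// subr_ge0 (@le_trans _ _ 1)// ?ler1n// mulr_ile1.
by rewrite /P; lra.
Qed.

Let PN y : P (- y) = - P y. Proof. by rewrite /P; ring. Qed.

Let iterP_bound n y : `|y| <= 1 -> `|iter n P y| <= 1.
Proof.
elim: n => //= n IH /IH; set z := iter n P y.
case: (leP 0 z) => z0 h.
  have /P01/andP[h0 h1] : 0 <= z <= 1 by rewrite z0 -(ger0_norm z0).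
  by rewrite ger0_norm.
have /P01/andP[h0 h1] : 0 <= - z <= 1 by rewrite oppr_ge0 ltW//= -(ltr0_norm z0).
by rewrite -normrN -PN ger0_norm.
Qed.

Let iterP_cvg y : 0 < y <= 1 -> iter n P y @[n --> \oo] --> (1 : R).
Proof.
move=> /andP[y0 y1].
have inv n : y <= iter n P y <= 1 /\ 1 - iter n P y <= (1 - y / 2) ^+ n.
  elim: n => [|n [/andP[h1 h2] h3]] /=; first by rewrite lexx y1 expr0; split => //; lra.
  set z := iter n P y in h1 h2 h3 *.
  have z0 : 0 <= z by apply: le_trans h1; exact: ltW.
  have /P01/andP[g0 g1] : 0 <= z <= 1 by rewrite z0 h2.
  have gz : z <= P z.
    have : 0 <= z * ((1 - z) * (1 + z)) by rewrite !mulr_ge0 ?subr_ge0 ?addr_ge0.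
    by rewrite /P; lra.
  split; first by rewrite g1 andbT (le_trans h1).
  rewrite exprS; have : 1 - P z <= (1 - z) * (1 - y / 2).
    have a : 0 <= (1 - z) * (z * z) by rewrite !mulr_ge0 ?subr_ge0.
    have b : 0 <= (1 - z) * (z - y) by rewrite mulr_ge0 ?subr_ge0.
    by rewrite /P; lra.
  move=> h; apply: (le_trans h); rewrite mulrC; apply: ler_wpM2l => //.
  by lra.
have q : (1 - y / 2) ^+ n @[n --> \oo] --> (0 : R).
  apply: cvg_expr; rewrite ger0_norm; lra.
apply/cvgrPdist_le => e e0; have := q => /cvgrPdist_le/(_ e e0).
apply: filterS => n; have [/andP[h1 h2] h3] := inv n.
rewrite sub0r normrN [X in _ -> X <= _]ger0_norm ?subr_ge0// => h4; rewrite (le_trans h3)//.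
by rewrite (le_trans (ler_norm _)).
Qed.

(** [s - t] is rescaled into [[-1, 1]] and the iterates of [P] converge to its sign [sg]; the
    indicator of positivity is [(sg + sg ^+ 2) / 2]. *)
Lemma multiplier_gt s (t : R) : multiplier s -> multiplier (fun x => ((t < s x)%R)%:R).
Proof.
move=> hs; have [ms [M sM] _] := hs.
pose K := M + `|t| + 1.
have M0 : 0 <= M := le_trans (normr_ge0 _) (sM 0).
have K0 : 0 < K by rewrite ltr_wpDl// addr_ge0.
pose s1 x := K^-1 * s x + - (t / K).
have hs1 : multiplier s1 by apply: multiplierD => //; exact: multiplier_cst.
have s1b x : `|s1 x| <= 1.
  have i0 : 0 <= K^-1 by rewrite invr_ge0 ltW.
  rewrite /s1 mulrC -mulrBl normrM (ger0_norm i0).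
  rewrite ler_pdivrMr// mul1r (le_trans (ler_normB _ _))// /K.
  by have := sM x; lra.
have hit n : multiplier (fun x => iter n P (s1 x)).
  elim: n => //= n IH; have h3 := multiplierM (multiplierM IH IH) IH.
  have := multiplierD (3 / 2) IH (multiplierD (- 2^-1) h3 (multiplier_cst 0)).
  by apply: eq_multiplier => x; rewrite /P; field.
pose sg (y : R) : R := if 0 < y then 1 else if y < 0 then -1 else 0.
have hsg : multiplier (fun x => sg (s1 x)).
  apply: (multiplier_lim hit (M := 1)) => [n x|x]; first exact: iterP_bound.
  have := s1b x; move: (s1 x) => y yb; rewrite /sg; case: ltP => y0.
    by apply: iterP_cvg; rewrite y0 (le_trans (ler_norm _)).
  case: ltP => y1.
    have e n : iter n P y = - iter n P (- y).
      by elim: n => [|n IH] /=; rewrite ?opprK// IH PN.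
    rewrite (funext e); apply: cvgN; apply: iterP_cvg.
    by rewrite oppr_gt0 y1 -(ltr0_norm y1).
  have -> : y = 0 by apply/eqP; rewrite eq_le y0 y1.
  have e n : iter n P 0 = 0 by elim: n => //= n ->; rewrite /P mulr0 expr0n subr0 mul0r.
  by rewrite (funext e); exact: cvg_cst.
have := multiplierD (2^-1) hsg (multiplierD (2^-1) (multiplierM hsg hsg) (multiplier_cst 0)).
apply: eq_multiplier => x.
have -> : (t < s x)%R = (0 < s1 x)%R.
  by rewrite /s1 (mulrC K^-1) -mulrBl pmulr_lgt0 ?invr_gt0// subr_gt0.
rewrite /sg; case: ltP => y0 /=; first by field.
by case: ltP => y1; field.
Qed.

Definition mset (A : set V) := multiplier (\1_A).

Lemma msetC A : mset A -> mset (~` A).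
Proof.
move=> h; have := multiplierD (-1) h (multiplier_cst 1); apply: eq_multiplier => x.
rewrite !indicE; have [Ax|nAx] := pselect (A x).
  by rewrite mem_set// memNset/= ?mulN1r ?addNr//; exact.
by rewrite memNset// mem_set//= mulr0 add0r.
Qed.

Lemma msetI A B : mset A -> mset B -> mset (A `&` B).
Proof. by move=> hA hB; have := multiplierM hA hB; apply: eq_multiplier => x; rewrite indicI. Qed.

Lemma mset0 : mset set0.
Proof. by have := multiplier_cst 0; apply: eq_multiplier => x; rewrite indic0. Qed.

Lemma msetU A B : mset A -> mset B -> mset (A `|` B).
Proof. by move=> hA hB; rewrite -(setCK (A `|` B)) setCU; apply/msetC/msetI; exact: msetC. Qed.

Lemma mset_bigcup (A : nat -> set V) : (forall n, mset (A n)) -> mset (\bigcup_n A n).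
Proof.
move=> h; have hU n : mset (\big[setU/set0]_(i < n) A i).
  by elim/big_ind: _ => //; [exact: mset0|exact: msetU].
apply: (multiplier_lim hU (M := 1)) => [n x|x].
  by rewrite indicE; case: (_ \in _); rewrite ?normr1 ?normr0.
apply: cvg_near_cst.
have [[n _ An]|nA] := pselect ((\bigcup_n A n) x).
  exists n.+1 => // k /= nk; rewrite !indicE !mem_set//; first by exists n.
  by rewrite -bigcup_mkord; exists n.
exists 0%N => // k _; rewrite !indicE !memNset// -bigcup_mkord => -[n _ An].
by apply: nA; exists n.
Qed.

Lemma mset_measurable : (forall i t, mset [set x : V | t < x ord0 i]) ->
  forall A : set V, measurable A -> mset A.
Proof.
move=> ray; have coord i (B : set R) : measurable B -> mset [set x : V | B (x ord0 i)].
  move: B; rewrite -[@measurable _ _]/(measurable : set (set (measurableTypeR R))).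
  rewrite (@RGenOInfty.measurableE R) => B.
  suff : <<s @RGenOInfty.G R>> `<=` [set B | mset [set x : V | B (x ord0 i)]] by exact.
  apply: smallest_sub; last by move=> _ [a ->] /=; have := ray i a; congr mset;
    apply/seteqP; split => x /=; rewrite in_itv/= andbT.
  split => [|C hC|C hC] /=.
  - by have := mset0; congr mset; apply/seteqP; split.
  - rewrite (_ : [set x : V | _] = ~` [set x : V | C (x ord0 i)]); first exact: msetC.
    by apply/seteqP; split => x //= [].
  - rewrite (_ : [set x : V | _] = \bigcup_n [set x : V | C n (x ord0 i)]).
      exact: mset_bigcup.
    by apply/seteqP; split => x [n _ hn]; exists n.
suff h : <<s \big[setU/set0]_(i < d) preimage_set_system setT (fun x : V => x ord0 i : measurableTypeR R) measurable >> `<=` mset by exact: h.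
apply: smallest_sub.
  split => [|C hC|C hC]; [exact: mset0|by rewrite setTD; exact: msetC|exact: mset_bigcup].
move=> A; rewrite -bigcup_seq => -[i _ [B mB <-]].
by rewrite setTI; exact: coord.
Qed.

(** The sets whose indicator is a multiplier form a sigma-algebra. Once it contains the coordinate
    half-spaces it contains [F > 0], and the integrals of [F] over this set and over its complement
    both vanish. *)
Lemma determining : annih (fun=> 1) -> (forall i t, mset [set x : V | t < x ord0 i]) ->
  {ae lamd, forall x, F x = 0}.
Proof.
move=> h1 ray; have mF := intg_meas IF.
have zero (A : set V) : measurable A -> intg (fun x => \1_A x * F x) /\ \int[lamd]_x (\1_A x * F x) = 0.
  move=> mA; have [m [M hM] h] := mset_measurable ray mA.
  have I := intgM_bounded IF m hM; split => //.
  have [_ _ /(_ 0 0 Gam0)] := h _ h1.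
  by under eq_Rintegral => x _ do rewrite dotC dot0r addr0 cos0 mulr1 mul1r.
have mp : measurable [set x | 0 < F x].
  by have := mF measurableT _ (measurable_itv `]0, +oo[); rewrite setTI;
    congr measurable; apply/seteqP; split => x /=; rewrite in_itv/= andbT.
have [I1 E1] := zero _ mp; have [I2 E2] := zero _ (measurableC mp).
have e x : `|F x| = \1_[set x | 0 < F x] x * F x - \1_(~` [set x | 0 < F x]) x * F x.
  rewrite !indicE; case: (ltP 0 (F x)) => Fx.
    by rewrite mem_set// memNset//= ?mul1r ?mul0r ?subr0 ?gtr0_norm//; exact.
  rewrite memNset ?mem_set//= ?ler0_norm ?mul0r ?mul1r ?sub0r//.
    by apply/negP; rewrite -leNgt.
  by apply/negP; rewrite -leNgt.
have : \int[lamd]_x `|F x| = 0.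
  by rewrite (eq_Int lamd e) (IntB I1 I2) E1 E2 subr0.
move=> /(Int_eq0 _ _ (intg_norm IF)) h; have := h _ _.
have mn : measT (fun x => `|F x|) by exact: measurableT_comp.
by move=> /(_ mn (fun x => normr_ge0 _)); apply: filterS => x /eqP; rewrite normr_eq0 => /eqP.
Qed.

End determining.

(** * Coordinate half-spaces as multipliers *)

Section rays.
Context {R : realType} {d : nat}.
Notation V := 'rV[R]_d.
Notation lamd := (@lebesgue_rV R d).
Notation intg := (intg lamd).
Implicit Types F : V -> R.

Lemma dot_delta (a : R) i (x : V) : dot (a *: delta_mx ord0 i) x = a * x ord0 i.
Proof.
rewrite dotZl /dot (bigD1 i)//= mxE !eqxx mul1r big1 ?addr0// => j ji.
by rewrite mxE (negPf ji) mul0r.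
Qed.

Lemma sin_cos_shift (y : R) : sin y = cos (y + - (pi / 2)).
Proof. by rewrite cosB cos_pihalf sin_pihalf mulr0 mulr1 add0r. Qed.

(** [sin ((x_i - t) / (n + 1))] has the sign of [x_i - t] as soon as [n] exceeds [|x_i - t|], so the
    half-space is a pointwise limit of superlevel sets of waves. *)
Lemma determining_whole F : intg F ->
  (forall b th, \int[lamd]_x (F x * cos (dot b x + th)) = 0) -> {ae lamd, forall x, F x = 0}.
Proof.
move=> IF h; pose G (x : V) := True.
have GD x y : G x -> G y -> G (x + y) by []. have GN x : G x -> G (- x) by [].
apply: (@determining _ _ G I F IF) => [|i t].
  split; [exact: measurable_cst|by exists 1 => x; rewrite normr1|move=> b th _].
  by rewrite -[RHS](h b th); apply: eq_Int => x; rewrite mul1r.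
pose s n (x : V) : R := ((0 < cos (dot (n.+1%:R^-1 *: delta_mx ord0 i) x + (- (t / n.+1%:R) + - (pi / 2))))%R)%:R.
apply: (@multiplier_lim _ _ G F IF s _ 1).
- by move=> n; apply: (multiplier_gt IF); exact: (multiplier_cos GD GN IF).
- by move=> n x; rewrite normr_nat lern1 leq_b1.
move=> x; apply: cvg_near_cst; exists (Num.trunc `|x ord0 i - t|).+1 => // n /= hn.
rewrite /s dot_delta addrA -sin_cos_shift mulrC -mulrBl indicE.
have yn : `|x ord0 i - t| < n.+1%:R.
  have /andP[_ h2] := truncn_itv (normr_ge0 (x ord0 i - t)).
  by rewrite (lt_le_trans h2)// ler_nat; exact: ltnW.
have p1 : 1 < pi :> R by apply: lt_le_trans (pi_ge2 _); rewrite ltr1n.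
case: (ltP t (x ord0 i)) => tx.
  rewrite mem_set// (_ : (0 < sin _)%R = true)//; apply: sin_gt0_pi.
  rewrite divr_gt0 ?subr_gt0//= ltr_pdivrMr// (lt_trans (le_lt_trans (ler_norm _) yn))//.
  by rewrite ltr_pMl.
rewrite memNset/=; last by apply/negP; rewrite -leNgt.
rewrite (_ : (0 < _)%R = false)//; apply/negbTE; rewrite -leNgt -oppr_ge0 -sinN.
apply: sin_ge0_pi; rewrite -mulNr opprB; apply/andP; split.
  by apply: divr_ge0; rewrite ?subr_ge0// ltW.
rewrite ler_pdivrMr//.
rewrite distrC in yn; apply: le_trans (ler_norm _) _; apply: (le_trans (ltW yn)).
by rewrite ler_peMl// ltW.
Qed.

(** Only integer frequencies are available. On one period a half-line is described by the sign of
    the sine, which tells the two half-periods apart, and by a level of the cosine, which is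
    monotone on each of them. *)
Lemma determining_torus F : intg F -> (forall x, F x != 0 -> cell Torus x) ->
  (forall b th, freqs Torus b -> \int[lamd]_x (F x * cos (dot b x + th)) = 0) ->
  {ae lamd, forall x, F x = 0}.
Proof.
move=> IF Fc h; pose G := @freqs R d Torus.
have GD x y : G x -> G y -> G (x + y) by exact: freqs_add.
have GN x : G x -> G (- x) by exact: freqs_opp.
have G0 : G 0 by exact: freqs0.
have Gd i : G (1 *: delta_mx ord0 i).
  exists (delta_mx ord0 i) => //; apply/rowP => j; rewrite !mxE mul1r.
  by case: (_ && _).
apply: (@determining _ _ G G0 F IF) => [|i t].
  split; [exact: measurable_cst|by exists 1 => x; rewrite normr1|move=> b th Gb].
  by rewrite -[RHS](h b th Gb); apply: eq_Int => x; rewrite mul1r.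
have mray : measurable [set x : V | t < x ord0 i].
  rewrite (_ : [set x | _] = [set x : V | x ord0 i \in `]t, +oo[]).
    exact: measurable_coord_itv.
  by apply/seteqP; split => x /=; rewrite in_itv/= andbT.
have mi : measT (\1_[set x : V | t < x ord0 i] : V -> R) by exact: measurable_indic.
have bi : exists M, forall x, `|\1_[set x : V | t < x ord0 i] x : R| <= M.
  by exists 1 => x; rewrite indicE; case: (_ \in _); rewrite ?normr1 ?normr0.
have cosm u : multiplier G F (fun x : V => ((u < cos (x ord0 i))%R)%:R).
  apply: (multiplier_gt IF); have := multiplier_cos GD GN IF 0 (Gd i).
  by apply: eq_multiplier => x; rewrite dot_delta mul1r addr0.
have sinm : multiplier G F (fun x : V => ((0 < - sin (x ord0 i))%R)%:R).
  apply: (multiplier_gt IF); have := multiplier_cos GD GN IF (- (pi / 2)) (Gd i).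
  move=> H; have := multiplierD IF (-1) H (multiplier_cst G IF 0).
  by apply: eq_multiplier => x; rewrite dot_delta mul1r -sin_cos_shift mulN1r addr0.
have cosm' u : multiplier G F (fun x : V => ((cos (x ord0 i) < u)%R)%:R).
  have H := multiplier_cos GD GN IF 0 (Gd i).
  have := multiplier_gt IF (- u) (multiplierD IF (-1) H (multiplier_cst G IF 0)).
  by apply: eq_multiplier => x; rewrite dot_delta mul1r addr0 mulN1r addr0 ltrN2.
have neg (y : R) : pi < y < 2 * pi -> sin y < 0.
  move=> /andP[y1 y2]; rewrite -(subrK pi y) sinDpi oppr_lt0; apply: sin_gt0_pi.
  by rewrite subr_gt0 y1/=; lra.
have pos (y : R) : 0 <= y <= pi -> 0 <= sin y by exact: sin_ge0_pi.
have cmono (y z : R) : 0 <= y <= pi -> 0 <= z <= pi -> (cos y < cos z) = (z < y).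
  by move=> hy hz; apply: ltr_cos; rewrite in_itv.
case: (ltP t 0) => t0.
  apply: (multiplier_congr (s2 := \1_[set x : V | t < x ord0 i]) _ mi bi (multiplier_cst G IF 1)) => x /Fc cx.
  by have /andP[h0 _] := cx i; rewrite indicE mem_set//=; exact: lt_le_trans t0 h0.
(* For [0 <= t < pi], a coordinate exceeds [t] when its sine is negative or, otherwise, when its
   cosine is below [cos t]. *)
case: (ltP t pi) => tpi.
  have H := multiplierD IF 1 sinm (multiplierM (cosm' (cos t)) (multiplierD IF (-1) sinm (multiplier_cst G IF 1))).
  apply: (multiplier_congr (s2 := \1_[set x : V | t < x ord0 i]) _ mi bi H) => x /Fc cx; have /andP[h0 h2] := cx i.
  rewrite indicE mul1r; case: (leP (x ord0 i) pi) => xp.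
    have -> : (0 < - sin (x ord0 i))%R = false.
      by apply/negbTE; rewrite -leNgt oppr_le0; apply: pos; rewrite h0.
    rewrite mulr0 !add0r mulr1 cmono ?h0 ?t0 ?xp ?(ltW tpi)//; case: ltP => tx.
      by rewrite mem_set.
    by rewrite memNset//=; apply/negP; rewrite -leNgt.
  have -> : (0 < - sin (x ord0 i))%R by rewrite oppr_gt0; apply: neg; rewrite xp h2.
  by rewrite mulN1r addNr mulr0 addr0 mem_set//=; exact: lt_trans tpi xp.
case: (ltP t (2 * pi)) => t2; last first.
  apply: (multiplier_congr (s2 := \1_[set x : V | t < x ord0 i]) _ mi bi (multiplier_cst G IF 0)) => x /Fc cx.
  have /andP[_ h2] := cx i; rewrite indicE memNset//=; apply/negP; rewrite -leNgt.
  by rewrite (le_trans (ltW h2)).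
(* For [pi <= t < 2 * pi] the sine must be negative, and there the cosine increases, so it must
   exceed [cos t]. *)
have H := multiplierM sinm (cosm (cos t)).
apply: (multiplier_congr (s2 := \1_[set x : V | t < x ord0 i]) _ mi bi H) => x /Fc cx; have /andP[h0 h2] := cx i.
rewrite indicE; case: (leP (x ord0 i) pi) => xp.
  have -> : (0 < - sin (x ord0 i))%R = false.
    by apply/negbTE; rewrite -leNgt oppr_le0; apply: pos; rewrite h0.
  rewrite mul0r memNset//=; apply/negP; rewrite -leNgt; exact: le_trans xp tpi.
have -> : (0 < - sin (x ord0 i))%R by rewrite oppr_gt0; apply: neg; rewrite xp h2.
rewrite mul1r -(subrK pi t) -(subrK pi (x ord0 i)) !cosDpi ltrN2.
rewrite cmono; [|by rewrite subr_ge0 (ltW xp)/= lerBlDr; lra|by rewrite subr_ge0 tpi//= lerBlDr; lra].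
rewrite ltrD2r !subrK; case: ltP => tx; first by rewrite mem_set//= !subrK.
by rewrite memNset//=; apply/negP; rewrite -leNgt.
Qed.

End rays.

(** * Convergence in L^2 and truncation to cubes *)

Section L2_convergence.
Context {d : nat} {R : realType}.
Notation V := 'rV[R]_d.
Variable mu : {measure set V -> \bar R}.
Notation L2 := (L2 mu).
Notation nrm := (nrm mu).

Definition L2cv (f : nat -> V -> R) (g : V -> R) :=
  forall e, 0 < e -> exists N, forall n, (N <= n)%N -> nrm (fun x => f n x - g x) <= e.

Definition seqcv (u : nat -> R) (l : R) :=
  forall e, 0 < e -> exists N, forall n, (N <= n)%N -> `|u n - l| <= e.

Lemma seqcv_unique u l1 l2 : seqcv u l1 -> seqcv u l2 -> l1 = l2.
Proof.
move=> h1 h2; apply/eqP; rewrite -subr_eq0 -normr_le0; apply/ler_addgt0Pr => e e0.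
have e2 : 0 < e / 2 by rewrite divr_gt0.
have [N1 H1] := h1 _ e2; have [N2 H2] := h2 _ e2.
have a := H1 _ (leq_maxl N1 N2); have b := H2 _ (leq_maxr N1 N2).
rewrite add0r (_ : l1 - l2 = (u (maxn N1 N2) - l2) - (u (maxn N1 N2) - l1)); last by ring.
by apply: (le_trans (ler_normB _ _)); lra.
Qed.

Lemma L2cv_Int f g h : (forall n, L2 (f n)) -> L2 g -> L2 h -> L2cv f g ->
  seqcv (fun n => \int[mu]_x (f n x * h x)) (\int[mu]_x (g x * h x)).
Proof.
move=> Lf Lg Lh c e e0.
have K0 : 0 < nrm h + 1 by rewrite ltr_wpDl// nrm_ge0.
have [N HN] := c (e / (nrm h + 1)) (divr_gt0 e0 K0).
exists N => n /HN hn; have Ld := L2B (Lf n) Lg.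
rewrite -(IntB (L2M (Lf n) Lh) (L2M Lg Lh)).
rewrite (eq_Int mu (g := fun x => (f n x - g x) * h x)); last by move=> x; rewrite mulrBl.
apply: (le_trans (cauchy_schwarz Ld Lh)).
apply: (le_trans (ler_pM (nrm_ge0 _ _) (nrm_ge0 _ _) hn (lexx (nrm h)))).
by rewrite -mulrA ler_piMr ?(ltW e0)// ler_pdivrMl// mulr1 lerDl.
Qed.

Definition trn (n : nat) (f : V -> R) x : R := \1_(cube n) x * f x.

Lemma measurable_trn n f : measT f -> measT (trn n f).
Proof. by move=> mf; apply: measurable_funM => //; apply: measurable_indic; exact: measurable_cube. Qed.

Lemma trn_le n f x : `|trn n f x| <= `|f x|.
Proof. by rewrite /trn indicE; case: (_ \in _); rewrite ?mul1r// mul0r normr0. Qed.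

Lemma trn_L2 n f : L2 f -> L2 (trn n f).
Proof.
move=> Lf; apply: (L2_le _ Lf); last exact: trn_le.
by apply: measurable_trn; case: Lf.
Qed.

Lemma cube_eventually (x : V) : exists N, forall n, (N <= n)%N -> cube n x.
Proof.
exists (\max_(i < d) (Num.trunc `|x ord0 i|).+1) => n hn i.
have /andP[_ h] := truncn_itv (normr_ge0 (x ord0 i)).
rewrite (le_trans (ltW h))// ler_nat; apply: leq_trans hn.
exact: (leq_bigmax (F := fun i => (Num.trunc `|x ord0 i|).+1)).
Qed.

Lemma trn_cv f : L2 f -> L2cv (fun n => trn n f) f.
Proof.
move=> Lf; have [mf If] := Lf.
have [||||_ c] := @dct _ _ R mu (fun n x => (trn n f x - f x) ^+ 2) (fun=> 0) (fun x => f x ^+ 2).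
- by move=> n; apply: measurable_funX; apply: measurable_funB => //; exact: measurable_trn.
- move=> x; apply: cvg_near_cst; have [N hN] := cube_eventually x.
  exists N => // n /= /hN cx; rewrite /trn indicE mem_set// mul1r subrr expr0n//.
- exact: If.
- move=> n x; rewrite ger0_norm ?sqr_ge0// /trn indicE; case: (_ \in _).
    by rewrite mul1r subrr expr0n sqr_ge0.
  by rewrite mul0r sub0r sqrrN.
move=> e e0; rewrite Int0 in c; move/cvgrPdist_le : c => /(_ (e ^+ 2)).
rewrite exprn_gt0// => /(_ isT) [N _ HN]; exists N => n /HN.
rewrite sub0r normrN -nrm_sqr ger0_norm ?sqr_ge0// => h.
exact: ler_sqr_pos (ltW e0) h.
Qed.

Lemma L2cv_Cauchy f g : (forall n, L2 (f n)) -> L2 g -> L2cv f g ->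
  forall e, 0 < e -> exists N, forall m n, (N <= m)%N -> (N <= n)%N ->
     nrm (fun x => f m x - f n x) <= e.
Proof.
move=> Lf Lg c e e0; have e2 : 0 < e / 2 by rewrite divr_gt0.
have [N H] := c _ e2; exists N => m n /H hm /H hn.
apply: (le_trans (nrm_dist (Lf m) Lg (Lf n))).
by rewrite nrm_sym in hn; lra.
Qed.

End L2_convergence.

(** * Plancherel's theorem on the whole space *)

Section plancherel.
Context {R : realType} {d : nat}.
Notation V := 'rV[R]_d.
Notation mu := (@fmu R d WholeSpace).
Notation L2 := (L2 mu).
Notation intg := (intg mu).
Notation nrm := (nrm mu).
Notation ift := (ift WholeSpace).
Notation L2cv := (L2cv mu).
Implicit Types phi : V -> R.

Definition cc : R := (2 * pi) ^+ d.

Lemma cc_gt0 : 0 < cc. Proof. by rewrite exprn_gt0// mulr_gt0// pi_gt0. Qed.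

(** The kernel is symmetric in its two variables, so Fubini makes the transform self-adjoint. *)
Lemma dominated_cas (a : V -> R) (b : V -> R) : intg a -> intg b ->
  \int[mu]_x (a x * ift b x) = \int[mu]_x (ift a x * b x).
Proof.
move=> Ia Ib; have ma := intg_meas Ia; have mb := intg_meas Ib.
pose F (p : V * V) := a p.1 * (b p.2 * cas (dot p.1 p.2)).
have mF : measT F.
  apply: measurable_funM; first exact: (measurableT_comp ma).
  apply: measurable_funM; first exact: (measurableT_comp mb).
  by apply: measurable_cas; exact: measurable_dot2.
have bd x y : `|F (x, y)| <= `|a x| * (2 * `|b y|).
  by rewrite !normrM; apply: ler_wpM2l => //; rewrite mulrC ler_wpM2r// cas_bound.
have [I1 I2 E] := fubini_dominated mF (intg_norm Ia) (intgZ 2 (intg_norm Ib)) bd.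
rewrite (eq_Int mu (g := fun x => \int[mu]_y F (x, y))); last first.
  by move=> x; rewrite -(IntZ _ (ift_intg x Ib)).
rewrite E; apply: eq_Int => y; rewrite mulrC -(IntZ _ (ift_intg y Ia)).
by apply: eq_Int => x; rewrite /F /= dotC; ring.
Qed.

(** The test functions: a modulated gaussian and, up to a factor, its transform, the translated
    gaussian [gH]. Transforming twice multiplies by [cc], by [Zd_mul]. *)
Definition gG (del : R) (b x : V) := gaun del x * cas (dot b x).
Definition gH (del : R) (b x : V) := gaun (4 * del)^-1 (x - b).
Definition Zd (del : R) : R := Num.sqrt (pi / del) ^+ d.

Lemma Zd_mul del : 0 < del -> Zd del * Zd (4 * del)^-1 = cc.
Proof.
move=> d0; rewrite /Zd -exprMn -sqrtrM ?divr_ge0 ?pi_ge0 1?ltW// /cc; congr (_ ^+ d).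
rewrite (_ : pi / del * _ = (2 * pi) ^+ 2); last by field; rewrite gt_eqF.
by rewrite sqrtr_sqr ger0_norm// mulr_ge0// pi_ge0.
Qed.

Lemma gG_intg del b : 0 < del -> intg (gG del b) /\ L2 (gG del b).
Proof.
move=> d0; have I : intg (gaun del) := intg_gaun d d0.
have m := @measurable_casdot R d b.
have I1 : intg (gG del b).
  have := intgM_bounded I m (fun y => cas_bound _).
  by apply: eq_intg => x; rewrite mulrC.
split => //; split; first exact: intg_meas I1.
apply: (intg_le _ (intgZ 4 I)); first by apply: measurable_funX; exact: intg_meas I1.
move=> x; rewrite ger0_norm ?sqr_ge0// /gG exprMn mulrC.
have g0 := ltW (gaun_gt0 del x); have g1 := gaun_le1 x d0.
apply: ler_pM; rewrite ?sqr_ge0//.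
  rewrite -real_normK ?num_real// (_ : 4 = 2 ^+ 2 :> R); last by ring.
  by rewrite lerXn2r ?nnegrE// cas_bound.
by rewrite expr2 ler_piMl.
Qed.

Lemma gH_intg del b : 0 < del -> intg (gH del b) /\ L2 (gH del b).
Proof.
move=> d0; have d1 : 0 < (4 * del)^-1 by rewrite invr_gt0 mulr_gt0.
have I : intg (gaun (4 * del)^-1) := intg_gaun d d1.
have [I1 _] : intg (fun x => gaun (4 * del)^-1 (x - b)) /\
   \int[mu]_x gaun (4 * del)^-1 (x - b) = \int[mu]_x gaun (4 * del)^-1 x.
  apply: (@Int_comp_inv _ _ _ mu (fun x : V => x - b)) => //.
    exact: measurable_rV_map2.
  by move=> h mh h0; exact: fmu_shift.
split => //; split; first exact: intg_meas I1.
apply: (intg_le _ I1); first by apply: measurable_funX; exact: intg_meas I1.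
move=> x; have g0 := ltW (gaun_gt0 (4 * del)^-1 (x - b)); have g1 := gaun_le1 (x - b) d1.
by rewrite ger0_norm ?sqr_ge0// expr2 ler_piMl.
Qed.

Lemma gaunN (del : R) (x : V) : gaun del (- x) = gaun del x.
Proof. by rewrite /gaun dotNl dotNr opprK. Qed.

(** The product of two [cas] is the cosine of the difference of the phases plus the sine of their
    sum, and the sine integral vanishes. *)
Lemma gaun_cas2 del (x y : V) : 0 < del ->
  \int[mu]_z (gaun del z * cas (dot x z) * cas (dot y z)) = Zd del * gaun (4 * del)^-1 (x - y).
Proof.
move=> d0.
have mc w : measT (fun z : V => cos (dot z w)).
  by apply: measurable_cos; exact: measurable_dot.
have ms w : measT (fun z : V => sin (dot z w)).
  by apply: measurable_sin; exact: measurable_dot.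
have I : intg (gaun del) := intg_gaun d d0.
have Ic : intg (fun z => gaun del z * cos (dot z (x - y))).
  by apply: eq_intg (intgM_bounded I (mc (x - y)) (fun y => cos_max _)) => z; rewrite mulrC.
have Is : intg (fun z => gaun del z * sin (dot z (x + y))).
  by apply: eq_intg (intgM_bounded I (ms (x + y)) (fun y => sin_max _)) => z; rewrite mulrC.
rewrite (eq_Int mu (g := fun z => gaun del z * cos (dot z (x - y)) + gaun del z * sin (dot z (x + y)))); last first.
  move=> z; rewrite !(dotC z) dotDl dotNl cosB /cas dotDl sinD; ring.
rewrite (IntD Ic Is).
have E1 : \int[mu]_z (gaun del z * cos (dot z (x - y))) = Zd del * gaun (4 * del)^-1 (x - y) := gaun_cos (x - y) d0.
have E2 : \int[mu]_z (gaun del z * sin (dot z (x + y))) = 0 := gaun_sin (x + y) d0.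
by rewrite E1 E2 addr0.
Qed.

Lemma ift_gG del b x : 0 < del -> ift (gG del b) x = Zd del * gH del b x.
Proof.
by move=> d0; rewrite /ift /gG gaun_cas2// /gH -gaunN opprB.
Qed.

Lemma ift_gH del b x : 0 < del -> ift (gH del b) x = Zd (4 * del)^-1 * gG del b x.
Proof.
move=> d0; have d1 : 0 < (4 * del)^-1 by rewrite invr_gt0 mulr_gt0.
have [I _] := gH_intg b d0; have J := ift_intg x I.
have [_ <-] : intg (fun z => gH del b (z + b) * cas (dot x (z + b))) /\
   \int[mu]_z (gH del b (z + b) * cas (dot x (z + b))) = ift (gH del b) x.
  apply: (@Int_comp_inv _ _ _ mu (fun z : V => z + b) (fun z => gH del b z * cas (dot x z))) => //.
    exact: measurable_rV_map2.
  by move=> h mh h0; exact: fmu_shift.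
have mc w : measT (fun z : V => cos (dot z w)).
  by apply: measurable_cos; exact: measurable_dot.
have ms w : measT (fun z : V => sin (dot z w)).
  by apply: measurable_sin; exact: measurable_dot.
have I0 : intg (gaun (4 * del)^-1) := intg_gaun d d1.
have Ic : intg (fun z => gaun (4 * del)^-1 z * cos (dot z x)).
  by apply: eq_intg (intgM_bounded I0 (mc x) (fun y => cos_max _)) => z; rewrite mulrC.
have Is : intg (fun z => gaun (4 * del)^-1 z * sin (dot z x)).
  by apply: eq_intg (intgM_bounded I0 (ms x) (fun y => sin_max _)) => z; rewrite mulrC.
rewrite (eq_Int mu (g := fun z => cas (dot x b) * (gaun (4 * del)^-1 z * cos (dot z x)) +
  cas (- dot x b) * (gaun (4 * del)^-1 z * sin (dot z x)))); last first.
  move=> z; rewrite /gH addrK dotDr (addrC (dot x z)) casD !(dotC z); ring.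
rewrite (IntD (intgZ _ Ic) (intgZ _ Is)) (IntZ _ Ic) (IntZ _ Is).
have E1 : \int[mu]_z (gaun (4 * del)^-1 z * cos (dot z x)) = Zd (4 * del)^-1 * gaun (4 * (4 * del)^-1)^-1 x := gaun_cos x d1.
have E2 : \int[mu]_z (gaun (4 * del)^-1 z * sin (dot z x)) = 0 := gaun_sin x d1.
rewrite E1 E2 mulr0 addr0 /gG (_ : (4 * (4 * del)^-1)^-1 = del); last by field; rewrite gt_eqF.
by rewrite (dotC b); ring.
Qed.

Lemma gaun_add (a b : R) (x : V) : gaun a x * gaun b x = gaun (a + b) x.
Proof. by rewrite /gaun -expRD mulrDl opprD. Qed.

(** With a gaussian factor inserted, the integral of the square becomes [Zd e] times the pairing of
    [phi] with its convolution by a gaussian of mass [Zd (4 * e)^-1]. Young's inequality and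
    [Zd_mul] give [cc], and Fatou's lemma removes the factor. *)
Lemma bessel phi : intg phi -> L2 phi -> L2 (ift phi) /\ nrm (ift phi) <= Num.sqrt cc * nrm phi.
Proof.
move=> I L; have mi := measurable_ift WholeSpace (intg_meas I).
have A del : 0 < del -> L2 (fun x => gaun del x * ift phi x) /\
   nrm (fun x => gaun del x * ift phi x) <= Num.sqrt cc * nrm phi.
  (* Squaring doubles the parameter of the gaussian. *)
  move=> d0; pose e := 2 * del; have e0 : 0 < e by rewrite mulr_gt0.
  have e1 : 0 < (4 * e)^-1 by rewrite invr_gt0 mulr_gt0.
  have Ig : intg (gaun e) := intg_gaun d e0.
  have Ik : intg (gaun (4 * e)^-1) := intg_gaun d e1.
  have Lk : L2 (gaun (4 * e)^-1).
    have [_ Lk] := gH_intg 0 e0; apply: eq_L2 Lk => x; by rewrite /gH subr0.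
  have Igi : intg (fun x => gaun e x * ift phi x).
    have := intgM_bounded Ig mi (fun x => ift_bound x I).
    by apply: eq_intg => x; rewrite mulrC.
  have Igi2 : intg (fun x => (gaun del x * ift phi x) ^+ 2).
    have := intgM_bounded Igi mi (fun x => ift_bound x I).
    apply: eq_intg => x; rewrite exprMn expr2 gaun_add /e.
    by rewrite (_ : del + del = 2 * del); [ring|ring].
  have md : measT (fun x => gaun del x * ift phi x).
    by apply: measurable_funM => //; exact: measurable_gaun.
  split; first by split.
  have k0 (x : V) : 0 <= gaun (4 * e)^-1 x :> R := ltW (gaun_gt0 _ _).
  have [Lcv Ncv] := young1 k0 (fun x => normr_ge0 (phi x)) Ik (L2_norm L).
  have Ek : \int[mu]_x gaun (4 * e)^-1 x = Zd (4 * e)^-1.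
    have h : \int[mu]_z (gaun (4 * e)^-1 z * cos (dot z 0)) = Zd (4 * e)^-1 * gaun (4 * (4 * e)^-1)^-1 0 := gaun_cos 0 e1.
    rewrite (eq_Int mu (g := fun z => gaun (4 * e)^-1 z * cos (dot z 0))); last by move=> z; rewrite dot0r cos0 mulr1.
    by rewrite h /gaun dot0r mulr0 oppr0 expR0 mulr1.
  have nn : nrm (fun x => `|phi x|) = nrm phi.
    by congr Num.sqrt; apply: eq_Int => x; rewrite real_normK ?num_real.
  have inner xi : ift (fun x => gaun e x * ift phi x) xi = Zd e * \int[mu]_eta (phi eta * gaun (4 * e)^-1 (xi - eta)).
    have mp := intg_meas I.
    pose F (p : V * V) := gaun e p.1 * cas (dot xi p.1) * (phi p.2 * cas (dot p.1 p.2)).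
    have mF : measT F.
      apply: measurable_funM.
        apply: measurable_funM; first exact: (measurableT_comp (@measurable_gaun R d e)).
        exact: (measurableT_comp (measurable_casdot xi)).
      apply: measurable_funM; first exact: (measurableT_comp mp).
      by apply: measurable_cas; exact: measurable_dot2.
    have bd x y : `|F (x, y)| <= (2 * gaun e x) * (2 * `|phi y|).
      rewrite !normrM; apply: ler_pM => //.
        by rewrite mulrC (ger0_norm (ltW (gaun_gt0 _ _))); apply: ler_wpM2r; rewrite ?cas_bound// ltW// gaun_gt0.
      by rewrite mulrC ler_wpM2r// cas_bound.
    have [_ I2 E] := fubini_dominated mF (intgZ 2 Ig) (intgZ 2 (intg_norm I)) bd.
    transitivity (\int[mu]_x \int[mu]_y F (x, y)).
      by apply: eq_Int => x; rewrite mulrAC -(IntZ _ (ift_intg x I)).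
    have h y : \int[mu]_x F (x, y) = Zd e * (phi y * gaun (4 * e)^-1 (xi - y)).
      have [Iy _] := gG_intg xi e0.
      have := intgM_bounded Iy (measurable_casdot y) (fun z => cas_bound _) => Jy.
      have Jy' : intg (fun z => gaun e z * cas (dot xi z) * cas (dot y z)).
        by apply: eq_intg Jy => z; rewrite mulrC.
      rewrite mulrCA -(gaun_cas2 _ _ e0) -(IntZ _ Jy').
      by apply: eq_Int => z; rewrite /F /= (dotC z); ring.
    rewrite E (eq_Int mu h) (IntZ _)//.
    have := cv_intg (Logic.I : freqs WholeSpace xi) L Lk; exact.
  have Z0 : 0 <= Zd e by rewrite exprn_ge0// sqrtr_ge0.
  apply: (ler_sqr_pos (mulr_ge0 (sqrtr_ge0 _) (nrm_ge0 _ _))).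
  rewrite nrm_sqr exprMn sqr_sqrtr ?(ltW cc_gt0)//.
  rewrite (eq_Int mu (g := fun x => gaun e x * ift phi x * ift phi x)); last first.
    by move=> x; rewrite exprMn expr2 gaun_add (_ : del + del = e); [ring|rewrite /e; ring].
  rewrite (dominated_cas Igi I) (eq_Int mu (g := fun xi => Zd e * (phi xi * \int[mu]_eta (phi eta * gaun (4 * e)^-1 (xi - eta))))); last first.
    by move=> xi; rewrite inner; ring.
  have mcv : measT (cv WholeSpace phi (gaun (4 * e)^-1)).
    by apply: measurable_cv; [case: L|case: Lk].
  have bcv xi : `|cv WholeSpace phi (gaun (4 * e)^-1) xi| <= `|cv WholeSpace (gaun (4 * e)^-1) (fun x => `|phi x|) xi|.
    rewrite (cvC (Logic.I : freqs WholeSpace xi) Lk (L2_norm L)).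
    apply: le_trans (ler_norm _).
    apply: le_norm_Int; [exact: cv_intg|apply: cv_intg => //; exact: L2_norm|move=> eta].
    by rewrite normrM (ger0_norm (k0 _)).
  have Lc := L2_le mcv Lcv bcv.
  rewrite (IntZ _ (L2M L Lc)) -(Zd_mul e0) -mulrA; apply: ler_wpM2l => //.
  apply: (le_trans (ler_norm _)); apply: (le_trans (cauchy_schwarz L Lc)).
  rewrite expr2 mulrCA; apply: ler_wpM2l; first exact: nrm_ge0.
  by apply: (le_trans (le_nrm mcv Lcv bcv)); rewrite -Ek -nn; exact: Ncv.
have d0 n : 0 < n.+1%:R^-1 :> R by rewrite invr_gt0 ltr0Sn.
apply: (@fatou_L2 _ _ _ mu (fun n x => gaun n.+1%:R^-1 x * ift phi x) _ _ 0%N).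
- by move=> n; have [[m _] _] := A _ (d0 n).
- exact: mi.
- by move=> n _; have [] := A _ (d0 n).
- by move=> n _; have [] := A _ (d0 n).
apply: aeW => x; rewrite -[X in _ --> X]mul1r; apply: cvgMl.
have h : - (n.+1%:R^-1 * dot x x) @[n --> \oo] --> (- (0 * dot x x) : R).
  by apply: cvgN; apply: cvgMl; exact: cvg_harmonic.
rewrite mul0r oppr0 in h.
by have := cvg_comp _ _ h (@continuous_expR R 0); rewrite expR0.
Qed.

Lemma trn_intg n f : L2 f -> intg (trn n f).
Proof.
move=> Lf; have [I E] := @intg_cube R d n.
have L1 : L2 (\1_(@cube R d n)).
  split; first exact: intg_meas I.
  apply: eq_intg I => x; rewrite indicE; case: (_ \in _); first by rewrite expr1n.
  by rewrite expr0n.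
exact: (L2M L1 Lf).
Qed.

Lemma ift_trn_L2 n f : L2 f -> L2 (ift (trn n f)).
Proof. by move=> L; have [] := bessel (trn_intg n L) (trn_L2 n L). Qed.

Lemma ift_trn_Cauchy f : L2 f -> forall e, 0 < e -> exists N, forall m n, (N <= m)%N -> (N <= n)%N ->
     nrm (fun x => ift (trn m f) x - ift (trn n f) x) <= e.
Proof.
move=> L e e0.
have K0 : 0 < Num.sqrt cc by rewrite sqrtr_gt0; exact: cc_gt0.
have [N H] := L2cv_Cauchy (fun n => trn_L2 n L) L (trn_cv L) (divr_gt0 e0 K0).
exists N => m n hm hn; have I := intgB (trn_intg m L) (trn_intg n L).
rewrite (eq_nrm mu (g := ift (fun x => trn m f x - trn n f x))); last first.
  by move=> x; rewrite (iftB x (trn_intg m L) (trn_intg n L)).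
have [_ h] := bessel I (L2B (trn_L2 m L) (trn_L2 n L)).
apply: (le_trans h); apply: (le_trans (ler_wpM2l (sqrtr_ge0 _) (H m n hm hn))).
by rewrite mulrCA mulfV ?mulr1// gt_eqF.
Qed.

(** By [bessel] the transforms of the truncations form a Cauchy sequence. The last clause passes the
    self-adjointness to the limit, tested on modulated gaussians, whose transforms are explicit. *)
Lemma transform_ext f : L2 f -> exists chi, [/\ L2 chi, L2cv (fun n => ift (trn n f)) chi &
  forall del b, 0 < del -> \int[mu]_x (chi x * gG del b x) = \int[mu]_x (f x * ift (gG del b) x)].
Proof.
move=> L; have [chi Lc cv] := L2_complete (fun n => ift_trn_L2 n L) (ift_trn_Cauchy L).
exists chi; split => // del b d0; have [I1 L1] := gG_intg b d0.
have [L2g _] := bessel I1 L1.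
have s1 := L2cv_Int (fun n => ift_trn_L2 n L) Lc L1 cv.
have s2 := L2cv_Int (fun n => trn_L2 n L) L L2g (trn_cv L).
apply: (seqcv_unique s1); move=> e e0; have [N H] := s2 e e0; exists N => n hn.
by rewrite -(dominated_cas (trn_intg n L) I1); exact: H.
Qed.

(** The limit [chi] and [cc * phi] have the same integrals against all modulated gaussians, by two
    explicit transforms. Their difference times one gaussian is integrable and orthogonal to all
    waves, hence zero. *)
Lemma transform_ift phi : intg phi -> L2 phi ->
  L2cv (fun n => ift (trn n (ift phi))) (fun x => cc * phi x).
Proof.
move=> I L; have [Li _] := bessel I L; have [chi [Lc cv ch]] := transform_ext Li.
have Lcp := L2Z cc L; have Ld := L2B Lc Lcp.
have d1 : 0 < 1 :> R by [].
pose F x := (chi x - cc * phi x) * gaun 1 x.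
have IF b : intg (fun x => (chi x - cc * phi x) * gG 1 b x) /\
   \int[mu]_x ((chi x - cc * phi x) * gG 1 b x) = 0.
  have [I1 L1] := gG_intg b d1; have [I2 L2'] := gH_intg b d1.
  split; first exact: L2M.
  rewrite (eq_Int mu (g := fun x => chi x * gG 1 b x - cc * (phi x * gG 1 b x))); last first.
    by move=> x; ring.
  rewrite (IntB (L2M Lc L1) (intgZ _ (L2M L L1))) (IntZ _ (L2M L L1)) ch//.
  rewrite (eq_Int mu (f := fun x => ift phi x * _) (g := fun x => Zd 1 * (gH 1 b x * ift phi x))); last first.
    by move=> x; rewrite ift_gG//; ring.
  have [Li2 _] := bessel I L.
  rewrite (IntZ _ (L2M L2' Li2)) (dominated_cas I2 I).
  rewrite (eq_Int mu (f := fun x => ift (gH 1 b) x * _) (g := fun x => Zd (4 * 1)^-1 * (phi x * gG 1 b x))); last first.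
    by move=> x; rewrite ift_gH//; ring.
  by rewrite (IntZ _ (L2M L L1)) mulrA Zd_mul// subrr.
have Lg : L2 (gaun 1).
  have [_ Lk] := gG_intg 0 d1.
  have eG : gG 1 0 =1 @gaun R d 1 by move=> x; rewrite /gG dotC dot0r /cas cos0 sin0 addr0 mulr1.
  exact: eq_L2 eG Lk.
have IF0 : intg F := L2M Ld Lg.
have F0 : {ae mu, forall x, F x = 0}.
  apply: (determining_whole IF0) => b th.
  have [J1 E1] := IF b; have [J2 E2] := IF (- b).
  (* A cosine with phase [th] is [K1] times [cas] plus [K2] times the reflected [cas]. *)
  pose K1 := (cos th - sin th) / 2; pose K2 := (cos th + sin th) / 2.
  rewrite [LHS](eq_Int mu (g := fun x => K1 * ((chi x - cc * phi x) * gG 1 b x) +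
     K2 * ((chi x - cc * phi x) * gG 1 (- b) x))).
    by rewrite (IntD (intgZ _ J1) (intgZ _ J2)) (IntZ _ J1) (IntZ _ J2) E1 E2 !mulr0 addr0.
  by move=> x; rewrite /F /gG dotNl /cas cosN sinN cosD /K1 /K2; field.
have e : {ae mu, forall x, chi x = cc * phi x}.
  move: F0; apply: filterS => x /eqP; rewrite mulf_eq0 subr_eq0 => /orP[/eqP//|].
  by rewrite gt_eqF// gaun_gt0.
move=> eps e0; have [N H] := cv _ e0; exists N => n /H; congr (_ <= _).
apply: ae_nrm.
- by apply: L2B => //; exact: ift_trn_L2.
- by apply: measurable_funB; [case: (ift_trn_L2 n Li)|case: Lcp].
- by move: e; apply: filterS => x ->.
Qed.

Lemma plancherel phi psi : intg phi -> L2 phi -> intg psi -> L2 psi ->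
  \int[mu]_x (ift phi x * ift psi x) = cc * \int[mu]_x (phi x * psi x).
Proof.
move=> I L I' L'; have [Li _] := bessel I L; have [Li' _] := bessel I' L'.
have s1 := L2cv_Int (fun n => trn_L2 n Li) Li Li' (trn_cv Li).
have s2 := L2cv_Int (fun n => ift_trn_L2 n Li) (L2Z _ L) L' (transform_ift I L).
rewrite -(IntZ _ (L2M L L')) (eq_Int mu (f := fun x => cc * _) (g := fun x => cc * phi x * psi x)); last first.
  by move=> x; rewrite mulrA.
apply: (seqcv_unique s1) => e e0; have [N H] := s2 e e0; exists N => n hn.
by rewrite (dominated_cas (trn_intg n Li) I'); exact: H.
Qed.

(** By Plancherel the truncations of [f] have norms proportional to those of their transforms, hence
    tend to 0, while they also tend to [f]. *)
Lemma transform_inj f : L2 f -> L2cv (fun n => ift (trn n f)) (fun=> 0) -> {ae mu, forall x, f x = 0}.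
Proof.
move=> L h; apply: nrm_eq0 => //; apply/eqP; rewrite eq_le nrm_ge0 andbT.
apply/ler_addgt0Pr => e e0; rewrite add0r; have e2 : 0 < e / 2 by rewrite divr_gt0.
have K0 : 0 < Num.sqrt cc by rewrite sqrtr_gt0; exact: cc_gt0.
have [N1 H1] := h _ (mulr_gt0 e2 K0); have [N2 H2] := trn_cv L e2.
pose n := maxn N1 N2; have a := H1 n (leq_maxl _ _); have b := H2 n (leq_maxr _ _).
have E : nrm (ift (trn n f)) = Num.sqrt cc * nrm (trn n f).
  rewrite -[RHS](ger0_norm (mulr_ge0 (sqrtr_ge0 _) (nrm_ge0 _ _))) -sqrtr_sqr exprMn sqr_sqrtr ?(ltW cc_gt0)//.
  rewrite nrm_sqr; have P := plancherel (trn_intg n L) (trn_L2 n L) (trn_intg n L) (trn_L2 n L).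
  have -> : \int[mu]_x (trn n f x ^+ 2) = \int[mu]_x (trn n f x * trn n f x).
    by apply: eq_Int => x; rewrite expr2.
  by rewrite -P; congr Num.sqrt; apply: eq_Int => x; rewrite expr2.
have a2 : nrm (trn n f) <= e / 2.
  rewrite -(ler_pM2l K0) -E mulrC; apply: le_trans a.
  by rewrite (eq_nrm mu (g := fun x => ift (trn n f) x - 0))// => x; rewrite subr0.
have := nrmD (L2B L (trn_L2 n L)) (trn_L2 n L).
rewrite (eq_nrm mu (g := f)); last by move=> x; rewrite subrK.
by rewrite nrm_sym => t; apply: (le_trans t); lra.
Qed.

End plancherel.

(** * Fourier series on the torus *)

Section torus_fourier.
Context {R : realType} {d : nat}.
Notation V := 'rV[R]_d.
Notation cc := (@cc R d).
Notation lam := (@lebesgue_measure R).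
Notation mu := (@fmu R d Torus).
Notation lamd := (@lebesgue_rV R d).
Notation Zn := (@freqs R d Torus).

Lemma sin_2pi_int (m : int) : sin (2 * pi * m%:~R) = 0 :> R.
Proof.
have st (n : nat) : sin (2 * pi * n%:R) = 0 :> R.
  elim: n => [|n IH]; first by rewrite mulr0 sin0.
  by rewrite -[n.+1%:R]natr1 mulrDr mulr1 mulr_natl sinD2pi -mulr_natl.
by case: m => n; [exact: st|rewrite NegzE mulrNz mulrN sinN st oppr0].
Qed.

Lemma cos_2pi_int (m : int) : cos (2 * pi * m%:~R) = 1 :> R.
Proof.
have st (n : nat) : cos (2 * pi * n%:R) = 1 :> R.
  elim: n => [|n IH]; first by rewrite mulr0 cos0.
  by rewrite -[n.+1%:R]natr1 mulrDr mulr1 mulr_natl cosD2pi -mulr_natl.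
by case: m => n; [exact: st|rewrite NegzE mulrNz mulrN cosN st].
Qed.

Let I02 : set R := `[0, 2 * pi[%classic.

Lemma intg_I02 : intg lam (\1_I02 : R -> R) /\ \int[lam]_x (\1_I02 x : R) = 2 * pi.
Proof.
have p0 := pi_gt0 R.
have mI : measurable (I02 : set (measurableTypeR R)) by exact: measurable_itv.
have E : (\int[lam]_x (\1_I02 x : R)%:E = (2 * pi)%:E)%E.
  transitivity (lam I02); first by rewrite integral_indic// setIT.
  by rewrite /I02 lebesgue_measure_itv/= lte_fin ifT ?mulr_gt0// sube0.
split; last by rewrite /Rintegral E.
apply: intgP; first exact: measurable_indic.
by under eq_integral do rewrite ger0_norm//; rewrite E ltry.
Qed.

Lemma Int_I02 (F f : R -> R) : (forall x : R, is_derive x (1 : R) F (f x)) -> continuous f ->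
  F (2 * pi) = F 0 -> \int[lam]_x (\1_I02 x * f x) = 0.
Proof.
move=> dF cf e; have p0 : 0 < 2 * pi :> R by rewrite mulr_gt0// pi_gt0.
have cF : continuous F by move=> x; apply: differentiable_continuous; apply/derivable1_diffP; exact: ex_derive.
transitivity (\int[lam]_(x in I02) f x).
  rewrite [RHS]Rintegral_mkcond; apply: eq_Int => x; rewrite /patch indicE.
  by case: ifP => h; rewrite ?mul1r ?mul0r.
rewrite /I02 /Rintegral.
have -> : (\int[lam]_(x in `[0%R, (2 * pi)%R[) (f x)%:E = \int[lam]_(x in `[0%R, (2 * pi)%R]) (f x)%:E)%E.
  rewrite integral_itv_bndo_bndc//; apply/measurable_EFinP/measurable_funTS.
  exact: continuous_measurable_fun.
rewrite (@continuous_FTC2 _ f F)//.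
- by rewrite e subee.
- by apply: continuous_in_subspaceT => x _; exact: cf.
- split; [by move=> x _; exact: ex_derive|apply: cvg_at_right_filter; exact: cF|apply: cvg_at_left_filter; exact: cF].
- by move=> x _; rewrite derive1E; exact: derive_val.
Qed.

Lemma Int_I02_trig (m : int) :
  \int[lam]_x (\1_I02 x * sin (x * m%:~R)) = 0 /\
  \int[lam]_x (\1_I02 x * cos (x * m%:~R)) = 2 * pi * (m == 0)%:R.
Proof.
have [->|m0] := eqVneq m 0.
  split; first by rewrite (eq_Int lam (g := fun=> 0)) ?Int0// => x; rewrite mulr0 sin0 mulr0.
  rewrite (eq_Int lam (g := \1_I02 : R -> R)); first by rewrite intg_I02.2 mulr1.
  by move=> x; rewrite mulr0 cos0 mulr1.
have a0 : m%:~R != 0 :> R by rewrite intr_eq0.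
split.
  apply: (@Int_I02 (fun x => - (m%:~R^-1 * cos (x * m%:~R)))).
  - by move=> x; apply: is_derive_eq; rewrite /GRing.scale /= /GRing.scale /=; field.
  - move=> x; apply: (@continuous_comp _ _ _ (fun x : R => x * m%:~R) sin); last exact: continuous_sin.
    exact: mulrr_continuous.
  - by rewrite cos_2pi_int mul0r cos0.
rewrite mulr0; apply: (@Int_I02 (fun x => m%:~R^-1 * sin (x * m%:~R))).
- by move=> x; apply: is_derive_eq; rewrite /GRing.scale /= /GRing.scale /=; field.
- move=> x; apply: (@continuous_comp _ _ _ (fun x : R => x * m%:~R) cos); last exact: continuous_cos.
  exact: mulrr_continuous.
- by rewrite sin_2pi_int mul0r sin0.
Qed.

Lemma cellE (x : V) : \1_(cell Torus) x = prodf (\1_I02 : R -> R) x :> R.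
Proof.
rewrite prodf_indic; congr (\1_ _ _); apply/seteqP; split => y /= h i; have := h i;
  by rewrite /I02/= in_itv.
Qed.

Lemma intg_cell : intg lamd (\1_(@cell R d Torus)).
Proof.
by have := intg_prodf intg_I02.1 d; apply: eq_intg => x; rewrite cellE.
Qed.

Lemma cell_trig (k : V) : Zn k ->
  \int[lamd]_x (\1_(cell Torus) x * cos (dot x k)) = cc * (k == 0)%:R /\
  \int[lamd]_x (\1_(cell Torus) x * sin (dot x k)) = 0.
Proof.
move=> [l _ <-]; set k' := map_mx intr l.
have [h1 h2] := prodf_trig intg_I02.1 (xi := k') (fun i => ltac:(
  rewrite mxE; exact: (Int_I02_trig (l ord0 i)).1)).
split; last by rewrite -[RHS]h2; apply: eq_Int => x; rewrite cellE.
transitivity (\prod_i (2 * pi * (l ord0 i == 0)%:R) : R).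
  rewrite -[LHS](eq_Int lamd (f := fun x => prodf (\1_I02 : R -> R) x * cos (dot x k'))); last first.
    by move=> x; rewrite cellE.
  by rewrite h1; apply: eq_bigr => i _; rewrite mxE (Int_I02_trig _).2.
rewrite big_split/= prodr_const card_ord; congr (_ * _).
have [e|ne] := eqVneq k' 0.
  rewrite big1// => i _; have := congr1 (fun M : V => M ord0 i) e; rewrite !mxE => /eqP.
  by rewrite intr_eq0 => ->.
have /existsP[i hi] : [exists i, l ord0 i != 0].
  apply: contraT; rewrite negb_exists => /forallP h; case/eqP: ne.
  by apply/rowP => i; have := h i; rewrite negbK !mxE => /eqP ->.
by rewrite (bigD1 i)//= (negPf hi) mul0r.
Qed.

Lemma measurable_cell1 : measT (\1_(@cell R d Torus) : V -> R).
Proof. by apply: measurable_indic; exact: measurable_cell. Qed.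

Lemma cell_ortho (k l : V) : Zn k -> Zn l ->
  \int[lamd]_x (\1_(cell Torus) x * cas (dot x l) * cas (dot x k)) = cc * (l == k)%:R.
Proof.
move=> Zk Zl.
have mc w : measT (fun z : V => cos (dot z w)).
  by apply: measurable_cos; exact: measurable_dot.
have ms w : measT (fun z : V => sin (dot z w)).
  by apply: measurable_sin; exact: measurable_dot.
have Ic w : intg lamd (fun z => \1_(cell Torus) z * cos (dot z w)).
  by apply: eq_intg (intgM_bounded intg_cell (mc w) (fun y => cos_max _)) => z; rewrite mulrC.
have Is w : intg lamd (fun z => \1_(cell Torus) z * sin (dot z w)).
  by apply: eq_intg (intgM_bounded intg_cell (ms w) (fun y => sin_max _)) => z; rewrite mulrC.
rewrite (eq_Int lamd (g := fun x => \1_(cell Torus) x * cos (dot x (l - k)) + \1_(cell Torus) x * sin (dot x (l + k)))); last first.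
  by move=> x; rewrite !dotDr dotNr cosB sinD /cas; ring.
rewrite (IntD (Ic _) (Is _)) (cell_trig (freqs_sub Zl Zk)).1 (cell_trig (freqs_add Zl Zk)).2.
by rewrite addr0 subr_eq0.
Qed.

Lemma muT_pt (k : V) : Zn k -> measurable [set k] /\ mu [set k] = 1%E.
Proof.
move=> Zk; have mk := measurable_set1_rV k; split => //.
rewrite /= /muT /mrestr (_ : [set k] `&` _ = [set k]); last first.
  by apply/seteqP; split => [x [] //|x ->]; split.
rewrite /counting asboolT; last exact: finite_set1.
by rewrite fset_set1 finmap.cardfs1.
Qed.

Lemma muT_point (k : V) (f : V -> R) : Zn k ->
  \int[mu]_l (f l * (l == k)%:R) = f k.
Proof.
move=> Zk; have [mk m1] := muT_pt Zk.
have I1 : intg mu (\1_[set k] : V -> R) /\ \int[mu]_x (\1_[set k] x : R) = 1.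
  have E : (\int[mu]_x (\1_[set k] x : R)%:E = 1)%E.
    by transitivity (mu [set k]) => //; rewrite integral_indic// setIT.
  split; last by rewrite /Rintegral E.
  apply: intgP; first exact: measurable_indic.
  by under eq_integral do rewrite ger0_norm//; rewrite E ltry.
rewrite (eq_Int mu (g := fun l => f k * \1_[set k] l)); last first.
  move=> l; rewrite indicE; have [->|lk] := eqVneq l k; first by rewrite mem_set.
  by rewrite memNset ?mulr0//= => /eqP; rewrite (negPf lk).
by rewrite (IntZ _ I1.1) I1.2 mulr1.
Qed.

(** Fubini and the orthogonality of the [cas] over the cell leave a sum over the lattice with a
    single nonzero term. *)
Lemma coefficient (phi : V -> R) k : intg mu phi -> Zn k ->
  \int[lamd]_x (\1_(cell Torus) x * ift Torus phi x * cas (dot x k)) = cc * phi k.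
Proof.
move=> I Zk; have mp := intg_meas I.
pose F (p : V * V) := \1_(cell Torus) p.1 * cas (dot p.1 k) * (phi p.2 * cas (dot p.1 p.2)).
have mF : measT F.
  apply: measurable_funM.
    apply: measurable_funM; first exact: (measurableT_comp measurable_cell1).
    by apply: measurable_cas; apply: measurable_dot2.
  apply: measurable_funM; first exact: (measurableT_comp mp).
  by apply: measurable_cas; exact: measurable_dot2.
have c0 (x : V) : 0 <= \1_(cell Torus) x :> R by rewrite indicE.
have bd x y : `|F (x, y)| <= (2 * \1_(cell Torus) x) * (2 * `|phi y|).
  rewrite !normrM; apply: ler_pM => //.
    by rewrite mulrC (ger0_norm (c0 x)); apply: ler_wpM2r; rewrite ?cas_bound.
  by rewrite mulrC ler_wpM2r// cas_bound.
have [_ I2 E] := fubini_dominated mF (intgZ 2 intg_cell) (intgZ 2 (intg_norm I)) bd.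
transitivity (\int[lamd]_x \int[mu]_y F (x, y)).
  by apply: eq_Int => x; rewrite mulrAC -(IntZ _ (ift_intg x I)).
rewrite E -[RHS](muT_point (fun l => cc * phi l) Zk).
have e l : Zn l -> \int[lamd]_x F (x, l) = cc * phi l * (l == k)%:R.
  move=> Zl; rewrite mulrAC -(cell_ortho Zk Zl) mulrC.
  have J : intg lamd (fun x => \1_(cell Torus) x * cas (dot x l) * cas (dot x k)).
    have ml w : measT (fun z : V => cas (dot z w)).
      by apply: measurable_cas; exact: measurable_dot.
    have := intgM_bounded (intgM_bounded intg_cell (ml l) (fun y => cas_bound _)) (ml k) (fun y => cas_bound _).
    by apply: eq_intg => x; ring.
  by rewrite -(IntZ _ J); apply: eq_Int => x; rewrite /F /=; ring.
apply: (ae_Int I2).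
  apply: measurable_funM; first by apply: measurable_funM.
  rewrite (_ : (fun l : V => (l == k)%:R) = (\1_[set k] : V -> R)).
    by apply: measurable_indic; exact: measurable_set1_rV.
  apply/funext => l; rewrite indicE; have [->|lk] := eqVneq l k; first by rewrite mem_set.
  by rewrite memNset//= => /eqP; rewrite (negPf lk).
move: (ae_freqs (R := R) (d := d) Torus); apply: filterS => l Zl.
exact: e.
Qed.

Lemma torus_parseval phi psi : intg mu phi -> intg mu psi ->
  \int[lamd]_x (\1_(cell Torus) x * ift Torus phi x * ift Torus psi x) = cc * \int[mu]_k (psi k * phi k).
Proof.
move=> I I'; have mp := intg_meas I'; have mi := measurable_ift Torus (intg_meas I).
pose F (p : V * V) := \1_(cell Torus) p.1 * ift Torus phi p.1 * (psi p.2 * cas (dot p.1 p.2)).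
have mF : measT F.
  apply: measurable_funM.
    apply: measurable_funM; first exact: (measurableT_comp measurable_cell1).
    exact: (measurableT_comp mi).
  apply: measurable_funM; first exact: (measurableT_comp mp).
  by apply: measurable_cas; exact: measurable_dot2.
have c0 (x : V) : 0 <= \1_(cell Torus) x :> R by rewrite indicE.
have bd x y : `|F (x, y)| <= ((2 * n1 Torus phi) * \1_(cell Torus) x) * (2 * `|psi y|).
  rewrite !normrM; apply: ler_pM => //.
    by rewrite mulrC (ger0_norm (c0 x)); apply: ler_wpM2r; rewrite ?ift_bound.
  by rewrite mulrC ler_wpM2r// cas_bound.
have [_ I2 E] := fubini_dominated mF (intgZ _ intg_cell) (intgZ 2 (intg_norm I')) bd.
transitivity (\int[lamd]_x \int[mu]_y F (x, y)).
  by apply: eq_Int => x; rewrite -(IntZ _ (ift_intg x I')).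
have Jl l : intg lamd (fun x => \1_(cell Torus) x * ift Torus phi x * cas (dot x l)).
  have ml w : measT (fun z : V => cas (dot z w)).
    by apply: measurable_cas; exact: measurable_dot.
  have := intgM_bounded (intgM_bounded intg_cell mi (fun y => ift_bound y I)) (ml l) (fun y => cas_bound _).
  by apply: eq_intg => x; ring.
have e l : Zn l -> \int[lamd]_x F (x, l) = cc * (psi l * phi l).
  move=> Zl; rewrite mulrCA -(coefficient I Zl) -(IntZ _ (Jl l)).
  by apply: eq_Int => x; rewrite /F /=; ring.
have ae : {ae mu, forall l, \int[lamd]_x F (x, l) = cc * (psi l * phi l)}.
  by move: (ae_freqs (R := R) (d := d) Torus); apply: filterS => l Zl; exact: e.
have mpp : measT (fun l => cc * (psi l * phi l)).
  by apply: measurable_funM => //; apply: measurable_funM => //; exact: intg_meas I.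
have cc0 : cc != 0 :> R by rewrite gt_eqF// cc_gt0.
have Ipp : intg mu (fun l => psi l * phi l).
  have := intgZ cc^-1 (ae_intg mpp ae I2); apply: eq_intg => l.
  by rewrite mulKf.
by rewrite E -(IntZ _ Ipp); exact: ae_Int I2 mpp ae.
Qed.

Lemma torus_inj (g : V -> R) : intg lamd (fun x => \1_(cell Torus) x * g x) ->
  (forall k, Zn k -> \int[lamd]_x (\1_(cell Torus) x * g x * cas (dot k x)) = 0) ->
  {ae lamd, forall x, \1_(cell Torus) x * g x = 0}.
Proof.
move=> I h; apply: (determining_torus I).
  move=> x; rewrite indicE; case: (boolP (x \in _)) => [/set_mem//|_].
  by rewrite mul0r eqxx.
move=> b th Zb.
pose K1 := (cos th - sin th) / 2; pose K2 := (cos th + sin th) / 2.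
have J w : intg lamd (fun x => \1_(cell Torus) x * g x * cas (dot w x)).
  have := intgM_bounded I (measurable_casdot w) (fun y => cas_bound _).
  by apply: eq_intg => x; rewrite mulrC.
rewrite [LHS](eq_Int lamd (g := fun x => K1 * (\1_(cell Torus) x * g x * cas (dot b x)) +
   K2 * (\1_(cell Torus) x * g x * cas (dot (- b) x)))).
  by rewrite (IntD (intgZ _ (J _)) (intgZ _ (J _))) (IntZ _ (J _)) (IntZ _ (J _)) !h ?mulr0 ?addr0//; exact: freqs_opp.
by move=> x; rewrite dotNl /cas cosN sinN cosD /K1 /K2; field.
Qed.

End torus_fourier.

(** * The Hartley transform of a function *)

Section hartley_transform.
Context {R : realType} {d : nat} (Om : domain).
Notation V := 'rV[R]_d.
Notation lamd := (@lebesgue_rV R d).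
Notation mu := (@fmu R d Om).
Notation cc := (@cc R d).
Implicit Types (f g h phi psi : V -> R) (F : V -> R[i]).

Lemma L2_ereal mu' h (c : R) : measT h ->
  (\int[mu' : {measure set V -> \bar R}]_x (h x ^+ 2)%:E <= c%:E)%E -> L2 mu' h /\ nrm mu' h ^+ 2 <= c.
Proof.
move=> mh H; have L : L2 mu' h.
  split => //; apply: intgP; first exact: measurable_funX.
  under eq_integral do rewrite ger0_norm ?sqr_ge0//.
  by apply: (le_lt_trans H); rewrite ltry.
by split => //; move: H; rewrite (IntE L.2) lee_fin nrm_sqr.
Qed.

Lemma L2_erealE (mu' : {measure set V -> \bar R}) h : L2 mu' h ->
  (\int[mu']_x (h x ^+ 2)%:E = (nrm mu' h ^+ 2)%:E)%E.
Proof. by move=> L; rewrite (IntE L.2) nrm_sqr. Qed.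

Definition fc f x := \1_(cell Om) x * f x.

(** The transform of [f] truncated as in [truncated_fourier]. The variable of integration is the
    physical one, which carries Lebesgue measure on both domains; hence [WholeSpace]. *)
Definition gn f n := ift WholeSpace (trn n (fc f)).

Lemma measurable_fc f : measT f -> measT (fc f).
Proof. by move=> mf; apply: measurable_funM => //; apply: measurable_indic; exact: measurable_cell. Qed.

Lemma square_integrableP f :
  square_integrable Om f <-> [/\ on_domain Om f, measT f & L2 lamd (fc f)].
Proof.
have E : (\int[lamd]_(x in cell Om) ((f x) ^+ 2)%:E = \int[lamd]_x (fc f x ^+ 2)%:E)%E.
  rewrite integral_mkcond; apply: eq_integral => x _; rewrite /patch /fc indicE.
  by case: ifP => _; rewrite ?mul1r// mul0r expr0n.
split=> -[od mf H]; split => //.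
  split; first exact: measurable_fc.
  apply: intgP; first by apply: measurable_funX; exact: measurable_fc.
  by under eq_integral do rewrite ger0_norm ?sqr_ge0//; rewrite -E.
by rewrite E (L2_erealE H) ltry.
Qed.

(** Membership in L^2 has to be stated, because [nrm] of a function that is not square integrable is
    [0]. *)
Definition hcv (g : nat -> V -> R) phi := forall e, 0 < e -> exists N, forall n, (N <= n)%N ->
  L2 mu (fun x => g n x - phi x) /\ nrm mu (fun x => g n x - phi x) <= e.

(* [cc] is [(2 pi) ^ d], so that [f = ift phi]; on the torus only the values of
   [f] on one cell enter. *)
Definition htr f phi := [/\ square_integrable Om f, measT phi &
  hcv (gn f) (fun x => cc * phi x)].

Lemma fc_L2 f phi : htr f phi -> L2 lamd (fc f).
Proof. by move=> [/square_integrableP[]]. Qed.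

Lemma htr_domain f phi : htr f phi -> on_domain Om f.
Proof. by move=> [/square_integrableP[]]. Qed.

Lemma hcv_lin (a b : R) (g1 g2 : nat -> V -> R) phi1 phi2 : hcv g1 phi1 -> hcv g2 phi2 ->
  hcv (fun n x => a * g1 n x + b * g2 n x) (fun x => a * phi1 x + b * phi2 x).
Proof.
move=> h1 h2 e e0; pose K := `|a| + `|b| + 1.
have K0 : 0 < K by rewrite ltr_wpDl// addr_ge0.
have [N1 H1] := h1 _ (divr_gt0 e0 K0); have [N2 H2] := h2 _ (divr_gt0 e0 K0).
exists (maxn N1 N2) => n; rewrite geq_max => /andP[/H1[L1 B1] /H2[L2' B2]].
have E x : a * g1 n x + b * g2 n x - (a * phi1 x + b * phi2 x) =
  a * (g1 n x - phi1 x) + b * (g2 n x - phi2 x) by ring.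
have La := L2Z a L1; have Lb := L2Z b L2'.
split; first by apply: (eq_L2 _ (L2D La Lb)) => x; rewrite E.
rewrite (eq_nrm mu (g := fun x => a * (g1 n x - phi1 x) + b * (g2 n x - phi2 x)))//.
apply: (le_trans (nrmD La Lb)); rewrite !nrmZ//.
have t : `|a| * (e / K) + `|b| * (e / K) <= e.
  rewrite -mulrDl mulrCA ler_piMr ?(ltW e0)// ler_pdivrMr// mul1r.
  by rewrite lerDl.
by apply: le_trans t; apply: lerD; apply: ler_wpM2l.
Qed.

Lemma hcv_eq (g1 g2 : nat -> V -> R) phi1 phi2 : (forall n, g1 n =1 g2 n) -> phi1 =1 phi2 -> hcv g1 phi1 -> hcv g2 phi2.
Proof.
move=> e1 e2 h e /h[N HN]; exists N => n /HN[L B].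
have E x : g1 n x - phi1 x = g2 n x - phi2 x by rewrite e1 e2.
by split; [exact: (eq_L2 E L)|rewrite -(eq_nrm mu E)].
Qed.

Lemma hcv_unique (g : nat -> V -> R) phi psi : measT phi -> measT psi ->
  hcv g phi -> hcv g psi -> {ae mu, forall x, phi x = psi x}.
Proof.
move=> mp mq h1 h2.
have D e : 0 < e -> L2 mu (fun x => phi x - psi x) /\ nrm mu (fun x => phi x - psi x) <= e.
  move=> e0; have [N1 H1] := h1 _ (divr_gt0 e0 (ltr0n R 2)).
  have [N2 H2] := h2 _ (divr_gt0 e0 (ltr0n R 2)).
  have [L1 B1] := H1 _ (leq_maxl N1 N2); have [L2' B2] := H2 _ (leq_maxr N1 N2).
  have E x : (g (maxn N1 N2) x - psi x) - (g (maxn N1 N2) x - phi x) = phi x - psi x by ring.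
  split; first exact: (eq_L2 E (L2B L2' L1)).
  rewrite -(eq_nrm mu E); apply: (le_trans (nrmB L2' L1)).
  by rewrite (splitr e); exact: lerD.
have L := (D 1 ltr01).1.
have n0 : nrm mu (fun x => phi x - psi x) = 0.
  apply: le_anti; rewrite nrm_ge0 andbT; apply/ler_addgt0Pr => e e0.
  by rewrite add0r; exact: (D e e0).2.
by move: (nrm_eq0 L n0); apply: filterS => x /subr0_eq.
Qed.

Lemma gn_lin (a b : R) f1 f2 n x : L2 lamd (fc f1) -> L2 lamd (fc f2) ->
  gn (fun y => a * f1 y + b * f2 y) n x = a * gn f1 n x + b * gn f2 n x.
Proof.
move=> L1 L2'; have I1 := trn_intg n L1; have I2 := trn_intg n L2'.
rewrite /gn -iftZ// -(iftZ b)// -iftD//; first last.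
- exact: intgZ.
- exact: intgZ.
by apply: eq_Int => y; congr (_ * _); rewrite /trn /fc; ring.
Qed.

Lemma on_domain_lin (a b : R) f1 f2 : on_domain Om f1 -> on_domain Om f2 ->
  on_domain Om (fun x => a * f1 x + b * f2 x).
Proof. by case: (Om) => //= h1 h2 x k; rewrite h1 h2. Qed.

Lemma htr_lin (a b : R) f1 f2 phi1 phi2 : htr f1 phi1 -> htr f2 phi2 ->
  htr (fun x => a * f1 x + b * f2 x) (fun x => a * phi1 x + b * phi2 x).
Proof.
move=> [s1 p1 h1] [s2 p2 h2].
have /square_integrableP[dm1 m1 L1] := s1; have /square_integrableP[dm2 m2 L2'] := s2.
split.
- apply/square_integrableP; split; first exact: on_domain_lin.
    by apply: measurable_funD; apply: measurable_funM.
  by apply: eq_L2 (L2D (L2Z a L1) (L2Z b L2')) => x; rewrite /fc; ring.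
- by apply: measurable_funD; apply: measurable_funM.
- apply: hcv_eq (hcv_lin a b h1 h2) => [n x|x]; last by ring.
  by rewrite gn_lin.
Qed.

Lemma htr_eq f f' phi phi' : f =1 f' -> phi =1 phi' -> htr f phi -> htr f' phi'.
Proof. by move=> /funext -> /funext ->. Qed.

Lemma htr_unique f phi psi : htr f phi -> htr f psi -> {ae mu, forall x, phi x = psi x}.
Proof.
move=> [_ m1 h1] [_ m2 h2].
have h := hcv_unique (measurable_funM (measurable_cst cc) m1) (measurable_funM (measurable_cst cc) m2) h1 h2.
have c0 : cc != 0 by rewrite gt_eqF// cc_gt0.
by move: h; apply: filterS => x /(mulfI c0).
Qed.

Lemma htr_ae f phi psi : measT psi -> {ae mu, forall x, phi x = psi x} -> htr f phi -> htr f psi.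
Proof.
move=> mq h [sf mp H]; split => // e /H[N HN]; exists N => n /HN[L B].
have mL : measT (fun x => gn f n x - cc * psi x).
  apply: measurable_funB; last exact: measurable_funM.
  have -> : gn f n = fun x => (gn f n x - cc * phi x) + cc * phi x by apply/funext => x; rewrite subrK.
  by apply: measurable_funD; [exact: L.1|exact: measurable_funM].
have E : {ae mu, forall x, gn f n x - cc * phi x = gn f n x - cc * psi x}.
  by move: h; apply: filterS => x ->.
by split; [exact: (ae_L2 mL E L)|rewrite -(ae_nrm L mL E)].
Qed.

Lemma htr_ae_fun f f' phi : square_integrable Om f' -> {ae lamd, forall x, fc f x = fc f' x} ->
  htr f phi -> htr f' phi.
Proof.
move=> sf' h [sf mp H]; split; [exact: sf'|exact: mp|].
apply: (hcv_eq _ (fun=> erefl) H) => n x.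
have /square_integrableP[_ _ L1] := sf; have /square_integrableP[_ _ L2'] := sf'.
apply: (ae_ift (trn_intg n L1) (measurable_trn n L2'.1) _ x).
by move: h; apply: filterS => y; rewrite /trn => ->.
Qed.

End hartley_transform.

(** * Truncation and null sets on the torus *)

Section hartley_torus.
Context {R : realType} {d : nat}.
Notation V := 'rV[R]_d.
Notation lamd := (@lebesgue_rV R d).
Notation mu := (@fmu R d Torus).
Implicit Types (f g h phi psi : V -> R).

(** [8] is an integer above [2 * pi]: from this rank on, truncation to cubes leaves the cell
    untouched and the transforms are constant in [n]. *)
Lemma cell_cube8 n (x : V) : (8 <= n)%N -> cell Torus x -> cube n x.
Proof.
move=> n8 h i; have /andP[h0 h1] := h i; rewrite ger0_norm//.
have p4 : pi / 2 < 2 :> R by have /andP[] := pihalf_02 R.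
apply: (le_trans (ltW h1)); apply: (@le_trans _ _ 8); last by rewrite ler_nat.
by move: p4; rewrite ltr_pdivrMr// => p4; rewrite -[leRHS]/(2 * 4)%:R natrM ler_pM2l// (le_trans (ltW p4))// -natrM.
Qed.

Lemma trn_fcT n f : (8 <= n)%N -> trn n (fc Torus f) = fc Torus f.
Proof.
move=> n8; apply/funext => x; rewrite /trn /fc [\1_(cell _) x]indicE.
case: (boolP (x \in cell Torus)) => [/set_mem h|_]; last by rewrite mul0r mulr0.
by rewrite mul1r indicE mem_set ?mul1r//; exact: cell_cube8.
Qed.

Lemma gnT n f : (8 <= n)%N -> gn Torus f n = gn Torus f 8.
Proof. by move=> n8; rewrite /gn !trn_fcT. Qed.

Lemma fcT_intg f : L2 lamd (fc Torus f) -> intg lamd (fc Torus f).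
Proof. by move=> L; rewrite -(@trn_fcT 8 f)//; exact: trn_intg. Qed.

(** Every lattice point has mass 1, so none lies in a null set. *)
Lemma ae_muT (P : V -> Prop) (k : V) : {ae mu, forall x, P x} -> freqs Torus k -> P k.
Proof.
move=> [A [mA A0 sA]] Zk; apply: contrapT => nP.
have : (mu [set k] <= mu A)%E.
  by apply: le_measure; rewrite ?inE//; [exact: measurable_set1_rV|move=> x /= ->; exact: sA].
rewrite A0 leNgt => /negP; apply.
by rewrite (muT_pt Zk).2.
Qed.

End hartley_torus.

(** * Existence, injectivity and inversion of the transform *)

Section hartley_inversion.
Context {R : realType} {d : nat}.
Notation V := 'rV[R]_d.
Notation lamd := (@lebesgue_rV R d).
Notation cc := (@cc R d).
Implicit Types (f g h phi psi : V -> R) (Om : domain).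

Lemma fcW f : fc WholeSpace f = f.
Proof. by apply/funext => x; rewrite /fc /= indicT mul1r. Qed.

Lemma htr_ext Om f : square_integrable Om f -> exists phi, htr Om f phi.
Proof.
move=> sf; have /square_integrableP[dm mf L] := sf.
have c0 : cc != 0 by rewrite gt_eqF// cc_gt0.
case: Om sf dm mf L => sf dm mf L.
  have [chi [Lc cv _]] := transform_ext L.
  exists (fun x => cc^-1 * chi x); split => //; first by apply: measurable_funM => //; exact: Lc.1.
  move=> e /cv[N HN]; exists N => n /HN h.
  have E x : gn WholeSpace f n x - chi x = gn WholeSpace f n x - cc * (cc^-1 * chi x) by rewrite mulVKf.
  split; last by rewrite -(eq_nrm _ E).
  exact: (eq_L2 E (L2B (ift_trn_L2 n L) Lc)).
exists (fun x => cc^-1 * gn Torus f 8 x); split => //.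
  apply: measurable_funM => //; apply: measurable_ift; apply: measurable_trn; exact: L.1.
move=> e e0; exists 8%N => n n8.
have E x : 0 = gn Torus f n x - cc * (cc^-1 * gn Torus f 8 x) by rewrite mulVKf// gnT// subrr.
split; first exact: (eq_L2 E (L2_0 _)).
by rewrite -(eq_nrm _ E) nrm0 ltW.
Qed.

Lemma htr_inj0 Om g : htr Om g (fun=> 0) -> {ae lamd, forall x, fc Om g x = 0}.
Proof.
case: Om => -[sf _ H]; have /square_integrableP[dm mf L] := sf.
  apply: transform_inj => // e /H[N HN]; exists N => n /HN[_ h].
  by rewrite (eq_nrm _ (g := fun x => gn WholeSpace g n x - cc * 0))// => x; rewrite mulr0.
apply: torus_inj; first exact: fcT_intg.
move=> k Zk.
have H8 : hcv Torus (fun n => gn Torus g 8) (fun=> 0).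
  move=> e /H[N HN]; exists (maxn N 8) => n; rewrite geq_max => /andP[/HN h n8].
  by move: h; rewrite gnT// mulr0.
have mg : measT (gn Torus g 8).
  by apply: measurable_ift; apply: measurable_trn; exact: L.1.
have Hg : hcv Torus (fun n => gn Torus g 8) (gn Torus g 8).
  move=> e e0; exists 0%N => n _; have E x : 0 = gn Torus g 8 x - gn Torus g 8 x by rewrite subrr.
  split; first exact: (eq_L2 E (L2_0 _)).
  by rewrite -(eq_nrm _ E) nrm0 ltW.
have := ae_muT (hcv_unique mg (measurable_cst _) Hg H8) Zk.
by rewrite /gn trn_fcT.
Qed.

Lemma htr_inj Om f g phi psi : htr Om f phi -> htr Om g psi -> {ae fmu Om, forall x, phi x = psi x} ->
  {ae lamd, forall x, fc Om f x = fc Om g x}.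
Proof.
move=> hf hg h; have h1 := htr_lin 1 (-1) hf hg.
have h0 : htr Om (fun x => 1 * f x + -1 * g x) (fun=> 0).
  apply: htr_ae h1; first exact: measurable_cst.
  by move: h; apply: filterS => x ->; ring.
move: (htr_inj0 h0); apply: filterS => x; rewrite /fc => E.
by apply: subr0_eq; rewrite -[RHS]E; ring.
Qed.

Lemma htr_ift Om phi : intg (fmu Om) phi -> L2 (fmu Om) phi -> htr Om (ift Om phi) phi.
Proof.
case: Om => I L.
  have [Lb _] := bessel I L.
  have sq : square_integrable WholeSpace (ift WholeSpace phi).
    by apply/square_integrableP; split => //; [exact: Lb.1|rewrite fcW].
  split => //; first exact: L.1.
  move=> e /(transform_ift I L)[N HN]; exists N => n /HN; rewrite /gn fcW => h; split => //.
  exact: L2B (ift_trn_L2 n Lb) (L2Z _ L).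
have mi := measurable_ift Torus (intg_meas I).
have Lc : L2 lamd (fc Torus (ift Torus phi)).
  have I1 : L2 lamd (\1_(@cell R d Torus)).
    split; first exact: measurable_cell1.
    apply: eq_intg (intg_cell (R := R) (d := d)) => x; rewrite indicE; case: (_ \in _); first by rewrite expr1n.
    by rewrite expr0n.
  apply: (eq_L2 _ (L2M_bounded I1 mi (fun y => ift_bound y I))) => x; rewrite /fc; ring.
have sq : square_integrable Torus (ift Torus phi).
  by apply/square_integrableP; split => //; exact: ift_periodic.
split => //; first exact: L.1.
move=> e e0; exists 8%N => n n8.
have E : {ae fmu Torus, forall x, (0 : R) = gn Torus (ift Torus phi) n x - cc * phi x}.
  move: (ae_freqs (R := R) (d := d) Torus); apply: filterS => k Zk.
  rewrite -(coefficient I Zk) /gn trn_fcT// iftE -[LHS](subrr (\int[lamd]_x (\1_(cell Torus) x * ift Torus phi x * cas (dot x k)))).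
  by congr (_ - _); apply: eq_Int => x; rewrite /fc dotC.
have m : measT (fun x => gn Torus (ift Torus phi) n x - cc * phi x).
  apply: measurable_funB; first by apply: measurable_ift; apply: measurable_trn; exact: Lc.1.
  by apply: measurable_funM => //; exact: L.1.
split; first exact: (ae_L2 m E (L2_0 _)).
by rewrite -(ae_nrm (L2_0 _) m E) nrm0 ltW.
Qed.

Lemma parseval Om phi psi : intg (fmu Om) phi -> L2 (fmu Om) phi -> intg (fmu Om) psi -> L2 (fmu Om) psi ->
  \int[lamd]_x (fc Om (ift Om phi) x * ift Om psi x) = cc * \int[fmu Om]_k (phi k * psi k).
Proof.
case: Om => I1 L1 I2 L2'.
  rewrite -plancherel//.
  by apply: eq_Int => x; rewrite fcW.
rewrite -(torus_parseval I2 I1).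
by apply: eq_Int => x; rewrite /fc; ring.
Qed.

Lemma parseval_intg Om phi psi : intg (fmu Om) phi -> L2 (fmu Om) phi -> intg (fmu Om) psi -> L2 (fmu Om) psi ->
  intg lamd (fun x => fc Om (ift Om phi) x * ift Om psi x).
Proof.
move=> I1 L1 I2 L2'; have := L2M (fc_L2 (htr_ift I1 L1)) (fc_L2 (htr_ift I2 L2')).
apply: eq_intg => x; rewrite /fc indicE; case: (_ \in _); first by rewrite !mul1r.
by rewrite !mul0r.
Qed.

End hartley_inversion.

(** * From the complex Fourier transform to the Hartley transform *)

Section fourier_hartley.
Context {R : realType} {d : nat} (Om : domain).
Notation V := 'rV[R]_d.
Notation lamd := (@lebesgue_rV R d).
Notation mu := (@fmu R d Om).
Notation S := (@freqs R d Om).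
Notation cc := (@cc R d).
Notation nrm := (nrm mu).
Notation L2 := (L2 mu).
Notation Hs := (Hs Om).
Notation hn := (hn Om).
Implicit Types (f g h phi psi : V -> R) (F : V -> R[i]).

Lemma cvge0P {I : Type} {G : set_system I} {FG : Filter G} (u : I -> \bar R) : (forall i, 0 <= u i)%E ->
  (u x @[x --> G] --> 0%E) <-> (forall e, 0 < e -> \forall x \near G, (u x <= e%:E)%E).
Proof.
move=> u0; split.
  move=> /fine_cvgP[fu /cvgrPdist_le H] e e0; move: (H e e0) fu; apply: filterS2 => x h fx.
  by rewrite -(fineK fx) lee_fin -[leLHS]ger0_norm ?fine_ge0// -normrN -sub0r.
move=> H; apply/fine_cvgP.
have fin x (e : R) : (u x <= e%:E)%E -> u x \is a fin_num.
  by move=> h; rewrite ge0_fin_numE// (le_lt_trans h)// ltry.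
split; first by move: (H 1 ltr01); apply: filterS => x; exact: fin.
apply/cvgrPdist_le => e e0; move: (H e e0); apply: filterS => x h.
by rewrite sub0r normrN ger0_norm ?fine_ge0//= -lee_fin fineK// (fin _ _ h).
Qed.

(** For the kernel exp (- i x.xi), the real part and minus the imaginary part are the cosine and
    sine integrals, that is the even and odd parts of the Hartley transform. *)
Definition reS F := (fun x => complex.Re (F x)) \_ S.
Definition imS F := (fun x => - complex.Im (F x)) \_ S.

Lemma sqnormc_S (a b : R) F x : S x ->
  sqnormc (Complex a (- b) - F x) = (a - reS F x) ^+ 2 + (b - imS F x) ^+ 2.
Proof.
move=> Sx; rewrite /reS /imS /patch mem_set// /sqnormc.
by case: (F x) => u v /=; ring.
Qed.

Lemma truncated_fourierE f n xi : square_integrable Om f ->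
  truncated_fourier Om f n xi = Complex (ev (gn Om f n) xi) (- od (gn Om f n) xi).
Proof.
move=> /square_integrableP[_ mf L]; have I := trn_intg n L.
have E (c : V -> R) : \int[lamd]_(x in cell Om `&` cube n) (f x * c x) =
    \int[lamd]_x (trn n (fc Om f) x * c x).
  rewrite Rintegral_mkcond; apply: eq_Int => x; rewrite /patch /trn /fc in_setI !indicE.
  by case: (x \in cell Om); case: (x \in cube n); rewrite ?mul1r ?mul0r ?mulr0 ?mul0r.
have Ic : intg lamd (fun x => trn n (fc Om f) x * cos (dot x xi)).
  have h := intgM_bounded I (measurable_cos (measurable_dot xi)) (fun y => cos_max _).
  by apply: eq_intg h => y; rewrite mulrC.
have Is : intg lamd (fun x => trn n (fc Om f) x * sin (dot x xi)).
  have h := intgM_bounded I (measurable_sin (measurable_dot xi)) (fun y => sin_max _).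
  by apply: eq_intg h => y; rewrite mulrC.
have Ep : gn Om f n xi = \int[lamd]_x (trn n (fc Om f) x * cos (dot x xi)) +
     \int[lamd]_x (trn n (fc Om f) x * sin (dot x xi)).
  by rewrite -(IntD Ic Is); apply: eq_Int => x; rewrite dotC /cas mulrDr.
have Em : gn Om f n (- xi) = \int[lamd]_x (trn n (fc Om f) x * cos (dot x xi)) -
     \int[lamd]_x (trn n (fc Om f) x * sin (dot x xi)).
  rewrite -(IntB Ic Is); apply: eq_Int => x.
  by rewrite dotC dotNr /cas cosN sinN mulrBr.
by rewrite /truncated_fourier !E /ev /od Ep Em; congr Complex; field.
Qed.

Definition cplx phi x : R[i] := Complex (cc * ev phi x) (- (cc * od phi x)).

Lemma measurable_reS F : measurable_fun S (fun xi => complex.Re (F xi)) -> measT (reS F).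
Proof. by move=> h; apply/(measurable_restrictT _ (measurable_freqs Om)). Qed.

Lemma measurable_imS F : measurable_fun S (fun xi => complex.Im (F xi)) -> measT (imS F).
Proof.
move=> h; apply/(measurable_restrictT _ (measurable_freqs Om)).
exact: measurableT_comp.
Qed.

Lemma integral_sqnormc (w a b : V -> R) F : measT w -> (forall x, 0 <= w x) ->
  measT a -> measT b ->
  measT (reS F) -> measT (imS F) ->
  (\int[freq_measure Om]_(x in S) (w x * sqnormc (Complex (a x) (- b x) - F x))%:E =
   \int[mu]_x (w x * ((a x - reS F x) ^+ 2 + (b x - imS F x) ^+ 2))%:E)%E.
Proof.
move=> mw w0 ma mb mr mi; rewrite -integral_freqs; first last.
- by move=> x; rewrite lee_fin mulr_ge0// addr_ge0// sqr_ge0.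
- apply/measurable_EFinP; apply: measurable_funM => //; apply: measurable_funD;
    by apply: measurable_funX; apply: measurable_funB.
by apply: eq_integral => x /set_mem Sx; rewrite sqnormc_S.
Qed.

Lemma is_fourierP f F : is_fourier Om f F <->
  [/\ square_integrable Om f, measurable_fun S (fun xi => complex.Re (F xi)),
      measurable_fun S (fun xi => complex.Im (F xi)),
      hcv Om (fun n => ev (gn Om f n)) (reS F) & hcv Om (fun n => od (gn Om f n)) (imS F)].
Proof.
have K : square_integrable Om f -> measurable_fun S (fun xi => complex.Re (F xi)) ->
    measurable_fun S (fun xi => complex.Im (F xi)) ->
  ((\int[freq_measure Om]_(xi in S) (sqnormc (truncated_fourier Om f n xi - F xi))%:E)%E
        @[n --> \oo] --> 0%E) <->
  hcv Om (fun n => ev (gn Om f n)) (reS F) /\ hcv Om (fun n => od (gn Om f n)) (imS F).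
  move=> sf /measurable_reS mr /measurable_imS mi; have /square_integrableP[_ mf L] := sf.
  have mg n : measT (gn Om f n).
    by apply: measurable_ift; apply: measurable_trn; exact: measurable_fc.
  have mA n := measurable_ev (mg n); have mB n := measurable_od (mg n).
  pose A n x := ev (gn Om f n) x - reS F x; pose B n x := od (gn Om f n) x - imS F x.
  have mA' n : measT (A n) by exact: measurable_funB.
  have mB' n : measT (B n) by exact: measurable_funB.
  have E n : (\int[freq_measure Om]_(xi in S) (sqnormc (truncated_fourier Om f n xi - F xi))%:E =
    \int[mu]_x ((A n x) ^+ 2 + (B n x) ^+ 2)%:E)%E.
    transitivity (\int[freq_measure Om]_(xi in S) (1 * sqnormc (Complex (ev (gn Om f n) xi) (- od (gn Om f n) xi) - F xi))%:E)%E.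
      by apply: eq_integral => x _; rewrite mul1r truncated_fourierE.
    rewrite (integral_sqnormc (@measurable_cst _ _ V R setT (1 : R)) (fun=> ler01) (mA n) (mB n) mr mi).
    by apply: eq_integral => x _; rewrite mul1r.
  under eq_fun do rewrite E.
  have s0 n x : (0 <= ((A n x) ^+ 2 + (B n x) ^+ 2)%:E)%E by rewrite lee_fin addr_ge0 ?sqr_ge0.
  have mAB n : measT (fun x => ((A n x) ^+ 2 + (B n x) ^+ 2)%:E).
    by apply/measurable_EFinP; apply: measurable_funD; exact: measurable_funX.
  have U (C : nat -> V -> R) : (forall n, measT (C n)) ->
      (forall n x, (C n x) ^+ 2 <= (A n x) ^+ 2 + (B n x) ^+ 2) ->
      (forall e, 0 < e -> \forall n \near \oo, (\int[mu]_x ((A n x) ^+ 2 + (B n x) ^+ 2)%:E <= e%:E)%E) ->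
      forall e, 0 < e -> exists N, forall n, (N <= n)%N -> L2 (C n) /\ nrm (C n) <= e.
    move=> mC CAB H e e0; have [N _ HN] := H (e ^+ 2) (exprn_gt0 2 e0).
    exists N => n /HN h.
    have [LC nC] : L2 (C n) /\ nrm (C n) ^+ 2 <= e ^+ 2.
      apply: L2_ereal => //; apply: le_trans h; apply: ge0_le_integral => //.
        by move=> x _; rewrite lee_fin sqr_ge0.
        by apply/measurable_EFinP; exact: measurable_funX.
      by move=> x _; rewrite lee_fin.
    by split => //; rewrite -(ler_pXn2r (n := 2)) ?nnegrE ?nrm_ge0// ltW.
  split.
    move=> /cvge0P H; have {}H := H (fun n => integral_ge0 _ (fun x _ => s0 n x)).
    split; apply: U H => // n x; first by rewrite lerDl sqr_ge0.
    by rewrite lerDr sqr_ge0.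
  move=> [H1 H2]; apply/cvge0P; first by move=> n; apply: integral_ge0 => x _; exact: s0.
  move=> e e0; pose r := Num.min 1 (e / 2); have r0 : 0 < r by rewrite lt_min ltr01 divr_gt0.
  have [N1 h1] := H1 _ r0; have [N2 h2] := H2 _ r0; exists (maxn N1 N2) => // n /=.
  rewrite geq_max => /andP[/h1[LA nA] /h2[LB nB]].
  rewrite (_ : (\int[mu]_x _)%E = (nrm (A n) ^+ 2 + nrm (B n) ^+ 2)%:E); last first.
    by rewrite (IntE (intgD LA.2 LB.2)) (IntD LA.2 LB.2) !nrm_sqr.
  have sq (y : R) : 0 <= y -> y <= r -> y ^+ 2 <= e / 2.
    move=> y0 yr; have [r1 r2] : r <= 1 /\ r <= e / 2 by rewrite !ge_min !lexx orbT.
    by rewrite expr2 (le_trans (ler_pM y0 y0 (le_trans yr r1) (le_trans yr r2)))// mul1r.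
  by rewrite lee_fin (splitr e) lerD// sq// nrm_ge0.
split=> [[sf m1 m2 /(K sf m1 m2)[]]//|[sf m1 m2 h1 h2]].
by split => //; apply/(K sf m1 m2).
Qed.

Lemma hcv_opp (g : nat -> V -> R) phi : hcv Om g phi -> hcv Om (fun n x => g n (- x)) (fun x => phi (- x)).
Proof. by move=> h e /h[N HN]; exists N => n /HN[L B]; split; [exact: L2_opp L|rewrite (nrm_opp L)]. Qed.

Lemma hcv_ae (g : nat -> V -> R) phi psi : (forall n, measT (g n)) -> measT psi ->
  {ae mu, forall x, phi x = psi x} -> hcv Om g phi -> hcv Om g psi.
Proof.
move=> mg mp h H e /H[N HN]; exists N => n /HN[L B].
have m := measurable_funB (mg n) mp.
have E : {ae mu, forall x, g n x - phi x = g n x - psi x} by move: h; apply: filterS => x ->.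
by split; [exact: (ae_L2 m E L)|rewrite -(ae_nrm L m E)].
Qed.

Lemma htr_hcv f phi : htr Om f phi -> hcv Om (fun n => ev (gn Om f n)) (fun x => cc * ev phi x) /\
  hcv Om (fun n => od (gn Om f n)) (fun x => cc * od phi x).
Proof.
move=> [sf mp H]; have H' := hcv_opp H; split.
  by apply: hcv_eq (hcv_lin 2^-1 2^-1 H H') => [n x|x]; rewrite /ev; field.
by apply: hcv_eq (hcv_lin 2^-1 (- 2^-1) H H') => [n x|x]; rewrite /od; field.
Qed.

Lemma measurable_gn f n : square_integrable Om f -> measT (gn Om f n).
Proof.
by move=> /square_integrableP[_ mf _]; apply: measurable_ift; apply: measurable_trn; exact: measurable_fc.
Qed.

Lemma htr_fourier f phi F : htr Om f phi -> is_fourier Om f F ->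
  {ae mu, forall x, reS F x = cc * ev phi x /\ imS F x = cc * od phi x}.
Proof.
move=> hf /is_fourierP[sf mr mi h1 h2]; have [k1 k2] := htr_hcv hf; have [_ mp _] := hf.
have A := hcv_unique (measurable_reS mr) (measurable_funM (measurable_cst cc) (measurable_ev mp)) h1 k1.
have B := hcv_unique (measurable_imS mi) (measurable_funM (measurable_cst cc) (measurable_od mp)) h2 k2.
by move: A B; apply: filterS2 => x -> ->.
Qed.

Lemma fourier_htr f phi F : htr Om f phi ->
  measurable_fun S (fun xi => complex.Re (F xi)) -> measurable_fun S (fun xi => complex.Im (F xi)) ->
  {ae mu, forall x, reS F x = cc * ev phi x /\ imS F x = cc * od phi x} -> is_fourier Om f F.
Proof.
move=> hf mr mi h; have [k1 k2] := htr_hcv hf; have [sf mp _] := hf.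
have mg n := measurable_gn n sf.
apply/is_fourierP; split => //.
  apply: hcv_ae k1; [by move=> n; exact: measurable_ev|exact: measurable_reS|].
  by move: h; apply: filterS => x [-> _].
apply: hcv_ae k2; [by move=> n; exact: measurable_od|exact: measurable_imS|].
by move: h; apply: filterS => x [_ ->].
Qed.

Lemma htr_cplx f phi : htr Om f phi -> is_fourier Om f (cplx phi).
Proof.
move=> hf; have [sf mp _] := hf; apply: (fourier_htr hf).
- by apply: measurable_funTS; apply: measurable_funM => //; exact: measurable_ev.
- apply: measurable_funTS; apply: measurableT_comp => //; apply: measurable_funM => //; exact: measurable_od.
move: (ae_freqs (R := R) (d := d) Om); apply: filterS => x Sx.
by rewrite /reS /imS /patch mem_set//= opprK.
Qed.

(** A transform exists by [htr_ext], so [xget] returns an actual Fourier transform and not its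
    default value. *)
Lemma is_fourier_fourier f : square_integrable Om f -> is_fourier Om f (fourier Om f).
Proof. by move=> /htr_ext[phi /htr_cplx h]; exact: (xgetPex (cst 0) (ex_intro _ _ h)). Qed.

Lemma fourier_reim f phi : htr Om f phi ->
  {ae mu, forall x, reS (fourier Om f) x = cc * ev phi x /\ imS (fourier Om f) x = cc * od phi x}.
Proof. by move=> hf; have [sf _ _] := hf; apply: (htr_fourier hf); exact: is_fourier_fourier. Qed.

Lemma htr_abs_nabla f g phi : htr Om f phi -> htr Om g (fun x => eucl_norm x * phi x) -> is_abs_nabla Om f g.
Proof.
move=> hf hg; have [sf mp _] := hf; split => //.
have /is_fourierP[_ mr mi _ _] := is_fourier_fourier sf.
have mn := measurable_funTS (D := S) (@measurable_enorm R d).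
apply: (fourier_htr hg).
- apply: eq_measurable_fun (measurable_funM mn mr) => x _ /=.
  by case: (fourier Om f x) => u v /=; rewrite mul0r subr0.
- apply: eq_measurable_fun (measurable_funM mn mi) => x _ /=.
  by case: (fourier Om f x) => u v /=; rewrite mul0r addr0.
move: (fourier_reim hf); apply: filterS => x; rewrite /reS /imS /patch /ev /od enormN.
case: ifP => _; case: (fourier Om f x) => u v /=.
  by rewrite !mul0r subr0 addr0 -mulrN -mulrDr -mulrBr => -[-> ->]; split; ring.
move=> [e1 e2]; rewrite -mulrDr -mulrBr; split; [rewrite [X in 0 = X](_ : _ = eucl_norm x * (cc * ((phi x + phi (- x)) / 2))); last by ring|
  rewrite [X in 0 = X](_ : _ = eucl_norm x * (cc * ((phi x - phi (- x)) / 2))); last by ring].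
  by rewrite -e1 mulr0.
by rewrite -e2 mulr0.
Qed.

Lemma abs_nabla_htr f g phi : htr Om f phi -> is_abs_nabla Om f g -> htr Om g (fun x => eucl_norm x * phi x).
Proof.
move=> hf [sf fg]; have [_ mp _] := hf; have /is_fourierP[sg _ _ _ _] := fg.
have [chi hg] := htr_ext sg.
have mr : measT (fun x => eucl_norm x * phi x).
  by apply: measurable_funM => //; exact: measurable_enorm.
apply: (htr_ae mr _ hg); have c0 : cc != 0 by rewrite gt_eqF// cc_gt0.
have ns := ae_freqs (R := R) (d := d) Om.
move: ns (htr_fourier hg fg) (fourier_reim hf).
apply: filterS3 => x Sx; rewrite /reS /imS /patch mem_set//.
case: (fourier Om f x) => u v /=; rewrite !mul0r subr0 addr0 => -[e1 e2] [e3 e4].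
apply: (mulfI c0); rewrite (_ : chi x = ev chi x + od chi x); last by rewrite /ev /od; field.
by rewrite mulrDr -e1 -e2 -mulrN e3 e4 /ev /od; field.
Qed.

Lemma sobolev_ge0 s f : (0 <= sobolev_norm Om s f)%E.
Proof. exact: poweR_ge0. Qed.

Let w0 s (x : V) : 0 <= (1 + eucl_norm x ^+ 2) ^+ s.
Proof. by rewrite exprn_ge0// addr_ge0// sqr_ge0. Qed.

Let mw s : measT (fun x : V => (1 + eucl_norm x ^+ 2) ^+ s).
Proof.
by apply: measurable_funX; apply: measurable_funD => //; apply: measurable_funX; exact: measurable_enorm.
Qed.

Lemma sobolev_normE s f phi : htr Om f phi ->
  (sobolev_norm Om s f = (\int[mu]_x (cc ^+ 2 * ((1 + eucl_norm x ^+ 2) ^+ s * (ev phi x ^+ 2 + od phi x ^+ 2)))%:E) `^ (2^-1)%R)%E.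
Proof.
move=> hf; have [sf mp _] := hf; congr (_ `^ _)%E.
have /is_fourierP[_ mr mi _ _] := is_fourier_fourier sf.
have mrS := measurable_reS mr; have miS := measurable_imS mi.
transitivity (\int[freq_measure Om]_(x in S) ((1 + eucl_norm x ^+ 2) ^+ s * sqnormc (Complex 0 (- 0) - fourier Om f x))%:E)%E.
  apply: eq_integral => x _; rewrite /sqnormc; case: (fourier Om f x) => u v /=.
  by rewrite oppr0 !sub0r !sqrrN.
rewrite (integral_sqnormc (mw s) (w0 s) (@measurable_cst _ _ V R setT (0 : R)) (@measurable_cst _ _ V R setT (0 : R)) mrS miS).
apply: ge0_ae_eq_integral => //.
- apply/measurable_EFinP; apply: measurable_funM => //; apply: measurable_funD;
    by apply: measurable_funX; apply: measurable_funB.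
- apply/measurable_EFinP; apply: measurable_funM => //; apply: measurable_funM => //; apply: measurable_funD; apply: measurable_funX.
    exact: measurable_ev.
  exact: measurable_od.
- by move=> x _; rewrite lee_fin mulr_ge0// addr_ge0// sqr_ge0.
- by move=> x _; rewrite lee_fin mulr_ge0// ?sqr_ge0// mulr_ge0// addr_ge0// sqr_ge0.
by move: (fourier_reim hf); apply: filterS => x [-> ->] _ /=; congr (_%:E); rewrite /cst; ring.
Qed.

Lemma poweR_half_le (x : \bar R) (e : R) : (0 <= x)%E -> 0 <= e -> (x `^ 2^-1 <= e%:E)%E = (x <= (e ^+ 2)%:E)%E.
Proof.
case: x => [x||] x0 e0 //; last by rewrite poweRyr ?invr_eq0// !leNgt !ltry.
rewrite poweR_EFin !lee_fin powR12_sqrt// -{1}(ger0_norm e0) -sqrtr_sqr ler_sqrt//; exact: sqr_ge0.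
Qed.

Lemma sobolev_weight_le s (x : V) : (1 + eucl_norm x ^+ 2) ^+ s <= wgt s x ^+ 2.
Proof.
rewrite /wgt -exprM mulnC exprM lerXn2r ?nnegrE ?addr_ge0 ?sqr_ge0//.
by rewrite sqrrD expr1n mul1r -addrA lerD2l lerDr mulrn_wge0// enorm_ge0.
Qed.

Lemma sobolev_weight_ge s (x : V) : wgt s x ^+ 2 <= 2 ^+ s * (1 + eucl_norm x ^+ 2) ^+ s.
Proof.
rewrite /wgt -exprM mulnC exprM -exprMn lerXn2r ?nnegrE ?mulr_ge0 ?addr_ge0 ?sqr_ge0 ?enorm_ge0//.
by rewrite -subr_ge0 (_ : _ - _ = (1 - eucl_norm x) ^+ 2) ?sqr_ge0//; ring.
Qed.

Lemma mul_div_sqr (a c t : R) : c != 0 -> a / c ^+ 2 * (c ^+ 2 * t) = a * t.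
Proof. by move=> c0; rewrite mulrA divfK// expf_neq0. Qed.

Lemma weight_arith1 (a b c p q : R) : a <= b -> 0 <= c -> 0 <= p -> 0 <= q ->
  c * (a * ((p + q) / 2)) <= c / 2 * (b * p + b * q).
Proof.
move=> ab c0 p0 q0; rewrite (_ : c / 2 * _ = c * (b * ((p + q) / 2))); last by field.
by rewrite ler_wpM2l// ler_wpM2r// divr_ge0// addr_ge0.
Qed.

Lemma weight_arith2 (a b k p q : R) : b <= k * a -> 0 <= k * a -> 0 <= p -> 0 <= q ->
  b * p <= 2 * k * (a * ((p + q) / 2)).
Proof.
move=> bk ka p0 q0; rewrite (_ : 2 * k * _ = k * a * (p + q)); last by field.
by apply: (le_trans (ler_wpM2r p0 bk)); rewrite ler_wpM2l// lerDl.
Qed.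

Lemma sqr_evod phi (x : V) : ev phi x ^+ 2 + od phi x ^+ 2 = (phi x ^+ 2 + phi (- x) ^+ 2) / 2.
Proof. by rewrite /ev /od; field. Qed.

Lemma sobolev_norm_le s f phi : htr Om f phi -> Hs s phi -> (sobolev_norm Om s f <= (cc * hn s phi)%:E)%E.
Proof.
move=> hf H; have cc0 := ltW (@cc_gt0 R d); have [_ mp _] := hf.
rewrite (sobolev_normE s hf) poweR_half_le ?mulr_ge0 ?hn_ge0//; last first.
  by apply: integral_ge0 => x _; rewrite lee_fin mulr_ge0 ?sqr_ge0// mulr_ge0// addr_ge0 ?sqr_ge0.
pose g x := (wgt s x * phi x) ^+ 2; have [Ig' Eg] := intg_opp H.2.
have J := intgZ (cc ^+ 2 / 2) (intgD H.2 Ig').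
apply: (@le_trans _ _ (\int[mu]_x (cc ^+ 2 / 2 * (g x + g (- x)))%:E)%E).
  apply: ge0_le_integral => //.
  - by move=> x _; rewrite lee_fin mulr_ge0 ?sqr_ge0// mulr_ge0// addr_ge0 ?sqr_ge0.
  - apply/measurable_EFinP; apply: measurable_funM => //; apply: measurable_funM => //; apply: measurable_funD; apply: measurable_funX.
      exact: measurable_ev.
    exact: measurable_od.
  - by apply/measurable_EFinP; exact: (intg_meas J).
  move=> x _; rewrite lee_fin sqr_evod /g wgtN !exprMn.
  by apply: weight_arith1; rewrite ?sqr_ge0//; exact: sobolev_weight_le.
rewrite (IntE J) lee_fin (IntZ _ (intgD H.2 Ig')) (IntD H.2 Ig') Eg -nrm_sqr exprMn.
by rewrite le_eqVlt (_ : _ == _)//; apply/eqP; rewrite /hn; field.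
Qed.

(** A factor 2^s comes from comparing the two weights, a factor 2 from [phi x ^+ 2 <= 2 * (ev phi x
    ^+ 2 + od phi x ^+ 2)], and [cc] from the normalisation of [htr]. *)
Definition Ksob (s : nat) : R := Num.sqrt (2 ^+ s.+1) / cc.

Lemma Ksob_ge0 s : 0 <= Ksob s.
Proof. by rewrite divr_ge0// ?sqrtr_ge0// ltW// cc_gt0. Qed.

Lemma sobolev_norm_ge s f phi (e : R) : htr Om f phi -> 0 <= e -> (sobolev_norm Om s f <= e%:E)%E ->
  Hs s phi /\ hn s phi <= Ksob s * e.
Proof.
move=> hf e0; have cc0 := @cc_gt0 R d; have [_ mp _] := hf.
pose g x := cc ^+ 2 * ((1 + eucl_norm x ^+ 2) ^+ s * (ev phi x ^+ 2 + od phi x ^+ 2)).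
have g0 x : 0 <= g x by rewrite mulr_ge0 ?sqr_ge0// mulr_ge0// addr_ge0 ?sqr_ge0.
have mg : measT g.
  apply: measurable_funM => //; apply: measurable_funM => //; apply: measurable_funD; apply: measurable_funX.
    exact: measurable_ev.
  exact: measurable_od.
rewrite (sobolev_normE s hf) poweR_half_le//; last by apply: integral_ge0 => x _; rewrite lee_fin; exact: g0.
rewrite -/g => H; have mphi : measT (fun x => wgt s x * phi x).
  by apply: measurable_funM => //; exact: measurable_wgt.
have [L B] : L2 (fun x => wgt s x * phi x) /\ nrm (fun x => wgt s x * phi x) ^+ 2 <= (Ksob s * e) ^+ 2.
  apply: L2_ereal => //.
  pose K : R := 2 ^+ s.+1 / cc ^+ 2; have K0 : 0 <= K by rewrite /K divr_ge0// exprn_ge0// ltW.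
  apply: (@le_trans _ _ (\int[mu]_x (K%:E * (g x)%:E))%E).
    apply: ge0_le_integral => //.
    - by move=> x _; rewrite lee_fin sqr_ge0.
    - by apply/measurable_EFinP; exact: measurable_funX.
    - by apply/measurable_EFinP; apply: measurable_funM.
    move=> x _; rewrite -EFinM lee_fin exprMn.
    rewrite (_ : K * g x = 2 ^+ s.+1 * ((1 + eucl_norm x ^+ 2) ^+ s * (ev phi x ^+ 2 + od phi x ^+ 2))); last first.
      by apply: mul_div_sqr; rewrite gt_eqF.
    rewrite sqr_evod [2 ^+ s.+1]exprS.
    apply: (weight_arith2 (sobolev_weight_ge s x)); rewrite ?sqr_ge0//.
    by rewrite mulr_ge0// exprn_ge0.
  rewrite ge0_integralZl//; last 2 first.
  - by apply/measurable_EFinP.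
  - by move=> x _; rewrite lee_fin; exact: g0.
  apply: (le_trans (lee_wpmul2l _ H)) => //.
  rewrite -EFinM lee_fin /Ksob exprMn exprMn sqr_sqrtr ?exprn_ge0// exprVn.
  by rewrite /K.
by split => //; rewrite -(ler_pXn2r (n := 2)) ?nnegrE ?hn_ge0// mulr_ge0// Ksob_ge0.
Qed.

End fourier_hartley.

Lemma L2_pair_perturb d (T : measurableType d) (R : realType) (mu : {measure set T -> \bar R})
    (f g f' g' : T -> R) : L2 mu f -> L2 mu g -> L2 mu f' -> L2 mu g' ->
  `|\int[mu]_x (f x * g x) - \int[mu]_x (f' x * g' x)| <=
  nrm mu (fun x => f x - f' x) * nrm mu g + nrm mu f' * nrm mu (fun x => g x - g' x).
Proof.
move=> Lf Lg Lf' Lg'; have L1 := L2B Lf Lf'; have L3 := L2B Lg Lg'.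
rewrite -(IntB (L2M Lf Lg) (L2M Lf' Lg')).
rewrite (eq_Int mu (g := fun x => (f x - f' x) * g x + f' x * (g x - g' x))); last by move=> x; ring.
rewrite (IntD (L2M L1 Lg) (L2M Lf' L3)); apply: (le_trans (ler_normD _ _)).
by apply: lerD; exact: cauchy_schwarz.
Qed.

(** * Positivity and the Euler scheme *)

Section positivity.
Context {R : realType} {d : nat} (Om : domain) (p : nat) (hp : (d.+1 <= 2 * p)%N).
Notation V := 'rV[R]_d.
Notation rr := (@eucl_norm R d).
Notation lamd := (@lebesgue_rV R d).
Notation mu := (@fmu R d Om).
Notation S := (@freqs R d Om).
Notation L2 := (L2 mu).
Notation intg := (intg mu).
Notation nrm := (nrm mu).
Notation n1 := (n1 Om).
Notation Hs := (Hs Om).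
Notation Fs := (Fs Om).
Notation star := (kst Om (fun _ _ _ => 1)).
Notation ift := (ift Om).
Implicit Types phi psi chi : V -> R.

Lemma star_sup psi xi : L2 psi -> `|star psi psi xi| <= 2 * nrm psi ^+ 2.
Proof.
move=> L; have [Sx|nS] := pselect (S xi); last by rewrite kst_out// normr0 mulr_ge0// sqr_ge0.
have Le := ev_L2 L; have Lo := od_L2 L; have Ln := L2_opp L.
have I1 := L2M L (L2_reflect Sx Le); have I2 := L2M Ln (L2_reflect Sx Lo).
have b f g : L2 f -> L2 g -> nrm f <= nrm psi -> nrm g <= nrm psi ->
    `|\int[mu]_eta (f eta * g (xi - eta))| <= nrm psi ^+ 2.
  move=> Lf Lg nf ng; apply: (le_trans (cauchy_schwarz Lf (L2_reflect Sx Lg))).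
  by rewrite (nrm_reflect Sx Lg) expr2; apply: ler_pM => //; exact: nrm_ge0.
have ne : nrm (ev psi) <= nrm psi.
  rewrite (eq_nrm mu (g := fun x => 2^-1 * (psi x + psi (- x)))); last by move=> x; rewrite mulrC.
  rewrite nrmZ; last exact: L2D.
  rewrite ger0_norm ?invr_ge0// mulrC ler_pdivrMr// mulr_natr mulr2n.
  by apply: (le_trans (nrmD L Ln)); rewrite (nrm_opp L).
have no : nrm (od psi) <= nrm psi.
  rewrite (eq_nrm mu (g := fun x => 2^-1 * (psi x - psi (- x)))); last by move=> x; rewrite mulrC.
  rewrite nrmZ; last exact: L2B.
  rewrite ger0_norm ?invr_ge0// mulrC ler_pdivrMr// mulr_natr mulr2n.
  by apply: (le_trans (nrmB L Ln)); rewrite (nrm_opp L).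
rewrite kstE indicE mem_set// mulr1.
rewrite (eq_Int mu (g := fun eta => psi eta * ev psi (xi - eta) + psi (- eta) * od psi (xi - eta))); last first.
  by move=> eta; rewrite mul1r.
rewrite (IntD I1 I2) mulr_natl mulr2n; apply: (le_trans (ler_normD _ _)); apply: lerD.
  exact: b.
by apply: (b (fun x => psi (- x))) => //; rewrite (nrm_opp L).
Qed.

Lemma kst_eta k (a : V -> R) phi psi xi : (forall x, a (- x) = a x) ->
  kst Om (fun x y z => k x y z * a y) phi psi xi = kst Om k (fun x => a x * phi x) psi xi.
Proof.
move=> aN; rewrite !kstE; congr (_ * _); apply: eq_Int => eta.
by rewrite aN; ring.
Qed.

Lemma Fs_star s phi xi : mult s -> Hs p.+1 phi ->
  Fs s phi phi xi = star (fun x => s x * phi x) phi xi - s xi * star phi phi xi.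
Proof.
move=> ms H; have L := Hs_L2 H; have [Hs1 _] := mult_Hs ms H; have Ls := Hs_L2 Hs1.
have sN x : s (- x) = s x by case: ms.
have k1 : S xi -> kin Om (fun _ _ _ => 1) phi phi xi by move=> Sx; exact: kin1.
have k2 : S xi -> kin Om (fun _ y _ => 1 * s y) phi phi xi.
  move=> Sx; have := kin1 Sx Ls L; apply: eq_intg => eta.
  by rewrite sN; ring.
have k3 : S xi -> kin Om (fun x _ _ => (- s x) * 1) phi phi xi.
  by move=> Sx; have := intgZ (- s xi) (k1 Sx); apply: eq_intg => eta; ring.
rewrite FsE (_ : kF s = fun x y z => 1 * s y + (- s x) * 1); last first.
  by apply/funext => x; apply/funext => y; apply/funext => z; rewrite /kF; ring.
rewrite kst_kD//.
rewrite (@kst_eta (fun _ _ _ => 1) s)// (@kst_kZ _ _ Om (fun x => - s x) (fun _ _ _ => 1))//.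
by rewrite mulNr.
Qed.

(** Integrability is read off [Fs_star]: the function is the difference of the transform of a
    product and of [Fs s phi phi], both integrable. *)
Lemma star_mult_intg s phi : mult s -> Hs p.+1 phi ->
  [/\ intg (fun x => s x * star phi phi x), L2 (fun x => s x * star phi phi x) &
   forall x, ift (Fs s phi phi) x = ift phi x * ift (fun xi => s xi * phi xi) x -
     ift (fun xi => s xi * star phi phi xi) x].
Proof.
move=> ms H; have L := Hs_L2 H; have [I _] := embedS hp H.
have [Hs1 _] := mult_Hs ms H; have Ls := Hs_L2 Hs1; have [Is _] := embed hp Hs1.
have [HF _] := Fs_bound hp ms H H; have [IF _] := embed hp HF; have LF := Hs_L2 HF.
have J := star_intg Ls Is L I; have [LJ _] := star_bound Is Ls L.
have E xi : star (fun x => s x * phi x) phi xi - Fs s phi phi xi = s xi * star phi phi xi.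
  by rewrite Fs_star//; ring.
have I3 := eq_intg E (intgB J IF); split => //; first exact: (eq_L2 E (L2B LJ LF)).
move=> x; rewrite [ift phi x * _]mulrC -(ift_star x Ls Is L I) -(iftB x J I3).
by apply: eq_Int => xi; rewrite Fs_star.
Qed.

Lemma Hs_trn k n psi : L2 psi -> Hs k (trn n psi).
Proof.
move=> L; pose K : R := 1 + d%:R * n%:R ^+ 2; have K1 : 1 <= K by rewrite lerDl mulr_ge0// sqr_ge0.
have H0 : Hs 0 psi by rewrite HsE Hs0E.
have rK (x : V) : cube n x -> rr x <= K.
  move=> cx; rewrite -(ler_pXn2r (n := 2)) ?nnegrE ?enorm_ge0 ?(le_trans ler01 K1)//.
  rewrite enorm_sqr /dot; apply: (@le_trans _ _ (\sum_(i < d) (n%:R : R) ^+ 2)).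
    apply: ler_sum => i _; rewrite -expr2 -[leLHS]real_normK ?num_real// lerXn2r ?nnegrE//.
  have -> : \sum_(i < d) (n%:R : R) ^+ 2 = d%:R * n%:R ^+ 2 by rewrite sumr_const card_ord mulr_natl.
  apply: (@le_trans _ _ K); first by rewrite /K lerDr.
  by rewrite expr2 ler_peMr// (le_trans ler01 K1).
have C0 : 0 <= (1 + K) ^+ k by rewrite exprn_ge0// addr_ge0// (le_trans ler01 K1).
have m1 : measT (\1_(cube n) : V -> R) by apply: measurable_indic; exact: measurable_cube.
apply: (Hs_mul C0 m1 _ H0).1 => x; rewrite wgt0 mulr1 indicE.
case: (boolP (x \in cube n)) => [/set_mem cx|_]; last by rewrite normr0 mul0r.
by rewrite normr1 mul1r /wgt lerXn2r ?nnegrE ?addr_ge0 ?enorm_ge0 ?(le_trans ler01 K1)// lerD2l rK.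
Qed.

Variables (s : V -> R) (ms : mult s).
Hypothesis spos : forall phi x, L2 phi -> intg phi -> intg (fun xi => s xi * phi xi) ->
  intg (fun xi => s xi * star phi phi xi) ->
  0 <= 2 * ift phi x * ift (fun xi => s xi * phi xi) x - ift (fun xi => s xi * star phi phi xi) x.

(** Parseval carries the pointwise inequality [spos] for [psi], multiplied by [ift phi], to the
    frequency side. There the symbol is at most [|xi|] and the transform of the square at most twice
    the squared norm of [psi], which produces [n1] of [|xi| * phi]. *)
Lemma quasi_pos_regular phi psi : Hs p.+1 phi -> (forall x, 0 <= ift phi x) -> Hs p.+1 psi ->
  - (n1 (fun x => rr x * phi x) * nrm psi ^+ 2) <=
  \int[mu]_xi (psi xi * star phi (fun x => s x * psi x) xi).
Proof.
move=> H f0 Hq; have L := Hs_L2 H; have [I _] := embedS hp H.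
have Lq := Hs_L2 Hq; have [Iq _] := embedS hp Hq.
have [Hs1 _] := mult_Hs ms Hq; have Ls := Hs_L2 Hs1; have [Is _] := embed hp Hs1.
have J := star_intg L I Ls Is; have [LJ _] := star_bound I L Ls.
have [I3 L3 _] := star_mult_intg ms Hq.
set chi := star phi _ in J LJ *; set D := fun x => s x * star psi psi x in I3 L3.
have P1 := parseval Iq Lq J LJ; have Q1 := parseval_intg Iq Lq J LJ.
have P2 := parseval I L I3 L3; have Q2 := parseval_intg I L I3 L3.
have cmp : \int[lamd]_x (fc Om (ift phi) x * ift D x) <= \int[lamd]_x (2 * (fc Om (ift psi) x * ift chi x)).
  apply: Int_le Q2 (intgZ _ Q1) _ => x; rewrite (ift_star x L I Ls Is) /fc indicE.
  case: (_ \in _); last by rewrite !mul0r mulr0.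
  rewrite !mul1r -subr_ge0 (_ : _ - _ = ift phi x * (2 * ift psi x * ift (fun x => s x * psi x) x - ift D x)); last by ring.
  by apply: mulr_ge0 => //; exact: spos.
have cp := @cc_gt0 R d.
rewrite (IntZ _ Q1) P1 P2 mulrCA ler_pM2l// in cmp.
have lo : - (2 * nrm psi ^+ 2 * n1 (fun x => rr x * phi x)) <= \int[mu]_k (phi k * D k).
  have [Ir _] := embed_enorm hp H.
  rewrite lerNl -(IntN (L2M L L3)) n1E -(IntZ _ (intg_norm Ir)).
  apply: Int_le; [exact: intgN (L2M L L3)|exact: intgZ (intg_norm Ir)|].
  move=> k; apply: (le_trans (ler_norm _)).
  rewrite normrN /D (normrM (phi k)) (normrM (s k)) (normrM (rr k)).
  have [_ _ /(_ k)/andP[s0 sr] _] := ms.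
  rewrite (ger0_norm s0) (ger0_norm (enorm_ge0 k)).
  have b := star_sup k Lq; move: (normr_ge0 (star psi psi k)) b; move: `|star psi psi k| => t t0 tb.
  rewrite (_ : `|phi k| * (s k * t) = t * (s k * `|phi k|)); last by ring.
  by apply: ler_pM => //; [exact: mulr_ge0|exact: ler_wpM2r].
rewrite -(ler_pM2l (ltr0n R 2)); apply: (le_trans _ cmp); apply: (le_trans _ lo).
by apply: eq_ler; ring.
Qed.

(** By density: [psi] is truncated in frequency, which makes it regular without increasing the norms
    involved, and both sides are continuous under truncation. *)
Lemma quasi_pos_ift phi : Hs p.+1 phi -> (forall x, 0 <= ift phi x) -> quasi_pos Om s phi.
Proof.
move=> H f0 psi Lq Ls; have L := Hs_L2 H; have [I _] := embedS hp H.
set A := n1 _; have A0 : 0 <= A by exact: n1_ge0.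
have [LX NX] := star_bound I L Ls; set X := star phi _ in LX NX *.
(* [e / K] is the accuracy of the truncations that changes the right-hand integral by at most [e];
   the summand 1 keeps [K] positive. *)
pose K := 2 * n1 phi * nrm (fun x => s x * psi x) + nrm psi * (2 * n1 phi) + 1.
have n10 := n1_ge0 Om phi; have q0 := nrm_ge0 mu psi; have s0 := nrm_ge0 mu (fun x => s x * psi x).
have K0 : 0 < K by rewrite /K ltr_wpDl// addr_ge0// !mulr_ge0.
apply/ler_addgt0Pr => e e0; have eK := divr_gt0 e0 K0.
have [N1 h1] := trn_cv Lq eK; have [N2 h2] := trn_cv Ls eK.
pose n := maxn N1 N2; have {}h1 := h1 n (leq_maxl _ _); have {}h2 := h2 n (leq_maxr _ _).
set qn := trn n psi in h1; have Lqn : L2 qn by exact: trn_L2.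
have En x : s x * qn x = trn n (fun x => s x * psi x) x by rewrite /qn /trn mulrCA.
have Lsn : L2 (fun x => s x * qn x) by apply: (eq_L2 _ (trn_L2 n Ls)) => x; rewrite En.
have [LXn NXn] := star_bound I L Lsn; set Xn := star phi _ in LXn NXn.
have q := quasi_pos_regular H f0 (Hs_trn p.+1 n Lq); rewrite -/qn -/Xn -/A in q.
have nq : nrm qn <= nrm psi by apply: le_nrm => //; [exact: Lqn.1|move=> x; exact: trn_le].
have nsn : nrm (fun x => s x * qn x) <= nrm (fun x => s x * psi x).
  by apply: le_nrm => //; [exact: Lsn.1|move=> x; rewrite En; exact: trn_le].
have Lds := L2B Lsn Ls.
have [LDX NDX] := star_bound I L Lds.
have EX xi : star phi (fun x => s x * qn x - s x * psi x) xi = Xn xi - X xi.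
  by apply: kst_Br => Sx; exact: kin1.
rewrite (funext EX) in LDX NDX.
have d2 : nrm (fun x => s x * qn x - s x * psi x) <= e / K.
  by apply: le_trans h2; apply: eq_ler; apply: eq_nrm => x; rewrite En.
have pp := L2_pair_perturb Lqn LXn Lq LX.
have b3 : nrm (fun x => qn x - psi x) * nrm Xn + nrm psi * nrm (fun x => Xn x - X x) <= e.
  have nX : nrm Xn <= 2 * n1 phi * nrm (fun x => s x * psi x).
    by apply: (le_trans NXn); apply: ler_wpM2l => //; rewrite mulr_ge0.
  have nD : nrm (fun x => Xn x - X x) <= 2 * n1 phi * (e / K).
    by apply: (le_trans NDX); apply: ler_wpM2l d2; rewrite mulr_ge0.
  have t1 := ler_pM (nrm_ge0 _ _) (nrm_ge0 _ _) h1 nX; have t2 := ler_wpM2l q0 nD.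
  apply: (le_trans (lerD t1 t2)).
  rewrite (_ : _ + _ = e / K * (2 * n1 phi * nrm (fun x => s x * psi x) + nrm psi * (2 * n1 phi))); last by ring.
  by rewrite mulrAC ler_pdivrMr// ler_wpM2l ?(ltW e0)// /K lerDl.
have q2 : - (A * nrm psi ^+ 2) <= - (A * nrm qn ^+ 2).
  by rewrite lerN2 ler_wpM2l// lerXn2r ?nnegrE ?nrm_ge0.
apply: (le_trans q2); apply: (le_trans q).
by rewrite -lerBlDl; apply: (le_trans (ler_norm _)); apply: (le_trans pp).
Qed.

End positivity.

Section quasi_positivity.
Context {R : realType} {d : nat} (Om : domain) (p : nat) (hp : (d.+1 <= 2 * p)%N).
Notation V := 'rV[R]_d.
Implicit Types phi : V -> R.

Lemma quasi_pos_sub_mult (c : R -> R) phi : measT (c : measurableTypeR R -> R) ->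
  (forall s, 0 <= c s <= 1) -> Hs Om p.+1 phi -> (forall x, 0 <= ift Om phi x) ->
  quasi_pos Om (sub_mult c) phi.
Proof.
move=> mc c01; apply: (quasi_pos_ift hp); first exact: sub_mult_mult.
by move=> psi x; exact: sub_mult_positive.
Qed.

Lemma quasi_pos_enorm phi : Hs Om p.+1 phi -> (forall x, 0 <= ift Om phi x) ->
  quasi_pos Om (@eucl_norm R d) phi.
Proof.
move=> H f0; have c01 (s : R) : 0 <= (fun=> 1 : R) s <= 1 by rewrite ler01 lexx.
have := quasi_pos_sub_mult (@measurable_cst _ _ (measurableTypeR R) R setT 1) c01 H f0.
by rewrite (funext (@sub_mult1 R d)).
Qed.

End quasi_positivity.

Section small_arithmetic.
Context {R : realType}.
Implicit Types x y : R.

(** The product of [(1 + x) ^+ k] and [1 - k * x] stays at most 1 as [k] grows, and the second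
    factor is at least 1/2 at the end. *)
Lemma compound_le2 x n : 0 <= x -> n%:R * x <= 2^-1 -> (1 + x) ^+ n <= 2.
Proof.
move=> x0 h; have st k : (k <= n)%N -> (1 + x) ^+ k * (1 - k%:R * x) <= 1.
  elim: k => [|k IH] kn; first by rewrite expr0 mul0r subr0 mul1r.
  apply: (le_trans _ (IH (ltnW kn))); rewrite exprSr -mulrA ler_wpM2l ?exprn_ge0 ?addr_ge0//.
  rewrite -subr_ge0 -natr1 (_ : _ - _ = (k%:R + 1) * x ^+ 2); last by ring.
  by rewrite mulr_ge0 ?sqr_ge0// addr_ge0.
have h1 := st n (leqnn n); have h2 : 2^-1 <= 1 - n%:R * x by lra.
have e0 : 0 <= (1 + x) ^+ n by rewrite exprn_ge0// addr_ge0.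
have := le_trans (ler_wpM2l e0 h2) h1.
by rewrite ler_pdivrMr// mul1r.
Qed.

Lemma bernoulli_half x n : 0 <= x -> n%:R * x <= 2^-1 -> 2^-1 <= (1 - x) ^+ n.
Proof.
move=> x0 h; case: n h => [|n] h; first by rewrite expr0 invf_le1// ler1n.
have x1 : x <= 1.
  have n1 : x <= n.+1%:R * x by rewrite ler_peMl// ler1n.
  by apply: (le_trans n1); lra.
have st k : 1 - k%:R * x <= (1 - x) ^+ k.
  elim: k => [|k IH]; first by rewrite expr0 mul0r subr0.
  have y0 : 0 <= 1 - x by rewrite subr_ge0.
  rewrite exprSr; apply: (le_trans _ (ler_wpM2r y0 IH)).
  rewrite -subr_ge0 -natr1 (_ : _ - _ = k%:R * x ^+ 2); last by ring.
  by rewrite mulr_ge0 ?sqr_ge0.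
by apply: (le_trans _ (st n.+1)); lra.
Qed.

Lemma euler_arith (n2 b B q Q tau : R) : 0 <= n2 -> 0 <= b -> b <= B -> 0 <= q -> q <= Q ->
  0 <= tau -> tau * Q ^+ 2 <= 1 ->
  n2 * (1 + 2 * tau * b + tau ^+ 2 * q ^+ 2) <= (1 + tau * (2 * B + 1)) * n2.
Proof.
move=> n0 b0 bB q0 qQ t0 h; rewrite mulrC ler_wpM2r// -addrA lerD2l mulrDr mulr1.
apply: lerD.
  by rewrite (_ : 2 * tau * b = tau * (2 * b)); [rewrite ler_wpM2l// ler_wpM2l|ring].
rewrite expr2 -mulrA -[leRHS]mulr1 ler_wpM2l//; apply: le_trans h; apply: ler_wpM2l => //.
by rewrite lerXn2r ?nnegrE// (le_trans q0).
Qed.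

Lemma sqr_le2 x y c : 0 <= x -> 0 <= y -> c <= 2 -> x ^+ 2 <= c * y ^+ 2 -> x <= 2 * y.
Proof.
move=> x0 y0 c2 h; rewrite -(ler_pXn2r (n := 2)) ?nnegrE ?mulr_ge0//; apply: (le_trans h).
rewrite exprMn ler_wpM2r ?sqr_ge0//; lra.
Qed.

End small_arithmetic.

(** * Euler's method for the truncated equation *)

Section euler.
Context {R : realType} {d : nat} (Om : domain) (p : nat) (hp : (d.+1 <= 2 * p)%N).
Notation V := 'rV[R]_d.
Notation rr := (@eucl_norm R d).
Notation mu := (@fmu R d Om).
Notation L2 := (L2 mu).
Notation nrm := (nrm mu).
Notation n1 := (n1 Om).
Notation Hs := (Hs Om).
Notation hn := (hn Om).
Notation Fs := (Fs Om).
Notation tl := (tl Om p).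
Notation ift := (ift Om).
Notation sN N := (sub_mult (cut N) : V -> R).
Implicit Types phi psi : V -> R.

(** The exponent [p.+2] is the largest growth order among the weights in use, that of [tfun]; the
    Sobolev weight has order [p.+1]. *)
Definition energy_const (A : R) := (1 + 16 * 3 ^+ p.+2) * A.
(** [N * step_const A] bounds the coefficient of the quadratic term in [euler_energy]; [2 / JJ]
    comes from [cut_mult_bounded]. *)
Definition step_const (A : R) := 2 * A * (2 / JJ) + 16 * 3 ^+ p.+2 * A.

Lemma euler_weight g k phi (A N tau : R) : wfun g k -> (k <= p.+2)%N -> Hs p.+1 phi ->
  (forall x, 0 <= ift phi x) -> L2 (fun x => g (rr x) * phi x) ->
  n1 phi <= A -> n1 (fun x => rr x * phi x) <= A -> 1 <= N -> 0 <= tau ->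
  tau * (N * step_const A) ^+ 2 <= 1 ->
  L2 (fun x => g (rr x) * (phi x + tau * Fs (sN N) phi phi x)) /\
  nrm (fun x => g (rr x) * (phi x + tau * Fs (sN N) phi phi x)) ^+ 2 <=
    (1 + tau * (2 * energy_const A + 1)) * nrm (fun x => g (rr x) * phi x) ^+ 2.
Proof.
move=> wg kp H f0 Lw nA rA N1 t0 ht; have N0 : 0 <= N := le_trans ler01 N1.
have ms := @cut_mult R d N; have qp := quasi_pos_sub_mult hp (measurable_cut N) (cut01 N) H f0.
have sC x := @cut_mult_bounded R d N x N0.
have s0 (x : V) : 0 <= sN N x by case: ms => _ _ /(_ x)/andP[].
have Ls : L2 (fun x => sN N x * (g (rr x) * phi x)).
  apply: (L2M_bounded (M := 2 / JJ * N) Lw) => [|x]; first by case: ms.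
  by rewrite ger0_norm.
have [LF _] := weighted_Fs_L2 hp ms wg H Lw Ls.
have E := euler_energy hp ms wg H Lw Ls qp t0 sC.
split; first by apply: (eq_L2 _ (L2D Lw (L2Z tau LF))) => x; ring.
apply: (le_trans E).
have A0 : 0 <= A := le_trans (n1_ge0 Om _) nA.
have J0 : 0 <= 2 / (JJ : R) by rewrite divr_ge0// ltW// JJ_gt0.
have k3 : 3 ^+ k <= 3 ^+ p.+2 :> R by rewrite ler_weXn2l// ler1n.
apply: (@euler_arith _ _ _ (energy_const A) _ (N * step_const A)) => //.
- exact: sqr_ge0.
- by rewrite mulr_ge0 ?addr_ge0 ?mulr_ge0// n1_ge0.
- by apply: ler_pM => //; rewrite ?n1_ge0 ?addr_ge0 ?mulr_ge0// lerD2l ler_wpM2l.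
- have n0 := n1_ge0 Om; apply: addr_ge0; apply: mulr_ge0; try exact: n0.
  + by apply: mulr_ge0 => //; exact: n0.
  + exact: mulr_ge0.
  + exact: mulr_ge0.
rewrite /step_const mulrDr; apply: lerD.
  rewrite (_ : N * (2 * A * (2 / JJ)) = 2 * A * (2 / JJ * N)); last by ring.
  by apply: ler_wpM2r; [exact: mulr_ge0|exact: ler_wpM2l].
apply: (@le_trans _ _ (16 * 3 ^+ p.+2 * A)).
  by apply: ler_pM => //; rewrite ?n1_ge0 ?mulr_ge0// ler_wpM2l.
by apply: ler_peMl => //; apply: mulr_ge0 => //; apply: mulr_ge0 => //; exact: exprn_ge0.
Qed.

(** Writing [u] for [ift phi] and [L] for the truncated operator, [L (u^2) <= 2 u L u] gives
    [u L u - L (u^2) >= - u L u >= - 2 A u]: a step cannot lower [u] by more than the factor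
    [1 - 2 tau A]. *)
Lemma euler_positive phi (A N tau : R) x : Hs p.+1 phi -> (forall x, 0 <= ift phi x) ->
  n1 (fun x => rr x * phi x) <= A -> 0 <= tau ->
  (1 - tau * (2 * A)) * ift phi x <= ift (fun x => phi x + tau * Fs (sN N) phi phi x) x.
Proof.
move=> H f0 rA t0; have ms := @cut_mult R d N; have L := Hs_L2 H; have [I _] := embedS hp H.
have [Is nIs] := mult_n1 hp ms H; have [Iss Lss E] := star_mult_intg hp ms H.
have [HF _] := Fs_bound hp ms H H; have [IF _] := embed hp HF.
rewrite (iftD x I (intgZ tau IF)) (iftZ _ x IF) E mulrBl mul1r lerD2l -mulNr -subr_ge0.
have P := sub_mult_positive (measurable_cut N) (cut01 N) x L I Is Iss.
have b := le_trans (ift_bound x Is) (ler_wpM2l (ler0n R 2) (le_trans nIs rA)).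
move: b; rewrite ler_norml => /andP[_ b]; have fx := f0 x.
move: P b; set a := ift phi x in fx *; move: (ift (fun x => _) x) (ift (fun x => _) x) => y z P b.
have h : 0 <= a * (2 * A - z) by rewrite mulr_ge0// subr_ge0.
rewrite (_ : _ - _ = tau * ((2 * a * z - y) + a * (2 * A - z))); last by ring.
by rewrite mulr_ge0// addr_ge0.
Qed.

Variables (phi0 : V -> R) (H0 : Hs p.+1 phi0) (f0 : forall x, 0 <= ift phi0 x).

Definition sol_bound := 2 * hn p.+1 phi0.
Definition emb_bound := Kemb Om p (R := R) (d := d) * sol_bound.

Lemma sol_bound_ge0 : 0 <= sol_bound. Proof. by rewrite mulr_ge0// hn_ge0. Qed.
Lemma emb_bound_ge0 : 0 <= emb_bound. Proof. by rewrite mulr_ge0 ?Kemb_ge0// sol_bound_ge0. Qed.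

(* A convex set which contains all the Euler polygons and is closed under their
   limits. *)
Definition good phi := [/\ Hs p.+1 phi, hn p.+1 phi <= sol_bound,
  forall N, 0 < N -> tl N phi <= 2 * tl N phi0 & forall x, ift phi0 x / 2 <= ift phi x].

Lemma good_Hs phi : good phi -> Hs p.+1 phi. Proof. by case. Qed.

Lemma good_ge0 phi x : good phi -> 0 <= ift phi x.
Proof. by case=> _ _ _ /(_ x); apply: le_trans; rewrite divr_ge0. Qed.

Lemma good_n1 phi : good phi -> n1 phi <= emb_bound /\ n1 (fun x => rr x * phi x) <= emb_bound.
Proof.
move=> [H nH _ _]; have [_ h1] := embedS hp H; have [_ h2] := embed_enorm hp H.
by split; [apply: (le_trans h1)|apply: (le_trans h2)]; rewrite ler_wpM2l// Kemb_ge0.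
Qed.

Lemma tl_ge0 N phi : 0 <= tl N phi. Proof. exact: nrm_ge0. Qed.

Lemma tlD N phi psi : 0 < N -> Hs p.+1 phi -> Hs p.+1 psi ->
  tl N (fun x => phi x + psi x) <= tl N phi + tl N psi.
Proof.
move=> N0 H1 H2; have [L1 _] := tl_L2 N0 H1; have [L2' _] := tl_L2 N0 H2.
apply: le_trans (nrmD L1 L2'); apply: eq_ler.
by apply: eq_nrm => x; rewrite mulrDr.
Qed.

Lemma tlZ N a phi : 0 < N -> Hs p.+1 phi -> tl N (fun x => a * phi x) = `|a| * tl N phi.
Proof.
move=> N0 H1; have [L1 _] := tl_L2 N0 H1; rewrite -[RHS](nrmZ a L1).
by apply: eq_nrm => x; rewrite mulrCA.
Qed.

Lemma good_convex phi psi a : 0 <= a <= 1 -> good phi -> good psi ->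
  good (fun x => (1 - a) * phi x + a * psi x).
Proof.
move=> /andP[a0 a1] [H1 n1' t1 p1] [H2 n2' t2 p2].
have b0 : 0 <= 1 - a by rewrite subr_ge0.
have cx (u v c : R) : u <= c -> v <= c -> (1 - a) * u + a * v <= c.
  move=> uc vc; apply: (le_trans (lerD (ler_wpM2l b0 uc) (ler_wpM2l a0 vc))).
  by rewrite -mulrDl subrK mul1r.
have Ha := HsZ (1 - a) H1; have Hb := HsZ a H2; split.
- exact: HsD.
- apply: (le_trans (hnD Ha Hb)); rewrite (hnZ _ H1) (hnZ _ H2) !ger0_norm//; exact: cx.
- move=> N N0; apply: (le_trans (tlD N0 Ha Hb)); rewrite (tlZ _ N0 H1) (tlZ _ N0 H2) !ger0_norm//.
  by apply: cx; [exact: t1|exact: t2].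
move=> x; have [I1 _] := embedS hp H1; have [I2 _] := embedS hp H2.
rewrite (iftD x (intgZ _ I1) (intgZ _ I2)) (iftZ _ x I1) (iftZ _ x I2).
apply: le_trans (lerD (ler_wpM2l b0 (p1 x)) (ler_wpM2l a0 (p2 x))).
by rewrite -mulrDl subrK mul1r.
Qed.

Lemma good_limit psi : Hs p.+1 psi ->
  (forall e, 0 < e -> exists2 phi, good phi & hn p.+1 (fun x => psi x - phi x) <= e) -> good psi.
Proof.
move=> H h; split => //.
- apply/ler_addgt0Pr => e /h[phi [H1 b _ _] ne]; have Hd := HsB H H1.
  rewrite addrC; have -> : hn p.+1 psi = hn p.+1 (fun x => (psi x - phi x) + phi x).
    by congr (hn _ _); apply/funext => x; rewrite subrK.
  by apply: (le_trans (hnD Hd H1)); exact: lerD.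
- move=> N N0; apply/ler_addgt0Pr => e /h[phi [H1 _ b _] ne]; have Hd := HsB H H1.
  rewrite addrC; have -> : tl N psi = tl N (fun x => (psi x - phi x) + phi x).
    by congr (tl _ _); apply/funext => x; rewrite subrK.
  apply: (le_trans (tlD N0 Hd H1)); apply: lerD; last exact: b.
  by apply: le_trans ne; have [] := tl_L2 N0 Hd.
move=> x; apply/ler_addgt0Pr => e e0; pose K := 2 * Kemb Om p (R := R) (d := d) + 1.
have K0 : 0 < K by rewrite ltr_wpDl// mulr_ge0// Kemb_ge0.
have [phi [H1 _ _ b] ne] := h _ (divr_gt0 e0 K0); have Hd := HsB H H1.
have [I1 _] := embedS hp H1; have [I _] := embedS hp H; have [Id nd] := embedS hp Hd.
have := ift_bound x Id; rewrite (iftB x I I1) ler_distlC => /andP[_ c].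
apply: (le_trans (b x)); rewrite -lerBlDr; move: c; rewrite -lerBlDr; apply: le_trans.
have Ke : 0 <= Kemb Om p (R := R) (d := d) by exact: Kemb_ge0.
rewrite lerD2l lerN2; apply: (le_trans (ler_wpM2l (ler0n R 2) (le_trans nd (ler_wpM2l Ke ne)))).
rewrite mulrA (_ : _ * (e / K) = e * ((2 * Kemb Om p (R := R) (d := d)) / K)); last by ring.
by rewrite ler_piMr ?(ltW e0)// ler_pdivrMr// mul1r /K lerDl.
Qed.

Variables (N tau T : R) (N1 : 1 <= N) (tau0 : 0 < tau).
Let A := emb_bound.
Let D := 2 * energy_const A + 1.
Hypotheses (htau : tau * (N * step_const A) ^+ 2 <= 1) (hT : T * D <= 2^-1).

Definition euler n : V -> R := iter n (fun phi x => phi x + tau * Fs (sN N) phi phi x) phi0.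

Let D0 : 2 * A + 1 <= D.
Proof.
rewrite /D /energy_const lerD2r ler_wpM2l// ler_peMl ?emb_bound_ge0// lerDl mulr_ge0// exprn_ge0//.
Qed.

Let step_le n : n%:R * tau <= T -> n%:R * (tau * D) <= 2^-1 /\ n%:R * (tau * (2 * A)) <= 2^-1.
Proof.
move=> h; have A0 := emb_bound_ge0; have DD : 0 <= D by apply: le_trans D0; rewrite addr_ge0// mulr_ge0.
have h1 : n%:R * (tau * D) <= 2^-1 by rewrite mulrA; apply: le_trans hT; rewrite ler_wpM2r.
split => //; apply: le_trans h1; rewrite ler_wpM2l// ler_wpM2l ?(ltW tau0)//.
by apply: le_trans D0; rewrite lerDl.
Qed.

(** Over a total time [T] with [T * D <= 1/2], the compounded growth stays below 2 and the
    compounded decay above 1/2; these are the constants in [good]. *)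
Let euler_inv n : n%:R * tau <= T ->
  [/\ Hs p.+1 (euler n), hn p.+1 (euler n) ^+ 2 <= (1 + tau * D) ^+ n * hn p.+1 phi0 ^+ 2,
   forall M, 0 < M -> tl M (euler n) ^+ 2 <= (1 + tau * D) ^+ n * tl M phi0 ^+ 2 &
   forall x, (1 - tau * (2 * A)) ^+ n * ift phi0 x <= ift (euler n) x] ->
  good (euler n).
Proof.
move=> /step_le[h1 h2] [H b t q]; have A0 := emb_bound_ge0; have DD : 0 <= D by apply: le_trans D0; rewrite addr_ge0// mulr_ge0.
have c2 := compound_le2 (mulr_ge0 (ltW tau0) DD) h1.
split => //.
- by apply: sqr_le2 b; rewrite ?hn_ge0.
- by move=> M M0; apply: sqr_le2 (t M M0); rewrite ?tl_ge0.
move=> x; apply: le_trans (q x); rewrite mulrC ler_wpM2r//.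
by apply: bernoulli_half => //; rewrite mulr_ge0 ?(ltW tau0)// mulr_ge0.
Qed.

(** The induction carries the compounded bounds, not [good], whose constants would deteriorate; at
    each stage [good] is deduced and supplies the fixed bound [A] of the next step. *)
Lemma euler_good n : n%:R * tau <= T -> good (euler n).
Proof.
move=> h; apply: (euler_inv h).
elim: n h => [|n IH] h.
  by split; rewrite ?expr0 ?mul1r// => *; rewrite ?mul1r.
have hn' : n%:R * tau <= T by apply: le_trans h; rewrite ler_wpM2r ?(ltW tau0)// ler_nat.
have [H b t q] := IH hn'; have G := euler_inv hn' (IH hn').
have [nA rA] := good_n1 G; have g0 x := good_ge0 x G.
have A0 := emb_bound_ge0; have DD : 0 <= 1 + tau * D by rewrite addr_ge0// mulr_ge0 ?(ltW tau0)//; apply: le_trans D0; rewrite addr_ge0// mulr_ge0.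
have W g k (wg : wfun g k) (kp : (k <= p.+2)%N) (Lw : L2 (fun x => g (rr x) * euler n x)) :=
  euler_weight wg kp H g0 Lw nA rA N1 (ltW tau0) htau.
have [L1 n1'] := W _ _ (wfun_1DX p.+1) (leqnSn _) H.
split.
- exact: L1.
- apply: (le_trans n1'); rewrite [(1 + tau * D) ^+ n.+1]exprS -mulrA; exact: ler_wpM2l.
- move=> M M0; have [Lt _] := tl_L2 M0 H.
  have pp : (p.+1 + 1 <= p.+2)%N by rewrite addn1.
  have [_ n2'] := W _ _ (wfun_tfun p M0) pp Lt.
  apply: (le_trans n2'); rewrite [(1 + tau * D) ^+ n.+1]exprS -mulrA; apply: ler_wpM2l => //; exact: t.
move=> x; apply: le_trans (euler_positive N x H g0 rA (ltW tau0)).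
rewrite exprS -mulrA; apply: ler_wpM2l; last exact: q.
have [_ h2] := step_le h; rewrite subr_ge0.
have : tau * (2 * A) <= n.+1%:R * (tau * (2 * A)) by rewrite ler_peMl ?ler1n// mulr_ge0 ?(ltW tau0)// mulr_ge0.
by move=> h3; apply: (le_trans h3); apply: (le_trans h2); rewrite invf_le1// ler1n.
Qed.

End euler.

Ltac nonneg := repeat first [assumption | exact: ler0n | exact: ler01 | apply: mulr_ge0 |
  apply: addr_ge0 | apply: exprn_ge0 | rewrite invr_ge0 | apply: ltW; assumption].

(** * Polygonal interpolation *)

Section interpolation.
Context {R : realType} {d : nat} (Om : domain).
Notation V := 'rV[R]_d.
Notation Hs := (Hs Om).
Notation hn := (hn Om).
Variables (b F : nat -> V -> R) (tau : R) (tau0 : 0 < tau).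
Hypothesis bS : forall n x, b n.+1 x = b n x + tau * F n x.

Definition lin m t x : R := b m x + (t - m%:R * tau) * F m x.

Lemma lin_start m x : lin m (m%:R * tau) x = b m x.
Proof. by rewrite /lin subrr mul0r addr0. Qed.

Lemma lin_end m x : lin m (m.+1%:R * tau) x = b m.+1 x.
Proof. by rewrite /lin bS -mulrBl -natr1 addrAC subrr add0r mul1r. Qed.

Lemma lin_convex m t x : lin m t x =
  (1 - (t - m%:R * tau) / tau) * b m x + (t - m%:R * tau) / tau * b m.+1 x.
Proof. by rewrite /lin bS; field; rewrite gt_eqF. Qed.

(** The increment of the polygon is a time average of its slopes, each within [e] of [g]; the
    induction removes the first, possibly partial, segment. *)
Lemma lin_slope q g (e : R) k : forall m t t', 0 <= e ->
  (forall i, (m <= i <= m + k)%N -> Hs q (fun x => F i x - g x) /\ hn q (fun x => F i x - g x) <= e) ->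
  m%:R * tau <= t -> t <= m.+1%:R * tau -> (m + k)%:R * tau <= t' -> t <= t' ->
  Hs q (fun x => lin (m + k) t' x - lin m t x - (t' - t) * g x) /\
  hn q (fun x => lin (m + k) t' x - lin m t x - (t' - t) * g x) <= (t' - t) * e.
Proof.
elim: k => [|k IH] m t t' e0 hF h1 h2 h3 h4.
  have [H n] : Hs q (fun x => F m x - g x) /\ hn q (fun x => F m x - g x) <= e by apply: hF; rewrite addn0 leqnn.
  have E : (fun x => lin (m + 0) t' x - lin m t x - (t' - t) * g x) = fun x => (t' - t) * (F m x - g x).
    by apply/funext => x; rewrite addn0 /lin; ring.
  rewrite E; split; first exact: HsZ.
  by rewrite (hnZ _ H) ger0_norm ?subr_ge0// ler_wpM2l ?subr_ge0.
have [Hm nm] : Hs q (fun x => F m x - g x) /\ hn q (fun x => F m x - g x) <= e.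
  by apply: hF; rewrite leqnn leq_addr.
have mk : (m + k.+1 = m.+1 + k)%N by rewrite addnS addSn.
pose t2 := m.+1%:R * tau; have t2t : t2 <= t'.
  by apply: le_trans h3; rewrite ler_wpM2r ?(ltW tau0)// ler_nat mk leq_addr.
have [H2 n2] : Hs q (fun x => lin (m.+1 + k) t' x - lin m.+1 t2 x - (t' - t2) * g x) /\
  hn q (fun x => lin (m.+1 + k) t' x - lin m.+1 t2 x - (t' - t2) * g x) <= (t' - t2) * e.
  apply: IH => //; last by rewrite -mk.
    by move=> i /andP[i1 i2]; apply: hF; rewrite mk i2 andbT ltnW.
  by rewrite ler_wpM2r ?(ltW tau0)// ler_nat.
have E : (fun x => lin (m + k.+1) t' x - lin m t x - (t' - t) * g x) =
   fun x => (lin (m.+1 + k) t' x - lin m.+1 t2 x - (t' - t2) * g x) + (t2 - t) * (F m x - g x).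
  by apply/funext => x; rewrite mk lin_start -lin_end -/t2 /lin; ring.
have H3 := HsZ (t2 - t) Hm; rewrite E; split; first exact: HsD.
apply: (le_trans (hnD H2 H3)); rewrite (hnZ _ Hm) ger0_norm ?subr_ge0//.
rewrite (_ : (t' - t) * e = (t' - t2) * e + (t2 - t) * e); last by ring.
by apply: lerD => //; rewrite ler_wpM2l// subr_ge0.
Qed.

End interpolation.

Lemma interpolation_split {R : realType} (a c f g t nt mt nk : R) :
  (a + (t - mt) * f) - (c + (t - nk) * g) =
  ((t - nt) * f - (c - (a + (nt - mt) * f))) - (t - nk) * g.
Proof. by ring. Qed.

Lemma sub_le_add {R : realType} (a b c e : R) : a <= c + e -> b - c <= b - a + e.
Proof. lra. Qed.

Lemma quarter_arith {R : realType} (C e : R) : 0 <= C -> 0 < e ->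
  C * (e / 4 / (C + 1) + e / 4 / (C + 1)) <= e / 2.
Proof.
move=> C0 e0; have C1 : 0 < C + 1 by rewrite ltr_wpDl.
rewrite (_ : _ * _ = e / 2 * (C / (C + 1))); last by field; rewrite gt_eqF.
by rewrite ler_piMr ?divr_ge0 ?(ltW e0)// ler_pdivrMr// mul1r lerDl.
Qed.

(** * Convergence of the Euler curves *)

Section existence.
Context {R : realType} {d : nat} (Om : domain) (p : nat) (hp : (d.+1 <= 2 * p)%N).
Notation V := 'rV[R]_d.
Notation rr := (@eucl_norm R d).
Notation mu := (@fmu R d Om).
Notation L2 := (L2 mu).
Notation nrm := (nrm mu).
Notation Hs := (Hs Om).
Notation hn := (hn Om).
Notation Fs := (Fs Om).
Notation ift := (ift Om).
Notation tl := (tl Om p).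
Notation sN N := (sub_mult (cut N) : V -> R).
Implicit Types phi psi : V -> R.

Lemma wfunZ (c : R) g k : 0 <= c -> wfun g k -> wfun (fun t : R => c * g t) k.
Proof.
move=> c0 [m g0 gm gk]; split.
- by apply: measurable_funM.
- by move=> t t0; rewrite mulr_ge0// g0.
- by move=> t s t0 ts; rewrite ler_wpM2l// gm.
by move=> t s t0 ts; rewrite -mulrA [leRHS]mulrCA ler_wpM2l// gk.
Qed.

Lemma cut_arith (N M r K : R) : 1 <= N -> N <= M -> 0 <= r -> 0 <= K ->
  K * r * (r / (M + `|r|)) <= K / N * (1 + r) ^+ 2.
Proof.
move=> N1 NM r0 K0; have N0 : 0 < N := lt_le_trans ltr01 N1; have M0 : 0 < M := lt_le_trans N0 NM.
have Mr : 0 < M + r by rewrite ltr_pwDl.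
rewrite (ger0_norm r0) -mulrA -[leRHS]mulrA ler_wpM2l// [N^-1 * _]mulrC mulrA.
apply: ler_pM; [exact: mulr_ge0|by rewrite invr_ge0 ltW| |].
  by rewrite expr2 ler_pM// lerDr.
by rewrite lef_pV2 ?posrE// (le_trans NM)// lerDl.
Qed.

Lemma cut_diff (N N' : R) (x : V) : 1 <= N -> N <= N' ->
  `|sN N' x - sN N x| <= 2 * (Kcut : R) / N * (1 + rr x) ^+ 2.
Proof.
move=> N1 NN; have N0 : 0 < N := lt_le_trans ltr01 N1; have N'0 : 0 < N' := lt_le_trans N0 NN.
have r0 := enorm_ge0 x; have K0 := @Kcut_ge0 R.
have b M : N <= M -> `|sN M x - rr x| <= Kcut / N * (1 + rr x) ^+ 2.
  move=> NM; have M0 : 0 < M := lt_le_trans N0 NM.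
  by apply: (le_trans (cut_mult_close x M0)); exact: cut_arith.
rewrite (_ : _ - _ = (sN N' x - rr x) - (sN N x - rr x)); last by ring.
apply: (le_trans (ler_normB _ _)); apply: (le_trans (lerD (b _ NN) (b _ (lexx _)))).
by rewrite -[leLHS]mulr2n -[leLHS]mulr_natl !mulrA.
Qed.

Lemma Hs_complete k (f : nat -> V -> R) : (forall n, Hs k (f n)) ->
  (forall e, 0 < e -> exists N, forall m n, (N <= m)%N -> (N <= n)%N -> hn k (fun x => f m x - f n x) <= e) ->
  exists2 g, Hs k g & forall e, 0 < e -> exists N, forall n, (N <= n)%N -> hn k (fun x => f n x - g x) <= e.
Proof.
move=> Hf C; pose h n x := wgt k x * f n x.
have Ch e : 0 < e -> exists N, forall m n, (N <= m)%N -> (N <= n)%N -> nrm (fun x => h m x - h n x) <= e.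
  move=> /C[N HN]; exists N => m n hm hn'; apply: le_trans (HN m n hm hn').
  by apply: eq_ler; apply: eq_nrm => x; rewrite mulrBr.
have [g Lg cg] := L2_complete Hf Ch.
have w0 (x : V) : wgt k x != 0 by rewrite gt_eqF// wgt_gt0.
exists (fun x => (wgt k x)^-1 * g x).
  by apply: eq_L2 Lg => x; rewrite mulVKf.
move=> e /cg[N HN]; exists N => n /HN; apply: le_trans.
by apply: eq_ler; apply: eq_nrm => x; rewrite mulrBr mulVKf.
Qed.

Variables (phi0 : V -> R) (H0 : Hs p.+1 phi0) (f0 : forall x, 0 <= ift phi0 x).
Let M := sol_bound Om p phi0.
Let A := emb_bound Om p phi0.
Let D := 2 * energy_const p A + 1.
Notation Ke := (Kemb Om p (R := R) (d := d)).
Notation good := (good Om p phi0).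

Let M0 : 0 <= M. Proof. exact: sol_bound_ge0. Qed.
Let A0 : 0 <= A. Proof. exact: emb_bound_ge0. Qed.
Let Ke0 : 0 <= Ke. Proof. exact: Kemb_ge0. Qed.

Let p1 : (1 <= p)%N. Proof. by case: (p) hp. Qed.

Definition rate_bound := 2 * 2 ^+ p * 2 * Ke *
  (M * M).

Lemma rate_bound_ge0 : 0 <= rate_bound.
Proof. by have := M0; have := Ke0; rewrite /rate_bound => k0 m0; nonneg. Qed.

Lemma good_rate s phi : mult s -> good phi -> Hs p (Fs s phi phi) /\ hn p (Fs s phi phi) <= rate_bound.
Proof.
move=> ms [H n _ _]; have [HF nF] := Fs_bound hp ms H H; split => //.
apply: (le_trans nF); apply: ler_wpM2l; first by have := Ke0 => k0; nonneg.
by apply: ler_pM => //; exact: hn_ge0.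
Qed.

Definition cut_const := 8 * 2 ^+ (0 + 2) * (A * (2 * (Kcut : R) * M)).

(** The symbols differ by at most a multiple of (1 + |xi|)^2 / N. Two derivatives are thus spent for
    a gain of 1/N, which H^(p+1) affords since [p] is positive. *)
Lemma good_cut phi (N N' : R) : good phi -> 1 <= N -> N <= N' ->
  L2 (fun x => Fs (sN N') phi phi x - Fs (sN N) phi phi x) /\
  nrm (fun x => Fs (sN N') phi phi x - Fs (sN N) phi phi x) <= cut_const / N.
Proof.
move=> G N1 NN; have [H n _ _] := G; have N0 : 0 < N := lt_le_trans ltr01 N1.
have [nA _] := good_n1 hp G; have K0 := @Kcut_ge0 R.
have c0 : 0 <= 2 * (Kcut : R) / N by nonneg.
have we := wfunZ c0 (@wfun_1DX R 2).
have p2 : (2 <= p.+1)%N by rewrite ltnS.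
have [H2 n2] := Hs_le p2 H.
have Le := L2Z (2 * (Kcut : R) / N) H2.
have e2 x : (1 + rr x) ^+ 0 * (2 * (Kcut : R) / N * (1 + rr x) ^+ 2) * phi x =
   2 * (Kcut : R) / N * (wgt 2 x * phi x) by rewrite expr0 mul1r mulrA.
have Le' : L2 (fun x => (1 + rr x) ^+ 0 * (2 * (Kcut : R) / N * (1 + rr x) ^+ 2) * phi x).
  by apply: eq_L2 Le => x; rewrite e2.
have [h1 h2] := change_mult hp (cut_mult N') (cut_mult N) we (fun x => cut_diff x N1 NN) H Le'.
rewrite HsE Hs0E in h1; rewrite hn0 in h2; split => //.
apply: (le_trans h2); rewrite (eq_nrm mu e2) (nrmZ _ H2) (ger0_norm c0) -hnE.
rewrite /cut_const -[leRHS]mulrA; apply: ler_wpM2l; first by nonneg.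
rewrite [leRHS](_ : _ = A * (2 * (Kcut : R) / N * M)); last by rewrite /A /M; move: (Kcut : R) => K'; ring.
apply: ler_pM => //; first exact: n1_ge0.
  by apply: mulr_ge0 => //; exact: hn_ge0.
by apply: ler_wpM2l => //; exact: le_trans n2 n.
Qed.

Lemma comparison_arith (n2 nd ip1 ip2 ee G tau AA : R) : 0 <= tau -> 0 <= nd ->
  ip1 <= 7 * AA * nd ^+ 2 -> ip2 <= nd * ee -> n2 <= G ^+ 2 ->
  nd ^+ 2 + 2 * tau * (ip1 + ip2) + tau ^+ 2 * n2 <=
  (1 + tau * (14 * AA + 1)) * nd ^+ 2 + tau * (ee ^+ 2 + tau * G ^+ 2).
Proof.
move=> t0 d0 h1 h2 h3.
have h4 : 2 * (nd * ee) <= nd ^+ 2 + ee ^+ 2.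
  by rewrite -subr_ge0 (_ : _ - _ = (nd - ee) ^+ 2) ?sqr_ge0//; ring.
have h5 : 2 * (ip1 + ip2) <= (14 * AA + 1) * nd ^+ 2 + ee ^+ 2.
  rewrite [(14 * AA + 1) * _]mulrDl mul1r mulrDr -addrA; apply: lerD; last by apply: le_trans h4; rewrite ler_wpM2l.
  by rewrite (_ : 14 * AA * nd ^+ 2 = 2 * (7 * AA * nd ^+ 2)); [rewrite ler_wpM2l|ring].
have h6 := ler_wpM2l t0 h5; have h7 := ler_wpM2l (mulr_ge0 t0 t0) h3.
rewrite (_ : _ + _ = nd ^+ 2 + (tau * (2 * (ip1 + ip2)) + tau * tau * n2)); last by ring.
rewrite [leRHS](_ : _ = nd ^+ 2 + (tau * ((14 * AA + 1) * nd ^+ 2 + ee ^+ 2) + tau * tau * G ^+ 2)); last by ring.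
by rewrite lerD2l lerD.
Qed.

Lemma energy_factor : 14 <= 2 * (1 + 16 * 3 ^+ p.+2) :> R.
Proof. by have : 1 <= 3 ^+ p.+2 :> R by [rewrite exprn_ege1// ler1n]; lra. Qed.

Lemma euler_step_L2 (f c a b g h : V -> R) (AA ee G tau : R) : 0 <= tau ->
  L2 (fun x => f x - c x) -> L2 (fun x => a x - b x) -> L2 (fun x => b x - g x) ->
  L2 (fun x => g x - h x) -> L2 a -> L2 h ->
  \int[mu]_x ((f x - c x) * (a x - b x)) <= 7 * AA * nrm (fun x => f x - c x) ^+ 2 ->
  nrm (fun x => b x - g x) + nrm (fun x => g x - h x) <= ee -> nrm a + nrm h <= G ->
  nrm (fun x => (f x + tau * a x) - (c x + tau * h x)) ^+ 2 <=
  (1 + tau * (14 * AA + 1)) * nrm (fun x => f x - c x) ^+ 2 + tau * (ee ^+ 2 + tau * G ^+ 2).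
Proof.
move=> t0 Ld L1 L3 L4 La Lh i1 he hG.
have Lr : L2 (fun x => b x - h x) by apply: (eq_L2 _ (L2D L3 L4)) => x; ring.
have nr : nrm (fun x => b x - h x) <= ee.
  apply: (le_trans _ he); rewrite (eq_nrm mu (g := fun x => (b x - g x) + (g x - h x))); last by move=> x; ring.
  exact: nrmD.
have LD := L2B La Lh; have nD := le_trans (nrmB La Lh) hG.
have I := intgD (L2M Ld L1) (L2M Ld Lr).
have E : nrm (fun x => (f x + tau * a x) - (c x + tau * h x)) ^+ 2 =
  nrm (fun x => f x - c x) ^+ 2 + 2 * tau * (\int[mu]_x ((f x - c x) * (a x - b x)) +
   \int[mu]_x ((f x - c x) * (b x - h x))) + tau ^+ 2 * nrm (fun x => a x - h x) ^+ 2.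
  rewrite -(IntD (L2M Ld L1) (L2M Ld Lr)) !nrm_sqr.
  rewrite -(IntZ (2 * tau) I) -(IntZ (tau ^+ 2) LD.2) -(IntD Ld.2 (intgZ _ I)) -(IntD (intgD Ld.2 (intgZ _ I)) (intgZ _ LD.2)).
  by apply: eq_Int => x; ring.
rewrite E; apply: comparison_arith => //.
- exact: nrm_ge0.
- apply: (le_trans (ler_norm _)); apply: (le_trans (cauchy_schwarz Ld Lr)).
  by apply: ler_wpM2l nr; exact: nrm_ge0.
by rewrite lerXn2r ?nnegrE ?nrm_ge0// (le_trans (nrm_ge0 _ _) nD).
Qed.

(** [f] is a vertex of the fine curve and [c] a point of the coarse one, which moves with the slope
    frozen at its vertex [e]. The slopes differ by [Fs f - Fs c], which positivity of [f] controls,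
    by the error of freezing, and by the change of symbol; the last two are collected in [ee]. *)
Lemma comparison_step (f c e : V -> R) (N N' ee tau : R) : good f -> good c -> good e ->
  1 <= N -> N <= N' -> 0 <= tau ->
  2 * Ke * (2 * M) * hn 1 (fun x => c x - e x) + cut_const / N <= ee ->
  nrm (fun x => (f x + tau * Fs (sN N') f f x) - (c x + tau * Fs (sN N) e e x)) ^+ 2 <=
  (1 + tau * D) * nrm (fun x => f x - c x) ^+ 2 + tau * (ee ^+ 2 + tau * (2 * rate_bound) ^+ 2).
Proof.
move=> Gf Gc Ge N1 NN t0 he.
have [Hf nf _ _] := Gf; have [Hc nc _ _] := Gc; have [He ne _ _] := Ge.
have ms' := @cut_mult R d N'; have ms := @cut_mult R d N.
have qp := quasi_pos_sub_mult hp (measurable_cut N') (cut01 N') Hf (fun x => good_ge0 f0 x Gf).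
have rt := difference_rate hp ms' Hf Hc qp.
have [L1 b1] := Fs_lip hp ms' Hc He; have [L3 b3] := good_cut Ge N1 NN.
have [L4 _] := Fs_lip hp ms' Hf Hc.
have [HF1 r1] := good_rate ms' Gf; have [HF2 r2] := good_rate ms Ge.
have [HF1' nF1] := Hs_le (leq0n p) HF1; have [HF2' nF2] := Hs_le (leq0n p) HF2.
rewrite HsE Hs0E hn0 in HF1' nF1; rewrite HsE Hs0E hn0 in HF2' nF2.
have Ld := L2B (Hs_L2 Hf) (Hs_L2 Hc).
have nr : nrm (fun x => Fs (sN N') c c x - Fs (sN N') e e x) + nrm (fun x => Fs (sN N') e e x - Fs (sN N) e e x) <= ee.
  apply: (le_trans _ he); apply: lerD => //; apply: (le_trans b1).
  apply: ler_wpM2r; first exact: hn_ge0.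
  by apply: ler_wpM2l; [rewrite mulr_ge0|rewrite mulr_natl mulr2n lerD].
have nG : nrm (Fs (sN N') f f) + nrm (Fs (sN N) e e) <= 2 * rate_bound.
  rewrite mulr_natl mulr2n.
  by apply: lerD; [exact: le_trans nF1 r1|exact: le_trans nF2 r2].
have [nA rA] := good_n1 hp Gf; have [_ rC] := good_n1 hp Gc.
have i1 : \int[mu]_x ((f x - c x) * (Fs (sN N') f f x - Fs (sN N') c c x)) <= 7 * A * nrm (fun x => f x - c x) ^+ 2.
  apply: (le_trans rt); apply: ler_wpM2r; first exact: sqr_ge0.
  rewrite (_ : 7 * A = 5 * A + 2 * A); last by ring.
  by apply: lerD; apply: ler_wpM2l.
apply: (le_trans (euler_step_L2 t0 Ld L4 L1 L3 HF1' HF2' i1 nr nG)).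
rewrite lerD2r; apply: ler_wpM2r; first exact: sqr_ge0.
rewrite lerD2l; apply: ler_wpM2l => //; rewrite /D lerD2r /energy_const mulrA.
apply: ler_wpM2r => //; exact: energy_factor.
Qed.

Notation rb := rate_bound.
Variables (T : R) (T0 : 0 < T).
Hypotheses (hT1 : T * step_const p A ^+ 2 <= 1) (hT2 : T * D <= 2^-1).

Let Nj j : R := 2 ^+ j.
Let tj j : R := T / 4 ^+ j.

Let e4 j : 0 < (4 : R) ^+ j. Proof. by rewrite exprn_gt0. Qed.
Let tj0 j : 0 < tj j. Proof. exact: divr_gt0. Qed.
Let Nj1 j : 1 <= Nj j. Proof. by rewrite exprn_ege1// ler1n. Qed.
Let Nj0 j : 0 < Nj j. Proof. exact: lt_le_trans ltr01 (Nj1 j). Qed.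
Let N2 j : Nj j ^+ 2 = 4 ^+ j.
Proof. by rewrite /Nj -exprM mulnC exprM; congr (_ ^+ j); rewrite -natrX. Qed.

Let rb0 : 0 <= rb. Proof. exact: rate_bound_ge0. Qed.
Let D0 : 0 <= D.
Proof.
by apply: addr_ge0 => //; apply: mulr_ge0 => //; apply: mulr_ge0 => //.
Qed.

(** [tj j * Nj j ^+ 2] equals [T] for every [j], so a single smallness condition on [T] serves all
    steps. *)
Let htau j : tj j * (Nj j * step_const p A) ^+ 2 <= 1.
Proof. by rewrite exprMn N2 mulrA /tj divfK// gt_eqF. Qed.

Let tjT j : tj j <= T / Nj j.
Proof.
rewrite /tj ler_wpM2l ?(ltW T0)// lef_pV2 ?posrE// /Nj lerXn2r ?nnegrE//.
by rewrite ler_nat.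
Qed.

Let le_tj n j : (n <= 4 ^ j)%N -> n%:R * tj j <= T.
Proof. by rewrite /tj mulrCA ger_pMr// ler_pdivrMr// mul1r -natrX ler_nat. Qed.

Let eu j := euler Om phi0 (Nj j) (tj j).
Let Fj j n := Fs (sN (Nj j)) (eu j n) (eu j n).
Let ln j := lin (eu j) (Fj j) (tj j).

Let eu_good j n : (n <= 4 ^ j)%N -> good (eu j n).
Proof.
by move=> h; apply: (euler_good hp H0 f0 (Nj1 j) (tj0 j) (htau j) hT2); exact: le_tj.
Qed.

Let euS j n x : eu j n.+1 x = eu j n x + tj j * Fj j n x. Proof. by []. Qed.

Let ln_good j m t : (m < 4 ^ j)%N -> m%:R * tj j <= t -> t <= m.+1%:R * tj j -> good (ln j m t).
Proof.
move=> hm h1 h2; have -> : ln j m t = fun x => (1 - (t - m%:R * tj j) / tj j) * eu j m x + (t - m%:R * tj j) / tj j * eu j m.+1 x.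
  by apply/funext => x; rewrite -(lin_convex (tj0 j) (euS j)).
apply: good_convex => //; [|exact: eu_good (ltnW hm)|exact: eu_good].
rewrite divr_ge0 ?subr_ge0 ?(ltW (tj0 j))//= ler_pdivrMr// mul1r lerBlDl.
by move: h2; rewrite -natr1 mulrDl mul1r.
Qed.

Let eu_rate j n : (n <= 4 ^ j)%N -> Hs p (Fj j n) /\ hn p (Fj j n) <= rb.
Proof. by move=> h; apply: (good_rate (cut_mult _)); exact: eu_good. Qed.

(** The defect of a step, [ee ^+ 2] plus the quadratic Euler term, with the common factor 4^-j taken
    out. *)
Definition grid_err := (4 * Ke * M * (T * rb) + cut_const) ^+ 2 + T * (2 * rb) ^+ 2.

Let grid_err_ge0 : 0 <= grid_err.
Proof. by rewrite addr_ge0 ?sqr_ge0// mulr_ge0 ?sqr_ge0// ltW. Qed.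

(** One step of the discrete Gronwall inequality: [n] defects [q * E] accumulate, all enlarged by
    the total growth factor. *)
Lemma grid_step_arith (q x E : R) n : 0 <= q -> 0 <= E -> 0 <= x ->
  x <= (1 + q * D) ^+ n * (n%:R * q * E) ->
  (1 + q * D) * x + q * E <= (1 + q * D) ^+ n.+1 * (n.+1%:R * q * E).
Proof.
move=> q0 E0 x0 h; have c0 : 0 <= 1 + q * D by nonneg.
have c1 : 1 <= (1 + q * D) ^+ n.+1 by rewrite exprn_ege1// lerDl mulr_ge0.
rewrite [leRHS](_ : _ = (1 + q * D) ^+ n.+1 * (n%:R * q * E) + (1 + q * D) ^+ n.+1 * (q * E)); last first.
  by rewrite -natr1; ring.
apply: lerD; first by rewrite exprS -mulrA; apply: ler_wpM2l.
by rewrite ler_peMl// mulr_ge0.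
Qed.

(** The fine curve is followed from vertex to vertex while the coarse one is evaluated at the same
    times. [K = 4 ^ (k - j)] fine steps fill a coarse one. *)
Let grid_compare j k n m : (j <= k)%N -> (m < 4 ^ j)%N -> (m * 4 ^ (k - j) <= n)%N -> (n <= m.+1 * 4 ^ (k - j))%N ->
  nrm (fun x => eu k n x - ln j m (n%:R * tj k) x) ^+ 2 <=
  (1 + tj k * D) ^+ n * (n%:R * tj k * (grid_err / 4 ^+ j)).
Proof.
move=> jk; set K := (4 ^ (k - j))%N; have K0 : (0 < K)%N by rewrite expn_gt0.
have tK : tj j = K%:R * tj k.
  have e : (4 : R) ^+ k = 4 ^+ (k - j) * 4 ^+ j by rewrite -exprD subnK.
  rewrite /tj /K natrX e invfM mulrCA mulVKf// gt_eqF.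
have kj : (4 ^ k = 4 ^ j * K)%N by rewrite -expnD subnKC.
have tkj : tj k <= tj j by rewrite tK ler_peMl ?ler1n// ltW.
have NN : Nj j <= Nj k by rewrite ler_weXn2l// ler1n.
have E0 : 0 <= grid_err / 4 ^+ j by rewrite divr_ge0// ltW.
pose P n m := nrm (fun x => eu k n x - ln j m (n%:R * tj k) x) ^+ 2 <=
  (1 + tj k * D) ^+ n * (n%:R * tj k * (grid_err / 4 ^+ j)).
have step m' n' : (m' < 4 ^ j)%N -> (m' * K <= n')%N -> (n' < m'.+1 * K)%N -> P n' m' -> P n'.+1 m'.
  move=> hm h1 h2 h.
  have t1 : m'%:R * tj j <= n'%:R * tj k.
    by rewrite tK mulrA -natrM; apply: ler_wpM2r; [exact: ltW|rewrite ler_nat].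
  have t2 : n'%:R * tj k <= m'.+1%:R * tj j.
    by rewrite tK mulrA -natrM; apply: ler_wpM2r; [exact: ltW|rewrite ler_nat; exact: ltnW].
  have n4 : (n' <= 4 ^ k)%N by rewrite kj (leq_trans (ltnW h2))// leq_mul2r hm orbT.
  have Gf := eu_good n4; have Gc := ln_good hm t1 t2; have Ge := eu_good (ltnW hm).
  pose ee := (4 * Ke * M * (T * rb) + cut_const) / Nj j.
  have [HF nF] := eu_rate (ltnW hm); have [HF1 nF1] := Hs_le p1 HF.
  have he : 2 * Ke * (2 * M) * hn 1 (fun x => ln j m' (n'%:R * tj k) x - eu j m' x) + cut_const / Nj j <= ee.
    rewrite /ee [X in _ <= X]mulrDl lerD2r; have -> : (fun x => ln j m' (n'%:R * tj k) x - eu j m' x) =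
       fun x => (n'%:R * tj k - m'%:R * tj j) * Fj j m' x.
      by apply/funext => x; rewrite /ln /lin addrC addKr.
    rewrite (hnZ _ HF1) ger0_norm ?subr_ge0//.
    rewrite (_ : 2 * Ke * (2 * M) = 4 * Ke * M); last by rewrite -[4]/((2 * 2)%:R) natrM; ring.
    rewrite -[leRHS]mulrA; apply: ler_wpM2l; first by have := M0; have := Ke0 => k0 m0; nonneg.
    rewrite [T * _ / _]mulrAC; apply: ler_pM; rewrite ?subr_ge0 ?hn_ge0//; last exact: le_trans nF1 nF.
    apply: le_trans (tjT j); rewrite lerBlDl; move: t2; rewrite -natr1 mulrDl mul1r.
    by rewrite [_ + tj j]addrC addrC.
  have := comparison_step Gf Gc Ge (Nj1 j) NN (ltW (tj0 k)) he.
  have -> : (fun x => eu k n' x + tj k * Fs (sN (Nj k)) (eu k n') (eu k n') x - (ln j m' (n'%:R * tj k) x + tj k * Fs (sN (Nj j)) (eu j m') (eu j m') x)) =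
     fun x => eu k n'.+1 x - ln j m' (n'.+1%:R * tj k) x.
    apply/funext => x; rewrite [in RHS]euS -/(Fj k n') -/(Fj j m') -natr1 mulrDl mul1r /ln /lin.
    by ring.
  move=> c; apply: (le_trans c); apply: le_trans (grid_step_arith (ltW (tj0 k)) E0 (sqr_ge0 _) h).
  rewrite lerD2l; apply: ler_wpM2l; first exact: ltW.
  rewrite /grid_err [X in _ <= X]mulrDl; apply: lerD.
    by rewrite /ee expr_div_n N2.
  by rewrite [T * _ / _]mulrAC; apply: ler_wpM2r; [exact: sqr_ge0|exact: tkj].
have main m' : (m' < 4 ^ j)%N -> P (m' * K)%N m' -> forall r, (r <= K)%N -> P (m' * K + r)%N m'.
  move=> hm h; elim=> [|r IH] rK; first by rewrite addn0.
  rewrite addnS; apply: step => //; [exact: leq_addr| |exact: IH (ltnW rK)].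
  by rewrite mulSn addnC ltn_add2r.
(* Two adjacent coarse segments agree at their common vertex, which carries the bound from one to
   the next. *)
have base m' : (m' < 4 ^ j)%N -> P (m' * K)%N m'.
  elim: m' => [|m' IH] hm.
    rewrite /P mul0n expr0 mul1r !mul0r (_ : (fun x => _) = fun=> 0) ?nrm0 ?expr0n//.
    by apply/funext => x; rewrite /ln /lin !mul0r subrr mul0r addr0 subrr.
  have := main m' (ltnW hm) (IH (ltnW hm)) K (leqnn K).
  rewrite -mulSnr /P.
  have -> : (m'.+1 * K)%:R * tj k = m'.+1%:R * tj j by rewrite natrM -mulrA -tK.
  have -> : (fun x => eu k (m'.+1 * K) x - ln j m' (m'.+1%:R * tj j) x) = fun x => eu k (m'.+1 * K) x - ln j m'.+1 (m'.+1%:R * tj j) x.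
    by apply/funext => x; rewrite /ln (lin_end (euS j)) lin_start.
  by [].
move=> hm h1 h2; have := main m hm (base m hm) (n - m * K)%N.
by rewrite subnKC//; apply; rewrite leq_subLR -mulSnr.
Qed.

Let idx j (t : R) := Num.trunc (t / tj j).
Let curve j t := ln j (idx j t) t.

Let idx_bd j t : 0 <= t -> t < T ->
  [/\ (idx j t < 4 ^ j)%N, (idx j t)%:R * tj j <= t & t < (idx j t).+1%:R * tj j].
Proof.
move=> t0 tT; have x0 : 0 <= t / tj j by rewrite divr_ge0// ltW.
have /andP[h1 h2] := truncn_itv x0; rewrite -/(idx j t) in h1 h2.
rewrite ler_pdivlMr// in h1; rewrite ltr_pdivrMr// in h2; split => //.
have := le_lt_trans h1 tT; rewrite /tj mulrCA gtr_pMr// ltr_pdivrMr// mul1r.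
by rewrite -natrX ltr_nat.
Qed.

Let curve_good j t : 0 <= t -> t < T -> good (curve j t).
Proof. by move=> t0 tT; have [h1 h2 h3] := idx_bd j t0 tT; apply: ln_good => //; exact: ltW. Qed.

Definition curve_const := Num.sqrt (2 * (T * grid_err)) + 2 * (T * rb).

(** [grid_compare] holds at the last fine vertex before [t], with growth factor at most 2. From
    there to [t] each curve moves by at most [T * rb / Nj j]. *)
Let curve_close j k t : (j <= k)%N -> 0 <= t -> t < T ->
  nrm (fun x => curve j t x - curve k t x) <= curve_const / Nj j.
Proof.
move=> jk t0 tT; have [m4 mt tm] := idx_bd j t0 tT; have [n4 nt tn] := idx_bd k t0 tT.
rewrite /curve; set m := idx j t in m4 mt tm *; set n := idx k t in n4 nt tn *.
have e : (4 : R) ^+ k = 4 ^+ (k - j) * 4 ^+ j by rewrite -exprD subnK.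
have tK : tj j = (4 ^ (k - j))%:R * tj k.
  by rewrite /tj natrX e invfM mulrCA mulVKf// gt_eqF.
have c1 : (m * 4 ^ (k - j) <= n)%N.
  by have := le_lt_trans mt tn; rewrite tK mulrA -natrM ltr_pM2r// ltr_nat ltnS.
have c2 : (n <= m.+1 * 4 ^ (k - j))%N.
  by have := le_lt_trans nt tm; rewrite tK mulrA -natrM ltr_pM2r// ltr_nat => /ltnW.
have X := grid_compare jk m4 c1 c2; have G := eu_good (ltnW n4).
have tk0 := ltW (tj0 k).
have tkj : tj k <= T / Nj j.
  apply: (le_trans (tjT k)); apply: ler_wpM2l; first exact: ltW.
  by rewrite lef_pV2 ?posrE// ler_weXn2l// ler1n.
have nT : n%:R * tj k <= T := le_tj (ltnW n4).
have c2' : (1 + tj k * D) ^+ n <= 2.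
  apply: compound_le2; first exact: mulr_ge0.
  by rewrite mulrA; apply: le_trans hT2; apply: ler_wpM2r.
have X' : nrm (fun x => eu k n x - ln j m (n%:R * tj k) x) <= Num.sqrt (2 * (T * grid_err)) / Nj j.
  rewrite -(ler_pXn2r (n := 2)) ?nnegrE ?nrm_ge0 ?divr_ge0 ?sqrtr_ge0 ?(ltW (Nj0 _))//.
  apply: (le_trans X); rewrite expr_div_n N2 sqr_sqrtr; last by rewrite mulr_ge0// mulr_ge0// ltW.
  rewrite -[leRHS]mulrA -[T * _ / _]mulrA; apply: ler_pM => //.
  - by apply: exprn_ge0; apply: addr_ge0 => //; exact: mulr_ge0.
  - by apply: mulr_ge0; [apply: mulr_ge0|apply: divr_ge0 => //; exact: ltW].
  by apply: ler_wpM2r => //; apply: divr_ge0 => //; exact: ltW.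
have seg i q : (q < 4 ^ i)%N -> L2 (fun x => (t - n%:R * tj k) * Fj i q x) /\
    nrm (fun x => (t - n%:R * tj k) * Fj i q x) <= T * rb / Nj j.
  move=> q4; have [HF nF] := eu_rate (ltnW q4); have LF := Hs_L2 HF.
  have [_ nF0] := Hs_le (leq0n p) HF; rewrite hn0 in nF0.
  split; first exact: L2Z.
  rewrite (nrmZ _ LF) ger0_norm ?subr_ge0// [T * rb / _]mulrAC.
  apply: ler_pM; rewrite ?subr_ge0 ?nrm_ge0//; last exact: le_trans nF0 nF.
  by apply: le_trans tkj; rewrite lerBlDl; apply: ltW; move: tn; rewrite -natr1 mulrDl mul1r.
have [LY nY] := seg j m m4; have [LZ nZ] := seg k n n4.
have LX : L2 (fun x => eu k n x - ln j m (n%:R * tj k) x).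
  apply: L2B; first exact: Hs_L2 (good_Hs G).
  apply: (@Hs_L2 _ _ Om p.+1); apply: (@good_Hs _ _ Om p phi0); apply: ln_good => //.
    by apply: (@le_trans _ _ ((m * 4 ^ (k - j))%:R * tj k)); [by rewrite tK mulrA -natrM|apply: ler_wpM2r => //; rewrite ler_nat].
  by apply: ltW; exact: le_lt_trans nt tm.
have -> : (fun x => ln j m t x - ln k n t x) = fun x => ((t - n%:R * tj k) * Fj j m x - (eu k n x - ln j m (n%:R * tj k) x)) - (t - n%:R * tj k) * Fj k n x.
  by apply/funext => x; exact: interpolation_split.
apply: (le_trans (nrmB (L2B LY LX) LZ)); apply: (le_trans (lerD (nrmB LY LX) (lexx _))).
rewrite [leRHS](_ : _ = T * rb / Nj j + Num.sqrt (2 * (T * grid_err)) / Nj j + T * rb / Nj j); last first.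
  by rewrite /curve_const; ring.
exact: (lerD (lerD nY X') nZ).
Qed.

Lemma pow2_small (c e : R) : 0 < e -> exists J, forall j, (J <= j)%N -> c / Nj j <= e.
Proof.
move=> e0; exists (Num.trunc (`|c| / e)).+1 => j hj.
have h0 : 0 <= `|c| / e by rewrite divr_ge0// ltW.
have /andP[_ h] := truncn_itv h0; rewrite ltr_pdivrMr// in h.
rewrite ler_pdivrMr//; apply: (le_trans (ler_norm c)); apply: (le_trans (ltW h)).
rewrite mulrC; apply: ler_wpM2l; first exact: ltW.
by rewrite /Nj -natrX ler_nat (leq_trans hj)// ltnW// ltn_expl.
Qed.

Lemma tl_small e : 0 < e -> exists n0, forall n, (n0 <= n)%N -> tl n.+1%:R phi0 <= e.
Proof.
move=> e0; have /cvgrPdist_le/(_ e e0)[n0 _ h] := tl_cvg H0.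
by exists n0 => n /h /=; rewrite sub0r normrN ger0_norm// tl_ge0.
Qed.

(** On [good] the tails are dominated by those of the single function [phi0]. Hence one frequency
    [N] suffices for all pairs, and L^2 closeness implies closeness in H^(p+1), uniformly. *)
Lemma good_modulus e : 0 < e -> exists2 del, 0 < del & forall phi psi, good phi -> good psi ->
  nrm (fun x => phi x - psi x) <= del -> hn p.+1 (fun x => phi x - psi x) <= e.
Proof.
(* The tail of a difference is at most 4 times that of [phi0], and [hn_tail] doubles it; 8 times e /
   16 is half of [e]. *)
move=> e0; have e16 : 0 < e / 16 by rewrite divr_gt0.
have [n0 /(_ n0 (leqnn _)) h] := tl_small e16; pose N : R := n0.+1%:R; have N0 : 0 < N by [].
have W0 : 0 < (1 + N) ^+ p.+1 by rewrite exprn_gt0// addr_gt0.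
exists (e / 2 / (1 + N) ^+ p.+1); first by rewrite !divr_gt0.
move=> phi psi [H1 _ t1 _] [H2 _ t2 _] hd; have Hd := HsB H1 H2.
apply: (le_trans (hn_tail N0 Hd)); have -> : e = e / 2 + e / 2 by field.
apply: lerD.
  by rewrite mulrC -ler_pdivlMr.
have tb : tl N (fun x => phi x - psi x) <= 2 * tl N phi0 + 2 * tl N phi0.
  have Hm : Hs p.+1 (fun x => -1 * psi x) by exact: HsZ.
  have := tlD N0 H1 Hm; rewrite (tlZ _ N0 H2) normrN1 mul1r.
  have -> : (fun x => phi x + -1 * psi x) = fun x => phi x - psi x by apply/funext => x; rewrite mulN1r.
  by move=> h1; apply: (le_trans h1); apply: lerD; [exact: t1|exact: t2].
apply: (le_trans (ler_wpM2l (ler0n R 2) tb)); rewrite -mulrDl -natrD mulrA -natrM.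
apply: (le_trans (ler_wpM2l (ler0n R _) h)); rewrite -[(2 * (2 + 2))%N]/8%N.
by apply: eq_ler; field.
Qed.

Let curve_cauchy e : 0 < e -> exists J, forall j k t, (J <= j)%N -> (J <= k)%N -> 0 <= t -> t < T ->
  hn p.+1 (fun x => curve j t x - curve k t x) <= e.
Proof.
move=> e0; have [del del0 hd] := good_modulus e0; have [J hJ] := pow2_small curve_const del0.
have main j k t : (J <= j)%N -> (j <= k)%N -> 0 <= t -> t < T -> hn p.+1 (fun x => curve j t x - curve k t x) <= e.
  move=> Jj jk t0 tT; apply: hd; [exact: curve_good|exact: curve_good|].
  by apply: (le_trans (curve_close jk t0 tT)); exact: hJ.
exists J => j k t Jj Jk t0 tT; have [jk|/ltnW kj] := leqP j k; first exact: main.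
by rewrite hn_sym; exact: main.
Qed.

Let limit_exists : exists Phi : R -> V -> R,
  (forall t, 0 <= t -> t < T -> good (Phi t)) /\
  (forall e, 0 < e -> exists J, forall j t, (J <= j)%N -> 0 <= t -> t < T ->
     hn p.+1 (fun x => curve j t x - Phi t x) <= e).
Proof.
have ex (t : R) : exists g, 0 <= t -> t < T -> Hs p.+1 g /\
   forall e, 0 < e -> exists N, forall n, (N <= n)%N -> hn p.+1 (fun x => curve n t x - g x) <= e.
  have [t0|t0] := boolP (0 <= t); last by exists (fun=> 0).
  have [tT|tT] := boolP (t < T); last by exists (fun=> 0).
  have [g Hg cg] : exists2 g, Hs p.+1 g & forall e, 0 < e -> exists N, forall n, (N <= n)%N -> hn p.+1 (fun x => curve n t x - g x) <= e.
    apply: Hs_complete => [n|e /curve_cauchy[J hJ]]; first exact: good_Hs (curve_good n t0 tT).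
    by exists J => m n hm hn'; exact: hJ.
  by exists g.
have [Phi hPhi] := choice ex; exists Phi; split.
  move=> t t0 tT; have [Hg cg] := hPhi t t0 tT; apply: (good_limit hp) => // e /cg[N /(_ N (leqnn _)) h].
  by exists (curve N t); [exact: curve_good|rewrite hn_sym].
move=> e e0; have [J hJ] := curve_cauchy e0; exists J => j t Jj t0 tT.
have [Hg cg] := hPhi t t0 tT; apply/ler_addgt0Pr => e' /cg[N hN].
have h1 := hN (maxn N J) (leq_maxl _ _); have h2 := hJ j (maxn N J) t Jj (leq_maxr _ _) t0 tT.
have G1 := good_Hs (curve_good j t0 tT); have G2 := good_Hs (curve_good (maxn N J) t0 tT).
by apply: (le_trans (hn_dist G1 G2 Hg)); exact: lerD.
Qed.

Let curve_slope j q (s t e : R) g : 0 <= e -> 0 <= s -> s <= t -> t < T ->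
  (forall i, (idx j s <= i <= idx j t)%N -> Hs q (fun x => Fj j i x - g x) /\ hn q (fun x => Fj j i x - g x) <= e) ->
  Hs q (fun x => curve j t x - curve j s x - (t - s) * g x) /\
  hn q (fun x => curve j t x - curve j s x - (t - s) * g x) <= (t - s) * e.
Proof.
move=> e0 s0 st tT h; have [_ h1 h2] := idx_bd j s0 (le_lt_trans st tT).
have [_ h3 h4] := idx_bd j (le_trans s0 st) tT.
have ij : (idx j s <= idx j t)%N.
  have := le_lt_trans h1 (le_lt_trans st h4); rewrite ltr_pM2r// ltr_nat ltnS//.
have := @lin_slope _ _ Om _ _ _ (tj0 j) (euS j) q g e (idx j t - idx j s) (idx j s) s t e0.
rewrite subnKC//; apply => //; exact: ltW.
Qed.

Let slope_limit q (Phi : R -> V -> R) (s t B : R) g : (q <= p.+1)%N -> Hs p.+1 (Phi s) -> Hs p.+1 (Phi t) -> Hs q g ->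
  (forall e, 0 < e -> exists f f', [/\ Hs p.+1 f /\ Hs p.+1 f', hn p.+1 (fun x => f x - Phi s x) <= e,
     hn p.+1 (fun x => f' x - Phi t x) <= e & hn q (fun x => f' x - f x - (t - s) * g x) <= B]) ->
  hn q (fun x => Phi t x - Phi s x - (t - s) * g x) <= B.
Proof.
move=> qp Hps Hpt Hg h; apply/ler_addgt0Pr => e e0.
have [f [f' [[H1 H2] h1 h2 h3]]] := h (e / 2) (divr_gt0 e0 (ltr0n R 2)).
have [D1 n1'] := Hs_le qp (HsB H1 Hps); have [D2 n2'] := Hs_le qp (HsB H2 Hpt).
have D3 : Hs q (fun x => f' x - f x - (t - s) * g x).
  by apply: HsB; [exact: (Hs_le qp (HsB H2 H1)).1|exact: HsZ].
have -> : (fun x => Phi t x - Phi s x - (t - s) * g x) =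
   fun x => (f' x - f x - (t - s) * g x) - (f' x - Phi t x) + (f x - Phi s x).
  by apply/funext => x; ring.
apply: (le_trans (hnD (HsB D3 D2) D1)); apply: (le_trans (lerD (hnB D3 D2) (lexx _))).
rewrite (splitr e) addrA; apply: lerD; last exact: le_trans n1' h1.
by apply: lerD => //; exact: le_trans n2' h2.
Qed.

Lemma rate_lip phi psi : good phi -> good psi ->
  Hs p (fun x => Fs rr phi phi x - Fs rr psi psi x) /\
  hn p (fun x => Fs rr phi phi x - Fs rr psi psi x) <=
  2 * 2 ^+ p * 2 * Ke * (2 * M) * hn p.+1 (fun x => phi x - psi x).
Proof.
move=> [H1 m1 _ _] [H2 m2 _ _]; have Hd := HsB H1 H2; have me := @mult_enorm R d.
have [Ha na] := Fs_bound hp me H1 Hd; have [Hb nb] := Fs_bound hp me Hd H2.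
rewrite (funext (fun x => Fs_sub me x H1 H2)); split; first exact: HsD.
apply: (le_trans (hnD Ha Hb)); apply: (le_trans (lerD na nb)).
rewrite -mulrDr -[leRHS]mulrA; apply: ler_wpM2l; first by have := Ke0 => k0; nonneg.
rewrite [X in _ + X]mulrC -mulrDl; apply: ler_wpM2r; first exact: hn_ge0.
by rewrite mulr_natl mulr2n; exact: lerD.
Qed.

(** In H^p there is no derivative to spend for a rate. The symbol error times the weight of H^p is a
    multiple of [tfun], so the change is bounded by the tail of [phi0], which tends to 0. *)
Let cut_rate j phi : good phi ->
  Hs p (fun x => Fs (sN (Nj j)) phi phi x - Fs rr phi phi x) /\
  hn p (fun x => Fs (sN (Nj j)) phi phi x - Fs rr phi phi x) <=
  8 * 2 ^+ (p + 2) * (A * ((Kcut : R) * (2 * tl (Nj j) phi0))).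
Proof.
move=> G; have [H m t _] := G; have [nA _] := good_n1 hp G; have K0 := @Kcut_ge0 R.
have we := wfunZ K0 (wfun_mul (@wfun_1D R) (wfun_tail (Nj0 j))).
have b (x : V) : `|sN (Nj j) x - rr x| <= (Kcut : R) * ((1 + rr x) * (rr x / (Nj j + `|rr x|))).
  apply: (le_trans (cut_mult_close x (Nj0 j))); rewrite -mulrA; apply: ler_wpM2l => //.
  apply: ler_wpM2r; last by rewrite lerDr.
  by apply: divr_ge0; [exact: enorm_ge0|apply: addr_ge0 => //; exact: ltW].
have [Lt _] := tl_L2 (Nj0 j) H; have LK := L2Z (Kcut : R) Lt.
have eK x : (1 + rr x) ^+ p * ((Kcut : R) * ((1 + rr x) * (rr x / (Nj j + `|rr x|)))) * phi x =
   (Kcut : R) * (tfun p (Nj j) (rr x) * phi x).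
  by rewrite /tfun exprSr; move: (Kcut : R) => K'; ring.
have Le : L2 (fun x => (1 + rr x) ^+ p * ((Kcut : R) * ((1 + rr x) * (rr x / (Nj j + `|rr x|)))) * phi x).
  by apply: eq_L2 LK => x; rewrite eK.
have [h1 h2] := change_mult hp (cut_mult (Nj j)) (@mult_enorm R d) we b H Le.
split => //; apply: (le_trans h2); rewrite (eq_nrm mu eK) (nrmZ _ Lt) (ger0_norm K0).
apply: ler_wpM2l; first by nonneg.
apply: ler_pM => //; [exact: n1_ge0|apply: mulr_ge0 => //; exact: nrm_ge0|].
by apply: ler_wpM2l => //; exact: t.
Qed.

(** The slopes of an Euler curve between [a] and [b] are the truncated rates at its vertices. They
    approach the rate at [Phi s] by [cut_rate], by uniform convergence and by the continuity of
    [Phi] in time. Either end point may be taken as [s], which yields both one-sided derivatives. *)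
Lemma solution_exists : exists Phi : R -> V -> R,
  [/\ forall t, 0 <= t -> t < T -> good (Phi t), hn p.+1 (fun x => phi0 x - Phi 0 x) <= 0,
   forall s t, 0 <= s -> s <= t -> t < T -> hn p (fun x => Phi t x - Phi s x) <= (t - s) * rb &
   forall e, 0 < e -> exists2 del, 0 < del & forall a s b, 0 <= a -> a <= s -> s <= b -> b < T -> b - a <= del ->
     hn p (fun x => Phi b x - Phi a x - (b - a) * Fs rr (Phi s) (Phi s) x) <= (b - a) * e].
Proof.
have [Phi [gP cP]] := limit_exists; exists Phi.
have lip s t : 0 <= s -> s <= t -> t < T -> hn p (fun x => Phi t x - Phi s x) <= (t - s) * rb.
  move=> s0 st tT; have t0 := le_trans s0 st; have sT := le_lt_trans st tT.
  have Gs := good_Hs (gP s s0 sT).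
  have Z : Hs p ((fun=> 0) : V -> R).
    have e0 : (fun x => Phi s x - Phi s x) = fun=> 0 by apply/funext => x; rewrite subrr.
    by have := (Hs_le (leqnSn p) (HsB Gs Gs)).1; rewrite e0.
  have := @slope_limit p Phi s t ((t - s) * rb) (fun=> 0) (leqnSn p) (good_Hs (gP s s0 sT)) (good_Hs (gP t t0 tT)) Z.
  have -> : (fun x => Phi t x - Phi s x - (t - s) * 0) = fun x => Phi t x - Phi s x.
    by apply/funext => x; rewrite mulr0 subr0.
  apply => e /cP[J hJ]; exists (curve J s), (curve J t); split.
  - by split; [exact: good_Hs (curve_good J s0 sT)|exact: good_Hs (curve_good J t0 tT)].
  - exact: hJ.
  - exact: hJ.
  apply: (curve_slope rb0 s0 st tT _).2 => i /andP[_ i2].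
  have -> : (fun x => Fj J i x - 0) = Fj J i by apply/funext => x; rewrite subr0.
  have [i4 _ _] := idx_bd J t0 tT; apply: eu_rate; exact: leq_trans i2 (ltnW i4).
split => //.
  apply/ler_addgt0Pr => e /cP[J /(_ J 0 (leqnn _) (lexx _) T0)]; rewrite add0r.
  have -> // : curve J 0 = phi0.
  apply/funext => x; have [_ h _] := idx_bd J (lexx 0) T0.
  have i0 : idx J 0 = 0%N by rewrite /idx mul0r truncn0.
  by rewrite /curve i0 /ln /lin !mul0r subrr mul0r addr0.
move=> e e0; pose C := 2 * 2 ^+ p * 2 * Ke * (2 * M); pose C' := 8 * 2 ^+ (p + 2) * (A * ((Kcut : R) * 2)).
have C0 : 0 <= C by have := M0; have := Ke0 => k0 m0; rewrite /C; nonneg.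
have C'0 : 0 <= C' by have := A0; have := @Kcut_ge0 R => k0 m0; rewrite /C'; nonneg.
pose eta := e / 4 / (C + 1); have C1 : 0 < C + 1 by rewrite ltr_wpDl.
have eta0 : 0 < eta by rewrite !divr_gt0.
have [del0 d0 hdel] := good_modulus eta0.
have rb1 : 0 < rb + 1 by rewrite ltr_wpDl.
(* The times of the vertices involved lie within [del + del] of [s], and [Phi] moves at speed at
   most [rb]. *)
pose del := del0 / (rb + 1) / 2; have del_gt0 : 0 < del by rewrite !divr_gt0.
exists del => // a s b a0 as_ sb bT bad.
have s0 := le_trans a0 as_; have sT := le_lt_trans sb bT; have b0 := le_trans s0 sb.
have Gs := gP s s0 sT; have Hrs := (Fs_bound hp (@mult_enorm R d) (good_Hs Gs) (good_Hs Gs)).1.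
have aT := le_lt_trans as_ sT.
apply: (@slope_limit p Phi a b ((b - a) * e) _ (leqnSn p)) => //.
- exact: good_Hs (gP a a0 aT).
- exact: good_Hs (gP b b0 bT).
move=> eps /cP[J1 hJ1]; have [J2 hJ2] := cP _ eta0; have [J3 hJ3] := pow2_small T del_gt0.
have e2 : 0 < e / 2 / (C' + 1) by rewrite !divr_gt0// ltr_wpDl.
have [n0 hn0'] := tl_small e2.
pose J := maxn (maxn J1 J2) (maxn J3 n0.+1).
have [k1 k2 k3 k4] : [/\ (J1 <= J)%N, (J2 <= J)%N, (J3 <= J)%N & (n0.+1 <= J)%N].
  by rewrite /J !leq_max !leqnn !orbT.
have ab := le_trans as_ sb.
exists (curve J a), (curve J b); split.
- by split; [exact: good_Hs (curve_good J a0 aT)|exact: good_Hs (curve_good J b0 bT)].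
- exact: hJ1.
- exact: hJ1.
apply: (curve_slope (ltW e0) a0 ab bT _).2 => i /andP[i1 i2].
have [ia4 ia1 ia2] := idx_bd J a0 aT; have [ib4 ib1 ib2] := idx_bd J b0 bT.
have Gi := eu_good (leq_trans i2 (ltnW ib4)).
pose ti := i%:R * tj J.
have ti0 : 0 <= ti by rewrite mulr_ge0// ltW.
have tib : ti <= b by apply: le_trans ib1; apply: ler_wpM2r; [exact: ltW|rewrite ler_nat].
have tiT := le_lt_trans tib bT.
have ati : a <= ti + tj J.
  apply: (le_trans (ltW ia2)); rewrite /ti -natr1 mulrDl mul1r lerD2r.
  by apply: ler_wpM2r; [exact: ltW|rewrite ler_nat].
have Ec : eu J i = curve J ti.
  have ii : idx J ti = i by rewrite /idx /ti mulfK ?gt_eqF// natrK.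
  by rewrite /curve ii; apply/funext => x; rewrite /ln lin_start.
have tjd : tj J <= del by apply: (le_trans (tjT J)); exact: hJ3.
have close : hn p.+1 (fun x => eu J i x - Phi s x) <= eta + eta.
  have GP := gP ti ti0 tiT.
  apply: (le_trans (hn_dist (good_Hs Gi) (good_Hs GP) (good_Hs Gs))); apply: lerD.
    by rewrite Ec; exact: hJ2.
  apply: hdel => //; apply: (@le_trans _ _ ((del + del) * rb)); last first.
    rewrite /del -splitr -mulrA ler_piMr ?(ltW d0)// mulrC ler_pdivrMr// mul1r lerDl//.
  have nz f : Hs p f -> nrm f <= hn p f by move=> Hf; have [_] := Hs_le (leq0n p) Hf; rewrite hn0.
  have HB := (Hs_le (leqnSn p) (HsB (good_Hs GP) (good_Hs Gs))).1.
  apply: (le_trans (nz _ HB)); have [h|/ltW h] := leP ti s.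
    rewrite hn_sym; apply: (le_trans (lip _ _ ti0 h sT)); apply: ler_wpM2r => //.
    rewrite lerBlDr; apply: (le_trans sb); rewrite -lerBlDr.
    apply: (@le_trans _ _ (b - a + tj J)); last exact: lerD.
    exact: sub_le_add.
  apply: (le_trans (lip _ _ s0 h tiT)); apply: ler_wpM2r => //.
  apply: (@le_trans _ _ (b - a)); first by apply: lerB.
  by apply: (le_trans bad); rewrite lerDl ltW.
have [Hc nc] := cut_rate J Gi; have [Hl nl] := rate_lip Gi Gs.
have -> : (fun x => Fj J i x - Fs rr (Phi s) (Phi s) x) = fun x =>
   (Fs (sN (Nj J)) (eu J i) (eu J i) x - Fs rr (eu J i) (eu J i) x) + (Fs rr (eu J i) (eu J i) x - Fs rr (Phi s) (Phi s) x).
  by apply/funext => x; rewrite addrA subrK.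
split; first exact: HsD.
apply: (le_trans (hnD Hc Hl)); rewrite (splitr e); apply: lerD.
  apply: (le_trans nc); have tb : tl (Nj J) phi0 <= e / 2 / (C' + 1).
    have NJ : Nj J = (2 ^ J).-1.+1%:R by rewrite prednK ?expn_gt0// natrX.
    rewrite NJ; apply: hn0'; rewrite -ltnS prednK ?expn_gt0//.
    by apply: (leq_trans k4); rewrite ltnW// ltn_expl.
  rewrite [leLHS](_ : _ = C' * tl (Nj J) phi0); last by rewrite /C'; move: (Kcut : R) => K'; ring.
  apply: (le_trans (ler_wpM2l C'0 tb)); rewrite mulrCA ler_piMr ?divr_ge0 ?(ltW e0)//.
  by rewrite ler_pdivrMr ?ltr_wpDl// mul1r lerDl.
apply: (le_trans nl); apply: (le_trans (ler_wpM2l C0 close)).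
exact: quarter_arith.
Qed.

End existence.

(** * Solutions *)

Section real_analysis.
Context {R : realType}.
Implicit Types f y : R -> R.

Lemma within_cts f (a b : R) : (forall t, a <= t -> t <= b -> forall e, 0 < e -> exists2 del, 0 < del &
    forall r, a <= r -> r <= b -> `|r - t| < del -> `|f r - f t| <= e) -> {within `[a, b], continuous f}.
Proof.
move=> H; apply/subspace_continuousP => t /=; rewrite in_itv/= => /andP[ta tb].
apply/cvgrPdist_le => e e0; have [del del0 hd] := H t ta tb e e0.
apply/nbhs_ballP; exists del => //= r /= rt; rewrite in_itv/= => /andP[ra rb].
by rewrite distrC; apply: hd => //; rewrite distrC.
Qed.

(** With the integrating factor exp (- C t) the function becomes nonincreasing. The derivative is
    given by estimates relative to [[0, b]], so that nothing is asked outside this interval. *)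
Lemma gronwall y dy (b C : R) : 0 <= b -> (forall t, 0 <= t -> t <= b -> dy t <= C * y t) -> y 0 = 0 ->
  (forall t, 0 <= t -> t <= b -> forall e, 0 < e -> exists2 del, 0 < del &
    forall r, 0 <= r -> r <= b -> `|r - t| < del -> `|y r - y t - (r - t) * dy t| <= e * `|r - t|) ->
  y b <= 0.
Proof.
move=> b0 hC y0 H; pose z t := expR (- (C * t)) * y t.
have cy : {within `[0, b], continuous y}.
  apply: within_cts => t t0 tb e e0; have [del del0 hd] := H t t0 tb 1 ltr01.
  pose K := 1 + `|dy t|; have K0 : 0 < K by rewrite ltr_pwDl.
  exists (Num.min del (e / K)); first by rewrite lt_min del0 divr_gt0.
  move=> r r0 rb; rewrite lt_min => /andP[h1 h2].
  rewrite (_ : y r - y t = (y r - y t - (r - t) * dy t) + (r - t) * dy t); last by ring.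
  apply: (le_trans (ler_normD _ _)); apply: (le_trans (lerD (hd r r0 rb h1) (lexx _))).
  rewrite normrM [X in _ + X]mulrC -mulrDl -/K mulrC -ler_pdivlMr//; exact: ltW.
have ce : {within `[0, b], continuous (fun s => expR (- (C * s)))}.
  apply: continuous_subspaceT => s; apply: (continuous_comp (f := fun s : R => - (C * s))); last exact: continuous_expR.
  by apply: continuousN; exact: mulrl_continuous.
have cz : {within `[0, b], continuous z}.
  by move=> t; rewrite /z; apply: cvgM; [exact: ce|exact: cy].
have dyt t : t \in `]0, b[ -> is_derive t (1 : R) y (dy t).
  rewrite in_itv/= => /andP[t0 tb]; apply: is_derive_eps => e e0.
  have [del del0 hd] := H t (ltW t0) (ltW tb) e e0.
  exists (Num.min del (Num.min t (b - t))); first by rewrite !lt_min del0 t0 subr_gt0.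
  move=> h; rewrite !lt_min => /and3P[h1 h2 h3].
  have := hd (t + h); rewrite (_ : t + h - t = h); last by ring.
  apply => //; first by move: h2; rewrite ltr_norml => /andP[h2 _]; rewrite -lerBlDl sub0r ltW.
  by move: h3; rewrite ltr_norml => /andP[_ h3]; rewrite -lerBrDl ltW.
have dz t : t \in `]0, b[ -> is_derive t (1 : R) z (expR (- (C * t)) * (dy t - C * y t)).
  move=> tb; have dt := dyt t tb.
  by apply: is_derive_eq; rewrite /GRing.scale/= /GRing.scale/=; ring.
have zb : z b <= z 0.
  apply: (@ler0_derive1_nincr R z 0 b) => //.
  - by move=> t tb; have := dz t tb => h; exact: ex_derive.
  - move=> t tb; have h := dz t tb; rewrite derive1E derive_val.
    apply: mulr_ge0_le0; first exact: expR_ge0.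
    by move: tb; rewrite in_itv/= => /andP[t0 tb]; rewrite subr_le0 hC// ltW.
by move: zb; rewrite /z y0 mulr0 pmulr_rle0// expR_gt0.
Qed.

(** [M] need not be differentiable. On [[s, t]] its maximum can only be at [s], since any other
    point has larger values to its left; applied at [t], the same property makes the inequality
    strict. *)
Lemma strictly_decreasing (T L : R) (M : R -> R) :
  (forall s t, 0 <= s -> s <= t -> t < T -> `|M t - M s| <= L * (t - s)) ->
  (forall s t, 0 <= s -> s < t -> t < T -> exists2 r, s < r < t & M t < M r) ->
  forall s t, 0 <= s -> s < t -> t < T -> M t < M s.
Proof.
move=> lip left s t s0 st tT.
have cM : {within `[s, t], continuous M}.
  apply: within_cts => a sa at_ e e0; pose K := `|L| + 1.
  have K0 : 0 < K by rewrite ltr_wpDl.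
  exists (e / K); first by rewrite divr_gt0.
  have main a' b' : s <= a' -> a' <= b' -> b' <= t -> b' - a' < e / K -> `|M b' - M a'| <= e.
    move=> h1 h2 h3 h4; apply: (le_trans (lip a' b' (le_trans s0 h1) h2 (le_lt_trans h3 tT))).
    have b0 : 0 <= b' - a' by rewrite subr_ge0.
    apply: (@le_trans _ _ (K * (b' - a'))).
      by apply: ler_wpM2r => //; apply: (le_trans (ler_norm L)); rewrite /K lerDl.
    by rewrite mulrC -ler_pdivlMr// ltW.
  move=> r sr rt ra; have [h|/ltW h] := leP a r.
    by apply: main => //; move: ra; rewrite ger0_norm ?subr_ge0.
  by rewrite distrC; apply: main => //; move: ra; rewrite distrC ger0_norm ?subr_ge0.
have [c cst hc] := EVT_max (ltW st) cM.
move: cst; rewrite in_itv/= => /andP[sc ct].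
have cs : c = s.
  apply/eqP; rewrite eq_le sc andbT leNgt; apply/negP => slc.
  have [r /andP[sr rc] Mr] := left s c s0 slc (le_lt_trans ct tT).
  have := hc r; rewrite in_itv/= (ltW sr) (ltW (lt_le_trans rc ct)) => /(_ isT).
  by rewrite leNgt Mr.
rewrite cs in hc; have [r /andP[sr rt] Mr] := left s t s0 st tT.
by apply: (lt_le_trans Mr); apply: hc; rewrite in_itv/= (ltW sr) (ltW rt).
Qed.

End real_analysis.

(** * Continuous representatives *)

Section continuous_representatives.
Context {R : realType} {d : nat} (Om : domain).
Notation V := 'rV[R]_d.
Notation lamd := (@lebesgue_rV R d).

(** The cell is half-open, so the box extends from [y] in the positive directions, where there is
    always room. *)
Lemma cell_room (y : V) rho : cell Torus y -> 0 < rho ->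
  exists z r, 0 < r /\ forall x, box z r x -> cell Torus x /\ box y rho x.
Proof.
move=> cy rho0; pose N := (\max_(i < d) (Num.trunc (2 * pi - y ord0 i)^-1).+1).+1.
have p2 i : 0 < 2 * pi - y ord0 i by rewrite subr_gt0; have /andP[] := cy i.
have hN i : (N%:R : R)^-1 < 2 * pi - y ord0 i.
  rewrite invf_plt ?posrE//.
  have i0 : 0 <= (2 * pi - y ord0 i)^-1 by rewrite invr_ge0 ltW.
  have /andP[_ h] := truncn_itv i0; apply: (lt_le_trans h); rewrite ler_nat ltnW// ltnS.
  exact: (leq_bigmax (F := fun i => (Num.trunc (2 * pi - y ord0 i)^-1).+1)).
pose r := Num.min (rho / 2) ((N%:R)^-1 / 2).
have r0 : 0 < r by rewrite lt_min !divr_gt0// invr_gt0.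
have [r1 r2] : r <= rho / 2 /\ r <= (N%:R)^-1 / 2 by rewrite !ge_min !lexx orbT.
rewrite ler_pdivlMr// in r1; rewrite ler_pdivlMr// in r2.
exists (y + const_mx r), r; split => // x hx.
have b i : y ord0 i <= x ord0 i /\ x ord0 i <= y ord0 i + r * 2.
  have := hx i; rewrite !mxE ler_norml => /andP[h1 h2].
  by move: h1 h2; move: (x ord0 i) (y ord0 i) => a b h1 h2; split; lra.
split=> i; have [h1 h2] := b i; have /andP[c1 _] := cy i.
  rewrite (le_trans c1 h1)/=; apply: (le_lt_trans h2); rewrite -ltrBrDl.
  exact: le_lt_trans r2 (hN i).
rewrite ger0_norm ?subr_ge0// lerBlDl; apply: (le_trans h2); rewrite lerD2l//.
Qed.

Lemma cell_translate (x : V) : exists k : 'rV[int]_d, cell Torus (x - (2 * pi) *: map_mx intr k).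
Proof.
have p0 : 0 < 2 * pi :> R by rewrite mulr_gt0// pi_gt0.
exists (\row_i Num.floor (x ord0 i / (2 * pi))) => i; rewrite !mxE.
have /andP[h1 h2] := floor_itv (x ord0 i / (2 * pi)).
rewrite ler_pdivlMr// in h1; rewrite ltr_pdivrMr// in h2.
rewrite subr_ge0 mulrC h1/= ltrBlDl; apply: (lt_le_trans h2).
by rewrite intrD mulrDl mul1r.
Qed.

Lemma rep_unique (f g : V -> R) : continuous f -> continuous g -> on_domain Om f -> on_domain Om g ->
  {ae lamd, forall x, fc Om f x = fc Om g x} -> f = g.
Proof.
move=> cf cg df dg h.
have cfg : continuous (fun y => f y - g y).
  by move=> x; apply: (@continuousB R R^o V f g x); [exact: cf|exact: cg].
have h' : {ae lamd, forall y, cell Om y -> f y - g y = 0}.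
  move: h; apply: filterS => y; rewrite /fc indicE => e cy.
  by move: e; rewrite mem_set// !mul1r => ->; rewrite subrr.
apply/funext => x; apply: subr0_eq; case: (Om) df dg h' => df dg h'.
  apply: (continuous_ae0_at cfg h') => rho rho0; exists x, rho; split => // y hy.
have [k ck] := cell_translate x; set y := x - _ in ck.
have e : x = y + (2 * pi) *: map_mx intr k by rewrite /y subrK.
rewrite e df dg; apply: (continuous_ae0_at cfg h') => rho rho0; exact: cell_room.
Qed.

End continuous_representatives.

(** * Decay at infinity and attained maxima *)

Section maxima.
Context {R : realType} {d : nat} (p : nat) (hp : (d.+1 <= 2 * p)%N).
Notation V := 'rV[R]_d.
Notation rr := (@eucl_norm R d).
Notation lamd := (@lebesgue_rV R d).

Lemma ift_lip Om (phi : V -> R) x y : intg (fmu Om) phi -> intg (fmu Om) (fun xi => rr xi * phi xi) ->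
  `|ift Om phi y - ift Om phi x| <= 2 * d%:R * n1 Om (fun xi => rr xi * phi xi) * `|y - x|.
Proof.
move=> I Ir; rewrite !iftE -(IntB (ift_intg y I) (ift_intg x I)).
rewrite n1E -mulrA [_ * `|y - x|]mulrC mulrA -(IntZ _ (intg_norm Ir)).
apply: le_norm_Int; [exact: intgB (ift_intg y I) (ift_intg x I)|exact: intgZ (intg_norm Ir)|].
move=> xi; rewrite -mulrBr normrM (normrM (rr xi)) (ger0_norm (enorm_ge0 xi)).
have h := cas_lipschitz (dot x xi) (dot y xi).
have e : dot y xi - dot x xi = dot (y - x) xi by rewrite dotDl dotNl.
rewrite e in h; have h2 := dot_le_norm (y - x) xi.
rewrite mulrC [leRHS](_ : _ = 2 * (d%:R * `|y - x| * rr xi) * `|phi xi|); last by ring.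
by apply: ler_wpM2r => //; apply: (le_trans h); exact: ler_wpM2l.
Qed.

Lemma cube_compact (n : nat) : compact (@cube R d n).
Proof.
have -> : @cube R d n = [set v | forall i, `[- n%:R, n%:R]%classic (v ord0 i)].
  by apply/seteqP; split => x h i; have := h i; rewrite /= in_itv/= ler_norml.
exact: (@rV_compact R d (fun=> `[- n%:R, n%:R]%classic) (fun=> @segment_compact R _ _)).
Qed.

Lemma cube_max (f : V -> R) n : continuous f -> exists2 c, cube n c & forall x, cube n x -> f x <= f c.
Proof.
move=> cf; have c0 : @cube R d n !=set0 by exists 0 => i; rewrite mxE normr0.
have cc : {within cube n, continuous f} by apply: continuous_subspaceT => x; exact: cf.
have [c /set_mem cn h] := EVT_max_rV c0 (@cube_compact n) cc.
by exists c => // x hx; apply: h; exact: mem_set.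
Qed.

(** The function is Lipschitz and square integrable: a value [c] far away would force values at
    least [c / 2] on a box of fixed size, carrying more mass than the tail of the integral
    allows. *)
Lemma ift_decay (phi : V -> R) (c : R) : Hs WholeSpace p.+1 phi -> 0 < c -> exists n, forall x, ~ cube n x -> ift WholeSpace phi x < c.
Proof.
move=> H c0; have [I _] := embedS hp H; have [Ir _] := embed_enorm hp H.
have [Lu _] := bessel I (Hs_L2 H).
pose K := 2 * d%:R * n1 WholeSpace (fun xi => rr xi * phi xi) + 1.
have K0 : 0 < K by rewrite ltr_wpDl// !mulr_ge0// n1_ge0.
pose rho := c / 2 / K; have rho0 : 0 < rho by rewrite !divr_gt0.
(* The mass that values at least [c / 2] put on a box of half-side [rho]. *)
pose kap := (c / 2) ^+ 2 * (2 * rho) ^+ d; have kap0 : 0 < kap by rewrite mulr_gt0// exprn_gt0// ?divr_gt0// mulr_gt0.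
have e0 : 0 < Num.sqrt kap / 2 by rewrite divr_gt0// sqrtr_gt0.
have [n /(_ n (leqnn n)) hn] := trn_cv Lu e0.
pose n' := (n + (Num.trunc rho).+1)%N; exists n' => x nx; rewrite ltNge; apply/negP => cx.
have [i hi] : exists i, n'%:R < `|x ord0 i|.
  apply: contrapT => h; apply: nx => i; rewrite leNgt; apply/negP => hi; apply: h; by exists i.
have rho_n : rho < (Num.trunc rho).+1%:R by have /andP[] := truncn_itv (ltW rho0).
have out y : box x rho y -> \1_(cube n) y = 0 :> R.
  move=> /(_ i) hy; rewrite indicE memNset// => /(_ i) cy.
  have : `|x ord0 i| <= `|y ord0 i| + `|y ord0 i - x ord0 i|.
    by have := ler_normB (y ord0 i) (y ord0 i - x ord0 i); rewrite subKr.
  move=> t; have : n'%:R < n%:R + rho by apply: (lt_le_trans hi); apply: (le_trans t); exact: lerD.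
  by rewrite /n' natrD ltrD2l ltNge (ltW rho_n).
have low y : box x rho y -> c / 2 <= ift WholeSpace phi y.
  move=> hy; have yx := box_close hy (ltW rho0).
  have := ift_lip x y I Ir; rewrite ler_distl => /andP[h _]; apply: le_trans h.
  rewrite lerBrDl -lerBrDr (_ : ift WholeSpace phi x - c / 2 = ift WholeSpace phi x - c + c / 2); last by field.
  apply: (@le_trans _ _ (c / 2)); last by rewrite lerDr subr_ge0.
  apply: (@le_trans _ _ (K * rho)); last by rewrite /rho mulrC divfK// gt_eqF.
  by apply: ler_pM => //; rewrite ?mulr_ge0 ?n1_ge0// /K lerDl.
have [IB EB] := box_integral x (ltW rho0); have Ld := L2B (trn_L2 n Lu) Lu.
have : kap <= (Num.sqrt kap / 2) ^+ 2.
  apply: (@le_trans _ _ (nrm lamd (fun x => trn n (ift WholeSpace phi) x - ift WholeSpace phi x) ^+ 2)); last first.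
    by rewrite lerXn2r ?nnegrE ?nrm_ge0// ltW.
  rewrite nrm_sqr /kap -EB -(IntZ _ IB); apply: Int_le; [exact: intgZ|exact: Ld.2|].
  move=> y; rewrite indicE; case: (boolP (y \in box x rho)) => [/set_mem hy|_]; last by rewrite mulr0 sqr_ge0.
  rewrite mulr1 /trn (out y hy) mul0r sub0r sqrrN lerXn2r ?nnegrE ?divr_ge0 ?(ltW c0)//.
    by apply: le_trans (low y hy); rewrite divr_ge0// ltW.
  exact: low.
rewrite expr_div_n sqr_sqrtr ?(ltW kap0)// ler_pdivlMr ?exprn_gt0// -subr_le0.
rewrite (_ : _ - _ = 3 * kap); last by ring.
by rewrite leNgt mulr_gt0.
Qed.

(** On R^d the function is positive at 0 and smaller than that value outside a cube; on the torus a
    cube containing the cell is enough. *)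
Lemma max_exists Om (phi : V -> R) : Hs Om p.+1 phi -> (forall x, 0 < ift Om phi x) ->
  exists x, forall y, ift Om phi y <= ift Om phi x.
Proof.
case: Om => H f0; have [I _] := embedS hp H; have cf := ift_continuous I.
  have [n hn] := ift_decay H (f0 0); have [c cn hc] := cube_max n cf.
  exists c => y; have [cy|ncy] := pselect (cube n y); first exact: hc.
  apply: (le_trans (ltW (hn y ncy))); apply: hc => i; by rewrite mxE normr0.
have [c _ hc] := cube_max 8 cf; exists c => y.
have [k ck] := cell_translate y; set z := y - _ in ck.
have -> : y = z + (2 * pi) *: map_mx intr k by rewrite /z subrK.
rewrite (ift_periodic I); apply: hc; exact: cell_cube8.
Qed.

Lemma whole_nonconstant (phi : V -> R) x : (0 < d)%N -> Hs WholeSpace p.+1 phi ->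
  (forall y, 0 < ift WholeSpace phi y) -> exists x1, ift WholeSpace phi x1 < ift WholeSpace phi x.
Proof.
move=> d0 H f0; have [n hn] := ift_decay H (f0 x); exists (const_mx n.+1%:R); apply: hn.
move=> /(_ (Ordinal d0)); rewrite mxE ger0_norm// ler_nat ltnn//.
Qed.

End maxima.

(** * The equation for transforms and its solutions *)

Section equation.
Context {R : realType} {d : nat} (Om : domain) (p : nat) (hp : (d.+1 <= 2 * p)%N).
Notation V := 'rV[R]_d.
Notation rr := (@eucl_norm R d).
Notation mu := (@fmu R d Om).
Notation L2 := (L2 mu).
Notation intg := (intg mu).
Notation nrm := (nrm mu).
Notation Hs := (Hs Om).
Notation hn := (hn Om).
Notation Fs := (Fs Om).
Notation ift := (ift Om).
Notation star := (kst Om (fun _ _ _ => 1)).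
Notation Ke := (Kemb Om p (R := R) (d := d)).
Implicit Types (f g : V -> R) (phi psi : V -> R).

Lemma class_C1_continuous f : class_C1 f -> continuous f.
Proof. by move=> [df _] x; apply: differentiable_continuous. Qed.

Lemma htrB f g phi psi : htr Om f phi -> htr Om g psi ->
  htr Om (fun x => f x - g x) (fun x => phi x - psi x).
Proof.
move=> h1 h2; have := htr_lin 1 (-1) h1 h2.
by apply: htr_eq => x; rewrite mul1r mulN1r.
Qed.

Lemma htrZ a f phi : htr Om f phi -> htr Om (fun x => a * f x) (fun x => a * phi x).
Proof. by move=> h1; have := htr_lin a 0 h1 h1; apply: htr_eq => x; rewrite mul0r addr0. Qed.

Lemma sobolev_htr s f phi : sobolev Om s f -> htr Om f phi -> Hs s phi.
Proof.
move=> [sf fin] hf; have [e e0 he] : exists2 e : R, 0 <= e & (sobolev_norm Om s f <= e%:E)%E.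
  have s0 := sobolev_ge0 Om s f; have fn : sobolev_norm Om s f \is a fin_num by rewrite ge0_fin_numE.
  by exists (fine (sobolev_norm Om s f)); [exact: fine_ge0|rewrite fineK].
by have [] := sobolev_norm_ge hf e0 he.
Qed.

Lemma htr_sobolev s f phi : htr Om f phi -> Hs s phi -> sobolev Om s f.
Proof.
move=> hf H; have [sf _ _] := hf; split => //.
by apply: (le_lt_trans (sobolev_norm_le hf H)); rewrite ltry.
Qed.

Lemma Hs_htr phi : Hs p.+1 phi -> htr Om (ift phi) phi.
Proof. by move=> H; have [I _] := embedS hp H; exact: htr_ift (Hs_L2 H). Qed.

(** The function and its inversion formula have the same transform, hence agree almost everywhere on
    a cell; both are continuous and periodic. *)
Lemma sobolev_rep f : sobolev Om p.+1 f -> continuous f ->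
  exists phi, [/\ Hs p.+1 phi, htr Om f phi & f = ift phi].
Proof.
move=> sf cf; have [sq _] := sf; have [phi hf] := htr_ext sq; have H := sobolev_htr sf hf.
have [I _] := embedS hp H; exists phi; split => //.
apply: (rep_unique (Om := Om)) => //; first exact: ift_continuous.
- exact: htr_domain hf.
- exact: ift_periodic.
by apply: (htr_inj hf (Hs_htr H)); apply: filterE.
Qed.

Lemma near_within (T t : R) (P : R -> Prop) : (\forall r \near within `[0, T[%classic (nbhs t), P r) <->
  (exists2 del, 0 < del & forall r, 0 <= r -> r < T -> `|r - t| < del -> P r).
Proof.
split.
  move=> /nbhs_ballP[del /= del0 h]; exists del => // r r0 rT rt.
  by apply: (h r); [rewrite -ball_normE/= distrC|rewrite in_itv/= r0].
move=> [del del0 h]; apply/nbhs_ballP; exists del => //= r /= rt; rewrite in_itv/= => /andP[r0 rT].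
by apply: h => //; rewrite distrC.
Qed.

Lemma near_within_deleted (T t : R) (P : R -> Prop) : (\forall r \near within `[0, T[%classic (dnbhs t), P r) <->
  (exists2 del, 0 < del & forall r, 0 <= r -> r < T -> `|r - t| < del -> r != t -> P r).
Proof.
split.
  move=> /nbhs_ballP[del /= del0 h]; exists del => // r r0 rT rt rn.
  by apply: (h r) => //; [rewrite -ball_normE/= distrC|rewrite in_itv/= r0].
move=> [del del0 h]; apply/nbhs_ballP; exists del => //= r /= rt rn; rewrite in_itv/= => /andP[r0 rT].
by apply: h => //; rewrite distrC.
Qed.

Lemma continuous_sobolevP s T (u : R -> V -> R) (phi : R -> V -> R) :
  (forall t, 0 <= t -> t < T -> htr Om (u t) (phi t)) ->
  continuous_sobolev Om s T u <->
  (forall t, 0 <= t -> t < T -> Hs s (phi t)) /\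
  (forall t e, 0 <= t -> t < T -> 0 < e -> exists2 del, 0 < del & forall r, 0 <= r -> r < T ->
     `|r - t| < del -> hn s (fun x => phi r x - phi t x) <= e).
Proof.
move=> hu; have cc0 := @cc_gt0 R d; split.
  move=> H; split.
    by move=> t t0 tT; have [sob _] := H t (introT andP (conj t0 tT)); exact: sobolev_htr (hu t t0 tT).
  move=> t e t0 tT e0; have [_ /cvge0P cv] := H t (introT andP (conj t0 tT)).
  have K0 : 0 < @Ksob R d s + 1 by rewrite ltr_wpDl// Ksob_ge0.
  have e1 : 0 < e / (@Ksob R d s + 1) by rewrite divr_gt0.
  have /near_within[del del0 hd] := cv (fun r => sobolev_ge0 _ _ _) _ e1.
  exists del => // r r0 rT rt; have hB := htrB (hu r r0 rT) (hu t t0 tT).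
  have [_ n] := sobolev_norm_ge hB (ltW e1) (hd r r0 rT rt).
  apply: (le_trans n); rewrite mulrCA ler_piMr ?(ltW e0)// ler_pdivrMr// mul1r lerDl//.
move=> [H1 H2] t /andP[t0 tT]; split; first exact: htr_sobolev (hu t t0 tT) (H1 t t0 tT).
apply/cvge0P; first by move=> r; exact: sobolev_ge0.
move=> e e0; have [del del0 hd] := H2 t (e / cc (d := d)) t0 tT (divr_gt0 e0 cc0).
apply/near_within; exists del => // r r0 rT rt; have hB := htrB (hu r r0 rT) (hu t t0 tT).
apply: (le_trans (sobolev_norm_le hB (HsB (H1 r r0 rT) (H1 t t0 tT)))).
by rewrite lee_fin mulrC -ler_pdivlMr//; exact: hd.
Qed.

Lemma time_derivativeP s T (u ut : R -> V -> R) (phi chi : R -> V -> R) :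
  (forall t, 0 <= t -> t < T -> htr Om (u t) (phi t)) ->
  (forall t, 0 <= t -> t < T -> htr Om (ut t) (chi t)) ->
  (forall t, 0 <= t -> t < T -> Hs s (phi t)) ->
  (forall t, 0 <= t -> t < T -> Hs s (chi t)) ->
  is_time_derivative Om s T u ut <->
  (forall t e, 0 <= t -> t < T -> 0 < e -> exists2 del, 0 < del & forall r, 0 <= r -> r < T ->
     `|r - t| < del -> hn s (fun x => phi r x - phi t x - (r - t) * chi t x) <= e * `|r - t|).
Proof.
move=> hu hut H1 H2; have cc0 := @cc_gt0 R d.
have hq r t : 0 <= r -> r < T -> 0 <= t -> t < T ->
  htr Om (fun x => (u r x - u t x) / (r - t) - ut t x) (fun x => (r - t)^-1 * (phi r x - phi t x) - chi t x).
  move=> r0 rT t0 tT; have := htrB (htrZ (r - t)^-1 (htrB (hu r r0 rT) (hu t t0 tT))) (hut t t0 tT).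
  by apply: htr_eq => x; rewrite // mulrC.
have Hq r t : 0 <= r -> r < T -> 0 <= t -> t < T -> Hs s (fun x => (r - t)^-1 * (phi r x - phi t x) - chi t x).
  move=> r0 rT t0 tT; exact: HsB (HsZ _ (HsB (H1 r r0 rT) (H1 t t0 tT))) (H2 t t0 tT).
have E r t : 0 <= r -> r < T -> 0 <= t -> t < T -> r != t ->
   hn s (fun x => phi r x - phi t x - (r - t) * chi t x) =
   `|r - t| * hn s (fun x => (r - t)^-1 * (phi r x - phi t x) - chi t x).
  move=> r0 rT t0 tT rt; rewrite -(hnZ _ (Hq r t r0 rT t0 tT)); congr (hn _ _); apply/funext => x.
  by rewrite mulrBr mulVKf// subr_eq0.
split.
  move=> H t e t0 tT e0; have /cvge0P cv := H t (introT andP (conj t0 tT)).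
  have K0 : 0 < @Ksob R d s + 1 by rewrite ltr_wpDl// Ksob_ge0.
  have e1 : 0 < e / (@Ksob R d s + 1) by rewrite divr_gt0.
  have /near_within_deleted[del del0 hd] := cv (fun r => sobolev_ge0 _ _ _) _ e1.
  exists del => // r r0 rT rt; have [->|rn] := eqVneq r t.
    rewrite subrr normr0 mulr0 (_ : (fun x => _) = fun=> 0) /hn; last first.
      by apply/funext => x; rewrite !subrr mul0r subr0.
    by rewrite (eq_nrm mu (g := fun=> 0)) ?nrm0// => x; rewrite mulr0.
  have [_ n] := sobolev_norm_ge (hq r t r0 rT t0 tT) (ltW e1) (hd r r0 rT rt rn).
  rewrite E// mulrC; apply: ler_wpM2r => //; apply: (le_trans n).
  by rewrite mulrCA ler_piMr ?(ltW e0)// ler_pdivrMr// mul1r lerDl.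
move=> H t /andP[t0 tT]; apply/cvge0P; first by move=> r; exact: sobolev_ge0.
move=> e e0; have [del del0 hd] := H t (e / cc (d := d)) t0 tT (divr_gt0 e0 cc0).
apply/near_within_deleted; exists del => // r r0 rT rt rn.
apply: (le_trans (sobolev_norm_le (hq r t r0 rT t0 tT) (Hq r t r0 rT t0 tT))).
rewrite lee_fin mulrC -ler_pdivlMr//; have := hd r r0 rT rt.
by rewrite E// mulrC ler_pM2r// normr_gt0 subr_eq0.
Qed.

Lemma star_htr phi : Hs p.+1 phi -> htr Om (fun x => ift phi x ^+ 2) (star phi phi).
Proof.
move=> H; have L := Hs_L2 H; have [I _] := embedS hp H.
have J := star_intg L I L I; have [LJ _] := star_bound I L L.
by apply: htr_eq (htr_ift J LJ) => // x; rewrite (ift_star x L I L I) expr2.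
Qed.

Lemma rate_htr phi : Hs p.+1 phi ->
  Hs p (Fs rr phi phi) /\ htr Om (ift (Fs rr phi phi)) (Fs rr phi phi).
Proof.
move=> H; have [HF _] := Fs_bound hp (@mult_enorm R d) H H; have [IF _] := embed hp HF.
by split => //; apply: htr_ift => //; exact: Hs_L2 HF.
Qed.

(** The equation read on transforms. The derivative is stated as an estimate relative to [[0, T)],
    one-sided at 0, in the form that Gronwall's inequality uses. *)
Definition evolution (T : R) (psi : R -> V -> R) :=
  [/\ forall t, 0 <= t -> t < T -> Hs p.+1 (psi t),
   forall t e, 0 <= t -> t < T -> 0 < e -> exists2 del, 0 < del & forall r, 0 <= r -> r < T ->
     `|r - t| < del -> hn p.+1 (fun x => psi r x - psi t x) <= e &
   forall t e, 0 <= t -> t < T -> 0 < e -> exists2 del, 0 < del & forall r, 0 <= r -> r < T ->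
     `|r - t| < del -> hn p (fun x => psi r x - psi t x - (r - t) * Fs rr (psi t) (psi t) x) <= e * `|r - t|].

(** The equation holds almost everywhere on a cell and so identifies the transform of the time
    derivative as [Fs] of that of the solution; everything else is a change of notation for
    norms. *)
Lemma solution_transform T u0 v : is_solution Om p.+1 T u0 v ->
  exists2 psi, evolution T psi & forall t, 0 <= t -> t < T -> v t = ift (psi t).
Proof.
move=> [C1 csob [vt [_ cvt dvt eqn]] _].
have ex (t : R) : exists psi, 0 <= t -> t < T -> [/\ Hs p.+1 psi, htr Om (v t) psi & v t = ift psi].
  have [t0|t0] := boolP (0 <= t); last by exists (fun=> 0).
  have [tT|tT] := boolP (t < T); last by exists (fun=> 0).
  have tt : 0 <= t < T by rewrite t0.
  have [sob _] := csob t tt; have [psi h] := sobolev_rep sob (class_C1_continuous (C1 t tt)).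
  by exists psi.
have [psi hpsi] := choice ex.
have hv t (t0 : 0 <= t) (tT : t < T) : htr Om (v t) (psi t) by have [] := hpsi t t0 tT.
have Hv t (t0 : 0 <= t) (tT : t < T) : Hs p.+1 (psi t) by have [] := hpsi t t0 tT.
have [_ cts] := (continuous_sobolevP p.+1 hv).1 csob.
have hvt t (t0 : 0 <= t) (tT : t < T) : htr Om (vt t) (Fs rr (psi t) (psi t)).
  have tt : 0 <= t < T by rewrite t0.
  have [[sq _] _] := cvt t tt; have [g [h [hg hh ae]]] := eqn t tt.
  have H := Hv t t0 tT; have [_ _ ev] := hpsi t t0 tT.
  have aee (phi : V -> R) : {ae mu, forall x, phi x = phi x} by apply: filterE.
  have g1 := abs_nabla_htr (hv t t0 tT) hg.
  have h2 : htr Om (fun x => v t x ^+ 2) (star (psi t) (psi t)) by rewrite ev; exact: star_htr.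
  have h1 := abs_nabla_htr h2 hh.
  have [Hr _] := mul_enorm H; have [Ir _] := embed hp Hr.
  have [Iss Lss EF] := star_mult_intg hp (@mult_enorm R d) H.
  have ag := htr_inj g1 (htr_ift Ir (Hs_L2 Hr)) (aee _).
  have ah := htr_inj h1 (htr_ift Iss Lss) (aee _).
  apply: (htr_ae_fun sq _ (rate_htr H).2).
  move: ae ag ah; apply: filterS3 => x; rewrite /fc indicE.
  case: (boolP (x \in cell Om)) => [/set_mem cx|_]; last by rewrite !mul0r.
  move=> /(_ cx) e; rewrite !mul1r => e1 e2.
  by rewrite EF -e1 -e2 -ev; move: e => /eqP; rewrite -addrA addr_eq0 => /eqP ->; ring.
exists psi; last by move=> t t0 tT; have [] := hpsi t t0 tT.
split => //; apply: (time_derivativeP hv hvt _ _).1 dvt.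
  by move=> t t0 tT; exact: (Hs_le (leqnSn p) (Hv t t0 tT)).1.
by move=> t t0 tT; exact: (rate_htr (Hv t t0 tT)).1.
Qed.

(** The squared norm has derivative [2 * \int a g]; the remainder is made explicit for use in
    Gronwall's inequality. *)
Lemma nrm_increment (a b g : V -> R) (h e : R) : L2 a -> L2 b -> L2 g ->
  nrm (fun x => b x - a x - h * g x) <= e ->
  `|nrm b ^+ 2 - nrm a ^+ 2 - h * (2 * \int[mu]_x (a x * g x))| <=
  2 * nrm a * e + (e + `|h| * nrm g) ^+ 2.
Proof.
move=> La Lb Lg he; have Lba := L2B Lb La; have LE := L2B Lba (L2Z h Lg).
have -> : nrm b ^+ 2 - nrm a ^+ 2 - h * (2 * \int[mu]_x (a x * g x)) =
  2 * \int[mu]_x (a x * (b x - a x - h * g x)) + nrm (fun x => b x - a x) ^+ 2.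
  rewrite !nrm_sqr -(IntZ 2 (L2M La Lg)) -(IntZ h (intgZ 2 (L2M La Lg))) -(IntZ 2 (L2M La LE)).
  rewrite -(IntB Lb.2 La.2) -(IntB (intgB Lb.2 La.2) (intgZ h (intgZ 2 (L2M La Lg)))).
  rewrite -(IntD (intgZ 2 (L2M La LE)) Lba.2).
  by apply: eq_Int => x; ring.
have e0 : 0 <= e := le_trans (nrm_ge0 _ _) he.
apply: (le_trans (ler_normD _ _)); apply: lerD.
  rewrite normrM ger0_norm// -mulrA; apply: ler_wpM2l => //.
  apply: (le_trans (cauchy_schwarz La LE)); apply: ler_wpM2l => //; exact: nrm_ge0.
rewrite ger0_norm ?sqr_ge0// lerXn2r ?nnegrE ?nrm_ge0//.
  by apply: addr_ge0 => //; apply: mulr_ge0 => //; exact: nrm_ge0.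
rewrite -(nrmZ h Lg) (eq_nrm mu (g := fun x => (b x - a x - h * g x) + h * g x)); last by move=> x; ring.
by apply: (le_trans (nrmD LE (L2Z h Lg))); rewrite lerD2r.
Qed.

Lemma increment_arith (na ng e h : R) : 0 <= na -> 0 <= ng -> 0 < e ->
  let e' := Num.min 1 (e / (8 * (na + 1))) in 0 < e' /\
  (`|h| < e / 2 / (2 + ng) ^+ 2 ->
  2 * na * (2 * e' * `|h|) + (2 * e' * `|h| + `|h| * ng) ^+ 2 <= e * `|h|).
Proof.
move=> na0 ng0 e0 e'; have n1 : 0 < 8 * (na + 1) by rewrite mulr_gt0// ltr_wpDl.
have e'0 : 0 < e' by rewrite lt_min ltr01 divr_gt0.
split => // hh; have [h1 h2] : e' <= 1 /\ e' <= e / (8 * (na + 1)) by rewrite !ge_min !lexx orbT.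
rewrite ler_pdivlMr// in h2.
have a0 := normr_ge0 h; set a := `|h| in a0 hh *.
have ng2 : 0 < (2 + ng) ^+ 2 by rewrite exprn_gt0// ltr_pwDl.
have t1 : 2 * na * (2 * e' * a) <= e / 2 * a.
  rewrite (_ : 2 * na * (2 * e' * a) = 4 * (e' * na) * a); last by ring.
  apply: ler_wpM2r => //; have : e' * na <= e' * (na + 1) by rewrite ler_wpM2l ?(ltW e'0)// lerDl.
  by move: h2; rewrite mulrCA; lra.
have t2 : (2 * e' * a + a * ng) ^+ 2 <= e / 2 * a.
  rewrite (_ : 2 * e' * a + a * ng = a * (2 * e' + ng)); last by ring.
  rewrite exprMn expr2 -mulrA mulrC; apply: ler_wpM2r => //.
  rewrite ltr_pdivlMr// in hh; apply: le_trans (ltW hh); apply: ler_wpM2l => //.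
  rewrite lerXn2r ?nnegrE ?addr_ge0 ?mulr_ge0 ?(ltW e'0)// lerD2r; lra.
by rewrite [X in _ <= X](_ : _ = e / 2 * a + e / 2 * a); [exact: lerD|field].
Qed.

(** A solution may blow up at [T]; on a compact interval [[0, b]] its norm is continuous and attains
    a maximum, which gives Gronwall's constant. *)
Lemma evolution_bounded T (psi : R -> V -> R) b : evolution T psi -> 0 <= b -> b < T ->
  exists N, forall t, 0 <= t -> t <= b -> hn p.+1 (psi t) <= N.
Proof.
move=> [Hpsi cpsi _] b0 bT; have [||c _ h] := @EVT_max R (fun t => hn p.+1 (psi t)) 0 b => //.
  apply: within_cts => t t0 tb e e0; have tT := le_lt_trans tb bT.
  have [del del0 hd] := cpsi t e t0 tT e0; exists del => // r r0 rb rt.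
  have rT := le_lt_trans rb bT; apply: le_trans (hd r r0 rT rt).
  have tri s s' : Hs p.+1 (psi s) -> Hs p.+1 (psi s') -> hn p.+1 (psi s) - hn p.+1 (psi s') <= hn p.+1 (fun x => psi s x - psi s' x).
    move=> H H'; rewrite lerBlDr; have -> : hn p.+1 (psi s) = hn p.+1 (fun x => (psi s x - psi s' x) + psi s' x).
      by congr (hn _ _); apply/funext => x; rewrite subrK.
    exact: hnD (HsB H H') H'.
  have Ht := Hpsi t t0 tT; have Hr := Hpsi r r0 rT.
  by rewrite ler_norml tri// lerNl opprB hn_sym tri.
by exists (hn p.+1 (psi c)) => t t0 tb; apply: h; rewrite in_itv/= t0.
Qed.

(** Nonnegativity is asked of [phi] alone, as in [difference_rate], so that the constructed solution
    can be compared with an arbitrary one. *)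
Lemma evolution_unique T (phi psi : R -> V -> R) : evolution T phi -> evolution T psi ->
  (forall t x, 0 <= t -> t < T -> 0 <= ift (phi t) x) -> nrm (fun x => phi 0 x - psi 0 x) = 0 ->
  forall t, 0 <= t -> t < T -> nrm (fun x => phi t x - psi t x) = 0.
Proof.
move=> Ephi Epsi pos z0 b b0 bT; have [N1 hN1] := evolution_bounded Ephi b0 bT.
have [N2 hN2] := evolution_bounded Epsi b0 bT.
have [H1 c1 d1] := Ephi; have [H2 c2 d2] := Epsi; have me := @mult_enorm R d.
pose G t x := Fs rr (phi t) (phi t) x - Fs rr (psi t) (psi t) x.
pose dl t x := phi t x - psi t x.
have bd t : 0 <= t -> t <= b -> [/\ Hs p.+1 (phi t), Hs p.+1 (psi t), L2 (dl t) & L2 (G t)].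
  move=> t0 tb; have tT := le_lt_trans tb bT; have h1 := H1 t t0 tT; have h2 := H2 t t0 tT.
  by split => //; [exact: L2B (Hs_L2 h1) (Hs_L2 h2)|exact: (Fs_lip hp me h1 h2).1].
have Ke0 : 0 <= Ke by exact: Kemb_ge0.
suff : nrm (dl b) ^+ 2 <= 0.
  by rewrite le_eqVlt ltNge sqr_ge0 orbF sqrf_eq0 => /eqP.
apply: (@gronwall R (fun t => nrm (dl t) ^+ 2) (fun t => 2 * \int[mu]_x (dl t x * G t x)) b
  (2 * (5 * (Ke * N1) + 2 * (Ke * N2)))) => //.
- move=> t t0 tb; have tT := le_lt_trans tb bT; have [h1 h2 _ _] := bd t t0 tb.
  have qp := quasi_pos_enorm hp h1 (fun x => pos t x t0 tT).
  have rt := difference_rate hp me h1 h2 qp.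
  have [_ e1] := embed_enorm hp h1; have [_ e2] := embed_enorm hp h2.
  rewrite -mulrA; apply: ler_wpM2l => //; apply: (le_trans rt); apply: ler_wpM2r; first exact: sqr_ge0.
  have e1' := le_trans e1 (ler_wpM2l Ke0 (hN1 t t0 tb)).
  have e2' := le_trans e2 (ler_wpM2l Ke0 (hN2 t t0 tb)).
  by apply: lerD; apply: ler_wpM2l.
- by rewrite z0 expr0n.
move=> t t0 tb e e0; have tT := le_lt_trans tb bT; have [h1 h2 Ld LG] := bd t t0 tb.
have [e'0 ar] := @increment_arith (nrm (dl t)) (nrm (G t)) e 0 (nrm_ge0 _ _) (nrm_ge0 _ _) e0.
set e' := Num.min _ _ in e'0 ar.
have [del1 del10 hd1] := d1 t e' t0 tT e'0; have [del2 del20 hd2] := d2 t e' t0 tT e'0.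
have g2 : 0 < e / 2 / (2 + nrm (G t)) ^+ 2.
  by rewrite !divr_gt0// exprn_gt0// ltr_pwDl// nrm_ge0.
exists (Num.min del1 (Num.min del2 (e / 2 / (2 + nrm (G t)) ^+ 2))); first by rewrite !lt_min del10 del20.
move=> r r0 rb; rewrite !lt_min => /and3P[k1 k2 k3]; have rT := le_lt_trans rb bT.
have [h3 h4 Ldr _] := bd r r0 rb.
have Hp f : Hs p.+1 f -> Hs p (Fs rr f f) by move=> H; exact: (rate_htr H).1.
have Hq f : Hs p.+1 f -> Hs p f by move=> H; exact: (Hs_le (leqnSn p) H).1.
have X1 : Hs p (fun x => phi r x - phi t x - (r - t) * Fs rr (phi t) (phi t) x).
  by apply: HsB; [apply: HsB; exact: Hq|apply: HsZ; exact: Hp].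
have X2 : Hs p (fun x => psi r x - psi t x - (r - t) * Fs rr (psi t) (psi t) x).
  by apply: HsB; [apply: HsB; exact: Hq|apply: HsZ; exact: Hp].
have [Y1 y1] := Hs_le (leq0n p) X1; have [Y2 y2] := Hs_le (leq0n p) X2.
rewrite hn0 in y1; rewrite hn0 in y2.
have ne : nrm (fun x => dl r x - dl t x - (r - t) * G t x) <= 2 * e' * `|r - t|.
  rewrite (eq_nrm mu (g := fun x => (phi r x - phi t x - (r - t) * Fs rr (phi t) (phi t) x) - (psi r x - psi t x - (r - t) * Fs rr (psi t) (psi t) x))); last first.
    by move=> x; rewrite /dl /G; ring.
  apply: (le_trans (nrmB (Hs_L2 X1) (Hs_L2 X2))); rewrite -mulrA mulr_natl mulr2n.
  by apply: lerD; [exact: le_trans y1 (hd1 r r0 rT k1)|exact: le_trans y2 (hd2 r r0 rT k2)].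
apply: (le_trans (nrm_increment Ld Ldr LG ne)).
by have [_] := @increment_arith (nrm (dl t)) (nrm (G t)) e (r - t) (nrm_ge0 _ _) (nrm_ge0 _ _) e0; apply.
Qed.

Lemma nrm0_ift f g : Hs p.+1 f -> Hs p.+1 g -> nrm (fun x => f x - g x) = 0 -> ift f = ift g.
Proof.
move=> Hf Hg h; have [If _] := embedS hp Hf; apply/funext => x.
apply: (ae_ift If (Hs_meas Hg)).
have := nrm_eq0 (L2B (Hs_L2 Hf) (Hs_L2 Hg)) h.
by apply: filterS => y /subr0_eq.
Qed.

Lemma max_rate_lt0 phi x : Hs p.+1 phi -> (forall y, 0 < ift phi y) -> (forall y, ift phi y <= ift phi x) ->
  (exists x1, ift phi x1 < ift phi x) -> ift (Fs rr phi phi) x < 0.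
Proof.
move=> H f0 fM [x1 fx1]; have L := Hs_L2 H; have [I _] := embedS hp H.
have [Ir _] := embed_enorm hp H; have [Iss _ E] := star_mult_intg hp (@mult_enorm R d) H.
have J := star_intg L I L I; set M := ift phi x in fM fx1 *.
(* [Y] is the transform of [u * (M - u)], where [u] is [ift phi]. *)
have IY := intgB (intgZ M I) J; set Y := fun xi => M * phi xi - star phi phi xi in IY.
have EY y : ift Y y = ift phi y * (M - ift phi y).
  by rewrite (iftB y (intgZ M I) J) (iftZ _ y I) (ift_star y L I L I); ring.
have eY xi : M * (rr xi * phi xi) - rr xi * star phi phi xi = rr xi * Y xi by rewrite /Y; ring.
have IrY := eq_intg eY (intgB (intgZ M Ir) Iss).
have -> : ift (Fs rr phi phi) x = ift (fun xi => rr xi * Y xi) x.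
  by rewrite E -/M -(iftZ M x Ir) -(iftB x (intgZ M Ir) Iss); apply: eq_Int => xi; rewrite eY.
apply: enorm_ift_lt0 => //.
- by move=> y; rewrite EY mulr_ge0// ?subr_ge0// ltW.
- by rewrite EY subrr mulr0.
by exists x1; rewrite EY mulr_gt0// subr_gt0.
Qed.

Lemma lt_of_slope (a b k r t : R) : - (- k * (t - r)) < a - b - (r - t) * k -> b < a.
Proof.
rewrite -subr_gt0 => h; rewrite -subr_gt0.
by rewrite (_ : a - b = a - b - (r - t) * k - - (- k * (t - r)))//; ring.
Qed.

Lemma small_time (Q D K eta : R) : 0 < D -> 0 <= K -> 0 < eta ->
  exists T, [/\ 0 < T, T * Q ^+ 2 <= 1, T * D <= 2^-1 & K * T <= eta].
Proof.
move=> D0 K0 e0; have Q1 : 0 < Q ^+ 2 + 1 by rewrite ltr_wpDl// sqr_ge0.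
have K1 : 0 < K + 1 by rewrite ltr_wpDl.
pose T := Num.min (Q ^+ 2 + 1)^-1 (Num.min (2^-1 / D) (eta / (K + 1))).
have [t1 [t2 t3]] : T <= (Q ^+ 2 + 1)^-1 /\ (T <= 2^-1 / D /\ T <= eta / (K + 1)).
  by rewrite !ge_min !lexx !orbT.
have T0 : 0 < T by rewrite !lt_min invr_gt0 Q1 !divr_gt0.
exists T; split => //.
- move: t1; rewrite -[X in _ <= X]mul1r ler_pdivlMr// => t1; apply: le_trans t1.
  by rewrite ler_wpM2l ?(ltW T0)// lerDl.
- by rewrite -ler_pdivlMr.
rewrite ler_pdivlMr// in t3; apply: le_trans t3; rewrite mulrC ler_wpM2l ?(ltW T0)//.
by rewrite lerDl.
Qed.

(** The lifespan is also chosen so short that the solution stays within [eta] of its data; on the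
    torus this keeps it from becoming constant. *)
Lemma evolution_exists phi0 eta : Hs p.+1 phi0 -> (forall x, 0 < ift phi0 x) -> 0 < eta ->
  exists T L Phi, [/\ 0 < T, 0 <= L,
    evolution T Phi /\ ift (Phi 0) = ift phi0,
    (forall t x, 0 <= t -> t < T -> 0 < ift (Phi t) x) /\
    (forall t x, 0 <= t -> t < T -> `|ift (Phi t) x - ift phi0 x| <= eta) &
    (forall s t x, 0 <= s -> s <= t -> t < T -> `|ift (Phi t) x - ift (Phi s) x| <= L * (t - s)) /\
    continuous_sobolev Om p T (fun t => ift (Fs rr (Phi t) (Phi t)))].
Proof.
move=> H0 f0 e0; have f0' x := ltW (f0 x); have Ke0 : 0 <= Ke by exact: Kemb_ge0.
have rb0 := rate_bound_ge0 Om p phi0.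
have A0 := emb_bound_ge0 Om p phi0; have M0 := sol_bound_ge0 Om p phi0.
pose D := 2 * energy_const p (emb_bound Om p phi0) + 1.
have D0 : 0 < D.
  by rewrite /D ltr_wpDl//; apply: mulr_ge0 => //; apply: mulr_ge0 => //.
pose L := 2 * (Ke * rate_bound Om p phi0).
have L0 : 0 <= L by rewrite /L; nonneg.
have [T [T0 hT1 hT2 hT3]] := @small_time (step_const p (emb_bound Om p phi0)) D L eta D0 L0 e0.
have [Phi [gP Z lip slope]] := solution_exists hp H0 f0' T0 hT1 hT2.
have HP t (t0 : 0 <= t) (tT : t < T) : Hs p.+1 (Phi t) := good_Hs (gP t t0 tT).
have HPp t (t0 : 0 <= t) (tT : t < T) : Hs p (Phi t) := (Hs_le (leqnSn p) (HP t t0 tT)).1.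
have lip' s t : 0 <= s -> s < T -> 0 <= t -> t < T -> hn p (fun x => Phi t x - Phi s x) <= `|t - s| * rate_bound Om p phi0.
  move=> s0 sT t0 tT; have [st|/ltW ts] := leP s t.
    by rewrite ger0_norm ?subr_ge0//; exact: lip.
  by rewrite distrC ger0_norm ?subr_ge0// hn_sym; exact: lip.
have cts t e : 0 <= t -> t < T -> 0 < e -> exists2 del, 0 < del & forall r, 0 <= r -> r < T ->
     `|r - t| < del -> hn p.+1 (fun x => Phi r x - Phi t x) <= e.
  move=> t0 tT e1; have [del del0 hd] := good_modulus H0 e1.
  have rb1 : 0 < rate_bound Om p phi0 + 1 by rewrite ltr_wpDl.
  exists (del / (rate_bound Om p phi0 + 1)); first exact: divr_gt0.
  move=> r r0 rT rt; apply: hd; [exact: gP|exact: gP|].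
  have [_ h] := Hs_le (leq0n p) (HsB (HPp r r0 rT) (HPp t t0 tT)); rewrite hn0 in h.
  apply: (le_trans h); apply: (le_trans (lip' t r t0 tT r0 rT)).
  rewrite ltr_pdivlMr// in rt; apply: le_trans (ltW rt); apply: ler_wpM2l => //.
  by rewrite lerDl.
have E0 : ift (Phi 0) = ift phi0.
  apply/esym; apply: (nrm0_ift H0 (HP 0 (lexx _) T0)); apply/eqP; rewrite eq_le nrm_ge0 andbT.
  by have [_ h] := Hs_le (leq0n p.+1) (HsB H0 (HP 0 (lexx _) T0)); rewrite hn0 in h; exact: le_trans h Z.
have lipx s t x : 0 <= s -> s <= t -> t < T -> `|ift (Phi t) x - ift (Phi s) x| <= L * (t - s).
  move=> s0 st tT; have t0 := le_trans s0 st; have sT := le_lt_trans st tT.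
  have Hd := HsB (HPp t t0 tT) (HPp s s0 sT); have [Id nd] := embed hp Hd.
  have [It _] := embed hp (HPp t t0 tT); have [Is _] := embed hp (HPp s s0 sT).
  rewrite -(iftB x It Is); apply: (le_trans (ift_bound x Id)).
  have -> : L * (t - s) = 2 * (Ke * ((t - s) * rate_bound Om p phi0)).
    by rewrite /L; move: (rate_bound Om p phi0) => rb; ring.
  apply: ler_wpM2l => //; apply: (le_trans nd); apply: ler_wpM2l => //.
  exact: lip.
exists T, L, Phi; split => //.
- split => //; split => // t e t0 tT e1; have [del del0 hd] := slope e e1.
  exists del => // r r0 rT rt; have [tr|/ltW tr] := leP t r.
    rewrite [X in _ <= X]mulrC [`|r - t|]ger0_norm ?subr_ge0//; apply: hd => //.
    by rewrite ltW//; move: rt; rewrite ger0_norm ?subr_ge0.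
  rewrite [X in _ <= X]mulrC distrC [`|t - r|]ger0_norm ?subr_ge0//.
  have -> : hn p (fun x => Phi r x - Phi t x - (r - t) * Fs rr (Phi t) (Phi t) x) =
     hn p (fun x => Phi t x - Phi r x - (t - r) * Fs rr (Phi t) (Phi t) x).
    rewrite !hnE -[LHS]nrmN; apply: eq_nrm => x.
    by move: (Fs _ _ _ x) (Phi t x) (Phi r x) (wgt p x) => a b c w; ring.
  apply: hd => //; by rewrite ltW//; move: rt; rewrite distrC ger0_norm ?subr_ge0.
- split=> t x t0 tT.
    by have [_ _ _ h] := gP t t0 tT; apply: lt_le_trans (h x); rewrite divr_gt0.
  rewrite -E0; apply: (le_trans (lipx 0 t x (lexx _) t0 tT)); rewrite subr0.
  by apply: le_trans hT3; apply: ler_wpM2l => //; exact: ltW.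
split => //.
apply/(continuous_sobolevP p (fun t t0 tT => (rate_htr (HP t t0 tT)).2)).
split=> [t t0 tT|t e t0 tT e1]; first exact: (rate_htr (HP t t0 tT)).1.
pose C := 2 * 2 ^+ p * 2 * Ke * (2 * sol_bound Om p phi0).
have C0 : 0 <= C by rewrite /C; nonneg.
have C1 : 0 < C + 1 by rewrite ltr_wpDl.
have [del del0 hd] := cts t (e / (C + 1)) t0 tT (divr_gt0 e1 C1); exists del => // r r0 rT rt.
have [_ h] := rate_lip hp (gP r r0 rT) (gP t t0 tT).
apply: (le_trans h); apply: (le_trans (ler_wpM2l C0 (hd r r0 rT rt))).
by rewrite mulrCA ler_piMr ?(ltW e1)// ler_pdivrMr// mul1r lerDl.
Qed.

Lemma evolution_solution T phi0 Phi : 0 < T -> evolution T Phi -> ift (Phi 0) = ift phi0 ->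
  continuous_sobolev Om p T (fun t => ift (Fs rr (Phi t) (Phi t))) ->
  is_solution Om p.+1 T (ift phi0) (fun t => ift (Phi t)).
Proof.
move=> T0 [HP cP dP] E0 cF.
have hu t (t0 : 0 <= t) (tT : t < T) : htr Om (ift (Phi t)) (Phi t) := Hs_htr (HP t t0 tT).
have HPp t (t0 : 0 <= t) (tT : t < T) : Hs p (Phi t) := (Hs_le (leqnSn p) (HP t t0 tT)).1.
have hF t (t0 : 0 <= t) (tT : t < T) := (rate_htr (HP t t0 tT)).1.
have hut t (t0 : 0 <= t) (tT : t < T) := (rate_htr (HP t t0 tT)).2.
split; last exact: E0.
- move=> t /andP[t0 tT]; have [I _] := embedS hp (HP t t0 tT); have [Ir _] := embed_enorm hp (HP t t0 tT).
  exact: ift_class_C1.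
- by apply/(continuous_sobolevP p.+1 hu); split; [exact: HP|exact: cP].
exists (fun t => ift (Fs rr (Phi t) (Phi t))); split.
- apply/(continuous_sobolevP p hu); split; first exact: HPp.
  move=> t e t0 tT e1; have [del del0 hd] := cP t e t0 tT e1; exists del => // r r0 rT rt.
  apply: le_trans (hd r r0 rT rt).
  exact: (Hs_le (leqnSn p) (HsB (HP r r0 rT) (HP t t0 tT))).2.
- exact: cF.
- exact/(time_derivativeP hu hut HPp hF).
move=> t /andP[t0 tT]; have H := HP t t0 tT.
have [Ir _] := embed_enorm hp H; have [Hr _] := mul_enorm H.
have [Iss Lss E] := star_mult_intg hp (@mult_enorm R d) H.
exists (ift (fun xi => rr xi * Phi t xi)), (ift (fun xi => rr xi * star (Phi t) (Phi t) xi)); split.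
- by apply: (htr_abs_nabla (hu t t0 tT)); apply: htr_ift => //; exact: Hs_L2 Hr.
- by apply: (htr_abs_nabla (star_htr H)); exact: htr_ift.
by apply: filterE => x _; rewrite E; ring.
Qed.

(** A first-order expansion at the fixed point [x]: the time derivative is negative there, so
    slightly earlier values are larger. *)
Lemma evolution_left_increase T Phi t x : evolution T Phi -> 0 <= t -> t < T ->
  ift (Fs rr (Phi t) (Phi t)) x < 0 -> forall s, 0 <= s -> s < t ->
  exists2 r, s < r < t & ift (Phi t) x < ift (Phi r) x.
Proof.
move=> [HP _ dP] t0 tT; set k := ift _ x => k0 s s0 st.
have Ke0 : 0 <= Ke by exact: Kemb_ge0. have K1 : 0 < 2 * Ke + 1 by rewrite ltr_wpDl// mulr_ge0.
(* An error [e] per unit of time in H^p costs at most [2 * Ke * e] pointwise, which this choice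
   keeps below [- k]. *)
have e0 : 0 < - k / (2 * Ke + 1) by rewrite divr_gt0// oppr_gt0.
have [del del0 hd] := dP t _ t0 tT e0.
pose r := Num.max ((s + t) / 2) (t - del / 2).
have sr : s < r by rewrite lt_max; apply/orP; left; rewrite ltr_pdivlMr//; lra.
have rt : r < t by rewrite gt_max; apply/andP; split; [rewrite ltr_pdivrMr//; lra|rewrite ltrBlDr ltrDl divr_gt0].
exists r; first by rewrite sr.
have r0 : 0 <= r := le_trans s0 (ltW sr); have rT := lt_trans rt tT.
have rd : `|r - t| < del.
  rewrite distrC ger0_norm ?subr_ge0 ?(ltW rt)// ltrBlDl.
  have : t - del / 2 <= r by rewrite le_max lexx orbT.
  by move=> h; rewrite -ltrBlDr; apply: lt_le_trans h; rewrite ltrD2l ltrN2 ltr_pdivrMr// ltr_pMr// ltr1n.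
have HF := (rate_htr (HP t t0 tT)).1.
have [IF _] := embed hp HF; have [It _] := embedS hp (HP t t0 tT); have [Ir _] := embedS hp (HP r r0 rT).
have HX : Hs p (fun x => Phi r x - Phi t x - (r - t) * Fs rr (Phi t) (Phi t) x).
  apply: HsB; last exact: HsZ.
  exact: (Hs_le (leqnSn p) (HsB (HP r r0 rT) (HP t t0 tT))).1.
have [IX nX] := embed hp HX; have bX := ift_bound x IX.
rewrite (iftB x (intgB Ir It) (intgZ (r - t) IF)) (iftB x Ir It) (iftZ _ x IF) -/k in bX.
have b2 := le_trans bX (ler_wpM2l (ler0n R 2) (le_trans nX (ler_wpM2l Ke0 (hd r r0 rT rd)))).
have tr : 0 < t - r by rewrite subr_gt0.
rewrite [`|r - t|]distrC (gtr0_norm tr) in b2.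
have b3 : 2 * (Ke * (- k / (2 * Ke + 1) * (t - r))) < - k * (t - r).
  rewrite (_ : 2 * _ = (2 * Ke) / (2 * Ke + 1) * (- k * (t - r))); last by field; rewrite gt_eqF.
  by rewrite gtr_pMl ?mulr_gt0 ?oppr_gt0// ltr_pdivrMr// mul1r ltrDl.
have := le_lt_trans b2 b3; rewrite ltr_norml => /andP[h _].
exact: (lt_of_slope h).
Qed.

Lemma nonconstant (phi : V -> R) x : (0 < d)%N -> Hs p.+1 phi -> (forall y, 0 < ift phi y) ->
  (forall y, ift phi y <= ift phi x) -> (Om = Torus -> exists y, ift phi y <> ift phi x) ->
  exists x1, ift phi x1 < ift phi x.
Proof.
case: Om => d0 H f0 fM nc; first exact: (whole_nonconstant hp x d0 H f0).
have [y /eqP yx] := nc erefl; exists y; by rewrite lt_neqAle yx fM.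
Qed.

End equation.

(** On the torus a positive constant is a stationary solution, whose maximum does not move; hence
    the premise of nonconstant data for the strict decrease there. *)
Theorem theorem2p1 (R : realType) (d : nat) (hd : (1 <= d)%N) (Om : domain)
    (m : nat) (hm : d%:R / 2 + 1 < m%:R :> R) (u0 : 'rV[R]_d -> R)
    (hu0 : sobolev Om m u0) (hu0C1 : class_C1 u0)
    (hu0pos : forall x, 0 < u0 x) :
  exists T : R, 0 < T /\
  exists u : R -> 'rV[R]_d -> R,
    [/\ is_solution Om m T u0 u,
        forall v, is_solution Om m T u0 v ->
          forall t, 0 <= t < T -> v t = u t,
        forall t x, 0 <= t < T -> 0 < u t x &
        exists M : R -> R,
          (forall t, 0 <= t < T -> is_max (u t) (M t)) /\
          ((Om = Torus -> exists x y, u0 x <> u0 y) ->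
           forall s t, 0 <= s -> s < t -> t < T -> M t < M s)].
Proof.
have md : (d.+2 < 2 * m)%N.
  move: hm; rewrite -ltrBrDr ltr_pdivrMr// -(ltr_nat R) natrM -[d.+2%:R]natr1 -natr1; lra.
case: m hm hu0 md => [|p] hm hu0 md; first by rewrite muln0 in md.
(* By integrality, [d / 2 + 1 < p + 1] becomes [d + 1 <= 2 p]. *)
have hp : (d.+1 <= 2 * p)%N by lia.
have cu := class_C1_continuous hu0C1.
have [phi0 [H0 hphi0 Eu]] := sobolev_rep hp hu0 cu.
have f0 x : 0 < ift Om phi0 x by rewrite -Eu.
(* A quarter of an oscillation of [u0]: a function within [eta] of [u0] retains at least half of
   that oscillation. For constant data any value serves. *)
have [eta e0 heta] : exists2 eta : R, 0 < eta & forall x y, u0 x <> u0 y ->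
    exists x' y', 4 * eta <= `|u0 x' - u0 y'|.
  have [[x [y xy]]|n] := pselect (exists x y, u0 x <> u0 y).
    exists (`|u0 x - u0 y| / 4); first by rewrite divr_gt0// normr_gt0 subr_eq0; apply/eqP.
    by move=> _ _ _; exists x, y; rewrite mulrC divfK.
  by exists 1 => // x y xy; case: n; exists x, y.
have [T [L [Phi [T0 L0 [EV E0] [pos near] [lip cF]]]]] := evolution_exists hp H0 f0 e0.
have [HP cP dP] := EV.
exists T; split => //; exists (fun t => ift Om (Phi t)); split.
- by rewrite Eu; exact: evolution_solution.
- move=> v hv t /andP[t0 tT]; have [psi EVp epsi] := solution_transform hp hv.
  have [Hpsi _ _] := EVp; have Hp0 := Hpsi 0 (lexx _) T0; have [_ _ _ v0] := hv.
  have Z : nrm (fmu Om) (fun x => Phi 0 x - psi 0 x) = 0.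
    (* At time 0 both transforms belong to [u0], hence agree almost everywhere. *)
    have h1 := Hs_htr hp (HP 0 (lexx _) T0); have h2 := Hs_htr hp Hp0.
    rewrite E0 -Eu -v0 (epsi 0 (lexx _) T0) in h1.
    have ae := htr_unique h1 h2.
    transitivity (nrm (fmu Om) ((fun=> 0) : 'rV[R]_d -> R)); last exact: nrm0.
    apply/esym; apply: (ae_nrm (L2_0 _)).
      by apply: measurable_funB; [exact: Hs_meas (HP 0 (lexx _) T0)|exact: Hs_meas Hp0].
    by move: ae; apply: filterS => x ->; rewrite subrr.
  have posw s x : 0 <= s -> s < T -> 0 <= ift Om (Phi s) x by move=> s0 sT; exact: ltW (pos s x s0 sT).
  have Zt := evolution_unique hp EV EVp posw Z t0 tT.
  rewrite epsi//; apply/esym; exact: (nrm0_ift hp (HP t t0 tT) (Hpsi t t0 tT) Zt).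
- by move=> t x /andP[t0 tT]; exact: pos.
have mx (t : R) : exists x, 0 <= t -> t < T -> forall y, ift Om (Phi t) y <= ift Om (Phi t) x.
  have [t0|t0] := boolP (0 <= t); last by exists 0.
  have [tT|tT] := boolP (t < T); last by exists 0.
  by have [x hx] := max_exists hp (HP t t0 tT) (fun x => pos t x t0 tT); exists x.
have [xm hxm] := choice mx; exists (fun t => ift Om (Phi t) (xm t)); split.
  by move=> t /andP[t0 tT]; split; [exists (xm t)|move=> x; exact: hxm].
move=> nc; apply: (@strictly_decreasing R T L).
  move=> s t s0 st tT; have t0 := le_trans s0 st; have sT := le_lt_trans st tT.
  have h1 := lip s t (xm t) s0 st tT; have h2 := lip s t (xm s) s0 st tT.
  have k1 := hxm s s0 sT (xm t); have k2 := hxm t t0 tT (xm s).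
  move: h1 h2 k1 k2; rewrite !ler_norml; move: (ift _ _ _) (ift _ _ _) (ift _ _ _) (ift _ _ _) => a b c e.
  by move=> /andP[a1 a2] /andP[b1 b2] k1 k2; apply/andP; split; lra.
move=> s t s0 st tT; have t0 := le_trans s0 (ltW st).
have nct : exists x1, ift Om (Phi t) x1 < ift Om (Phi t) (xm t).
  apply: (nonconstant hp hd (HP t t0 tT) (fun y => pos t y t0 tT) (hxm t t0 tT)) => OT.
  have [x [y xy]] := nc OT; have [x' [y' h]] := heta x y xy.
  apply: contrapT => nex.
  have ex z : ift Om (Phi t) z = ift Om (Phi t) (xm t) by apply: contrapT => hz; apply: nex; exists z.
  have n1 := near t x' t0 tT; have n2 := near t y' t0 tT.
  rewrite ex -Eu in n1; rewrite ex -Eu in n2.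
  move: n1 n2 h; move: (ift _ _ _) (u0 x') (u0 y') => a b c; rewrite distrC => n1 n2 h.
  have := ler_distD a b c; rewrite leNgt => /negP; apply.
  by apply: lt_le_trans h; apply: (le_lt_trans (lerD n1 n2)); lra.
have lt0 := max_rate_lt0 hp (HP t t0 tT) (fun y => pos t y t0 tT) (hxm t t0 tT) nct.
have [r /andP[sr rt] hr] := evolution_left_increase hp EV t0 tT lt0 s0 st.
exists r; first by rewrite sr.
by apply: (lt_le_trans hr); apply: hxm; [exact: le_trans s0 (ltW sr)|exact: lt_trans rt tT].
Qed.
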